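(* Let $1/2<\alpha<2$, $d\in\mathbb{N}$, $\tau\in(0,1)$, and $\boldsymbol{\gamma}=(\gamma_1,\ldots,\gamma_d)$ with $0<\gamma_j\le\underline{\kappa}_\alpha^{1/2}$ for all $j$. For $1/2\le\lambda<\alpha$ put $V_d(\alpha,\lambda,\boldsymbol{\gamma})=\prod_{j=1}^d\left(1+2\Gamma_{j,\alpha}^{1/\lambda}\zeta(\alpha/\lambda)\right)$ with $\Gamma_{j,\alpha}=\underline{\kappa}_\alpha^{-1/2}\gamma_j$ and $\zeta$ the Riemann zeta function. Assume that the integer $n_{\max}\ge2$ satisfies $$n_{\max}\ge2\inf_{1/2\le\lambda<\alpha}\frac{V_d(\alpha,\lambda,\boldsymbol{\gamma})-1}{1-\tau}.$$ Let $Q_{n_{\max},\tau}$ be the randomized tent-transformed lattice rule with $n$ and $\boldsymbol{z}$ drawn by the randomized component-by-component construction described in the context. Then the randomized error in the fractional Sobolev space $H_{\alpha,\boldsymbol{\gamma},d}^{\mathrm{sob}}$ satisfies $$e^{\mathrm{ran}}(H_{\alpha,\boldsymbol{\gamma},d}^{\mathrm{sob}};Q_{n_{\max},\tau})\le C_{\lambda,\delta,\tau}\frac{\left(V_d(\alpha,\lambda,\boldsymbol{\gamma})-1\right)^{\lambda-\delta}}{n_{\max}^{\lambda+1/2-\delta}},$$ for any $1/2<\lambda<\alpha$ and $0<\delta<\min(\lambda-1/2,1)$, with a constant $C_{\lambda,\delta,\tau}>0$ depending only on $\lambda,\delta,\tau$.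
   Context: **Spaces.** Functions are real-valued. Let $\phi_0(x)=1$, $\phi_k(x)=\sqrt2\cos(k\pi x)$ for $k\in\mathbb{N}$, and $\phi_{\boldsymbol{k}}(\boldsymbol{x})=\prod_{j=1}^d\phi_{k_j}(x_j)$ for $\boldsymbol{k}\in\mathbb{N}_0^d$; put $\widetilde f(\boldsymbol{k})=\int_{[0,1]^d}f\phi_{\boldsymbol{k}}$. For $\alpha>1/2$ and weights $\gamma_j>0$ let $r_{\alpha,\gamma}(0)=1$, $r_{\alpha,\gamma}(k)=\gamma^{-1}k^\alpha$ for $k\in\mathbb{N}$, $r_{\alpha,\boldsymbol{\gamma}}(\boldsymbol{k})=\prod_{j=1}^d r_{\alpha,\gamma_j}(k_j)$. The half-period cosine space $H_{\alpha,\boldsymbol{\gamma},d}^{\cos}$ consists of $f\in L_2([0,1]^d)$ with $(\|f\|_{\alpha,\boldsymbol{\gamma},d}^{\cos})^2=\sum_{\boldsymbol{k}\in\mathbb{N}_0^d}|\widetilde f(\boldsymbol{k})|^2r_{\alpha,\boldsymbol{\gamma}}^2(\boldsymbol{k})<\infty$. Let $\mathcal{P}^{\cos}=\operatorname{span}\{\phi_k\mid k\in\mathbb{N}_0\}$ on $[0,1]$. On $\mathcal{P}^{\cos}$ define, for $1/2<\alpha<1$, $$\langle f,g\rangle_{\alpha,\gamma,1}^{\mathrm{sob}}=\int_0^1 f\int_0^1 g+\frac{1}{\gamma^2}\cdot\frac{(1-\alpha)\pi^3}{8}\int_0^1\!\int_0^1(f(x)-f(y))(g(x)-g(y))\left(\frac{1}{|\sin\frac{\pi(x-y)}{2}|^{2\alpha+1}}+\frac{1}{|\sin\frac{\pi(x+y)}{2}|^{2\alpha+1}}\right)dx\,dy,$$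 and, for $1<\alpha<2$, $$\langle f,g\rangle_{\alpha,\gamma,1}^{\mathrm{sob}}=\int_0^1 f\int_0^1 g+\frac{1}{\gamma^2}\left(\int_0^1 f'g'+\mathcal{B}_\alpha(f',g')\right),$$ $$\mathcal{B}_\alpha(f',g')=\frac{(\alpha-1)(2-\alpha)\pi^3}{8}\int_0^1\!\int_0^1\left(\frac{(f'(x)-f'(y))(g'(x)-g'(y))}{|\sin\frac{\pi(x-y)}{2}|^{2\alpha-1}}+\frac{(f'(x)+f'(y))(g'(x)+g'(y))}{|\sin\frac{\pi(x+y)}{2}|^{2\alpha-1}}\right)dx\,dy.$$ For these $\alpha$, $H_{\alpha,\gamma,1}^{\mathrm{sob}}$ is the completion of $\mathcal{P}^{\cos}$ in the induced norm. For $\alpha=1$, $H_{1,\gamma,1}^{\mathrm{sob}}$ is the space of $f$ with weak derivative $f'\in L_2([0,1])$ and inner product $\int_0^1 f\int_0^1 g+\gamma^{-2}\int_0^1 f'g'$. For $d\ge1$, $H_{\alpha,\boldsymbol{\gamma},d}^{\mathrm{sob}}=\bigotimes_{j=1}^dH_{\alpha,\gamma_j,1}^{\mathrm{sob}}$ (Hilbert tensor product), with norm $\|\cdot\|_{\alpha,\boldsymbol{\gamma},d}^{\mathrm{sob}}$. The identity on finite cosine expansions extends to an isomorphism of $H_{\alpha,\boldsymbol{\gamma},d}^{\cos}$ onto $H_{\alpha,\boldsymbol{\gamma},d}^{\mathrm{sob}}$, through which the two spaces are identified; their elements are continuous functions on $[0,1]^d$ (given by absolutely and uniformly convergent cosine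 series). **Constants.** $\underline{\kappa}_\alpha=c_\alpha$ if $1/2<\alpha<1$, $\underline{\kappa}_1=\pi^2$, $\underline{\kappa}_\alpha=c'_\alpha$ if $1<\alpha<2$, where $$c_\alpha=2(1-\alpha)\pi^{2-2\alpha}\int_0^{1/2}\frac{\sin^2(\pi t)}{t^{2\alpha+1}}dt,\qquad c'_\alpha=2(\alpha-1)(2-\alpha)\pi^{6-2\alpha}\int_0^{1/2}\frac{\sin^2(\pi t)}{t^{2\alpha-1}}dt.$$ **Lattice rule and randomized error.** For $\boldsymbol{z}\in\{0,\ldots,n-1\}^d$, $\boldsymbol{y}_i=(\{iz_1/n\},\ldots,\{iz_d/n\})$, $0\le i<n$, with $\{\cdot\}$ the fractional part. The tent transformation is $\varphi(x)=1-|2x-1|$, applied componentwise; $P^{\varphi}_{n,\boldsymbol{z}}=\{\boldsymbol{x}_i=\varphi(\boldsymbol{y}_i)\mid 0\le i<n\}$. Let $I(f)=\int_{[0,1]^d}f(\boldsymbol{x})\,d\boldsymbol{x}$ and $I(f;P^{\varphi}_{n,\boldsymbol{z}})=\frac1n\sum_{i=0}^{n-1}f(\boldsymbol{x}_i)$. For a randomized quadrature rule $Q=(Q^\omega)_{\omega\in\Omega}$ (a family of deterministic rules indexed by a probability space), $e^{\mathrm{ran}}(H;Q)=\sup_{f\in H,\ \|f\|_H\le1}\mathbb{E}_\omega|I(f)-Q^\omega(f)|$. **Randomized CBC construction.** Inputs: $n_{\max}\ge2$, $d$, $\alpha$, $\Gamma_{j,\alpha}$, $\tau\in(0,1)$.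 (i) Draw a prime $n$ uniformly from $\{n\text{ prime}\mid\lceil n_{\max}/2\rceil<n\le n_{\max}\}$. (ii) Set $z_1=1$. (iii) For $s=2,\ldots,d$: let $Z_s\subset\{1,\ldots,n-1\}$ be the subset of size $\lceil\tau(n-1)\rceil$ consisting of those $z$ with the smallest values of $E_{n,s}(z\mid(z_1,\ldots,z_{s-1}))$ (ties broken by taking smaller integers first), where $$E^2_{n,s}(z_s\mid(z_1,\ldots,z_{s-1}))=-1+\frac1n\sum_{i=0}^{n-1}\prod_{j=1}^s\left(1+\Gamma_{j,\alpha}^2\,\omega_{2\alpha}\left(\left\{\frac{iz_j}{n}\right\}\right)\right),\qquad\omega_{2\alpha}(x)=\sum_{k\in\mathbb{Z}\setminus\{0\}}|k|^{-2\alpha}e^{2\pi\mathrm{i}kx},$$ and draw $z_s$ uniformly at random from $Z_s$. The resulting rule is $Q_{n_{\max},\tau}(f)=I(f;P^{\varphi}_{n,\boldsymbol{z}})$. *)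

(* Defs.v *)
From HB Require Import structures.
From mathcomp Require Import all_boot all_order all_algebra.
From mathcomp Require Import all_classical all_reals all_analysis.
Set Implicit Arguments.
Unset Strict Implicit.
Unset Printing Implicit Defensive.
Import Order.TTheory GRing.Theory Num.Theory.
Import numFieldNormedType.Exports.
Local Open Scope classical_set_scope.
Local Open Scope ring_scope.

(* Functions on [0,1] and [0,1]^d are represented by functions on R and R^d;
   their values outside the unit cube are irrelevant. *)

Record fspace (R : realType) (T : Type) := FSpace {
  fmem : set (T -> R);
  fip : (T -> R) -> (T -> R) -> R }.

Definition fnorm (R : realType) (T : Type) (H : fspace R T) (f : T -> R) : R :=
  Num.sqrt (fip H f f).

Definition unit_ball (R : realType) (T : Type) (H : fspace R T) :
  set (T -> R) := [set f | fmem H f /\ fnorm H f <= 1].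

Section Completion.
Variables (R : realType) (T E : Type).
(* [V] is a pre-Hilbert space with inner product [ip]; [ev] is the function on
   [D] denoted by an element of [V]. *)
Variables (D : set T) (V : set E) (ev : E -> T -> R) (ip : E -> E -> R).

(* The square of the norm of the difference, expanded by bilinearity, so that
   [E] itself need not carry a subtraction. *)
Definition sqdist (u v : E) : R := ip u u - 2 * ip u v + ip v v.

Definition ip_cauchy (u : nat -> E) : Prop :=
  forall e : R, 0 < e ->
    exists N, forall m n, (N <= m)%N -> (N <= n)%N -> sqdist (u m) (u n) < e.

(* The element of the completion given by the Cauchy sequence [u] is the
   uniform limit of [u] on [D].  For the spaces below the norm dominates the
   supremum norm, and a Cauchy sequence with uniform limit 0 is a null
   sequence, so that this is a faithful model of the abstract completion. *)
Definition represents (u : nat -> E) (f : T -> R) : Prop :=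
  [/\ forall m, V (u m),
      ip_cauchy u &
      forall e : R, 0 < e ->
        \forall m \near \oo, forall x, D x -> `|ev (u m) x - f x| < e].

Definition completion : fspace R T := {|
  fmem := [set f | exists u, represents u f];
  fip := fun f g => xget 0 [set l : R | exists u v,
    [/\ represents u f, represents v g &
        ip (u m) (v m) @[m --> \oo] --> l]] |}.

End Completion.

Section OneDim.
Variable R : realType.
Implicit Types (f g : R -> R) (alpha gamma : R).
Notation mu := (@lebesgue_measure R).
Notation I01 := (`[0%R, 1%R]%classic : set R).

Definition int01 f : R := \int[mu]_(x in I01) f x.

Definition int01x01 (F : R -> R -> R) : R := int01 (fun y => int01 (F ^~ y)).

Definition cos_basis (k : nat) (x : R) : R :=
  if k == 0%N then 1 else Num.sqrt 2 * cos (k%:R * pi * x).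

Definition cos_poly : set (R -> R) :=
  [set f | exists n (c : nat -> R),
    f = fun x => \sum_(k < n) c k * cos_basis k x].

Definition ip_lt1 alpha gamma f g : R :=
  int01 f * int01 g +
  (gamma ^+ 2)^-1 * ((1 - alpha) * pi ^+ 3 / 8) *
  int01x01 (fun x y => (f x - f y) * (g x - g y) *
    ((`|sin (pi * (x - y) / 2)| `^ (2 * alpha + 1))^-1 +
     (`|sin (pi * (x + y) / 2)| `^ (2 * alpha + 1))^-1)).

Definition form_B alpha f' g' : R :=
  (alpha - 1) * (2 - alpha) * pi ^+ 3 / 8 *
  int01x01 (fun x y =>
    (f' x - f' y) * (g' x - g' y) /
      `|sin (pi * (x - y) / 2)| `^ (2 * alpha - 1) +
    (f' x + f' y) * (g' x + g' y) /
      `|sin (pi * (x + y) / 2)| `^ (2 * alpha - 1)).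

Definition ip_gt1 alpha gamma f g : R :=
  int01 f * int01 g +
  (gamma ^+ 2)^-1 * (int01 (fun x => derive1 f x * derive1 g x) +
                     form_B alpha (derive1 f) (derive1 g)).

Definition test_function (psi : R -> R) : Prop :=
  (forall n x, derivable (derive1n n psi) x 1) /\
  (exists a b, [/\ 0 < a, b < 1 &
     forall x, ~ (a <= x <= b) -> psi x = 0]).

Definition square_integrable f : Prop :=
  measurable_fun I01 f /\
  mu.-integrable I01 (fun x => (f x ^+ 2)%:E).

Definition is_weak_derivative f f' : Prop :=
  forall psi, test_function psi ->
    int01 (fun x => f x * derive1 psi x) = - int01 (fun x => f' x * psi x).

(* A function with a square-integrable weak derivative is taken to be its
   continuous representative. *)
Definition sob1_mem : set (R -> R) :=
  [set f | {within I01, continuous f} /\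
    exists f', square_integrable f' /\ is_weak_derivative f f'].

(* Unique almost everywhere on [0,1] for f in [sob1_mem]. *)
Definition weak_derivative f : R -> R :=
  xget (fun=> 0) [set f' | square_integrable f' /\ is_weak_derivative f f'].

Definition ip_eq1 gamma f g : R :=
  int01 f * int01 g +
  (gamma ^+ 2)^-1 *
  int01 (fun x => weak_derivative f x * weak_derivative g x).

(* Meaningful for 1/2 < alpha < 2.  For alpha = 1 the space is complete. *)
Definition sob1 alpha gamma : fspace R R :=
  if alpha < 1 then completion I01 cos_poly id (ip_lt1 alpha gamma)
  else if alpha == 1 then FSpace sob1_mem (ip_eq1 gamma)
  else completion I01 cos_poly id (ip_gt1 alpha gamma).

End OneDim.

Section Tensor.
Variables (R : realType) (d : nat).

Definition cube : set 'rV[R]_d := [set x | forall j, 0 <= x 0 j <= 1].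

(* The finite sequence [t] stands for the sum of the elementary tensors
   a_1 (x) ... (x) a_d, for a in [t]. *)
Definition tensor := seq ('I_d -> R -> R).

Definition tensor_eval (t : tensor) (x : 'rV[R]_d) : R :=
  \sum_(a <- t) \prod_(j < d) a j (x 0 j).

Variable H : 'I_d -> fspace R R.

Definition tensor_mem : set tensor :=
  [set t | forall a, a \in t -> forall j, fmem (H j) (a j)].

Definition tensor_ip (t u : tensor) : R :=
  \sum_(a <- t) \sum_(b <- u) \prod_(j < d) fip (H j) (a j) (b j).

Definition hilbert_tensor : fspace R 'rV[R]_d :=
  completion cube tensor_mem tensor_eval tensor_ip.

End Tensor.

Definition sob (R : realType) (d : nat) (alpha : R) (gamma : 'I_d -> R) :
  fspace R 'rV[R]_d := hilbert_tensor (fun j => sob1 alpha (gamma j)).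

Section Constants.
Variable R : realType.
Notation mu := (@lebesgue_measure R).

Definition kappa (alpha : R) : R :=
  if alpha < 1 then
    2 * (1 - alpha) * pi `^ (2 - 2 * alpha) *
    \int[mu]_(t in `[0, 2^-1]) (sin (pi * t) ^+ 2 / t `^ (2 * alpha + 1))
  else if alpha == 1 then pi ^+ 2
  else
    2 * (alpha - 1) * (2 - alpha) * pi `^ (6 - 2 * alpha) *
    \int[mu]_(t in `[0, 2^-1]) (sin (pi * t) ^+ 2 / t `^ (2 * alpha - 1)).

Definition Gamma (d : nat) (alpha : R) (gamma : 'I_d -> R) (j : 'I_d) : R :=
  kappa alpha `^ (- 2^-1) * gamma j.

Definition zeta (s : R) : R := limn (series (fun k => k.+1%:R `^ (- s))).

Definition V (d : nat) (alpha lambda : R) (gamma : 'I_d -> R) : R :=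
  \prod_(j < d)
    (1 + 2 * Gamma alpha gamma j `^ lambda^-1 * zeta (alpha / lambda)).

End Constants.

Section Lattice.
Variable R : realType.

Definition frac (x : R) : R := x - (Num.floor x)%:~R.

Definition tent (x : R) : R := 1 - `|2 * x - 1|.

Definition lattice_point (d n : nat) (z : 'I_d -> nat) (i : nat) : 'rV[R]_d :=
  \row_j frac ((i * z j)%:R / n%:R).

Definition tent_lattice_rule (d n : nat) (z : 'I_d -> nat)
    (f : 'rV[R]_d -> R) : R :=
  n%:R^-1 * \sum_(i < n) f (map_mx tent (lattice_point n z i)).

(* The integral over [0,1]^d, as an iterated Lebesgue integral; it is applied
   to continuous functions only. *)
Fixpoint cube_integral (d : nat) : ('rV[R]_d -> R) -> R :=
  match d with
  | 0 => fun f => f 0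
  | d'.+1 => fun f =>
      int01 (fun t => cube_integral (fun x : 'rV[R]_d' =>
        f (row_mx (t%:M : 'M[R]_1) x)))
  end.

(* The randomized error for the integral [I] of a family [Q] of rules indexed
   by a finite probability space [Omega] with probability mass function [P]. *)
Definition ran_error (T : Type) (H : fspace R T) (I : (T -> R) -> R)
    (Omega : finType) (P : Omega -> R) (Q : Omega -> (T -> R) -> R) : \bar R :=
  ereal_sup [set (\sum_(w : Omega) P w * `|I f - Q w f|)%:E
            | f in unit_ball H].

End Lattice.

Section CBC.
Variables (R : realType) (nmax d : nat) (alpha tau : R) (G : 'I_d -> R).

(* The sum of |k|^{-s} e^{2 pi i k x} over nonzero integers k; the terms for k
   and -k add up to a real number. *)
Definition omega_series (s x : R) : R :=
  limn (series (fun k =>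
    k.+1%:R `^ (- s) * (2 * cos (2 * pi * k.+1%:R * x)))).

(* Components are numbered from 0.  [crit n z s v] is the criterion for the
   value [v] of component [s] given the components [z j] for j < s. *)
Definition crit_sq (n : nat) (z : 'I_d -> nat) (s : 'I_d) (v : nat) : R :=
  - 1 + n%:R^-1 * \sum_(i < n) \prod_(j < d | (j <= s)%N)
    (1 + G j ^+ 2 * omega_series (2 * alpha)
       (frac ((i * (if j == s then v else z j))%:R / n%:R))).

Definition crit n z s v : R := Num.sqrt (crit_sq n z s v).

Definition crit_order n z s (v w : nat) : bool :=
  (crit n z s v < crit n z s w) ||
  ((crit n z s v == crit n z s w) && (v <= w)%N).

Definition candidates (n : nat) (z : 'I_d -> nat) (s : 'I_d) : seq nat :=
  if s == 0%N :> nat then [:: 1%N]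
  else take `|Num.ceil (tau * n.-1%:R)|%N
         (sort (crit_order n z s) (iota 1 n.-1)).

Definition admissible_primes : seq nat :=
  [seq n <- iota 0 nmax.+1 | prime n && (uphalf nmax < n)%N].

Definition unif_mass (s : seq nat) (v : nat) : R :=
  if v \in s then (size s)%:R^-1 else 0.

(* An outcome consists of the number of points n and the generating vector z;
   the numbers drawn are all at most [nmax]. *)
Definition outcome : finType :=
  ('I_nmax.+1 * {ffun 'I_d -> 'I_nmax.+1})%type.

Definition outcome_z (w : outcome) (j : 'I_d) : nat := w.2 j.

Definition cbc_mass (w : outcome) : R :=
  unif_mass admissible_primes w.1 *
  \prod_(s < d) unif_mass (candidates w.1 (outcome_z w) s) (outcome_z w s).

Definition cbc_rule (w : outcome) (f : 'rV[R]_d -> R) : R :=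
  tent_lattice_rule w.1 (outcome_z w) f.

End CBC.

(* Main.v *)
(** The one-dimensional Sobolev inner products are diagonal in the cosine basis, with eigenvalues
    [w k >= kappa / gamma ^ 2 * k ^ (2 alpha)] (for [alpha = 1] by density of the cosine polynomials in
    the [H^1] norm). Hence functions of the tensor product are uniform limits of cosine polynomials, and
    by Cauchy-Schwarz over the nonzero frequencies the squared mean error is at most
    [\sum_k 2 ^ - |supp k| (E A(k)) ^ 2 / w(k)], where [A(k)] is the average of the [k]-th wave over
    the lattice: a natural number not exceeding [2 ^ |supp k|].

    The contribution of the event that the prime [n] does not divide [k] is controlled by drawing each
    component from at least [tau (n - 1)] candidates, so that the expectation of [A(k)] is at most
    [2 ^ |supp k| / (tau (n - 1))] there; the remaining factor [E A(k)] is summed against [1 / w(k)]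
    and gives the lattice criterion. Since each drawn component beats at least [(1 - tau) (n - 1)]
    other values, induction on the components and Jensen's inequality with exponent
    [p = 1 / (2 lambda)] bound the [p]-th power of the criterion by [(V - 1) / ((1 - tau) (n - 1))].

    If [n] divides [k], then [n ^ - (2 alpha)] can be extracted from the weight; summing over
    pairs of primes, distinct primes contribute their product, and equal ones are rare because there
    are at least [c_e * n_max ^ (1 - e)] admissible primes for every [e > 0], by Erdos' estimates of
    [binomial(2m, m)]. *)

Require Import Defs.
From HB Require Import structures.
From mathcomp Require Import all_boot all_order all_algebra.
From mathcomp Require Import all_classical all_reals all_analysis.
From mathcomp Require Import measurable_realfun real_interval.
From mathcomp Require Import zify lra.
Set Implicit Arguments.
Unset Strict Implicit.
Unset Printing Implicit Defensive.
Import Order.TTheory GRing.Theory Num.Theory.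
Import numFieldNormedType.Exports.
Local Open Scope classical_set_scope.
Local Open Scope ring_scope.

(** * Prime counting *)

Section Primes.
Local Open Scope nat_scope.

(** The bound involves [V - 1], not [V], with a constant independent of [d], [alpha] and the
    weights. So the zero frequency is kept out of every sum, and products over components are
    compared only through differences of [Vp] or through convexity of [\prod_j (1 + q * x j)] in
    [q]. The squared error is to be of size [y ^ eps / nmax ^ (eps + 1)] with [y = V - 1] and
    [eps = 2 * (lambda - delta)]. The criterion comes out as [x ^ (2 * lambda)] with
    [x = y / ((1 - tau) * (n - 1))]. Lowering the exponent to [eps] is harmless for [x <= 1]; for
    [x > 1] the criterion must be bounded by 1 beforehand, and this is what the lower bound on
    [nmax] gives. The frequencies divisible by [n] need a second bound too, linear in [y]; it rests
    on [Gamma <= 1], that is, on the upper bound for [gamma]. The loss [delta] is due to the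
    elementary prime count: pairs of equal primes cost [nmax ^ (- 2 * alpha)] divided by the number
    of primes, known only to be at least [c * nmax ^ (1 - 2 * delta)]. *)

Lemma dvdn_prod_primes (s : seq nat) X : uniq s -> all prime s ->
  {in s, forall p, p %| X} -> \prod_(p <- s) p %| X.
Proof.
elim: s => [|p s IH] /=; first by rewrite big_nil dvd1n.
move=> /andP[ps us] /andP[pp sp] H; rewrite big_cons Gauss_dvd.
  by rewrite H ?mem_head//= IH// => q qs; rewrite H// inE qs orbT.
rewrite big_seq_cond; apply/(big_ind (fun x => coprime p x)).
- exact: coprimen1.
- by move=> x y hx hy; rewrite coprimeMr hx.
- move=> q /andP[qs _].
  have pq := allP sp q qs; rewrite prime_coprime// dvdn_prime2//.
  by apply: contra ps => /eqP ->.
Qed.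

(** The two binomials are different terms of the expansion of [(1 + 1) ^ n], or vanish when out of
    range. *)
Lemma bin_sum_le n i j : i != j -> 'C(n, i) + 'C(n, j) <= 2 ^ n.
Proof.
move=> ij; wlog lij : i j ij / i < j.
  move=> H; case: (ltngtP i j) ij => // h _.
  - by apply: H; rewrite // neq_ltn h.
  - by rewrite addnC; apply: H; rewrite // neq_ltn h.
case: (ltnP n j) => [nj|jn].
  rewrite (bin_small nj) addn0; case: (ltnP n i) => [ni|i_n].
    by rewrite bin_small.
  have := expnDn 1 1 n; rewrite addn1 => ->.
  rewrite (bigD1 (Ordinal (i_n : i < n.+1)))//= !exp1n !muln1; exact: leq_addr.
have := expnDn 1 1 n; rewrite addn1 => ->.
rewrite (bigD1 (Ordinal (leq_trans (ltnW lij) jn : i < n.+1)))//=.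
rewrite (bigD1 (Ordinal (jn : j < n.+1)))//=; last first.
  by rewrite -val_eqE/= eq_sym.
rewrite !exp1n !muln1 addnA; exact: leq_addr.
Qed.

(** The two middle binomials of an odd row are equal, and together they are at most
    [2 ^ (2m + 1) = 2 * 4 ^ m]. *)
Lemma bin_odd_le m : 'C(m.*2.+1, m) <= 4 ^ m.
Proof.
rewrite -(leq_pmul2l (isT : 0 < 2)).
have -> : 2 * 4 ^ m = 2 ^ m.*2.+1 by rewrite expnS -mul2n expnM.
have e : 'C(m.*2.+1, m.+1) = 'C(m.*2.+1, m).
  by rewrite -bin_sub; [congr 'C(_, _); lia | lia].
by rewrite mul2n -addnn -{2}e; apply: bin_sum_le; lia.
Qed.

(** The interval is open at [a], so that adjacent ranges concatenate without overlap. *)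
Definition primes_in a b := [seq p <- iota a.+1 (b - a) | prime p].

Lemma mem_primes_in a b p : (p \in primes_in a b) = prime p && (a < p <= b).
Proof. by rewrite mem_filter mem_iota; congr andb; lia. Qed.

Lemma primes_in_uniq a b : uniq (primes_in a b).
Proof. by rewrite filter_uniq// iota_uniq. Qed.

Lemma primes_in_all a b : all prime (primes_in a b).
Proof. by apply/allP => p; rewrite mem_primes_in => /andP[]. Qed.

Lemma primes_in_cat a b c : a <= b <= c ->
  primes_in a c = primes_in a b ++ primes_in b c.
Proof.
move=> H; rewrite /primes_in -filter_cat.
have -> : c - a = (b - a) + (c - b) by lia.
by rewrite iotaD (_ : a.+1 + (b - a) = b.+1)//; lia.
Qed.

(** Erdos' induction: for [n = 2m + 1], the primes in []m + 1, 2m + 1]] divide the factorial of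
    [2m + 1] but not those of [m] and [m + 1], hence their product divides ['C(2m + 1, m) <= 4 ^ m];
    the smaller primes are covered by the bound for [m + 1]. An even [n > 2] adds no prime. *)
Lemma primorial_le n : \prod_(p <- primes_in 0 n) p <= 4 ^ n.
Proof.
elim/ltn_ind: n => n IH.
case: (ltnP n 3) => [n3|n3].
  by case: n n3 {IH} => [|[|[|//]]] _; rewrite unlock.
have [on|en] := boolP (odd n); last first.
  rewrite (@primes_in_cat _ n.-1 n); last by lia.
  have -> : primes_in n.-1 n = [::].
    rewrite /primes_in (_ : n - n.-1 = 1) /=; last by lia.
    rewrite prednK; last by lia.
    by case: ifP => // /even_prime[|]; [lia|rewrite (negbTE en)].
  rewrite cats0 (leq_trans (IH _ _))//; first by lia.
  by rewrite leq_exp2l//; lia.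
set m := n./2; have nE : n = m.*2.+1 by rewrite /m; lia.
rewrite (@primes_in_cat _ m.+1 n); last by lia.
rewrite big_cat /= nE.
have -> : 4 ^ m.*2.+1 = 4 ^ m.+1 * 4 ^ m by rewrite -expnD; congr expn; lia.
apply: leq_mul; first by apply: IH; lia.
apply: leq_trans (bin_odd_le m).
apply: dvdn_leq; first by rewrite bin_gt0; lia.
apply: dvdn_prod_primes; [exact: primes_in_uniq|exact: primes_in_all|].
move=> p; rewrite mem_primes_in => /andP[pp /andP[p1 p2]].
have H : p %| (m.*2.+1)`! by rewrite dvdn_fact//; lia.
have nd k : k < p -> ~~ (p %| k`!).
  elim: k => [|k IHk] kp; first by rewrite fact0 dvdn1; lia.
  by rewrite factS Euclid_dvdM// negb_or IHk ?andbT; [rewrite gtnNdvd|lia].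
have mm : m <= m.*2.+1 by lia.
move: H; rewrite -(bin_fact mm) Euclid_dvdM// => /orP[//|].
by rewrite Euclid_dvdM// (negbTE (nd _ _)) ?(negbTE (nd _ _))//; lia.
Qed.

(** Induction through ['C(2k + 2, k + 1) = 2 * 'C(2k + 1, k)] and [(k + 1) * 'C(2k + 1, k) = (2k +
    1) * 'C(2k, k)]. *)
Lemma central_bin_ge m : 0 < m -> 4 ^ m <= m.*2 * 'C(m.*2, m).
Proof.
elim: m => // -[|m] IH _; first by [].
have {}IH := IH isT; set k := m.+1 in IH *.
have e1 := mul_bin_diag k.+1.*2 k; have e2 := mul_bin_down k.*2.+1 k.
rewrite doubleS /= in e1 e2.
have e3 : k.*2.+1 - k = k.+1 by lia.
rewrite e3 in e2; rewrite doubleS expnS.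
set a := 'C(k.*2.+2, k.+1) in e1 *; set b := 'C(k.*2.+1, k) in e1 e2.
set c := 'C(k.*2, k) in e2 IH.
have ab : a = b.*2 by nia.
rewrite ab; move: IH; set q := 4 ^ k => IH.
have : q * 4 <= 4 * (k.*2 * c) by nia.
nia.
Qed.

Lemma sum_widen n m (F : nat -> nat) : n <= m -> (forall k, n < k -> F k = 0) ->
  \sum_(1 <= k < n.+1) F k = \sum_(1 <= k < m.+1) F k.
Proof.
move=> nm F0; rewrite (@big_cat_nat _ _ _ n.+1 1 m.+1)//=.
rewrite (_ : \sum_(n.+1 <= i < m.+1) F i = 0) ?addn0//.
by rewrite big_nat_cond big1// => k; rewrite andbT => /andP[h _]; apply: F0.
Qed.

(** Legendre's formula for the three factorials, summed over the common range up to [2m] because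
    larger powers of [p] contribute nothing. The truncated subtraction is exact: doubling a quotient
    cannot exceed the quotient of the double. *)
Lemma logn_central_bin p m : prime p ->
  logn p 'C(m.*2, m) =
  \sum_(1 <= k < m.*2.+1) (m.*2 %/ p ^ k - (m %/ p ^ k).*2).
Proof.
move=> pp.
have mm : m <= m.*2 by lia.
have e : logn p (m.*2)`! = logn p 'C(m.*2, m) + (logn p m`!).*2.
  rewrite -(bin_fact mm) (_ : m.*2 - m = m); last by lia.
  by rewrite !lognM ?muln_gt0 ?fact_gt0 ?bin_gt0// addnn.
have -> : logn p 'C(m.*2, m) = logn p (m.*2)`! - (logn p m`!).*2 by lia.
rewrite !logn_fact//.
rewrite (@sum_widen m m.*2 (fun k => m %/ p ^ k))//; last first.
  move=> k mk; rewrite divn_small// (leq_trans mk)//.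
  by rewrite ltnW// ltn_expl// prime_gt1.
rewrite [X in _ - X](_ : _ = \sum_(1 <= k < m.*2.+1) (m %/ p ^ k).*2).
  rewrite sumnB// => k _; rewrite leq_divRL ?expn_gt0 ?prime_gt0//.
  by have := leq_trunc_div m (p ^ k); lia.
by rewrite -[LHS]mul2n big_distrr; apply: eq_bigr => i _ /=; rewrite mul2n.
Qed.

Lemma div_double_le q m : 0 < q -> m.*2 %/ q - (m %/ q).*2 <= (q <= m.*2).
Proof.
move=> q0; case: (leqP q m.*2) => h; last by rewrite divn_small.
have := divn_eq m q; have := ltn_pmod m q0; have := divn_eq m.*2 q.
have := ltn_pmod m.*2 q0.
set a := m %/ q; set b := m %% q; set c := m.*2 %/ q; set e := m.*2 %% q.
by move=> h1 h2 h3 h4; rewrite /=; nia.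
Qed.

(** Each Legendre term is 0 or 1, and it vanishes once [p ^ k] exceeds [2m]; so the exponent of [p]
    is at most the integer logarithm of [2m] to base [p]. *)
Lemma pfactor_central_bin p m : prime p -> 0 < m ->
  p ^ logn p 'C(m.*2, m) <= m.*2.
Proof.
move=> pp m0.
have m2 : 0 < m.*2 by lia.
apply: leq_trans (trunc_logP (prime_gt1 pp) m2).
rewrite leq_exp2l ?prime_gt1// logn_central_bin//.
apply: (@leq_trans (\sum_(1 <= k < m.*2.+1) (k <= trunc_log p m.*2))).
  apply: leq_sum => k _; apply: leq_trans (div_double_le _ _) _.
    by rewrite expn_gt0 prime_gt0.
  have [h|//] := leqP (p ^ k) m.*2.
  by rewrite (trunc_log_max (prime_gt1 pp) h).
set t := trunc_log _ _.
have tm : t <= m.*2.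
  apply: ltnW; apply: leq_trans (trunc_logP (prime_gt1 pp) m2).
  by rewrite ltn_expl// prime_gt1.
rewrite (@big_cat_nat _ _ _ t.+1 1 m.*2.+1)//=.
rewrite [X in _ + X](_ : _ = 0) ?addn0; last first.
  rewrite big_nat_cond big1// => k; rewrite andbT => /andP[h _].
  by rewrite leqNgt h.
apply: (@leq_trans (\sum_(1 <= k < t.+1) 1)); first by apply: leq_sum => k _; case: (k <= t).
by rewrite sum_nat_const_nat muln1; lia.
Qed.

(** From the second power of [p] on, all Legendre terms vanish. *)
Lemma logn_central_bin_le1 p m : prime p -> m.*2 < p * p ->
  logn p 'C(m.*2, m) <= m.*2 %/ p - (m %/ p).*2.
Proof.
move=> pp h; rewrite logn_central_bin//.
case: m h => [|m] h; first by rewrite big_geq.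
rewrite big_ltn; last by lia.
rewrite expn1 big_nat_cond big1 ?addn0// => k; rewrite andbT => /andP[k1 _].
rewrite divn_small// (leq_trans h)// mulnn leq_exp2l//; exact: prime_gt1.
Qed.
End Primes.

Section PrimesCount.
Local Open Scope nat_scope.

Lemma central_bin_prod m : 0 < m ->
  'C(m.*2, m) = \prod_(p <- primes_in 0 m.*2) p ^ logn p 'C(m.*2, m).
Proof.
move=> m0; set B := 'C(_, _).
have B0 : 0 < B by rewrite bin_gt0; lia.
rewrite [LHS](prod_prime_decomp B0) prime_decompE big_map /=.
rewrite [RHS](bigID (mem (primes B))) /= [X in _ = _ * X]big1 ?muln1; last first.
  by move=> p; rewrite mem_primes B0 /= => h; rewrite lognE B0 /= (negbTE h).
rewrite -[RHS]big_filter; apply: perm_big; apply: uniq_perm.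
- exact: primes_uniq.
- by rewrite filter_uniq// primes_in_uniq.
move=> p; rewrite mem_filter mem_primes_in/=; apply/idP/idP => [pB|/andP[]//].
rewrite pB; move: pB; rewrite mem_primes => /and3P[pp _ pB].
rewrite pp prime_gt0//= leqNgt; apply/negP => h.
have : p %| (m.*2)`!.
  by rewrite -(@bin_fact m.*2 m) ?dvdn_mulr//; lia.
apply/negP; elim: (m.*2) h => [|k IH] kp; first by rewrite fact0 dvdn1; case: (p) pp => [|[]].
by rewrite factS Euclid_dvdM// negb_or IH ?andbT; [rewrite gtnNdvd|lia].
Qed.

Lemma prod_le_expn (s : seq nat) (F : nat -> nat) b : 0 < b ->
  {in s, forall p, F p <= b} -> \prod_(p <- s) F p <= b ^ size s.
Proof.
move=> b0; elim: s => [|p s IH] H; first by rewrite big_nil.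
rewrite big_cons /= expnS leq_mul ?H ?mem_head// IH// => q qs.
by rewrite H// inE qs orbT.
Qed.

(** The prime factors of the central binomial are split at [s] (the integer square root of [2m]),
    [2m / 3] and [m]. Up to [s] and above [m], each prime power is at most [2m]. Between [s] and
    [2m / 3] the exponents are at most 1, so the primorial bound applies. Between [2m / 3] and [m]
    the exponents are 0, the quotients of [2m] and [m] being 2 and 1. The summand 1 in the exponent
    is the factor [2m] of [central_bin_ge]. *)
Lemma primes_in_count m s : 4 < m -> s * s <= m.*2 < s.+1 * s.+1 ->
  4 ^ (m - m.*2 %/ 3) <= m.*2 ^ (1 + s + size (primes_in m m.*2)).
Proof.
move=> m4 /andP[s1 s2].
have m0 : 0 < m by lia.
set B := 'C(m.*2, m).
have s3 : s <= m.*2 %/ 3 by rewrite leq_divRL//; nia.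
have H : B <= m.*2 ^ s * (4 ^ (m.*2 %/ 3) * m.*2 ^ size (primes_in m m.*2)).
  rewrite {1}/B (central_bin_prod m0) -/B.
  rewrite (@primes_in_cat 0 s m.*2); last by lia.
  rewrite (@primes_in_cat s (m.*2 %/ 3) m.*2); last by lia.
  rewrite (@primes_in_cat (m.*2 %/ 3) m m.*2); last by lia.
  rewrite !big_cat /=; apply: leq_mul.
    apply: leq_trans (prod_le_expn _ _) _; last 1 first.
    - apply: leq_pexp2l; first by lia.
      rewrite /primes_in size_filter (leq_trans (count_size _ _))// size_iota; lia.
    - by lia.
    move=> p; rewrite mem_primes_in => /andP[pp _].
    exact: pfactor_central_bin.
  apply: leq_mul; last first.
    rewrite -[leqRHS]mul1n; apply: leq_mul.
      rewrite big_seq_cond; apply: (big_ind (fun x => x <= 1)) => //.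
        by move=> x y hx hy; rewrite -[1]muln1 leq_mul.
      move=> p; rewrite andbT mem_primes_in => /andP[pp /andP[p1 p2]].
      have pm : m.*2 < p * p by nia.
      have := logn_central_bin_le1 pp pm.
      rewrite (_ : m.*2 %/ p - (m %/ p).*2 = 0).
        by rewrite leqn0 => /eqP ->.
      have p0 := prime_gt0 pp.
      have : m.*2 %/ p < 3 by rewrite ltn_divLR//; lia.
      have : 0 < m %/ p by rewrite divn_gt0.
      by lia.
    apply: prod_le_expn => [|p]; first by lia.
    by rewrite mem_primes_in => /andP[pp _]; apply: pfactor_central_bin.
  apply: leq_trans (primorial_le _).
  rewrite (@primes_in_cat 0 s (m.*2 %/ 3)); last by lia.
  rewrite big_cat /=; apply: leq_trans (leq_pmull _ _).
    rewrite big_seq_cond [leqRHS]big_seq_cond; apply: leq_prod => p.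
    rewrite andbT mem_primes_in => /andP[pp /andP[p1 p2]].
    have pm : m.*2 < p * p by nia.
    have := logn_central_bin_le1 pp pm.
    have := div_double_le m (prime_gt0 pp); rewrite -/B => h1 h2.
    rewrite -[leqRHS]expn1 leq_pexp2l ?prime_gt0//.
    by apply: leq_trans h2 (leq_trans h1 (leq_b1 _)).
  rewrite big_seq_cond; apply: prodn_cond_gt0 => p.
  by rewrite andbT mem_primes_in => /andP[pp _]; rewrite prime_gt0.
have H2 := central_bin_ge m0.
have m3 : m = (m - m.*2 %/ 3) + m.*2 %/ 3 by lia.
rewrite -(leq_pmul2r (_ : 0 < 4 ^ (m.*2 %/ 3))) ?expn_gt0// -expnD -m3.
apply: leq_trans H2 _; rewrite !expnD expn1 -!mulnA leq_mul2l.
by apply/orP; right; rewrite [X in _ <= _ * X]mulnC.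
Qed.
End PrimesCount.

Section PrimesLowerBound.
Variable R : realType.

Lemma ln_le_powR (e x : R) : 0 < e -> 1 <= x -> ln x <= x `^ e / e.
Proof.
move=> e0 x1; rewrite ler_pdivlMr// mulrC -ln_powR.
have x0 : 0 < x `^ e by rewrite powR_gt0// (lt_le_trans _ x1).
by have := ln_sublinear x0; lra.
Qed.

Lemma admissible_primesE nmax :
  admissible_primes nmax = primes_in (uphalf nmax) nmax.
Proof.
rewrite /admissible_primes /primes_in.
have -> : iota 0 nmax.+1 =
    iota 0 (uphalf nmax).+1 ++ iota (uphalf nmax).+1 (nmax - uphalf nmax).
  by rewrite -[X in _ ++ iota X _]add0n -iotaD; congr iota; rewrite uphalf_half; lia.
rewrite filter_cat [X in X ++ _](_ : _ = [::]).
  by apply: eq_in_filter => n; rewrite mem_iota => /andP[h _]; rewrite h andbT.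
apply/eqP; rewrite -[_ == _]negbK -has_filter; apply/hasPn => n.
by rewrite mem_iota negb_and -leqNgt => /andP[_ h]; apply/orP; right; lia.
Qed.

(** For odd [nmax = 2m + 1] the admissible range begins after [m + 1], so at most one prime of []m,
    2m]] is lost. *)
Lemma size_admissible_primes nmax :
  (size (primes_in nmax./2 nmax./2.*2) <= (size (admissible_primes nmax)).+1)%N.
Proof.
rewrite admissible_primesE uphalf_half.
case: (boolP (odd nmax)) => /= on; last first.
  by rewrite add0n (_ : nmax./2.*2 = nmax)//; lia.
rewrite add1n; set m := nmax./2; have mE : nmax = m.*2.+1 by rewrite /m; lia.
have [->|m0] := posnP m; first by [].
rewrite mE (@primes_in_cat m m.+1 m.*2); last by lia.
rewrite (@primes_in_cat m.+1 m.*2 m.*2.+1); last by lia.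
have : (size (primes_in m m.+1) <= 1)%N.
  by rewrite /primes_in size_filter (leq_trans (count_size _ _))// size_iota; lia.
by rewrite !size_cat; lia.
Qed.

Lemma nat_sqrt_exists k : exists s, (s * s <= k < s.+1 * s.+1)%N.
Proof.
elim: k => [|k [s hs]]; first by exists 0%N.
have [h|h] := ltnP k.+1 (s.+1 * s.+1); [by exists s; lia|by exists s.+1; lia].
Qed.

Lemma half_double_bounds N : (9 < N)%N ->
  [/\ (4 < N./2)%N, (0 < N./2.*2)%N, (N <= 2 * N./2.*2)%N &
      (N./2.*2 <= (N./2 - N./2.*2 %/ 3) * 6)%N].
Proof. by move=> h; split; lia. Qed.

(** Taking logarithms in [primes_in_count] and using [ln X <= X ^ h / h] for [X = 2m] gives
    [a * X ^ (1 - h) <= 2 + s + M]. If [s <= M], this is the claim; otherwise [s <= sqrt X] bounds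
    [X]. Bounded [nmax] are settled by [1 <= M], which is why the set of primes is assumed to be
    nonempty. *)
Lemma size_admissible_primes_ge (e : R) : 0 < e ->
  exists2 c : R, 0 < c & forall nmax, (1 < nmax)%N ->
    (0 < size (admissible_primes nmax))%N ->
    c * nmax%:R `^ (1 - e) <= (size (admissible_primes nmax))%:R.
Proof.
(* The cap keeps [1 - h] at [3 / 4] or more, so that [X ^ (1 - h)] outgrows the term [sqrt X] from
   the small primes. *)
move=> e0; pose h : R := Num.min e (4^-1).
have h0 : 0 < h by rewrite lt_min e0/=; lra.
have he : h <= e by rewrite ge_min lexx.
have h4 : h <= 4^-1 by rewrite ge_min lexx orbT.
pose a : R := ln 4 * h / 6.
have l4 : 0 < ln (4 : R) by rewrite ln_gt0//; lra.
have a0 : 0 < a by rewrite /a divr_gt0// mulr_gt0.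
(* If [M < s], then [a * X ^ (3 / 4) <= 4 * X ^ (1 / 2)], whence [X <= (4 / a) ^ 4]; and
   [nmax <= 2 * X]. *)
pose B : R := 2 * (4 / a) ^+ 4.
have B0 : 0 < B by rewrite /B mulr_gt0// exprn_gt0// divr_gt0.
(* One entry for each case: [nmax < 10], the asymptotic estimate, and [nmax <= B]. *)
pose c : R := Num.min (10^-1) (Num.min (a / 8) B^-1).
have c0 : 0 < c by rewrite !lt_min; apply/and3P; split; rewrite ?invr_gt0// divr_gt0.
exists c => // N N1 M0; set M := (size _)%:R.
have M1 : 1 <= M by rewrite /M ler1n.
have N1' : 1 <= N%:R :> R by rewrite ler1n ltnW.
have small (b : R) : 0 < b -> c <= b^-1 -> N%:R <= b -> c * N%:R `^ (1 - e) <= M.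
  move=> b0 cb Nb; apply: le_trans M1.
  apply: le_trans (_ : b^-1 * N%:R <= 1); last by rewrite mulrC ler_pdivrMr// mul1r.
  apply: ler_pM; [exact: ltW|exact: powR_ge0| |] => //.
  by apply: ler1_powR => //; lra.
have [N10|N10] := ltnP N 10.
  by apply: (small 10) => //; [rewrite ge_min lexx|rewrite (ler_nat R N 10) ltnW].
set m := N./2.
have [m4 m0 Nm m6] := half_double_bounds N10; rewrite -/m in m4 m0 Nm m6.
have [s hs] := nat_sqrt_exists m.*2.
have X1 : 1 <= (m.*2)%:R :> R by rewrite ler1n.
set X : R := (m.*2)%:R in X1 *.
have X0 : 0 < X by rewrite (lt_le_trans _ X1).
have H : (m - m.*2 %/ 3)%:R * ln 4 <=
         (1 + s + size (primes_in m m.*2))%:R * ln X.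
  by rewrite !mulr_natl -!lnXn// ler_ln ?posrE ?exprn_gt0// -!natrX ler_nat primes_in_count.
have NX : N%:R <= 2 * X by rewrite /X -natrM ler_nat.
have sX : s%:R <= X `^ 2^-1.
  have ss : Num.sqrt (s%:R ^+ 2) = s%:R :> R by rewrite sqrtr_sqr ger0_norm.
  rewrite powR12_sqrt ?(ltW X0)// -ss; apply: ler_wsqrtr; rewrite -natrX ler_nat -mulnn; by case/andP: hs.
have pM : (size (primes_in m m.*2))%:R <= M + 1.
  by rewrite /M natr1 ler_nat size_admissible_primes.
have mX : X / 6 <= (m - m.*2 %/ 3)%:R.
  by rewrite ler_pdivrMr// /X -natrM ler_nat.
have lnX := ln_le_powR h0 X1.
have Xh : 0 < X `^ h by rewrite powR_gt0.
have key : a * X `^ (1 - h) <= 2 + s%:R + M.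
  rewrite powRB ?powRr1 ?(ltW X0)//; last by apply/implyP => _; rewrite gt_eqF.
  rewrite mulrA ler_pdivrMr//.
  have lX0 : 0 <= ln X by rewrite ln_ge0.
  have k1 : X / 6 * ln 4 <= (2 + s%:R + M) * (X `^ h / h).
    apply: le_trans (_ : (1 + s + size (primes_in m m.*2))%:R * ln X <= _).
      by apply: le_trans H; rewrite ler_wpM2r// ltW.
    apply: ler_pM => //; rewrite !natrD; lra.
  have -> : a * X = X / 6 * ln 4 * h by rewrite /a; lra.
  by rewrite -ler_pdivlMr//; apply: le_trans k1 _; rewrite mulrA.
have [sM|Ms] := leP s%:R M.
  have k2 : a * X `^ (1 - h) <= 4 * M by lra.
  have k3 : N%:R `^ (1 - e) <= 2 * X `^ (1 - h).
    apply: le_trans (_ : N%:R `^ (1 - h) <= _); first by rewrite ler_powR//; lra.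
    apply: le_trans (_ : (2 * X) `^ (1 - h) <= _).
      by rewrite ge0_ler_powR ?nnegrE//; lra.
    rewrite powRM ?(ltW X0)// ler_wpM2r ?powR_ge0// ler1_powR//; lra.
  apply: le_trans (_ : a / 8 * (2 * X `^ (1 - h)) <= _); last by lra.
  apply: ler_pM; [exact: ltW|exact: powR_ge0| |] => //.
  by rewrite /c ge_min; apply/orP; right; rewrite ge_min lexx.
apply: (small B) => //.
  by rewrite /c ge_min; apply/orP; right; rewrite ge_min lexx orbT.
apply: (le_trans NX); rewrite /B ler_pM2l//.
have k2 : a * X `^ (1 - h) <= 4 * X `^ 2^-1 by lra.
have k3 : X `^ 4^-1 <= 4 / a.
  rewrite ler_pdivlMr// mulrC.
  have Xq : 0 < X `^ 2^-1 by rewrite powR_gt0.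
  rewrite -(ler_pM2r Xq) -mulrA -powRD; last by apply/implyP => _; rewrite gt_eqF.
  apply: le_trans k2; rewrite ler_pM2l// ler_powR//; lra.
have -> : X = (X `^ 4^-1) ^+ 4.
  by rewrite -powR_mulrn ?powR_ge0// -powRrM mulVf// powRr1// ltW.
by rewrite ler_pXn2r// nnegrE ?powR_ge0// divr_ge0// ltW.
Qed.
End PrimesLowerBound.

(** * Singular integrals of cosine polynomials *)

Section IntegralToolkit.
Variable R : realType.
Notation mu := (@lebesgue_measure R).
Implicit Types (f g : R -> R) (D E : set (measurableTypeR R)) (a b c : R).

Definition ig D f := mu.-integrable D (EFin \o f).

Lemma igD D f g : measurable D -> ig D f -> ig D g -> ig D (fun x => f x + g x).
Proof. by move=> mD hf hg; exact: (integrableD mD hf hg). Qed.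

Lemma igZ D c f : measurable D -> ig D f -> ig D (fun x => c * f x).
Proof. by move=> mD hf; exact: (integrableZl mD c hf). Qed.

Lemma igB D f g : measurable D -> ig D f -> ig D g -> ig D (fun x => f x - g x).
Proof. by move=> mD hf hg; exact: (integrableB mD hf hg). Qed.

Lemma ig0 D : measurable D -> ig D (fun=> 0).
Proof. by move=> mD; rewrite /ig (_ : EFin \o _ = cst 0%E)//; exact: integrable0. Qed.

Lemma ig_sum D (I : Type) (s : seq I) (F : I -> R -> R) : measurable D ->
  (forall i, ig D (F i)) -> ig D (fun x => \sum_(i <- s) F i x).
Proof.
move=> mD H; elim: s => [|i s IH].
  by rewrite (_ : (fun x => _) = fun=> 0); [exact: ig0|apply/funext => x; rewrite big_nil].
rewrite (_ : (fun x => _) = fun x => F i x + \sum_(j <- s) F j x).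
  exact: igD.
by apply/funext => x; rewrite big_cons.
Qed.

Lemma Rintegral_sum D (I : Type) (s : seq I) (F : I -> R -> R) : measurable D ->
  (forall i, ig D (F i)) ->
  \int[mu]_(x in D) (\sum_(i <- s) F i x) =
  \sum_(i <- s) \int[mu]_(x in D) F i x.
Proof.
move=> mD H; elim: s => [|i s IH].
  rewrite big_nil; under eq_Rintegral do rewrite big_nil.
  by rewrite Rintegral_cst// mul0r.
under eq_Rintegral do rewrite big_cons.
by rewrite big_cons RintegralD// ?IH//; [exact: H|exact: ig_sum].
Qed.

Lemma eq_ig D f g : {in D, f =1 g} -> measurable D -> ig D f -> ig D g.
Proof. by move=> fg mD; apply: eq_integrable => // x xD; rewrite /= fg. Qed.

Lemma ig_ext D f g : f =1 g -> ig D f -> ig D g.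
Proof. by move=> /funext ->. Qed.

Lemma ig_sub D E f : measurable D -> measurable E -> E `<=` D -> ig D f -> ig E f.
Proof. by move=> mD mE ED; apply: integrableS. Qed.

Lemma ig_continuous a b f : {within `[a, b], continuous f} -> ig `[a, b] f.
Proof. by move=> cf; apply: continuous_compact_integrable => //; exact: segment_compact. Qed.

Lemma ig_le D f g : measurable D -> measurable_fun D f ->
  (forall x, D x -> `|f x| <= g x) -> ig D g -> ig D f.
Proof.
move=> mD mf fg; apply: le_integrable => //; first exact/measurable_EFinP.
by move=> x Dx /=; rewrite lee_fin (le_trans (fg x Dx))// ler_norm.
Qed.

Lemma measurable_ig D f : ig D f -> measurable_fun D f.
Proof. by move/measurable_int/measurable_EFinP. Qed.

Lemma affine_measurable a c : measurable_fun [set: measurableTypeR R] (fun x : R => a * x + c).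
Proof.
apply: continuous_measurable_fun => x.
by apply: cvgD; [apply: cvgM; [exact: cvg_cst|exact: cvg_id]|exact: cvg_cst].
Qed.

(** The scaled pushforward agrees with Lebesgue measure on half-open intervals, and uniqueness does
    the rest. For negative [a] the preimage is closed at the other end, which does not change its
    length. *)
Lemma affine_pushforward a c (a0 : a != 0) (A : set (measurableTypeR R)) :
  measurable A ->
  mu A = (`|a|%:E * pushforward mu (fun x => (a * x + c)%R) A)%E.
Proof.
have na0 : 0 < `|a| by rewrite normr_gt0.
pose phi : measurableTypeR R -> measurableTypeR R := fun x => a * x + c.
have mphi : measurable_fun setT phi by exact: affine_measurable.
pose mphi' := isMeasurableFun.Build _ _ _ _ phi mphi.
pose pphi : {mfun (measurableTypeR R) >-> (measurableTypeR R)} := HB.pack phi mphi'.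
move=> mA.
have := @lebesgue_measure_unique R (mscale (NngNum (ltW na0)) (pushforward mu pphi)).
apply => // _ [[x y]] _ <-.
change (mu `]x, y]%classic = (`|a|%:E * mu (phi @^-1` `]x, y]%classic))%E).
case: (ltrgtP a 0) a0 na0 => [aN|aP|//] _ na0.
  rewrite (_ : phi @^-1` `]x, y]%classic = `[(y - c) / a, (x - c) / a[%classic); last first.
    apply/seteqP; split => t /=; rewrite !in_itv/= /phi ?ler_ndivrMr ?ltr_ndivlMr//;
      move=> /andP[h1 h2]; apply/andP; split; lra.
  rewrite !lebesgue_measure_itv/= !lte_fin ltr_ndivrMr// divfK ?lt_eqF// ltrD2r.
  case: ifPn => [xy|]; last by rewrite mule0.
  rewrite -!EFinB -EFinM; congr EFin; rewrite ltr0_norm// -mulrBl mulrC mulrN divfK ?lt_eqF//; lra.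
rewrite (_ : phi @^-1` `]x, y]%classic = `](x - c) / a, (y - c) / a]%classic); last first.
  apply/seteqP; split => t /=; rewrite !in_itv/= /phi ?ler_pdivlMr ?ltr_pdivrMr//;
    move=> /andP[h1 h2]; apply/andP; split; lra.
rewrite !lebesgue_measure_itv/= !lte_fin ltr_pdivrMr// divfK ?gt_eqF// ltrD2r.
case: ifPn => [xy|]; last by rewrite mule0.
rewrite -!EFinB -EFinM; congr EFin; rewrite gtr0_norm// -mulrBl mulrC divfK ?gt_eqF//; lra.
Qed.

Lemma ge0_integral_affine a c (a0 : a != 0) D (f : measurableTypeR R -> \bar R) :
  measurable D ->
  measurable_fun D f -> (forall x, D x -> (0 <= f x)%E) ->
  (\int[mu]_(x in D) f x =
   `|a|%:E * \int[mu]_(x in (fun x => (a * x + c)%R) @^-1` D) f (a * x + c)%R)%E.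
Proof.
move=> mD mf f0.
have na0 : 0 < `|a| by rewrite normr_gt0.
pose phi : measurableTypeR R -> measurableTypeR R := fun x => a * x + c.
have mphi : measurable_fun setT phi by exact: affine_measurable.
pose mphi' := isMeasurableFun.Build _ _ _ _ phi mphi.
pose pphi : {mfun (measurableTypeR R) >-> (measurableTypeR R)} := HB.pack phi mphi'.
have <- := @ge0_integral_pushforward _ _ _ _ R phi mphi mu D f mD mf
  (fun y yD => f0 y (set_mem yD)).
rewrite -(@ge0_integral_mscale _ _ _ (pushforward mu pphi) D mD (NngNum (ltW na0)) f mf)//.
apply: eq_measure_integral => A mA _ /=.
by rewrite /mscale/= -affine_pushforward.
Qed.

Lemma ig_affine a c (a0 : a != 0) D f : measurable D -> ig D f ->
  ig ((fun x => a * x + c) @^-1` D) (fun x => f (a * x + c)).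
Proof.
move=> mD /integrableP[mf foo].
have mE : measurable ((fun x : R => a * x + c) @^-1` D).
  by rewrite -[X in measurable X]setTI; apply: affine_measurable.
apply/integrableP; split.
  apply: (@measurable_comp _ _ _ _ _ _ D (EFin \o f) _ (fun x : measurableTypeR R => a * x + c : measurableTypeR R)) => //.
    by move=> _ [x Dx <-].
  by apply: measurable_funTS; exact: affine_measurable.
move: foo; rewrite (ge0_integral_affine c a0)//; last by apply: measurableT_comp.
rewrite -lte_pdivlMl ?normr_gt0// => /lt_le_trans; apply.
by rewrite leey.
Qed.

Lemma Rintegral_affine a c (a0 : a != 0) D f : measurable D -> ig D f ->
  \int[mu]_(x in D) f x =
  `|a| * \int[mu]_(x in (fun x => a * x + c) @^-1` D) f (a * x + c).
Proof.
move=> mD idf; have idf' := ig_affine c a0 mD idf.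
have mf := measurable_int mu idf.
have mE : measurable ((fun x : R => a * x + c) @^-1` D).
  by rewrite -[X in measurable X]setTI; apply: affine_measurable.
rewrite /Rintegral -[in RHS](_ : fine `|a|%:E = `|a|)// -fineM//; last exact: integrable_fin_num.
congr fine.
rewrite integralE [in RHS]integralE.
rewrite (ge0_integral_affine c a0 mD (measurable_funepos mf)) ?(ge0_integral_affine c a0 mD (measurable_funeneg mf))//.
have fP := @integrable_pos_fin_num _ _ _ mu _ mE _ idf'.
have -> : (\int[mu]_(x in (fun x => (a * x + c)%R) @^-1` D) (EFin \o f)^\+ (a * x + c)%R =
  \int[mu]_(x in (fun x => (a * x + c)%R) @^-1` D) (fun x => (f (a * x + c))%:E)^\+ x)%E.
  by apply: eq_integral => x _; rewrite !funeposE.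
have -> : (\int[mu]_(x in (fun x => (a * x + c)%R) @^-1` D) (EFin \o f)^\- (a * x + c)%R =
  \int[mu]_(x in (fun x => (a * x + c)%R) @^-1` D) (fun x => (f (a * x + c))%:E)^\- x)%E.
  by apply: eq_integral => x _; rewrite !funenegE.
by rewrite [RHS]muleBr// fin_num_adde_defr.
Qed.

Lemma Rintegral_setU_itv a b c f : a <= b <= c -> ig `[a, c] f ->
  \int[mu]_(x in `[a, c]) f x =
  \int[mu]_(x in `[a, b]) f x + \int[mu]_(x in `[b, c]) f x.
Proof.
move=> /andP[ab bc] idf.
have := @Rintegral_itvB R f (BLeft a) (BRight c) b idf; rewrite !bnd_simp.
move=> /(_ ab bc); rewrite Rintegral_itv_obnd_cbnd; last first.
  by apply: ig_sub idf => //; apply: subset_itvr; rewrite bnd_simp.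
by move=> <-; rewrite addrC subrK.
Qed.
End IntegralToolkit.

(** * Integrability against the singular kernel *)

Section SingularKernel.
Variable R : realType.
Notation mu := (@lebesgue_measure R).
Implicit Types (a b c x y u : R).

Lemma continuous_affine a c : continuous (fun x : R => a * x + c).
Proof.
by move=> x; apply: cvgD; [apply: cvgM; [exact: cvg_cst|exact: cvg_id]|exact: cvg_cst].
Qed.

Lemma continuous_sin_affine a c : continuous (fun x : R => sin (a * x + c)).
Proof. by move=> x; apply: continuous_comp; [exact: continuous_affine|exact: continuous_sin]. Qed.

Lemma continuous_cos_affine a c : continuous (fun x : R => cos (a * x + c)).
Proof. by move=> x; apply: continuous_comp; [exact: continuous_affine|exact: continuous_cos]. Qed.

Lemma continuous_cos_scale a : continuous (fun x : R => cos (a * x)).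
Proof. by move=> x; have := @continuous_cos_affine a 0 x; under eq_fun do rewrite addr0. Qed.

Lemma continuous_sin_scale a : continuous (fun x : R => sin (a * x)).
Proof. by move=> x; have := @continuous_sin_affine a 0 x; under eq_fun do rewrite addr0. Qed.

Lemma continuous_bigsum (I : Type) (s : seq I) (F : I -> R -> R) :
  (forall i, continuous (F i)) -> continuous (fun x => \sum_(i <- s) F i x).
Proof.
move=> cF; elim: s => [|i s IH] x.
  by under eq_fun do rewrite big_nil; exact: cvg_cst.
by under eq_fun do rewrite big_cons; apply: cvgD; [exact: cF|exact: IH].
Qed.

Lemma ig_continuousT a b (f : R -> R) : continuous f -> ig `[a, b] f.
Proof. by move=> cf; apply: ig_continuous; exact: continuous_subspaceT. Qed.

Lemma sin_le_id x : 0 <= x -> sin x <= x.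
Proof.
move=> x0.
have d (t : R) : t \in `]0, x[ -> is_derive t 1 (fun t : R => t - sin t) (1 - cos t).
  by move=> _; apply: is_deriveB.
have cf : {within `[0, x], continuous (fun t : R => t - sin t)}.
  by apply: continuous_subspaceT => t; apply: cvgB; [exact: cvg_id|exact: continuous_sin].
have [c _] := MVT_segment x0 d cf.
by rewrite sin0 !subr0 => h; have := cos_le1 c; nra.
Qed.

Lemma norm_sin_le x : `|sin x| <= `|x|.
Proof.
wlog x0 : x / 0 <= x => [H|].
  case: (leP 0 x) => [|/ltW h]; first exact: H.
  by have := H (- x); rewrite sinN !normrN oppr_ge0; apply.
rewrite (ger0_norm x0) ler_norml sin_le_id// andbT.
case: (leP x 2) => [x2|x2]; last by have := sin_geN1 x; lra.
have [->|xn0] := eqVneq x 0; first by rewrite sin0 oppr0.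
apply: le_trans (_ : 0 <= _); first by rewrite oppr_le0.
apply: sin_ge0_pi; rewrite x0/= (le_trans x2)//; exact: pi_ge2.
Qed.

(** Duplication and the mean value theorem give [sin x = x * cos t * cos (x / 2)] for some [t] below
    [x / 2]; both cosines are at least [cos (pi / 4)], whose square is [1 / 2]. *)
Lemma sin_ge_half x : 0 <= x <= pi / 2 -> x / 2 <= sin x.
Proof.
move=> /andP[x0 xp].
have pi2 := @pi_gt0 R.
pose c : R := cos (pi / 4).
have c0 : 0 <= c by apply: cos_ge0_pihalf; lra.
have cc : c ^+ 2 = 2^-1.
  have := cos_mulr2n (pi / 4 : R); rewrite -/c.
  have -> : (pi / 4 : R) *+ 2 = pi / 2 by lra.
  rewrite cos_pihalf => h; lra.
have cosge t : 0 <= t <= x / 2 -> c <= cos t.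
  move=> /andP[t0 t1]; rewrite /c leNgt ltr_cos ?in_itv/=; last 2 first.
    by apply/andP; split; lra.
    by apply/andP; split; lra.
  by rewrite -leNgt; lra.
have e : x = (x / 2) *+ 2 by lra.
rewrite [X in _ <= sin X]e sin_mulr2n.
have h1 : c <= cos (x / 2) by apply: cosge; lra.
have x20 : 0 <= x / 2 by lra.
have cf : {within `[0, x / 2], continuous (@sin R)}.
  by apply: continuous_subspaceT; exact: continuous_sin.
have [t tx] := MVT_segment x20 (fun t _ => is_derive_sin t) cf.
rewrite sin0 !subr0 => ->.
have h2 : c <= cos t by apply: cosge; move: tx; rewrite in_itv.
have h3 : c ^+ 2 <= cos (x / 2) * cos t.
  by rewrite expr2; apply: ler_pM.
rewrite cc in h3; nra.
Qed.

(** Both kernels of the Sobolev forms are this even function of period 2, taken at [x - y] and at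
    [x + y]. *)
Definition sing_kernel b u : R := (`|sin (pi * u / 2)| `^ b)^-1.

Lemma sing_kernelE b u : sing_kernel b u = `|sin (pi * u / 2)| `^ (- b).
Proof. by rewrite /sing_kernel powRN. Qed.

Lemma sing_kernelN b u : sing_kernel b (- u) = sing_kernel b u.
Proof. by rewrite /sing_kernel mulrN mulNr sinN normrN. Qed.

Lemma sing_kernelD2 b u : sing_kernel b (u + 2) = sing_kernel b u.
Proof.
rewrite /sing_kernel; have -> : pi * (u + 2) / 2 = pi * u / 2 + pi :> R by lra.
by rewrite sinDpi normrN.
Qed.

Lemma sing_kernel_ge0 b u : 0 <= sing_kernel b u.
Proof. by rewrite invr_ge0 powR_ge0. Qed.

Lemma measurable_sing_kernel b (D : set (measurableTypeR R)) : measurable_fun D (sing_kernel b).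
Proof.
rewrite (_ : sing_kernel b = (fun x : R => x `^ (- b)) \o (fun u => `|sin (pi * u / 2)|)); last first.
  by apply/funext => u; rewrite sing_kernelE.
apply: measurable_funTS; apply: measurableT_comp; first exact: measurable_powR.
apply: measurableT_comp => //; apply: continuous_measurable_fun => x.
rewrite (_ : (fun u => _) = fun u => sin ((pi / 2) * u)); first exact: continuous_sin_scale.
by apply/funext => u; congr sin; lra.
Qed.

Lemma sing_kernel_le b u : 0 <= b -> 0 < u <= 1 ->
  sing_kernel b u <= 2 `^ b * u `^ (- b).
Proof.
move=> b0 /andP[u0 u1].
have p2 := @pi_ge2 R.
have s0 : u / 2 <= `|sin (pi * u / 2)|.
  apply: le_trans (ler_norm _); apply: le_trans (sin_ge_half _); first nra.
  by apply/andP; split; nra.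
have -> : 2 `^ b * u `^ (- b) = ((u / 2) `^ b)^-1.
  by rewrite powRM ?(ltW u0)// invfM -!powRN -[2^-1]powR_inv1// -powRrM mulN1r opprK mulrC.
rewrite lef_pV2 ?posrE ?powR_gt0//; last 2 first.
- by apply: lt_le_trans s0; lra.
- by lra.
by rewrite ge0_ler_powR ?nnegrE//; lra.
Qed.

Lemma Rintegral_powR a (p : R) : 0 < a -> a < 1 -> -1 < p ->
  (\int[mu]_(x in `[a, 1%R]) (x `^ p)%:E = ((1 - a `^ (p + 1)) / (p + 1))%R%:E)%E.
Proof.
move=> a0 a1 p1; have p0 : p + 1 != 0 by lra.
have der (x : R) : 0 < x -> is_derive x 1 (fun x => x `^ (p + 1) / (p + 1)) (x `^ p).
  move=> x0; have xi : x \in `]0, +oo[%R by rewrite in_itv/= x0.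
  have dx := @derivable_powR R 1 (p + 1) x xi.
  have := powR_derive1 (p + 1) xi; rewrite addrK => e.
  have h := @is_deriveZ _ _ _ (fun x => x `^ (p + 1)) (p + 1)^-1 x 1 _ (DeriveDef dx erefl).
  have -> : (fun x : R => x `^ (p + 1) / (p + 1)) = (p + 1)^-1 \*: (fun x : R => x `^ (p + 1)).
    by apply/funext => y /=; rewrite mulrC.
  by apply: is_derive_eq h _; rewrite -derive1E e /GRing.scale/= mulrA mulVf// mul1r.
have cd (f : R -> R) (q : R) x : 0 < x -> {for x, continuous (fun x : R => x `^ q)}.
  move=> x0; have xi : x \in `]0, +oo[%R by rewrite in_itv/= x0.
  by apply: differentiable_continuous; apply/derivable1_diffP; exact: derivable_powR.
have sub x : x \in `[a, 1]%R -> 0 < x by rewrite in_itv/= => /andP[h _]; exact: lt_le_trans h.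
rewrite (@continuous_FTC2 R _ (fun x => x `^ (p + 1) / (p + 1)))//.
- by rewrite -EFinB powR1 -mulrBl.
- apply: continuous_in_subspaceT => x /[!inE] /sub x0; exact: cd.
- split => [x xi||].
  + by apply: ex_derive; apply: der; apply: sub; exact: subset_itv_oo_cc.
  + apply: cvg_at_right_filter; apply: cvgM; last exact: cvg_cst.
    exact: cd.
  + apply: cvg_at_left_filter; apply: cvgM; last exact: cvg_cst.
    exact: cd.
- move=> x xi; rewrite derive1E; have x0 : 0 < x by apply: sub; exact: subset_itv_oo_cc.
  by have := der x x0; move=> ?; rewrite derive_val.
Qed.

Lemma ig_closed (f : R -> R) a b : ig `]a, b] f -> ig `[a, b] f.
Proof.
move=> /integrableP[mf foo]; apply/integrableP; split.
  exact/measurable_EFinP/measurable_fun_itv_obnd_cbndP/measurable_EFinP.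
by rewrite -integral_itv_obnd_cbnd//; apply: measurableT_comp.
Qed.

(** Monotone convergence along the intervals from [1 / (n + 2)] to 1, on which the primitive bounds
    the integral by [1 / (p + 1)]. *)
Lemma ig_powR (p : R) : -1 < p -> ig `[0, 1] (fun x => x `^ p).
Proof.
move=> p1; apply: ig_closed.
have mp (D : set (measurableTypeR R)) : measurable_fun D (fun x : measurableTypeR R => (x `^ p)%:E).
  by apply/measurable_EFinP; apply: measurable_funTS; exact: measurable_powR.
apply/integrableP; split; first exact: mp.
under eq_integral do rewrite /= ger0_norm ?powR_ge0//.
pose F n : set (measurableTypeR R) := `[n.+2%:R^-1, 1]%classic.
have nF : nondecreasing_seq F.
  apply/nondecreasing_seqP => n; rewrite subsetEset; apply: subset_itvr.
  by rewrite bnd_simp lef_pV2 ?posrE// ler_nat.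
have -> : `]0, 1]%classic = \bigcup_i F i.
  apply/seteqP; split => x /=.
    rewrite in_itv/= => /andP[x0 x1].
    exists (Num.bound x^-1) => //; rewrite /F /= in_itv/= x1 andbT.
    rewrite -[leRHS]invrK lef_pV2 ?posrE ?invr_gt0//.
    apply: ltW; apply: lt_le_trans (archi_boundP _) _; first by rewrite invr_ge0 ltW.
    by rewrite ler_nat -addn2 leq_addr.
  by move=> [n _]; rewrite /F /= !in_itv/= => /andP[h ->]; rewrite andbT (lt_le_trans _ h)// invr_gt0.
have cv := @ge0_nondecreasing_set_cvg_integral _ _ R F (fun x => (x `^ p)%:E) mu nF
  (fun i => measurable_itv _) (fun i => mp _) (fun i x _ => ltac:(rewrite lee_fin powR_ge0; exact: isT)).
have := cvg_lim (@ereal_hausdorff R) cv => <-.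
apply: (@le_lt_trans _ _ ((p + 1)^-1)%:E); last exact: ltry.
apply: lime_le; first by apply/cvg_ex; eexists; exact: cv.
near=> n; rewrite /F Rintegral_powR//; last by rewrite invf_lt1// ltr1n.
have q0 : 0 < p + 1 by lra.
rewrite lee_fin ler_pdivrMr// mulVf ?gt_eqF// gerBl; exact: powR_ge0.
Unshelve. all: by end_near.
Qed.

(** Quadratic vanishing at 0 reduces the singularity to [u ^ (2 - b)] with [2 - b > -1]. The range
    [b < 3] covers the exponents [2 * alpha + 1] for [alpha < 1] and [2 * alpha - 1] for
    [alpha < 2]. *)
Lemma ig_sing_kernel b C (phi : R -> R) : 0 <= b < 3 -> continuous phi ->
  (forall u, 0 <= u <= 1 -> `|phi u| <= C * u ^+ 2) ->
  ig `[0, 1] (fun u => phi u * sing_kernel b u).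
Proof.
move=> /andP[b0 b3] cphi H.
have C0 : 0 <= C.
  by have := H 1; rewrite ler01 lexx expr1n mulr1 => /(_ isT); apply: le_trans.
apply: ig_closed.
apply: (@ig_le _ _ _ (fun u => C * 2 `^ b * u `^ (2 - b))) => //.
- apply: measurable_funM; last exact: measurable_sing_kernel.
  by apply: measurable_funTS; exact: continuous_measurable_fun.
- move=> u /=; rewrite in_itv/= => /andP[u0 u1].
  rewrite normrM (ger0_norm (sing_kernel_ge0 _ _)).
  apply: (@le_trans _ _ (C * u ^+ 2 * (2 `^ b * u `^ (- b)))).
    apply: ler_pM => //; first exact: sing_kernel_ge0.
      by apply: H; rewrite ltW.
    by apply: sing_kernel_le; rewrite ?u0.
  rewrite powRD; last by rewrite (gt_eqF u0) implybT.
  by rewrite powR_mulrn ?(ltW u0)//; lra.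
- apply: (@ig_sub _ `[0, 1]) => //; first exact: subset_itv_oc_cc.
  by apply: igZ => //; apply: ig_powR; lra.
Qed.

End SingularKernel.

Section SegmentIntegrals.
Variable R : realType.
Notation mu := (@lebesgue_measure R).
Implicit Types (a b c t : R) (f h : R -> R).

Lemma ig_cat a b c f : a <= b <= c -> ig `[a, b] f -> ig `[b, c] f -> ig `[a, c] f.
Proof.
move=> /andP[ab bc] h1 h2.
have e : `[a, c]%classic = `[a, b]%classic `|` `]b, c]%classic :> set R.
  by rewrite -itv_bndbnd_setU ?bnd_simp.
have h3 : ig `]b, c] f by apply: ig_sub h2 => //; exact: subset_itv_oc_cc.
have m1 := measurable_int mu h1; have m3 := measurable_int mu h3.
have mU : measurable_fun (`[a, b]%classic `|` `]b, c]%classic : set (measurableTypeR R)) (EFin \o f).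
  exact/measurable_funU.
rewrite e; apply/integrableP; split => //.
rewrite ge0_integral_setU//.
- by apply: lte_add_pinfty; [case/integrableP: h1|case/integrableP: h3].
- exact: measurableT_comp.
- apply/disj_setPS => x [] /=; rewrite !in_itv/= => /andP[_ h4] /andP[h5 _]; lra.
Qed.

Lemma preimage_shift a b t :
  (fun x : R => 1 * x + t) @^-1` `[a, b] = `[a - t, b - t]%classic.
Proof. by apply/seteqP; split => x /=; rewrite !in_itv/= => /andP[h1 h2]; apply/andP; split; lra. Qed.

Lemma preimage_opp a b :
  (fun x : R => -1 * x + 0) @^-1` `[a, b] = `[- b, - a]%classic.
Proof. by apply/seteqP; split => x /=; rewrite !in_itv/= => /andP[h1 h2]; apply/andP; split; lra. Qed.

Lemma ig_shift a b t f : ig `[a, b] f -> ig `[a - t, b - t] (fun x => f (x + t)).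
Proof.
move=> /(@ig_affine R 1 t (oner_neq0 _) _ _ (measurable_itv _)).
by rewrite preimage_shift; apply: ig_ext => x; rewrite mul1r.
Qed.

Lemma Rintegral_shift a b t f : ig `[a, b] f ->
  \int[mu]_(x in `[a, b]) f x = \int[mu]_(x in `[a - t, b - t]) f (x + t).
Proof.
move=> /(@Rintegral_affine R 1 t (oner_neq0 _) _ _ (measurable_itv _)) ->.
rewrite preimage_shift normr1 mul1r.
by apply: eq_Rintegral => x _; rewrite mul1r.
Qed.

Let N1 : -1 != 0 :> R. Proof. by rewrite oppr_eq0 oner_eq0. Qed.

Lemma ig_opp a b f : ig `[a, b] f -> ig `[- b, - a] (fun x => f (- x)).
Proof.
move=> /(@ig_affine R (-1) 0 N1 _ _ (measurable_itv _)).
by rewrite preimage_opp; apply: ig_ext => x; rewrite mulN1r addr0.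
Qed.

Lemma Rintegral_opp a b f : ig `[a, b] f ->
  \int[mu]_(x in `[a, b]) f x = \int[mu]_(x in `[- b, - a]) f (- x).
Proof.
move=> /(@Rintegral_affine R (-1) 0 N1 _ _ (measurable_itv _)) ->.
rewrite preimage_opp normrN normr1 mul1r.
by apply: eq_Rintegral => x _; rewrite mulN1r addr0.
Qed.

Lemma Rintegral_scale a b f : 0 < a -> ig `[0, a * b] f ->
  \int[mu]_(x in `[0, a * b]) f x = a * \int[mu]_(x in `[0, b]) f (a * x).
Proof.
move=> a0 /(@Rintegral_affine R a 0 (lt0r_neq0 a0) _ _ (measurable_itv _)) ->.
rewrite gtr0_norm//; congr (_ * _).
rewrite (_ : _ @^-1` _ = `[0, b]%classic); last first.
  apply/seteqP; split => x /=; rewrite !in_itv/= addr0 ler_pM2l// => /andP[h1 ->];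
    by rewrite andbT; nra.
by apply: eq_Rintegral => x _; rewrite addr0.
Qed.

(** Substitution makes the left side the integral of [h] over [[-1 - y, 1 - y]] and the right side
    that over [[-1, 1]], both full periods. This is how the pair of kernels at [x - y] and [x + y]
    becomes one convolution kernel on the circle of length 2. *)
Lemma int01_periodic_reflect h y : 0 <= y <= 1 -> (forall u, h (u + 2) = h u) ->
  ig `[0, 1] h -> ig `[0, 1] (fun u => h (- u)) ->
  int01 (fun x => h (x - y) + h (- x - y)) = int01 (fun u => h u + h (- u)).
Proof.
move=> /andP[y0 y1] per h1 h2.
have h3 : ig `[-1, 0] h.
  have := ig_opp h2; rewrite oppr0.
  by apply: ig_ext => x; rewrite opprK.
have h4 : ig `[-1, 1] h by apply: ig_cat h3 h1; lra.
have h5 : ig `[-3, -1] h.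
  have := ig_ext per (@ig_shift _ _ 2 _ h4).
  have -> : (-1 - 2 = -3 :> R) by lra.
  by have -> : (1 - 2 = -1 :> R) by lra.
have h6 : ig `[-3, 1] h by apply: ig_cat h5 h4; lra.
have sub a b : -3 <= a -> b <= 1 -> ig `[a, b] h.
  by move=> ha hb; apply: ig_sub h6 => //; apply: subset_itv; rewrite bnd_simp.
have s5 : \int[mu]_(x in `[-1 - y, -1]) h x = \int[mu]_(x in `[1 - y, 1]) h x.
  have i3 : ig `[1 - y, 1] h by apply: sub; lra.
  rewrite (@Rintegral_shift _ _ 2 _ i3).
  have -> : 1 - y - 2 = -1 - y by lra.
  have -> : (1 - 2 = -1 :> R) by lra.
  by apply: eq_Rintegral => x _; rewrite per.
have i1 : ig `[- y, 1 - y] h by apply: sub; lra.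
have i2 : ig `[-1 - y, - y] h by apply: sub; lra.
have e1 := @Rintegral_shift _ _ (- y) _ i1.
have j1 := @ig_shift _ _ (- y) _ i1.
have e2 := Rintegral_opp i2.
have j2' := ig_opp i2.
have e2' := @Rintegral_shift _ _ y _ j2'.
have j2 := @ig_shift _ _ y _ j2'.
rewrite opprK opprB (_ : y - (-1) - y = 1) ?subrr in e2' j2; last by lra.
rewrite opprK addNr subrK in e1 j1.
rewrite opprK opprB in e2.
have eN : (fun x => h (- x - y)) = (fun x => h (- (x + y))).
  by apply/funext => x; rewrite opprD.
have j3 : ig `[0, 1] (fun x => h (- x - y)) by rewrite eN.
rewrite /int01 RintegralD//.
rewrite -e1 eN -e2' -e2 RintegralD//.
have -> : \int[mu]_(x in `[0, 1]) h (- x) = \int[mu]_(x in `[-1, 0]) h x.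
  by rewrite (Rintegral_opp h3) oppr0 opprK.
have s1 : \int[mu]_(x in `[-1 - y, - y]) h x =
    \int[mu]_(x in `[-1 - y, -1]) h x + \int[mu]_(x in `[-1, - y]) h x.
  by apply: Rintegral_setU_itv => //; move: y0 y1; clear; lra.
have s2 : \int[mu]_(x in `[-1, 0]) h x =
    \int[mu]_(x in `[-1, - y]) h x + \int[mu]_(x in `[- y, 0]) h x.
  by apply: Rintegral_setU_itv => //; move: y0 y1; clear; lra.
have s3 : \int[mu]_(x in `[- y, 1 - y]) h x =
    \int[mu]_(x in `[- y, 0]) h x + \int[mu]_(x in `[0, 1 - y]) h x.
  by apply: Rintegral_setU_itv => //; move: y0 y1; clear; lra.
have s4 : \int[mu]_(x in `[0, 1]) h x =
    \int[mu]_(x in `[0, 1 - y]) h x + \int[mu]_(x in `[1 - y, 1]) h x.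
  by apply: Rintegral_setU_itv => //; move: y0 y1; clear; lra.
by move: s1 s2 s3 s4 s5; clear; lra.
Qed.

Lemma int01_cos (m : nat) : int01 (fun y : R => cos (m%:R * pi * y)) = (m == 0%N)%:R.
Proof.
case: m => [|m] /=.
  rewrite /int01; under eq_Rintegral do rewrite !mul0r cos0.
  by rewrite Rintegral_cst//= lebesgue_measure_itv/= lte_fin ltr01 -EFinB subr0 mulr1.
set r : R := m.+1%:R * pi.
have r0 : r != 0 by rewrite mulf_neq0// ?pnatr_eq0// gt_eqF// pi_gt0.
have der (x : R) : is_derive x 1 (fun x => r^-1 * sin (r * x)) (cos (r * x)).
  have h : is_derive x 1 (fun x : R => sin (r * x)) (r * cos (r * x)).
    by apply: is_derive_eq; rewrite /GRing.scale/= mulr1 mulrC.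
  have := @is_deriveZ _ _ _ _ r^-1 x 1 _ h.
  by rewrite /GRing.scale/= mulrA mulVf// mul1r.
rewrite /int01 /Rintegral (@continuous_FTC2 R _ (fun x => r^-1 * sin (r * x)))//.
- rewrite /= mulr0 sin0 mulr0 subr0 mulr1.
  suff -> : sin r = 0 by rewrite mulr0.
  by rewrite /r; elim: m.+1 => [|k IH]; rewrite ?mul0r ?sin0// -addn1 natrD mulrDl mul1r sinDpi IH oppr0.
- by apply: continuous_subspaceT; exact: continuous_cos_scale.
- have cc : continuous (fun x => r^-1 * sin (r * x)).
    by move=> x; apply: cvgM; [exact: cvg_cst|exact: continuous_sin_scale].
  split => [x _||].
  + by apply: ex_derive.
  + by apply: cvg_at_right_filter; exact: cc.
  + by apply: cvg_at_left_filter; exact: cc.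
- by move=> x _; rewrite derive1E; have := der x; move=> ?; rewrite derive_val.
Qed.

Lemma int01_cosB (k l : nat) :
  int01 (fun y : R => cos ((k%:R - l%:R) * pi * y)) = (k == l)%:R.
Proof.
wlog kl : k l / (l <= k)%N => [H|].
  case: (leqP l k) => [|/ltnW h]; first exact: H.
  rewrite eq_sym -H//; congr int01; apply/funext => y.
  by rewrite -cosN; congr cos; lra.
rewrite -natrB// int01_cos; congr (_%:R); congr nat_of_bool; lia.
Qed.

Lemma int01_cosD (k l : nat) :
  int01 (fun y : R => cos ((k%:R + l%:R) * pi * y)) = ((k == 0%N) && (l == 0%N))%:R.
Proof. by rewrite -natrD int01_cos addn_eq0. Qed.

Lemma int01_sum (I : Type) (s : seq I) (F : I -> R -> R) :
  (forall i, ig `[0, 1] (F i)) ->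
  int01 (fun x => \sum_(i <- s) F i x) = \sum_(i <- s) int01 (F i).
Proof. exact: Rintegral_sum. Qed.

Lemma int01Z c f : ig `[0, 1] f -> int01 (fun x => c * f x) = c * int01 f.
Proof. by move=> h; rewrite /int01 RintegralZl. Qed.

Lemma int01D f h : ig `[0, 1] f -> ig `[0, 1] h ->
  int01 (fun x => f x + h x) = int01 f + int01 h.
Proof. by move=> h1 h2; rewrite /int01 RintegralD. Qed.

Lemma eq_int01 f h : (forall x, 0 <= x <= 1 -> f x = h x) -> int01 f = int01 h.
Proof. by move=> H; apply: eq_Rintegral => x; rewrite inE/= in_itv/=; exact: H. Qed.

End SegmentIntegrals.

(** * Diagonalization of the singular double integrals *)

Section SingularQuadraticForm.
Variables (R : realType) (b : R).
Hypothesis b_itv : 0 <= b < 3.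
Notation K := (sing_kernel b).

(** The flag [s] lets one computation serve cosine polynomials ([alpha < 1]) and their derivatives,
    which are sine polynomials ([alpha > 1]). *)
Definition trig (s : bool) (k : nat) (x : R) : R :=
  if s then sin (k%:R * pi * x) else cos (k%:R * pi * x).

Lemma continuous_trig s k : continuous (trig s k).
Proof. by case: s; [exact: continuous_sin_scale|exact: continuous_cos_scale]. Qed.

Lemma trigD2 s k x : trig s k (x + 2) = trig s k x.
Proof.
have per (f : R -> R) : (forall y : R, f (y + pi *+ 2) = f y) -> f (k%:R * pi * (x + 2)) = f (k%:R * pi * x).
  move=> H; rewrite mulrDr; have -> : k%:R * pi * 2 = (pi *+ 2) *+ k :> R.
    by rewrite -[in RHS]mulr_natl -[pi *+ 2]mulr_natl; lra.
  elim: k => [|k IH]; first by rewrite mulr0n addr0.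
  elim: k.+1 (k.+1%:R * pi * x) => [|m IHm] z; first by rewrite mulr0n addr0.
  by rewrite mulrS addrA IHm H.
by case: s; apply: per; [exact: sinD2pi|exact: cosD2pi].
Qed.

Definition sing_coef (k l : nat) (r : R) : R :=
  int01 (fun u => 4 * sin (k%:R * pi * u / 2) * sin (l%:R * pi * u / 2) *
    cos (r * pi * u / 2) * K u).

Definition sing_eig (k : nat) : R :=
  int01 (fun u => 4 * sin (k%:R * pi * u / 2) ^+ 2 * K u).

Let dif s k y u := trig s k (y + u) - trig s k y.

Lemma trig_difference s k y u :
  dif s k y u = (if s then 2 * cos (k%:R * pi * (y + u / 2)) else - 2 * sin (k%:R * pi * (y + u / 2))) *
    sin (k%:R * pi * u / 2).
Proof.
rewrite /dif /trig.
have -> : k%:R * pi * (y + u) = k%:R * pi * (y + u / 2) + k%:R * pi * u / 2 by lra.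
have -> : k%:R * pi * y = k%:R * pi * (y + u / 2) - k%:R * pi * u / 2 by lra.
by case: s => /=; rewrite !(sinD, cosD, sinN, cosN); lra.
Qed.

Lemma trig_difference_le s k y u : `|dif s k y u| <= (k%:R * pi) * `|u|.
Proof.
rewrite trig_difference normrM.
have h : `|sin (k%:R * pi * u / 2)| <= k%:R * pi * `|u| / 2.
  apply: le_trans (norm_sin_le _) _.
  rewrite !normrM [`|2^-1|]ger0_norm// (ger0_norm (pi_ge0 R)) ger0_norm//.
apply: (@le_trans _ _ (2 * (k%:R * pi * `|u| / 2))); last by lra.
apply: ler_pM => //; case: s.
  by rewrite normrM ger0_norm// ler_piMr// cos_max.
by rewrite mulNr normrN normrM ger0_norm// ler_piMr// sin_max.
Qed.

(** Adding the contributions of [u] and [- u] cancels the products that are odd in [u]. Only cosines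
    of frequencies [k - l] and [k + l] in [y] remain, and they separate from the dependence on
    [u]. *)
Lemma trig_difference_prod s k l y u :
  dif s k y u * dif s l y u + dif s k y (- u) * dif s l y (- u) =
  4 * sin (k%:R * pi * u / 2) * sin (l%:R * pi * u / 2) *
  (cos ((k%:R - l%:R) * pi * y) * cos ((k%:R - l%:R) * pi * u / 2) +
   (if s then 1 else -1) *
   (cos ((k%:R + l%:R) * pi * y) * cos ((k%:R + l%:R) * pi * u / 2))).
Proof.
rewrite !trig_difference.
have e (m : nat) : m%:R * pi * (- u) / 2 = - (m%:R * pi * u / 2) :> R by lra.
rewrite !e !sinN.
have eD (m : nat) : m%:R * pi * (y + u / 2) = m%:R * pi * y + m%:R * pi * u / 2 :> R by lra.
have eB (m : nat) : m%:R * pi * (y + (- u) / 2) = m%:R * pi * y - m%:R * pi * u / 2 :> R by lra.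
have c1 : (k%:R - l%:R) * pi * y = k%:R * pi * y - l%:R * pi * y by lra.
have c2 : (k%:R - l%:R) * pi * u / 2 = k%:R * pi * u / 2 - l%:R * pi * u / 2 by lra.
have c3 : (k%:R + l%:R) * pi * y = k%:R * pi * y + l%:R * pi * y by lra.
have c4 : (k%:R + l%:R) * pi * u / 2 = k%:R * pi * u / 2 + l%:R * pi * u / 2 by lra.
rewrite c1 c2 c3 c4 !eD !eB.
move: (k%:R * pi * y) (l%:R * pi * y) (k%:R * pi * u / 2) (l%:R * pi * u / 2) => A B p q.
by case: s => /=; rewrite !(sinD, cosD, sinN, cosN); lra.
Qed.

Variables (n : nat) (c d : nat -> R).

Definition trigp s (c : nat -> R) x := \sum_(k <- iota 0 n) c k * trig s k x.

Lemma continuous_trigp s e : continuous (trigp s e).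
Proof.
apply: continuous_bigsum => k x; apply: cvgM; [exact: cvg_cst|exact: continuous_trig].
Qed.

Lemma trigpD2 s e x : trigp s e (x + 2) = trigp s e x.
Proof. by apply: eq_bigr => k _; rewrite trigD2. Qed.

Lemma ig_dif_prod s k l y t : t = 1 \/ t = -1 ->
  ig `[0, 1] (fun u => dif s k y (t * u) * dif s l y (t * u) * K u).
Proof.
move=> t1; apply: (@ig_sing_kernel _ _ (k%:R * pi * (l%:R * pi))) => //.
  move=> u; apply: cvgM; (apply: cvgB; last exact: cvg_cst);
  (apply: (@continuous_comp _ _ _ (fun u => y + t * u) (trig s _)); last exact: continuous_trig);
  (apply: cvgD; [exact: cvg_cst|apply: cvgM; [exact: cvg_cst|exact: cvg_id]]).
move=> u u01; rewrite normrM expr2.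
have nt : `|t * u| = `|u| by rewrite normrM; case: t1 => ->; rewrite ?normrN normr1 mul1r.
have := trig_difference_le s k y (t * u); have := trig_difference_le s l y (t * u).
rewrite nt [`|u|]ger0_norm; last by case/andP: u01.
by move=> h1 h2; rewrite mulrACA; apply: ler_pM.
Qed.

Lemma ig_sing_coef k l r : ig `[0, 1]
  (fun u => 4 * sin (k%:R * pi * u / 2) * sin (l%:R * pi * u / 2) * cos (r * pi * u / 2) * K u).
Proof.
apply: (@ig_sing_kernel _ _ (k%:R * pi * (l%:R * pi))) => //.
  have cs a : continuous (fun u : R => sin (a * pi * u / 2)).
    rewrite (_ : (fun u => _) = fun u => sin ((a * pi / 2) * u)); first exact: continuous_sin_scale.
    by apply/funext => u; congr sin; lra.
  have cc a : continuous (fun u : R => cos (a * pi * u / 2)).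
    rewrite (_ : (fun u => _) = fun u => cos ((a * pi / 2) * u)); first exact: continuous_cos_scale.
    by apply/funext => u; congr cos; lra.
  by move=> u; repeat apply: cvgM; [exact: cvg_cst|exact: cs|exact: cs|exact: cc].
move=> u /andP[u0 u1].
have h (m : nat) : `|sin (m%:R * pi * u / 2)| <= m%:R * pi * u / 2.
  apply: le_trans (norm_sin_le _) _.
  by rewrite !normrM [`|2^-1|]ger0_norm// (ger0_norm (pi_ge0 R)) !ger0_norm.
rewrite !normrM ger0_norm//.
have -> : k%:R * pi * (l%:R * pi) * u ^+ 2 =
   4 * (k%:R * pi * u / 2) * (l%:R * pi * u / 2) * 1 :> R by rewrite expr2; lra.
apply: ler_pM; [by rewrite !mulr_ge0|by []| |exact: cos_max].
apply: ler_pM; [by rewrite mulr_ge0|by []| |exact: h].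
by rewrite ler_pM2l// h.
Qed.

Lemma trigpB s e y u : trigp s e (y + u) - trigp s e y = \sum_(k <- iota 0 n) e k * dif s k y u.
Proof. by rewrite /trigp -sumrB; apply: eq_bigr => k _; rewrite -mulrBr. Qed.

(** With [h u] the product of the two increments from [y] to [y + u] times [K u], the summands are
    [h (x - y)] and [h (- x - y)], so [int01_periodic_reflect] removes the shift by [y]. *)
Lemma sing_quad_inner s y : 0 <= y <= 1 ->
  int01 (fun x => (trigp s c x - trigp s c y) * (trigp s d x - trigp s d y) * K (x - y) +
    (trigp s c (- x) - trigp s c y) * (trigp s d (- x) - trigp s d y) * K (x + y)) =
  \sum_(k <- iota 0 n) \sum_(l <- iota 0 n) c k * d l *
    (sing_coef k l (k%:R - l%:R) * cos ((k%:R - l%:R) * pi * y) +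
     (if s then 1 else -1) * sing_coef k l (k%:R + l%:R) * cos ((k%:R + l%:R) * pi * y)).
Proof.
move=> y01.
pose G x := (trigp s c x - trigp s c y) * (trigp s d x - trigp s d y).
pose h u := G (y + u) * K u.
have hE t u : t = 1 \/ t = -1 -> h (t * u) =
   \sum_(k <- iota 0 n) \sum_(l <- iota 0 n) c k * d l * (dif s k y (t * u) * dif s l y (t * u) * K u).
  move=> t1; rewrite /h /G !trigpB mulr_suml mulr_suml; apply: eq_bigr => k _.
  rewrite mulr_sumr mulr_suml; apply: eq_bigr => l _.
  have -> : K (t * u) = K u by case: t1 => ->; rewrite ?mul1r// mulN1r sing_kernelN.
  lra.
have ih t : t = 1 \/ t = -1 -> ig `[0, 1] (fun u => h (t * u)).
  move=> t1; apply: (ig_ext (fun u => esym (hE t u t1))).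
  apply: ig_sum => // k; apply: ig_sum => // l; apply: igZ => //.
  exact: ig_dif_prod.
transitivity (int01 (fun x => h (x - y) + h (- x - y))).
  congr int01; apply/funext => x; rewrite /h /G.
  have -> : y + (x - y) = x by lra.
  have -> : y + (- x - y) = - x by lra.
  by rewrite -opprD sing_kernelN.
rewrite int01_periodic_reflect//; last 3 first.
- by move=> u; rewrite /h addrA /G !trigpD2 sing_kernelD2.
- by apply: ig_ext (ih 1 (or_introl erefl)) => u; rewrite mul1r.
- by apply: ig_ext (ih (-1) (or_intror erefl)) => u; rewrite mulN1r.
transitivity (int01 (fun u => \sum_(k <- iota 0 n) \sum_(l <- iota 0 n) c k * d l *
   (cos ((k%:R - l%:R) * pi * y) * (4 * sin (k%:R * pi * u / 2) * sin (l%:R * pi * u / 2) *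
      cos ((k%:R - l%:R) * pi * u / 2) * K u) +
    (if s then 1 else -1) * cos ((k%:R + l%:R) * pi * y) *
     (4 * sin (k%:R * pi * u / 2) * sin (l%:R * pi * u / 2) *
      cos ((k%:R + l%:R) * pi * u / 2) * K u)))).
  congr int01; apply/funext => u.
  rewrite -[u in h u]mul1r -[- u]mulN1r !hE; [|by right|by left].
  rewrite -big_split; apply: eq_bigr => k _; rewrite -big_split; apply: eq_bigr => l _ /=.
  have := trig_difference_prod s k l y u; rewrite mul1r mulN1r => e.
  transitivity (c k * d l * ((dif s k y u * dif s l y u + dif s k y (- u) * dif s l y (- u)) * K u)); first by lra.
  by rewrite e; case: (s); lra.
rewrite int01_sum => [|k]; last first.
  apply: ig_sum => // l; apply: igZ => //; apply: igD => //; apply: igZ => //; exact: ig_sing_coef.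
apply: eq_bigr => k _; rewrite int01_sum => [|l]; last first.
  apply: igZ => //; apply: igD => //; apply: igZ => //; exact: ig_sing_coef.
apply: eq_bigr => l _.
have i r := ig_sing_coef k l r.
rewrite int01Z; last by apply: igD => //; apply: igZ.
rewrite int01D; [|by apply: igZ|by apply: igZ].
by rewrite !int01Z// /sing_coef; lra.
Qed.

(** The second summand is written at [- x]: parity turns it into a difference for cosines and into a
    sum for sines, as the two Sobolev forms require. Integration over [y] leaves the diagonal; at
    [k = l = 0] the additional term carries the factor [sin 0]. *)
Lemma sing_quad_form s :
  int01 (fun y => int01 (fun x =>
    (trigp s c x - trigp s c y) * (trigp s d x - trigp s d y) * K (x - y) +
    (trigp s c (- x) - trigp s c y) * (trigp s d (- x) - trigp s d y) * K (x + y))) =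
  \sum_(k <- iota 0 n) c k * d k * sing_eig k.
Proof.
rewrite (eq_int01 (@sing_quad_inner s)).
have ic r : ig `[0, 1] (fun y : R => cos (r * pi * y)).
  by apply: ig_continuousT; exact: continuous_cos_scale.
rewrite int01_sum => [|k]; last first.
  apply: ig_sum => // l; apply: igZ => //; apply: igD => //; apply: igZ => //.
rewrite [RHS]big_seq big_seq; apply: eq_bigr => k ks.
rewrite int01_sum => [|l]; last first.
  apply: igZ => //; apply: igD => //; apply: igZ => //.
rewrite (bigD1_seq k) ?iota_uniq//= big1 ?addr0.
  rewrite int01Z; last by apply: igD => //; apply: igZ.
  rewrite int01D; [|by apply: igZ|by apply: igZ].
  rewrite !int01Z// int01_cosB int01_cosD eqxx mulr1.
  have -> : sing_coef k k (k%:R - k%:R) = sing_eig k.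
    congr int01; apply/funext => u; rewrite subrr !mul0r cos0 expr2; lra.
  case: (k =P 0%N) => [->|_] /=; last by lra.
  suff -> : sing_coef 0 0 (0%:R + 0%:R) = 0 by lra.
  rewrite /sing_coef -[RHS](mul0r (int01 (fun=> 0 : R))) -int01Z ?ig0//.
  by congr int01; apply/funext => u; rewrite !mul0r sin0; lra.
move=> l lk; rewrite int01Z; last by apply: igD => //; apply: igZ.
rewrite int01D; [|by apply: igZ|by apply: igZ].
rewrite !int01Z// int01_cosB int01_cosD.
have -> : (k == l) = false by rewrite eq_sym; exact: negbTE.
have -> : (k == 0%N) && (l == 0%N) = false.
  by apply/negP => /andP[/eqP a /eqP a']; rewrite a a' eqxx in lk.
by rewrite !mulr0 addr0 mulr0.
Qed.

End SingularQuadraticForm.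

Section CosinePolynomials.
Variable R : realType.
Notation mu := (@lebesgue_measure R).
Implicit Types (alpha gamma : R) (c d : nat -> R).

Definition cosp (N : nat) c (x : R) : R := \sum_(k <- iota 0 N) c k * cos_basis k x.

Definition cos_scale (k : nat) : R := if k == 0%N then 1 else Num.sqrt 2.

Lemma cos_scale_sqr k : cos_scale k ^+ 2 = if k == 0%N then 1 else 2.
Proof. by rewrite /cos_scale; case: ifP => _; rewrite ?expr1n// sqr_sqrtr. Qed.

Lemma cos_basisE k (x : R) : cos_basis k x = cos_scale k * trig false k x.
Proof.
by rewrite /cos_basis /cos_scale /trig; case: eqP => [->|//]; rewrite !mul0r cos0 mulr1.
Qed.

Lemma continuous_cos_basis k : continuous (@cos_basis R k).
Proof.
rewrite (_ : cos_basis k = fun x => cos_scale k * trig false k x); last first.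
  by apply/funext => x; rewrite cos_basisE.
by move=> x; apply: cvgM; [exact: cvg_cst|exact: continuous_trig].
Qed.

Lemma continuous_cosp N c : continuous (cosp N c).
Proof.
apply: continuous_bigsum => k x; apply: cvgM; [exact: cvg_cst|exact: continuous_cos_basis].
Qed.

Lemma cospE N c : cosp N c = trigp N false (fun k => c k * cos_scale k).
Proof.
by apply/funext => x; apply: eq_bigr => k _; rewrite cos_basisE mulrA.
Qed.

Lemma big_iota_widen (V : nmodType) (n m : nat) (F : nat -> V) : (n <= m)%N ->
  (forall k, (n <= k)%N -> F k = 0) -> \sum_(k <- iota 0 n) F k = \sum_(k <- iota 0 m) F k.
Proof.
move=> nm F0; rewrite -(subnKC nm) iotaD big_cat /= [X in _ + X](_ : _ = 0) ?addr0//.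
by rewrite big_seq big1// => k; rewrite mem_iota => /andP[h _]; apply: F0.
Qed.

Definition trunc_coef (N : nat) c : nat -> R := fun k => if (k < N)%N then c k else 0.

Lemma cosp_widen n m c : (n <= m)%N -> cosp n c = cosp m (trunc_coef n c).
Proof.
move=> nm; apply/funext => x; rewrite /cosp -(@big_iota_widen _ n m)//.
  by rewrite big_seq [RHS]big_seq; apply: eq_bigr => k; rewrite mem_iota /trunc_coef => /andP[_ ->].
by move=> k nk; rewrite /trunc_coef ltnNge nk mul0r.
Qed.

Lemma cos_polyP (f : R -> R) : cos_poly f <-> exists N c, f = cosp N c.
Proof.
split=> -[n [c ->]]; exists n, c; apply/funext => x.
  by rewrite /cosp -[in iota 0 n](subn0 n) -/(index_iota 0 n) big_mkord.
by rewrite /cosp -[in iota 0 n](subn0 n) -/(index_iota 0 n) big_mkord.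
Qed.

Lemma cos_poly_common (f g : R -> R) : cos_poly f -> cos_poly g ->
  exists N c d, f = cosp N c /\ g = cosp N d.
Proof.
move=> /cos_polyP[n [c ->]] /cos_polyP[m [d ->]].
exists (maxn n m), (trunc_coef n c), (trunc_coef m d).
by split; apply: cosp_widen; rewrite leq_max leqnn ?orbT.
Qed.

Lemma continuous_cos_poly (f : R -> R) : cos_poly f -> continuous f.
Proof. by move=> /cos_polyP[N [c ->]]; exact: continuous_cosp. Qed.

Lemma int01_trig_prod s k l : int01 (fun x : R => trig s k x * trig s l x) =
  if k == l then (if s then (k != 0%N)%:R / 2 else (1 + (k == 0%N)%:R) / 2) else 0.
Proof.
have ic r : ig `[0, 1] (fun y : R => cos (r * pi * y)).
  by apply: ig_continuousT; exact: continuous_cos_scale.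
transitivity (int01 (fun x : R => 2^-1 * cos ((k%:R - l%:R) * pi * x) +
   (if s then - 2^-1 else 2^-1) * cos ((k%:R + l%:R) * pi * x))).
  congr int01; apply/funext => x.
  have -> : (k%:R - l%:R) * pi * x = k%:R * pi * x - l%:R * pi * x by lra.
  have -> : (k%:R + l%:R) * pi * x = k%:R * pi * x + l%:R * pi * x by lra.
  by rewrite /trig; case: s; rewrite !(cosD, cosN, sinN); lra.
rewrite int01D; [|by apply: igZ|by apply: igZ].
rewrite !int01Z// int01_cosB int01_cosD.
case: (k =P l) => [<-|kl].
  by rewrite andbb; case: (k == 0%N); case: s => /=; lra.
have -> : (k == 0%N) && (l == 0%N) = false.
  by apply/negP => /andP[/eqP a /eqP b]; apply: kl; rewrite a b.
by rewrite !mulr0 addr0.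
Qed.

Lemma int01_cos_basisM k l : int01 (fun x : R => cos_basis k x * cos_basis l x) = (k == l)%:R.
Proof.
have -> : (fun x : R => cos_basis k x * cos_basis l x) =
    (fun x => cos_scale k * cos_scale l * (trig false k x * trig false l x)).
  by apply/funext => x; rewrite !cos_basisE mulrACA.
rewrite int01Z; last first.
  by apply: ig_continuousT => x; apply: cvgM; exact: continuous_trig.
rewrite int01_trig_prod; case: (k =P l) => [<-|_]; last by rewrite mulr0.
by rewrite -expr2 cos_scale_sqr; case: (k == 0%N) => /=; lra.
Qed.

Definition cos_coef (f : R -> R) (k : nat) : R := int01 (fun x => f x * cos_basis k x).

Lemma cos_coef_cosp N c k : cos_coef (cosp N c) k = trunc_coef N c k.
Proof.
have i l : ig `[0, 1] (fun x : R => cos_basis l x * cos_basis k x).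
  by apply: ig_continuousT => x; apply: cvgM; exact: continuous_cos_basis.
transitivity (int01 (fun x => \sum_(l <- iota 0 N) c l * (cos_basis l x * cos_basis k x))).
  congr int01; apply/funext => x; rewrite /cosp mulr_suml.
  by apply: eq_bigr => l _; rewrite mulrA.
rewrite int01_sum => [|l]; last exact: igZ.
rewrite (eq_bigr (fun l => c l * (l == k)%:R)) => [|l _]; last by rewrite int01Z// int01_cos_basisM.
rewrite /trunc_coef; case: ltnP => kN.
  rewrite (bigD1_seq k) ?mem_iota ?iota_uniq//= eqxx mulr1 big1 ?addr0// => l /negbTE ->.
  by rewrite mulr0.
rewrite big_seq big1// => l; rewrite mem_iota => /andP[_ h].
have -> : (l == k) = false by lia.
by rewrite mulr0.
Qed.

Lemma int01_cosp N c : int01 (cosp N c) = trunc_coef N c 0.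
Proof. by rewrite -cos_coef_cosp; congr int01; apply/funext => x; rewrite /cos_basis eqxx mulr1. Qed.

Lemma is_derive_bigsum (I : Type) (s : seq I) (F : I -> R -> R) (dF : I -> R) (x : R) :
  (forall i, is_derive x 1 (F i) (dF i)) ->
  is_derive x 1 (fun x => \sum_(i <- s) F i x) (\sum_(i <- s) dF i).
Proof.
move=> H; elim: s => [|i s IH].
  rewrite big_nil (_ : (fun x => _) = cst 0); first exact: is_derive_cst.
  by apply/funext => y; rewrite big_nil.
rewrite big_cons (_ : (fun x => _) = F i + (fun x => \sum_(j <- s) F j x)).
  by apply: is_deriveD.
by apply/funext => y; rewrite big_cons.
Qed.

Lemma is_derive_cos_basis k (x : R) :
  is_derive x 1 (cos_basis k) (- (cos_scale k * (k%:R * pi)) * trig true k x).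
Proof.
rewrite (_ : cos_basis k = cos_scale k \*: (fun x => cos ((k%:R * pi) * x))); last first.
  by apply/funext => y; rewrite cos_basisE /trig.
have h : is_derive x 1 (fun x : R => cos (k%:R * pi * x)) (- sin (k%:R * pi * x) * (k%:R * pi)).
  by apply: is_derive_eq; rewrite /GRing.scale/= mulr1.
have := @is_deriveZ _ _ _ _ (cos_scale k) x 1 _ h.
by move=> h2; apply: is_derive_eq h2 _; rewrite /GRing.scale/= /trig; lra.
Qed.

Definition dcoef c (k : nat) : R := - (c k * cos_scale k * (k%:R * pi)).

Lemma is_derive_cosp N c (x : R) : is_derive x 1 (cosp N c) (trigp N true (dcoef c) x).
Proof.
have -> : trigp N true (dcoef c) x =
    \sum_(k <- iota 0 N) c k * (- (cos_scale k * (k%:R * pi)) * trig true k x).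
  by apply: eq_bigr => k _; rewrite /dcoef; lra.
apply: is_derive_bigsum => k.
have := @is_deriveZ _ _ _ (cos_basis k) (c k) x 1 _ (is_derive_cos_basis k x).
exact.
Qed.

Lemma derive1_cosp N c : derive1 (cosp N c) = trigp N true (dcoef c).
Proof.
by apply/funext => x; rewrite derive1E; have := is_derive_cosp N c x; move=> ?; rewrite derive_val.
Qed.

Lemma int01_trigp_true N c d : int01 (fun x => trigp N true c x * trigp N true d x) =
  \sum_(k <- iota 0 N) c k * d k * ((k != 0%N)%:R / 2).
Proof.
have i k l : ig `[0, 1] (fun x : R => trig true k x * trig true l x).
  by apply: ig_continuousT => x; apply: cvgM; exact: continuous_trig.
transitivity (int01 (fun x => \sum_(k <- iota 0 N) \sum_(l <- iota 0 N)
    c k * d l * (trig true k x * trig true l x))).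
  congr int01; apply/funext => x; rewrite /trigp mulr_suml; apply: eq_bigr => k _.
  by rewrite mulr_sumr; apply: eq_bigr => l _; rewrite mulrACA.
rewrite int01_sum => [|k]; last by apply: ig_sum => // l; exact: igZ.
rewrite big_seq [RHS]big_seq; apply: eq_bigr => k ks.
rewrite int01_sum => [|l]; last exact: igZ.
rewrite (eq_bigr (fun l => c k * d l * (if k == l then (k != 0%N)%:R / 2 else 0))); last first.
  by move=> l _; rewrite int01Z// int01_trig_prod.
rewrite (bigD1_seq k) ?iota_uniq//= eqxx big1 ?addr0// => l lk.
by rewrite eq_sym (negbTE lk) mulr0.
Qed.

(** The eigenvalue of the inner product at [cos_basis k]. The denominator 8 of the forms becomes 4
    because [cos_scale k ^ 2 = 2] for [k > 0]; for [alpha > 1] each derivative adds a factor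
    [k * pi]. *)
Definition sob_weight alpha gamma (k : nat) : R :=
  if k == 0%N then 1 else
  (gamma ^+ 2)^-1 *
  (if alpha < 1 then (1 - alpha) * pi ^+ 3 / 4 * sing_eig (2 * alpha + 1) k
   else if alpha == 1 then (k%:R * pi) ^+ 2
   else (k%:R * pi) ^+ 2 *
     (1 + (alpha - 1) * (2 - alpha) * pi ^+ 3 / 4 * sing_eig (2 * alpha - 1) k)).

Definition dform (w : nat -> R) (N : nat) c d := \sum_(k <- iota 0 N) w k * c k * d k.

Lemma sing_eig0 b : sing_eig b 0 = 0 :> R.
Proof.
rewrite /sing_eig; under eq_fun do rewrite !mul0r sin0 expr0n/= mulr0 mul0r.
by rewrite /int01 Rintegral_cst// mul0r.
Qed.

Lemma trunc_coef_sum (F : nat -> R) N : trunc_coef N F 0 = \sum_(k <- iota 0 N) (k == 0%N)%:R * F k.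
Proof.
rewrite /trunc_coef; case: N => [|N]; first by rewrite big_nil.
rewrite /= big_cons eqxx mul1r big_seq big1 ?addr0// => k; rewrite mem_iota => /andP[k1 _].
by have -> : (k == 0%N) = false; [lia|rewrite mul0r].
Qed.

Lemma trunc_coefM c d N : trunc_coef N c 0 * trunc_coef N d 0 = trunc_coef N (fun k => c k * d k) 0.
Proof. by rewrite /trunc_coef; case: ifP; rewrite ?mulr0. Qed.

Lemma ip_lt1_cosp alpha gamma N c d : 2^-1 < alpha < 1 ->
  ip_lt1 alpha gamma (cosp N c) (cosp N d) = dform (sob_weight alpha gamma) N c d.
Proof.
move=> /andP[a0 a1].
have b3 : 0 <= 2 * alpha + 1 < 3 by apply/andP; split; lra.
rewrite /ip_lt1 !int01_cosp trunc_coefM trunc_coef_sum.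
have -> : int01x01 (fun x y : R => (cosp N c x - cosp N c y) * (cosp N d x - cosp N d y) *
    ((`|sin (pi * (x - y) / 2)| `^ (2 * alpha + 1))^-1 +
     (`|sin (pi * (x + y) / 2)| `^ (2 * alpha + 1))^-1)) =
    \sum_(k <- iota 0 N) (c k * cos_scale k) * (d k * cos_scale k) * sing_eig (2 * alpha + 1) k.
  rewrite -(sing_quad_form b3 N _ _ false) !cospE; congr int01; apply/funext => y.
  congr int01; apply/funext => x.
  have tN e : trigp N false e (- x) = trigp N false e x.
    by apply: eq_bigr => k _; rewrite /trig mulrN cosN.
  by rewrite !tN /sing_kernel mulrDr.
rewrite mulr_sumr -big_split; apply: eq_bigr => k _ /=.
rewrite /sob_weight a1; case: (k =P 0%N) => [->|k0] /=.
  by rewrite sing_eig0; lra.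
have := cos_scale_sqr k; case: eqP => // _; rewrite expr2 => e.
have -> : c k * cos_scale k * (d k * cos_scale k) = c k * d k * (cos_scale k * cos_scale k) by lra.
by rewrite e; lra.
Qed.

Lemma ip_gt1_cosp alpha gamma N c d : 1 < alpha < 2 ->
  ip_gt1 alpha gamma (cosp N c) (cosp N d) = dform (sob_weight alpha gamma) N c d.
Proof.
move=> /andP[a1 a2].
have b3 : 0 <= 2 * alpha - 1 < 3 by apply/andP; split; lra.
rewrite /ip_gt1 !int01_cosp trunc_coefM trunc_coef_sum /form_B !derive1_cosp int01_trigp_true.
have -> : int01x01 (fun x y : R =>
    (trigp N true (dcoef c) x - trigp N true (dcoef c) y) * (trigp N true (dcoef d) x - trigp N true (dcoef d) y) /
      `|sin (pi * (x - y) / 2)| `^ (2 * alpha - 1) +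
    (trigp N true (dcoef c) x + trigp N true (dcoef c) y) * (trigp N true (dcoef d) x + trigp N true (dcoef d) y) /
      `|sin (pi * (x + y) / 2)| `^ (2 * alpha - 1)) =
    \sum_(k <- iota 0 N) dcoef c k * dcoef d k * sing_eig (2 * alpha - 1) k.
  rewrite -(sing_quad_form b3 N _ _ true); congr int01; apply/funext => y.
  congr int01; apply/funext => x.
  have tN e : trigp N true e (- x) = - trigp N true e x.
    by rewrite /trigp -sumrN; apply: eq_bigr => k _; rewrite /trig mulrN sinN mulrN.
  rewrite !tN /sing_kernel; congr (_ + _); congr (_ * _); lra.
rewrite mulr_sumr -big_split mulr_sumr -big_split; apply: eq_bigr => k _ /=.
have na : (alpha < 1) = false by apply/negbTE; rewrite -leNgt ltW.
rewrite /sob_weight na (gt_eqF a1) /dcoef; case: (k =P 0%N) => [->|k0] /=; first by lra.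
have := cos_scale_sqr k; case: eqP => // _; rewrite expr2 => e.
have -> : - (c k * cos_scale k * (k%:R * pi)) * - (d k * cos_scale k * (k%:R * pi)) =
  c k * d k * (cos_scale k * cos_scale k) * (k%:R * pi) ^+ 2 by rewrite expr2; lra.
rewrite e; move: (sing_eig _ _) (k%:R * pi) (gamma ^+ 2)^-1 (pi ^+ 3) => S K G P.
by rewrite !expr2; lra.
Qed.

Definition sin2_moment (b : R) : R :=
  \int[mu]_(t in `[0, 2^-1]) (sin (pi * t) ^+ 2 / t `^ b).

Lemma powRD_gt0 (x r t : R) : 0 < x -> x `^ (r + t) = x `^ r * x `^ t.
Proof. by move=> x0; rewrite powRD// (gt_eqF x0) implybT. Qed.

(** Replace [sin (pi * u / 2)] by the larger [pi * u / 2] in the kernel, discard [u > 1 / k], and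
    substitute [u = 2 * t / k]. This is the origin of the range [[0, 1 / 2]] in the integral
    defining [kappa]. *)
Lemma sing_eig_ge b k : 0 <= b < 3 -> (0 < k)%N ->
  8 * k%:R `^ (b - 1) * pi `^ (- b) * sin2_moment b <= sing_eig b k.
Proof.
move=> /andP[b0 b3] k0.
have p0 := @pi_gt0 R.
have k0' : 0 < k%:R :> R by rewrite ltr0n.
have k1' : 1 <= k%:R :> R by rewrite ler1n.
pose g (u : R) := 4 * sin (k%:R * pi * u / 2) ^+ 2 * (pi * u / 2) `^ (- b).
have ie : ig `[0, 1] (fun u : R => 4 * sin (k%:R * pi * u / 2) ^+ 2 * sing_kernel b u).
  have := @ig_sing_coef R b _ k k 0; rewrite b0 b3 => /(_ isT).
  by apply: ig_ext => u; rewrite !mul0r cos0 expr2; lra.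
have g0 u : 0 <= g u by apply: mulr_ge0; [apply: mulr_ge0 => //; exact: sqr_ge0|exact: powR_ge0].
have gle u : 0 <= u <= 1 -> g u <= 4 * sin (k%:R * pi * u / 2) ^+ 2 * sing_kernel b u.
  move=> /andP[u0 u1]; have [->|un0] := eqVneq u 0.
    by rewrite /g !mulr0 mul0r sin0 expr0n/= mulr0 !mul0r.
  have {un0 u0}u0 : 0 < u by rewrite lt0r un0.
  apply: ler_wpM2l; first by apply: mulr_ge0 => //; exact: sqr_ge0.
  rewrite /sing_kernel powRN.
  have s0 : 0 < sin (pi * u / 2).
    apply: lt_le_trans (sin_ge_half _); first by rewrite !divr_gt0// mulr_gt0.
    by apply/andP; split; nra.
  rewrite gtr0_norm// lef_pV2 ?posrE ?powR_gt0//; last first.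
    by rewrite divr_gt0// mulr_gt0.
  rewrite ge0_ler_powR ?nnegrE ?(ltW s0)//.
    by rewrite ltW// divr_gt0// mulr_gt0.
  by apply: sin_le_id; rewrite ltW// divr_gt0// mulr_gt0.
have ig1 : ig `[0, 1] g.
  apply: ig_le ie => //.
    apply: measurable_funTS; apply: measurable_funM.
      apply: continuous_measurable_fun => x.
      rewrite (_ : (fun u => _) = fun u : R => 4 * (sin ((k%:R * pi / 2) * u)) ^+ 2).
        by apply: cvgM; [exact: cvg_cst|apply: cvgM; exact: continuous_sin_scale].
      by apply/funext => u; congr (_ * (sin _) ^+ 2); lra.
    apply: (@measurableT_comp _ _ _ _ _ _ (fun x : R => x `^ (- b)) _ (fun u : R => pi * u / 2)).
      exact: measurable_powR.
    apply: continuous_measurable_fun => x; apply: cvgM; last exact: cvg_cst.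
    by apply: cvgM; [exact: cvg_cst|exact: cvg_id].
  by move=> x /=; rewrite in_itv/= => hx; rewrite ger0_norm// gle.
pose a : R := 2 / k%:R.
have a0 : 0 < a by rewrite /a divr_gt0.
have ak : a * 2^-1 = k%:R^-1 by rewrite /a mulrC mulrA mulVf ?mul1r.
have sub : `[0, a * 2^-1]%classic `<=` `[0, 1]%classic.
  by apply: subset_itvl; rewrite bnd_simp ak invf_le1.
have ig2 : ig `[0, a * 2^-1] g by apply: ig_sub ig1.
have ig3 : ig `[0, 2^-1] (fun t : R => sin (pi * t) ^+ 2 / t `^ b).
  have h := @ig_affine R a 0 (lt0r_neq0 a0) _ _ (measurable_itv _) ig2.
  have h2 := @igZ R _ (4^-1 * ((pi / k%:R) `^ (- b))^-1) _ _ h.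
  have e : (fun x : R => a * x + 0) @^-1` `[0, a * 2^-1] = `[0, 2^-1]%classic.
    apply/seteqP; split => x /=; rewrite !in_itv/= addr0 ler_pM2l// => /andP[h1 ->];
      by rewrite andbT; nra.
  rewrite e in h2; apply: eq_ig (h2 _) => // t; rewrite inE/= in_itv/= => /andP[t0 _].
  have -> : g (a * t + 0) = 4 * sin (pi * t) ^+ 2 * ((pi / k%:R) * t) `^ (- b).
    rewrite /g /a; congr (_ * sin _ ^+ 2 * _ `^ _).
      by rewrite addr0 -[RHS](mulfK (lt0r_neq0 k0')); lra.
    by rewrite addr0; lra.
  rewrite (powRM _ _ t0); last by rewrite divr_ge0// ltW.
  have ne : (pi / k%:R) `^ (- b) != 0 by rewrite gt_eqF// powR_gt0// divr_gt0.
  rewrite [t `^ (- b)]powRN; move: (_ `^ (- b)) ne (t `^ b) (sin _ ^+ 2) => A A0 T S.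
  have -> : 4^-1 * A^-1 * (4 * S * (A * T^-1)) = (A^-1 * A) * (S / T) by lra.
  by rewrite mulVf// mul1r.
apply: (@le_trans _ _ (int01 g)); last first.
  by apply: le_Rintegral => // x /=; rewrite in_itv; exact: gle.
apply: (@le_trans _ _ (\int[mu]_(x in `[0, a * 2^-1]) g x)); last first.
  rewrite /int01 (@Rintegral_setU_itv R 0 (a * 2^-1) 1 g) //.
    by rewrite lerDl Rintegral_ge0.
  by rewrite ak invr_ge0 ler0n invf_le1.
rewrite Rintegral_scale//.
have -> : \int[mu]_(x in `[0, 2^-1]) g (a * x) =
   \int[mu]_(x in `[0, 2^-1]) (4 * (pi / k%:R) `^ (- b) * (sin (pi * x) ^+ 2 / x `^ b)).
  apply: eq_Rintegral => t; rewrite inE/= in_itv/= => /andP[t0 _].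
  have -> : g (a * t) = 4 * sin (pi * t) ^+ 2 * ((pi / k%:R) * t) `^ (- b).
    rewrite /g /a; congr (_ * sin _ ^+ 2 * _ `^ _).
      by rewrite -[RHS](mulfK (lt0r_neq0 k0')); lra.
    by lra.
  rewrite (powRM _ _ t0); last by rewrite divr_ge0// ltW.
  by rewrite [t `^ (- b)]powRN; lra.
rewrite RintegralZl// -/(sin2_moment b).
have -> : (pi / k%:R) `^ (- b) = pi `^ (- b) * k%:R `^ b :> R.
  rewrite powRM ?invr_ge0 ?(ltW p0)//; congr (_ * _).
  by rewrite -powR_inv1// -powRrM mulrNN mul1r.
have -> : k%:R `^ (b - 1) = k%:R `^ b / k%:R :> R.
  by rewrite powRD_gt0// powR_inv1.
by rewrite /a; lra.
Qed.

Lemma sin2_moment_ge0 b : 0 <= sin2_moment b.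
Proof. by apply: Rintegral_ge0 => x _; rewrite divr_ge0 ?sqr_ge0 ?powR_ge0. Qed.

Lemma kappa_ge0 alpha : 2^-1 < alpha < 2 -> 0 <= kappa alpha.
Proof.
move=> /andP[a0 a2]; rewrite /kappa; case: ifPn => [a1|a1].
  by rewrite !mulr_ge0 ?powR_ge0 ?sin2_moment_ge0//; lra.
case: ifPn => [_|an1]; first by rewrite sqr_ge0.
by rewrite -leNgt in a1; rewrite !mulr_ge0 ?powR_ge0 ?sin2_moment_ge0//; lra.
Qed.

(** [kappa] collects the constants of [sing_eig_ge]. For [alpha > 1] the contribution of the
    first-order term is discarded; at [alpha = 1] there is equality. *)
Lemma sob_weight_ge alpha gamma k : 2^-1 < alpha < 2 -> (0 < k)%N ->
  kappa alpha / gamma ^+ 2 * k%:R `^ (2 * alpha) <= sob_weight alpha gamma k.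
Proof.
move=> /andP[a0 a2] k0.
have p0 := @pi_gt0 R.
have k0' : 0 < k%:R :> R by rewrite ltr0n.
rewrite /sob_weight (gtn_eqF k0).
have -> : kappa alpha / gamma ^+ 2 * k%:R `^ (2 * alpha) =
  (gamma ^+ 2)^-1 * (kappa alpha * k%:R `^ (2 * alpha)) by rewrite [kappa _ / _]mulrC mulrA.
apply: ler_wpM2l; first by rewrite invr_ge0 sqr_ge0.
have pX (n : nat) : pi ^+ n = pi `^ n%:R :> R by rewrite powR_mulrn// ltW.
have kX (n : nat) : k%:R ^+ n = k%:R `^ n%:R :> R by rewrite powR_mulrn.
have pD (r s : R) : pi `^ r * pi `^ s = pi `^ (r + s).
  by rewrite powRD_gt0.
have kD (r s : R) : k%:R `^ r * k%:R `^ s = k%:R `^ (r + s).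
  by rewrite powRD_gt0.
rewrite /kappa; case: ifPn => [a1|a1].
  have := @sing_eig_ge (2 * alpha + 1) k; rewrite -/(sin2_moment (2 * alpha + 1)) => h.
  have {}h := h _ k0.
  apply: (@le_trans _ _ ((1 - alpha) * pi ^+ 3 / 4 *
     (8 * k%:R `^ (2 * alpha + 1 - 1) * pi `^ (- (2 * alpha + 1)) * sin2_moment (2 * alpha + 1)))).
    have -> : 2 * alpha + 1 - 1 = 2 * alpha by lra.
    have -> : 2 - 2 * alpha = 3 + - (2 * alpha + 1) by lra.
    by rewrite -pD pX; lra.
  rewrite ler_wpM2l ?h ?divr_ge0 ?mulr_ge0 ?exprn_ge0 ?(ltW p0)//; first by lra.
  by apply/andP; split; lra.
rewrite -leNgt in a1; case: ifPn => [/eqP ->|an1].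
  by rewrite exprMn mulrC mulr1 -[k%:R ^+ 2]powR_mulrn.
have {an1}a1 : 1 < alpha by rewrite lt_neqAle eq_sym an1.
have := @sing_eig_ge (2 * alpha - 1) k; rewrite -/(sin2_moment (2 * alpha - 1)) => h.
have {}h := h _ k0.
have kp0 : 0 <= (k%:R * pi) ^+ 2 :> R by exact: sqr_ge0.
apply: (@le_trans _ _ ((k%:R * pi) ^+ 2 * ((alpha - 1) * (2 - alpha) * pi ^+ 3 / 4 *
     (8 * k%:R `^ (2 * alpha - 1 - 1) * pi `^ (- (2 * alpha - 1)) * sin2_moment (2 * alpha - 1))))).
  have -> : 2 * alpha = 2 + (2 * alpha - 1 - 1) by lra.
  have -> : 6 - (2 + (2 * alpha - 1 - 1)) = (2 + 3) + - (2 * alpha - 1) by lra.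
  rewrite -kD -pD -pD exprMn !pX !kX.
  have -> : 2 + (2 * alpha - 1 - 1) - 1 = 2 * alpha - 1 by lra.
  by lra.
have {}h := h (ltac:(apply/andP; split; lra)).
have q0 : 0 <= (alpha - 1) * (2 - alpha) * pi ^+ 3 / 4.
  by rewrite divr_ge0// !mulr_ge0 ?exprn_ge0 ?(ltW p0)//; move: a1 a2; clear; lra.
have := ler_wpM2l q0 h; move: (_ * _ * _ / _ * sing_eig _ _) (_ * (_ * sin2_moment _)) => A B AB.
by rewrite ler_wpM2l//; move: AB; clear; lra.
Qed.

End CosinePolynomials.

(** * Completions as weighted coefficient spaces *)

Section WeightedForms.
Variables (R : realType) (K : Type) (I : nat -> seq K) (w : K -> R).
Hypothesis w_ge0 : forall k, 0 <= w k.
Hypothesis I_mono : forall F : K -> R, (forall k, 0 <= F k) ->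
  forall N, \sum_(k <- I N) F k <= \sum_(k <- I N.+1) F k.
Implicit Types (x y : K -> R).

(** The lists [I N] exhaust the frequencies: initial segments in one dimension, boxes in dimension
    [d]. The same completion argument thus serves the factors and their tensor product. *)
Definition wform N x y := \sum_(k <- I N) w k * x k * y k.

Lemma wformC N x y : wform N x y = wform N y x.
Proof. by apply: eq_bigr => k _; lra. Qed.

Lemma wform_ge0 N x : 0 <= wform N x x.
Proof. by apply: sumr_ge0 => k _; rewrite -mulrA mulr_ge0// -expr2 sqr_ge0. Qed.

Lemma wform_nd x : nondecreasing_seq (fun N => wform N x x).
Proof.
apply/nondecreasing_seqP => N; apply: I_mono => k.
by rewrite -mulrA mulr_ge0// -expr2 sqr_ge0.
Qed.

Lemma wformBl N x y z : wform N (fun k => x k - y k) z = wform N x z - wform N y z.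
Proof. by rewrite -sumrB; apply: eq_bigr => k _ /=; lra. Qed.

Lemma wformBr N x y z : wform N z (fun k => x k - y k) = wform N z x - wform N z y.
Proof. by rewrite !(wformC _ z) wformBl. Qed.

Lemma wformBB N x y : wform N (fun k => x k - y k) (fun k => x k - y k) =
  wform N x x - 2 * wform N x y + wform N y y.
Proof. by rewrite wformBl !wformBr (wformC _ y x); lra. Qed.

Lemma wformDD N x y : wform N (fun k => x k + y k) (fun k => x k + y k) =
  wform N x x + 2 * wform N x y + wform N y y.
Proof. by rewrite /wform mulr_sumr -!big_split; apply: eq_bigr => k _ /=; lra. Qed.

Lemma wform_sum_le N x y :
  wform N x x <= 2 * wform N y y + 2 * wform N (fun k => x k - y k) (fun k => x k - y k).
Proof.
rewrite /wform !mulr_sumr -big_split; apply: ler_sum => k _ /=.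
have := w_ge0 k; move: (w k) (x k) (y k) => a b c a0.
have : 0 <= a * (b - c *+ 2) ^+ 2 by rewrite mulr_ge0// sqr_ge0.
by rewrite expr2 mulr2n; lra.
Qed.

Lemma wform_young N x y t : 0 < t ->
  `|wform N x y| <= (wform N x x / t + t * wform N y y) / 2.
Proof.
move=> t0; apply: le_trans (ler_norm_sum _ _ _) _.
rewrite /wform mulr_suml mulr_sumr -big_split mulr_suml; apply: ler_sum => k _ /=.
rewrite -mulrA normrM ger0_norm// normrM.
have -> : w k * x k * x k / t = w k * (`|x k| ^+ 2 / t).
  by rewrite real_normK ?num_real// expr2; lra.
have -> : t * (w k * y k * y k) = w k * (t * `|y k| ^+ 2).
  by rewrite real_normK ?num_real// expr2; lra.
rewrite -mulrDr -mulrA; apply: ler_wpM2l => //.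
move: (`|x k|) (`|y k|) => a b.
have : 0 <= (a - t * b) ^+ 2 / t by rewrite divr_ge0 ?sqr_ge0// ltW.
have -> : (a - t * b) ^+ 2 / t = a ^+ 2 / t - 2 * a * b * (t / t) + t * b ^+ 2 * (t / t).
  by rewrite !expr2; lra.
by rewrite divff ?gt_eqF//; lra.
Qed.

Lemma wform_cvg (F : set_system nat) {FF : Filter F} N
    (xs ys : nat -> K -> R) x y :
  (forall k, xs m k @[m --> F] --> x k) -> (forall k, ys m k @[m --> F] --> y k) ->
  wform N (xs m) (ys m) @[m --> F] --> wform N x y.
Proof.
move=> hx hy; rewrite /wform; elim: (I N) => [|k s IH].
  by under eq_fun do rewrite big_nil; rewrite big_nil; exact: cvg_cst.
under eq_fun do rewrite big_cons; rewrite big_cons.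
by apply: cvgD => //; apply: cvgM => //; apply: cvgM => //; exact: cvg_cst.
Qed.
End WeightedForms.

Section CompletionCoefficients.
Variables (R : realType) (T E : Type) (D : set T) (V : set E) (ev : E -> T -> R) (ip : E -> E -> R).
Variables (K : Type) (I : nat -> seq K) (w : K -> R) (coef : E -> K -> R) (cf : (T -> R) -> K -> R).
Hypothesis w_ge0 : forall k, 0 <= w k.
Hypothesis I_mono : forall F : K -> R, (forall k, 0 <= F k) ->
  forall N, \sum_(k <- I N) F k <= \sum_(k <- I N.+1) F k.
Hypothesis ip_coef : forall u v, V u -> V v ->
  wform I w N (coef u) (coef v) @[N --> \oo] --> ip u v.
Hypothesis cf_coef : forall u f, represents D V ev ip u f ->
  forall k, coef (u m) k @[m --> \oo] --> cf f k.
Notation W := (wform I w).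
Notation rep := (represents D V ev ip).

Lemma wform_le_lim u : V u -> forall N, W N (coef u) (coef u) <= ip u u.
Proof.
move=> Vu N; have := ip_coef Vu Vu => h.
rewrite -(cvg_lim (@Rhausdorff R) h); apply: nondecreasing_cvgn_le; last by apply/cvg_ex; exists (ip u u).
exact: wform_nd.
Qed.

Lemma wformBB_le_sqdist u v : V u -> V v -> forall N,
  W N (fun k => coef u k - coef v k) (fun k => coef u k - coef v k) <= sqdist ip u v.
Proof.
move=> Vu Vv N.
have h : W N (fun k => coef u k - coef v k) (fun k => coef u k - coef v k) @[N --> \oo] --> sqdist ip u v.
  under eq_fun do rewrite wformBB.
  by apply: cvgD; [apply: cvgB; [exact: ip_coef|apply: cvgM; [exact: cvg_cst|exact: ip_coef]]|exact: ip_coef].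
rewrite -(cvg_lim (@Rhausdorff R) h); apply: nondecreasing_cvgn_le; last by apply/cvg_ex; exists (sqdist ip u v).
exact: wform_nd.
Qed.

(** A truncated form has finitely many terms, so the Cauchy estimate between [u m] and [u n] passes
    to the limit in [n]; the bound does not depend on the truncation [N]. *)
Lemma represents_tail u f e : rep u f -> 0 < e -> exists M, forall m N, (M <= m)%N ->
  W N (fun k => coef (u m) k - cf f k) (fun k => coef (u m) k - cf f k) <= e.
Proof.
move=> uf e0; have [Vu cu _] := uf; have [M HM] := cu e e0; exists M => m N Mm.
have h : W N (fun k => coef (u m) k - coef (u n) k) (fun k => coef (u m) k - coef (u n) k) @[n --> \oo]
    --> W N (fun k => coef (u m) k - cf f k) (fun k => coef (u m) k - cf f k).
  by apply: wform_cvg => // k; apply: cvgB; [exact: cvg_cst|exact: cf_coef|exact: cvg_cst|exact: cf_coef].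
rewrite -(cvg_lim (@Rhausdorff R) h); apply: limr_le; first by apply/cvg_ex; eexists; exact: h.
exists M => // n /= Mn; apply: le_trans (wformBB_le_sqdist (Vu m) (Vu n) N) _.
exact/ltW/HM.
Qed.

Lemma wform_cf_bounded u f : rep u f -> exists B, forall N, W N (cf f) (cf f) <= B.
Proof.
move=> uf; have [M HM] := represents_tail uf ltr01; have [Vu _ _] := uf.
exists (2 * ip (u M) (u M) + 2) => N.
apply: le_trans (wform_sum_le I w_ge0 N (cf f) (coef (u M))) _.
have := HM M N (leqnn _); have := wform_le_lim (Vu M) N.
have -> : W N (fun k => cf f k - coef (u M) k) (fun k => cf f k - coef (u M) k) =
  W N (fun k => coef (u M) k - cf f k) (fun k => coef (u M) k - cf f k).
  by apply: eq_bigr => k _; lra.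
by lra.
Qed.

Lemma wform_coef_bounded u f : rep u f -> exists2 B, 0 <= B & exists M, forall m N,
  (M <= m)%N -> W N (coef (u m)) (coef (u m)) <= B.
Proof.
move=> uf; have [M HM] := represents_tail uf ltr01.
have [B HB] := wform_cf_bounded uf.
have B0 : 0 <= B by apply: le_trans (HB 0%N); exact: wform_ge0.
exists (2 * B + 2); first by lra.
exists M => m N Mm; apply: le_trans (wform_sum_le I w_ge0 N (coef (u m)) (cf f)) _.
by have := HM m N Mm; have := HB N; lra.
Qed.

(** Polarization expresses the pairing through three truncated squared norms, each nondecreasing and
    bounded in [N]. *)
Lemma wform_cf_cvg u v f g : rep u f -> rep v g ->
  cvgn (fun N => W N (cf f) (cf g)).
Proof.
move=> uf vg; have [A HA] := wform_cf_bounded uf; have [B HB] := wform_cf_bounded vg.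
pose S N := W N (fun k => cf f k + cf g k) (fun k => cf f k + cf g k).
have e N : W N (cf f) (cf g) = 2^-1 * (S N - W N (cf f) (cf f) - W N (cf g) (cf g)).
  by rewrite /S wformDD; lra.
have cS : cvgn S.
  apply: nondecreasing_is_cvgn; first exact: wform_nd.
  exists (2 * A + 2 * B) => _ [N _ <-]; rewrite /S.
  have := wform_ge0 I w_ge0 N (fun k => cf f k - cf g k); rewrite wformBB wformDD.
  by have := HA N; have := HB N; lra.
have cA : cvgn (fun N => W N (cf f) (cf f)).
  by apply: nondecreasing_is_cvgn; [exact: wform_nd|exists A => _ [N _ <-]].
have cB : cvgn (fun N => W N (cf g) (cf g)).
  by apply: nondecreasing_is_cvgn; [exact: wform_nd|exists B => _ [N _ <-]].
under eq_fun do rewrite e.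
apply/cvg_ex; eexists; apply: cvgM; first exact: cvg_cst.
by apply: cvgB; [apply: cvgB; [exact: cS|exact: cA]|exact: cB].
Qed.

(** The tails of both sequences are small uniformly in [N], so the limits in [m] and [N]
    interchange. The limit depends on [f] and [g] only, not on the representing sequences. *)
Lemma ip_cvg_wform u v f g : rep u f -> rep v g ->
  ip (u m) (v m) @[m --> \oo] --> limn (fun N => W N (cf f) (cf g)).
Proof.
move=> uf vg; set L := limn _.
have cL : W N (cf f) (cf g) @[N --> \oo] --> L by exact: wform_cf_cvg uf vg.
have [Vu _ _] := uf; have [Vv _ _] := vg.
have [A HA] := wform_cf_bounded uf; have [B B0 [MB HB]] := wform_coef_bounded vg.
have A0 : 0 <= A by apply: le_trans (HA 0%N); exact: wform_ge0.
apply/cvgrPdist_le => e e0.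
(* Used both as the accuracy [t ^ 2] of the tails and as the parameter of Young's inequality: the
   four resulting terms add up to [t * (A + B + 2) / 2]. *)
pose t := e / (A + B + 2).
have t0 : 0 < t by rewrite divr_gt0//; lra.
have te : t * (A + B + 2) = e by rewrite divfK// gt_eqF//; lra.
have tt0 : 0 < t ^+ 2 by rewrite exprn_gt0.
have [M1 H1] := represents_tail uf tt0; have [M2 H2] := represents_tail vg tt0.
exists (maxn MB (maxn M1 M2)) => // m /=; rewrite !geq_max => /and3P[mB m1 m2].
have h : W N (cf f) (cf g) - W N (coef (u m)) (coef (v m)) @[N --> \oo] --> L - ip (u m) (v m).
  by apply: cvgB => //; exact: ip_coef.
have hn : `|W N (cf f) (cf g) - W N (coef (u m)) (coef (v m))| @[N --> \oo] --> `|L - ip (u m) (v m)|.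
  by apply: cvg_norm; exact: h.
 rewrite -(cvg_lim (@Rhausdorff R) hn).
apply: limr_le; first by apply/cvg_ex; eexists; exact: hn.
near=> N.
have -> : W N (cf f) (cf g) - W N (coef (u m)) (coef (v m)) =
  - (W N (fun k => coef (u m) k - cf f k) (coef (v m)) +
     W N (fun k => coef (v m) k - cf g k) (cf f)).
  by rewrite !wformBl (wformC I w N _ (cf f)) (wformC I w N (cf g)); lra.
rewrite normrN; apply: le_trans (ler_normD _ _) _.
have y1 := wform_young I w_ge0 N (fun k => coef (u m) k - cf f k) (coef (v m)) t0.
have y2 := wform_young I w_ge0 N (fun k => coef (v m) k - cf g k) (cf f) t0.
have q1 : W N (fun k => coef (u m) k - cf f k) (fun k => coef (u m) k - cf f k) / t <= t.
  by rewrite ler_pdivrMr// -expr2; exact: H1.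
have q2 : W N (fun k => coef (v m) k - cf g k) (fun k => coef (v m) k - cf g k) / t <= t.
  by rewrite ler_pdivrMr// -expr2; exact: H2.
have q3 : t * W N (coef (v m)) (coef (v m)) <= t * B by rewrite ler_pM2l// HB.
have q4 : t * W N (cf f) (cf f) <= t * A by rewrite ler_pM2l// HA.
move: y1 y2 q1 q2 q3 q4 te e0 => y1 y2 q1 q2 q3 q4 te e0.
rewrite !mulrDr in te.
lra.
Unshelve. all: by end_near. Qed.

Notation H := (completion D V ev ip).

(** The inner product of the completion is a chosen limit; the choice is immaterial since every
    admissible limit equals the one computed from the coefficients. *)
Lemma completion_ip_cvg u v f g : rep u f -> rep v g ->
  ip (u m) (v m) @[m --> \oo] --> fip H f g.
Proof.
move=> uf vg; have h := ip_cvg_wform uf vg.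
suff -> : fip H f g = limn (fun N => W N (cf f) (cf g)) by [].
apply: xget_unique; first by exists u, v.
move=> l [u' [v' [uf' vg' hl]]].
by rewrite -(cvg_lim (@Rhausdorff R) hl); apply: cvg_lim; [exact: Rhausdorff|exact: ip_cvg_wform].
Qed.

Lemma completion_coef_cvg f g : fmem H f -> fmem H g ->
  W N (cf f) (cf g) @[N --> \oo] --> fip H f g.
Proof.
move=> [u uf] [v vg].
have := cvg_unique (@Rhausdorff R) (completion_ip_cvg uf vg) (ip_cvg_wform uf vg) => ->.
exact: wform_cf_cvg uf vg.
Qed.
End CompletionCoefficients.

Section UniformLimits.
Variable R : realType.
Notation mu := (@lebesgue_measure R).
Notation I01 := (`[0%R, 1%R]%classic : set R).
Implicit Types (f g : R -> R).

Definition unif_cvg01 (u : nat -> R -> R) f := forall e : R, 0 < e ->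
  \forall m \near \oo, forall x, I01 x -> `|u m x - f x| < e.

Lemma within_continuousP f : {within I01, continuous f} <->
  forall x, 0 <= x <= 1 -> forall e : R, 0 < e -> exists2 d : R, 0 < d &
    forall y, 0 <= y <= 1 -> `|x - y| < d -> `|f x - f y| < e.
Proof.
split=> [/subspace_continuousP cf x x01 e e0|H].
  have /cvgrPdist_lt /(_ e e0) := cf x ltac:(by rewrite /= in_itv).
  rewrite near_withinE => /nbhs_ballP[d /= d0 H]; exists d => // y y01 xy.
  by apply: H; rewrite /= ?in_itv//.
apply/subspace_continuousP => x /=; rewrite in_itv/= => x01.
apply/cvgrPdist_lt => e e0; have [d d0 Hd] := H x x01 e e0.
rewrite near_withinE; apply/nbhs_ballP; exists d => //= y xy.
by rewrite in_itv/= => y01; exact: Hd.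
Qed.

Lemma within_continuous_unif f :
  (forall e : R, 0 < e -> exists2 g, {within I01, continuous g} &
     forall x, 0 <= x <= 1 -> `|g x - f x| <= e) ->
  {within I01, continuous f}.
Proof.
move=> H; apply/within_continuousP => x x01 e e0.
have e4 : 0 < e / 4 by rewrite divr_gt0.
have [g /within_continuousP cg gf] := H _ e4.
have [d d0 Hd] := cg x x01 _ e4; exists d => // y y01 xy.
have := Hd y y01 xy; have := gf x x01; have := gf y y01.
rewrite !ler_norml !ltr_norml => /andP[? ?] /andP[? ?] /andP[? ?].
by apply/andP; split; lra.
Qed.

Lemma within_continuousT f : continuous f -> {within I01, continuous f}.
Proof. exact: continuous_subspaceT. Qed.

Lemma unif_cvg01_continuous u f : (forall m, {within I01, continuous (u m)}) ->
  unif_cvg01 u f -> {within I01, continuous f}.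
Proof.
move=> cu uf; apply: within_continuous_unif => e e0.
have [M _ HM] := uf e e0; exists (u M) => // x x01.
by apply/ltW/(HM M) => //=; rewrite in_itv.
Qed.

Lemma within_continuousM f g : {within I01, continuous f} -> {within I01, continuous g} ->
  {within I01, continuous (fun x => f x * g x)}.
Proof. by move=> cf cg x; apply: cvgM; [exact: cf|exact: cg]. Qed.

Lemma within_continuousD f g : {within I01, continuous f} -> {within I01, continuous g} ->
  {within I01, continuous (fun x => f x + g x)}.
Proof. by move=> cf cg x; apply: cvgD; [exact: cf|exact: cg]. Qed.

Lemma within_continuousZ c f : {within I01, continuous f} ->
  {within I01, continuous (fun x => c * f x)}.
Proof. by move=> cf; apply: within_continuousM => //; apply: within_continuousT => x; exact: cvg_cst. Qed.

Lemma int01_norm_le f e : ig I01 f -> (forall x, 0 <= x <= 1 -> `|f x| <= e) -> `|int01 f| <= e.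
Proof.
move=> If fe; apply: le_trans (le_normr_Rintegral _ If) _ => //.
apply: (@le_trans _ _ (\int[mu]_(x in I01) e)).
  have h1 : ig I01 (fun x => `|f x|) by exact: (integrable_norm If).
  have h2 : ig I01 (fun=> e) by apply: ig_continuousT => x; exact: cvg_cst.
  apply: (le_Rintegral _ h1 h2) => // x /=; rewrite in_itv; exact: fe.
by rewrite Rintegral_cst//= lebesgue_measure_itv/= lte_fin ltr01 -EFinB subr0 mulr1.
Qed.

Lemma int01B f g : ig I01 f -> ig I01 g -> int01 (fun x => f x - g x) = int01 f - int01 g.
Proof. by move=> h1 h2; rewrite /int01 RintegralB. Qed.

Lemma int01_dist_le f g e : ig I01 f -> ig I01 g ->
  (forall x, 0 <= x <= 1 -> `|f x - g x| <= e) -> `|int01 f - int01 g| <= e.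
Proof. by move=> h1 h2 H; rewrite -int01B//; apply: int01_norm_le => //; exact: igB. Qed.

Lemma cos_basis_le2 k (x : R) : `|cos_basis k x| <= 2.
Proof.
rewrite cos_basisE normrM /cos_scale /trig -[2]mulr1; apply: ler_pM => //; last exact: cos_max.
case: (k == 0%N); first by rewrite normr1 ler1n.
rewrite ger0_norm ?sqrtr_ge0// -[leRHS](ger0_norm (ler0n _ 2)) -sqrtr_sqr.
by apply: ler_wsqrtr; rewrite expr2; lra.
Qed.

Lemma ig_cos_coef f k : {within I01, continuous f} -> ig I01 (fun x => f x * cos_basis k x).
Proof.
move=> cf; apply: ig_continuous; apply: within_continuousM => //.
by apply: within_continuousT; exact: continuous_cos_basis.
Qed.

Lemma cos_coef_cvg u f k : (forall m, {within I01, continuous (u m)}) -> unif_cvg01 u f ->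
  cos_coef (u m) k @[m --> \oo] --> cos_coef f k.
Proof.
move=> cu uf; have cf := unif_cvg01_continuous cu uf.
apply/cvgrPdist_le => e e0; have e2 : 0 < e / 2 by rewrite divr_gt0.
have [M _ HM] := uf _ e2; exists M => // m /= Mm.
apply: int01_dist_le; [exact: ig_cos_coef|exact: ig_cos_coef|move=> x x01].
rewrite -mulrBl normrM distrC (_ : e = e / 2 * 2); last by rewrite divfK.
by apply: ler_pM => //; [apply/ltW/HM => //=; rewrite in_itv|exact: cos_basis_le2].
Qed.

Lemma int01_cvg u f : (forall m, {within I01, continuous (u m)}) -> unif_cvg01 u f ->
  int01 (u m) @[m --> \oo] --> int01 f.
Proof.
move=> cu uf; have cf := unif_cvg01_continuous cu uf.
apply/cvgrPdist_le => e e0; have [M _ HM] := uf _ e0; exists M => // m /= Mm.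
apply: int01_dist_le; [exact: ig_continuous|exact: ig_continuous|move=> x x01].
by rewrite distrC; apply/ltW/HM => //=; rewrite in_itv.
Qed.
End UniformLimits.

Section CosineCompletion.
Variable R : realType.
Notation I01 := (`[0%R, 1%R]%classic : set R).
Variables (ip : (R -> R) -> (R -> R) -> R) (w : nat -> R).
Hypothesis w_ge0 : forall k, 0 <= w k.
Hypothesis ip_cosp : forall N c d, ip (cosp N c) (cosp N d) = dform w N c d.
Notation W := (wform (iota 0) w).
Notation H := (completion I01 (@cos_poly R) id ip).

Lemma iota_mono (F : nat -> R) : (forall k, 0 <= F k) ->
  forall N, \sum_(k <- iota 0 N) F k <= \sum_(k <- iota 0 N.+1) F k.
Proof. by move=> F0 N; rewrite -addn1 iotaD big_cat /= big_seq1 lerDl. Qed.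

Lemma ip_cos_coef_eq f g : cos_poly f -> cos_poly g ->
  exists M, forall N, (M <= N)%N -> W N (cos_coef f) (cos_coef g) = ip f g.
Proof.
move=> hf hg; have [M [c [d [-> ->]]]] := cos_poly_common hf hg.
exists M => N MN; rewrite ip_cosp /wform /dform -(@big_iota_widen _ M N)//.
  rewrite big_seq [RHS]big_seq; apply: eq_bigr => k; rewrite mem_iota => /andP[_ kM].
  by rewrite !cos_coef_cosp /trunc_coef kM.
by move=> k Mk; rewrite !cos_coef_cosp /trunc_coef ltnNge Mk mulr0.
Qed.

Lemma ip_cos_coef f g : cos_poly f -> cos_poly g ->
  W N (cos_coef f) (cos_coef g) @[N --> \oo] --> ip f g.
Proof.
move=> hf hg; have [M HM] := ip_cos_coef_eq hf hg.
apply: cvg_near_cst; exists M => // N /= MN; exact/HM.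
Qed.

Lemma represents_unif u f : represents I01 (@cos_poly R) id ip u f -> unif_cvg01 u f.
Proof. by case. Qed.

Lemma represents_cos_coef u f : represents I01 (@cos_poly R) id ip u f ->
  forall k, cos_coef (u m) k @[m --> \oo] --> cos_coef f k.
Proof.
move=> uf k; have [Vu _ _] := uf; apply: cos_coef_cvg (represents_unif uf) => m.
by apply: within_continuousT; exact: continuous_cos_poly.
Qed.

Lemma cos_completion_coef_cvg f g : fmem H f -> fmem H g ->
  W N (cos_coef f) (cos_coef g) @[N --> \oo] --> fip H f g.
Proof. exact: (completion_coef_cvg w_ge0 iota_mono ip_cos_coef represents_cos_coef). Qed.

Lemma cos_completion_ip_cvg u v f g : represents I01 (@cos_poly R) id ip u f ->
  represents I01 (@cos_poly R) id ip v g -> ip (u m) (v m) @[m --> \oo] --> fip H f g.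
Proof. exact: (completion_ip_cvg w_ge0 iota_mono ip_cos_coef represents_cos_coef). Qed.

(** One representing sequence is fixed for each function, so that all inner products among the
    factors of a tensor can be approximated simultaneously. *)
Lemma cos_completion_approx : exists appr : (R -> R) -> nat -> R -> R,
  (forall f, fmem H f -> (forall m, cos_poly (appr f m)) /\ unif_cvg01 (appr f) f) /\
  (forall f g, fmem H f -> fmem H g ->
     limn (fun N => W N (cos_coef (appr f m)) (cos_coef (appr g m))) @[m --> \oo] --> fip H f g).
Proof.
have ch f : {u | fmem H f -> represents I01 (@cos_poly R) id ip u f}.
  apply: cid; have [[u uf]|nf] := pselect (fmem H f); first by exists u.
  by exists (fun=> f).
pose appr f := projT1 (ch f).
have ha f : fmem H f -> represents I01 (@cos_poly R) id ip (appr f) f by exact: projT2 (ch f).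
exists appr; split=> [f Hf|f g Hf Hg].
  by have [] := ha f Hf.
rewrite (_ : (fun m => _) = fun m => ip (appr f m) (appr g m)).
  exact: cos_completion_ip_cvg (ha f Hf) (ha g Hg).
apply/funext => m; apply: cvg_lim; first exact: Rhausdorff.
by apply: ip_cos_coef; [have [] := ha f Hf|have [] := ha g Hg].
Qed.
End CosineCompletion.

Section FirstOrderForm.
Variable R : realType.

(** The counterpart of [ip_eq1] with classical derivatives. On cosine polynomials it makes
    [alpha = 1] a completion like the other cases. *)
Definition ip_h1 (gamma : R) (f g : R -> R) : R := int01 f * int01 g +
  (gamma ^+ 2)^-1 * int01 (fun x => derive1 f x * derive1 g x).

Lemma ip_h1_cosp (gamma : R) N c d :
  ip_h1 gamma (cosp N c) (cosp N d) = dform (sob_weight 1 gamma) N c d.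
Proof.
rewrite /ip_h1 !int01_cosp trunc_coefM trunc_coef_sum !derive1_cosp int01_trigp_true.
rewrite mulr_sumr -big_split; apply: eq_bigr => k _ /=.
rewrite /sob_weight ltxx eqxx /dcoef; case: (k =P 0%N) => [->|k0] /=; first by lra.
have := cos_scale_sqr R k; case: eqP => // _; rewrite expr2 => e.
have -> : - (c k * cos_scale R k * (k%:R * pi)) * - (d k * cos_scale R k * (k%:R * pi)) =
  c k * d k * (cos_scale R k * cos_scale R k) * (k%:R * pi) ^+ 2 by rewrite expr2; lra.
rewrite e; move: (k%:R * pi) (gamma ^+ 2)^-1 => K G.
by rewrite !expr2; lra.
Qed.
End FirstOrderForm.

(** * Density of cosine polynomials for first order forms *)

Section SmoothFunctions.
Variable R : realType.
Implicit Types (f g : R -> R) (x : R).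

Definition smooth f := forall n x, derivable (derive1n n f) x 1.

Lemma derive1nSr n f : derive1n n.+1 f = derive1n n (derive1 f).
Proof. by rewrite /derive1n iterSr. Qed.

(** Closure of a class under differentiation replaces any formula for iterated derivatives. *)
Lemma smooth_class (C : set (R -> R)) :
  (forall f, C f -> exists2 g, C g & forall x, is_derive x 1 f (g x)) ->
  forall f, C f -> smooth f.
Proof.
move=> H f Cf n; elim: n f Cf => [|n IH] f Cf x; have [g Cg fg] := H f Cf.
  by have := fg x => ?; exact: ex_derive.
have e : derive1 f = g.
  by apply/funext => y; rewrite derive1E; have := fg y => ?; rewrite derive_val.
by rewrite derive1nSr e; exact: IH.
Qed.

Lemma smooth_primitive f g : (forall x, is_derive x 1 f (g x)) -> smooth g -> smooth f.
Proof.
move=> fg sg [|n] x; first by have := fg x => ?; exact: ex_derive.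
have e : derive1 f = g.
  by apply/funext => y; rewrite derive1E; have := fg y => ?; rewrite derive_val.
by rewrite derive1nSr e; exact: sg.
Qed.

Lemma smoothB f g : smooth f -> smooth g -> smooth (fun x => f x - g x).
Proof.
pose C := [set h | exists f g, [/\ smooth f, smooth g & h = fun x => f x - g x]].
move=> sf sg; apply: (@smooth_class C); last by exists f, g.
move=> _ [a [b [sa sb ->]]]; exists (fun x => derive1 a x - derive1 b x).
  exists (derive1 a), (derive1 b); split; last by reflexivity.
    by move=> n x; rewrite -derive1nSr; exact: sa.
  by move=> n x; rewrite -derive1nSr; exact: sb.
move=> x; rewrite !derive1E; apply: is_deriveB; apply: DeriveDef => //; [exact: (sa 0%N)|exact: (sb 0%N)].
Qed.

Lemma smooth_affine f (k a b : R) : smooth f -> smooth (fun x => k * f (a * x + b)).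
Proof.
pose C := [set h | exists k f, smooth f /\ h = fun x => k * f (a * x + b)].
move=> sf; apply: (@smooth_class C); last by exists k, f.
move=> _ [c [g [sg ->]]]; exists (fun x => (c * a) * derive1 g (a * x + b)).
  exists (c * a), (derive1 g); split; last by reflexivity.
  by move=> n x; rewrite -derive1nSr; exact: sg.
move=> x.
have dg : is_derive (a * x + b) 1 g (derive1 g (a * x + b)).
  by rewrite derive1E; apply: DeriveDef => //; exact: (sg 0%N).
have da : is_derive x 1 (fun x : R => a * x + b) a.
  by apply: is_derive_eq; rewrite /GRing.scale/= mulr1 addr0.
have h := @is_derive1_comp R g (fun x : R => a * x + b) x _ _ dg da.
have h2 := @is_deriveZ _ _ _ _ c x 1 _ h.
by apply: is_derive_eq h2 _; rewrite /GRing.scale/=; lra.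
Qed.

(** The functions [x ^ (- n) * exp (- 1 / x)], extended by 0; their linear span is stable under
    differentiation. *)
Definition exp_bump (n : nat) x : R := if 0 < x then x^-1 ^+ n * expR (- x^-1) else 0.

Lemma exp_bump_ge0 n x : 0 <= exp_bump n x.
Proof. by rewrite /exp_bump; case: ifP => // x0; rewrite mulr_ge0 ?expR_ge0// exprn_ge0// invr_ge0 ltW. Qed.

Lemma exp_bump_eq0 n x : x <= 0 -> exp_bump n x = 0.
Proof. by rewrite /exp_bump leNgt => /negbTE ->. Qed.

(** The term of degree [n + 2] in the exponential series. The square on the right makes the
    difference quotients at 0 vanish in the limit, for every [n]. *)
Lemma exp_bump_le n x : exp_bump n x <= (n.+2)`!%:R * x ^+ 2.
Proof.
rewrite /exp_bump; case: ifP => [x0|_]; last by rewrite mulr_ge0 ?sqr_ge0.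
have y0 : 0 < x^-1 by rewrite invr_gt0.
have := @expR_ge1Dxn R x^-1 n.+1 (ltW y0) => h.
have f0 : 0 < (n.+2)`!%:R :> R by rewrite ltr0n fact_gt0.
have h2 : x^-1 ^+ n.+2 <= (n.+2)`!%:R * expR x^-1.
  by rewrite mulrC -ler_pdivrMr//; lra.
rewrite expRN ler_pdivrMr ?expR_gt0//.
have -> : x^-1 ^+ n = x^-1 ^+ n.+2 * x ^+ 2.
  by rewrite -addn2 exprD -mulrA -exprMn mulVf ?gt_eqF// expr1n mulr1.
by rewrite [leRHS]mulrAC ler_pM2r// exprn_gt0.
Qed.

Lemma is_derive_exp_bump n x : is_derive x 1 (exp_bump n) (exp_bump n.+2 x - n%:R * exp_bump n.+1 x).
Proof.
case: (ltrgtP 0 x) => [x0|x0|<-].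
- have dinv : is_derive x 1 (fun x : R => x^-1) (- x ^- 2).
    have xn0 : x != 0 by rewrite gt_eqF.
    by have := @is_deriveV R id x 1 1 xn0 (is_derive_id _ _); rewrite /GRing.scale/= mulr1.
  have dg (y : R) : is_derive y 1 (fun y : R => y ^+ n * expR (- y)) (n%:R * y ^+ n.-1 * expR (- y) - y ^+ n * expR (- y)).
    have d1 : is_derive y 1 (fun y : R => expR (- y)) (- expR (- y)).
      by apply: is_derive_eq; rewrite /GRing.scale/= mulrN1.
    have d2 : is_derive y 1 (fun y : R => y ^+ n) (n%:R * y ^+ n.-1).
      have -> : (fun y : R => y ^+ n) = (id : R -> R) ^+ n.
        by apply/funext => z; elim: (n) => [|k IH]; [by rewrite !expr0|rewrite !exprS IH].
      by have := @is_deriveX _ _ id n y 1 1 (is_derive_id _ _); rewrite /GRing.scale/= mulr1.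
    have d3 := is_deriveM d2 d1.
    by apply: is_derive_eq d3 _; rewrite /GRing.scale/=; lra.
  have h := @is_derive1_comp R _ (fun x : R => x^-1) x _ _ (dg x^-1) dinv.
  have e : exp_bump n.+2 x - n%:R * exp_bump n.+1 x =
    (n%:R * x^-1 ^+ n.-1 * expR (- x^-1) - x^-1 ^+ n * expR (- x^-1)) * (- x ^- 2).
    rewrite /exp_bump x0 -exprVn; case: n {dg h} => [|n] /=; rewrite ?exprS ?expr0; lra.
  rewrite e; apply: near_eq_is_derive h.
  by near=> y; rewrite /= /exp_bump ifT//; near: y; exact: lt_nbhsr.
- rewrite !exp_bump_eq0 ?(ltW x0)// mulr0 subr0.
  have h : is_derive x 1 (cst 0 : R -> R) 0 by exact: is_derive_cst.
  apply: near_eq_is_derive h.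
  by near=> y; rewrite exp_bump_eq0//; apply: ltW; near: y; exact: lt_nbhsl.
rewrite !exp_bump_eq0// mulr0 subr0.
have h : (fun t : R => t^-1 *: (exp_bump n (t *: (1 : R) + 0) - exp_bump n 0)) @ 0^' --> (0 : R).
  apply/cvgrPdist_le => e e0.
  have f0 : 0 < (n.+2)`!%:R :> R by rewrite ltr0n fact_gt0.
  near=> t; rewrite sub0r normrN (exp_bump_eq0 _ (lexx 0)) subr0 addr0 /GRing.scale/= mulr1.
  have tn0 : t != 0 by near: t; exact: nbhs_dnbhs_neq.
  rewrite normrM normfV ger0_norm ?exp_bump_ge0// mulrC ler_pdivrMr ?normr_gt0//.
  apply: le_trans (exp_bump_le n t) _.
  rewrite -real_normK ?num_real// expr2 mulrA ler_pM2r ?normr_gt0//.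
  rewrite mulrC -ler_pdivlMr//; near: t.
  have q0 : 0 < e / (n.+2)`!%:R by rewrite divr_gt0.
  exact: dnbhs0_le.
apply: DeriveDef; first by apply/cvg_ex; exists 0.
exact: (cvg_lim (@Rhausdorff R) h).
Unshelve. all: by end_near. Qed.

(** Each triple holds a coefficient and two exponents, so that the derivative is again encoded by a
    list, with four triples for each one. *)
Definition bump_sum (s : seq (R * nat * nat)) x : R :=
  \sum_(t <- s) t.1.1 * (exp_bump t.1.2 x * exp_bump t.2 (1 - x)).

Lemma smooth_bump_sum s : smooth (bump_sum s).
Proof.
apply: (@smooth_class (range bump_sum)); last by exists s.
move=> _ [{}s _ <-].
exists (bump_sum (flatten [seq [:: (t.1.1, t.1.2.+2, t.2); (- t.1.1 * t.1.2%:R, t.1.2.+1, t.2);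
   (- t.1.1, t.1.2, t.2.+2); (t.1.1 * t.2%:R, t.1.2, t.2.+1)] | t <- s])); first by eexists.
move=> x.
have -> : bump_sum (flatten [seq [:: (t.1.1, t.1.2.+2, t.2); (- t.1.1 * t.1.2%:R, t.1.2.+1, t.2);
   (- t.1.1, t.1.2, t.2.+2); (t.1.1 * t.2%:R, t.1.2, t.2.+1)] | t <- s]) x =
  \sum_(t <- s) t.1.1 * ((exp_bump t.1.2.+2 x - t.1.2%:R * exp_bump t.1.2.+1 x) * exp_bump t.2 (1 - x)
   - exp_bump t.1.2 x * (exp_bump t.2.+2 (1 - x) - t.2%:R * exp_bump t.2.+1 (1 - x))).
  rewrite /bump_sum; elim: s => [|t s IH] /=; first by rewrite !big_nil.
  by rewrite !big_cons IH /=; lra.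
apply: is_derive_bigsum => t.
have da : is_derive x 1 (fun x : R => 1 - x) (-1).
  by apply: is_derive_eq; rewrite add0r mul1r.
have d2 := @is_derive1_comp R _ (fun x : R => 1 - x) x _ _ (is_derive_exp_bump t.2 (1 - x)) da.
have d3 := is_deriveM (is_derive_exp_bump t.1.2 x) d2.
have d4 := @is_deriveZ _ _ _ _ t.1.1 x 1 _ d3.
by apply: is_derive_eq d4 _; rewrite /GRing.scale/=; lra.
Qed.

Definition bump01 x : R := exp_bump 0 x * exp_bump 0 (1 - x).

Lemma bump01E : bump01 = bump_sum [:: (1 : R, 0%N, 0%N)].
Proof. by apply/funext => x; rewrite /bump_sum big_seq1/= mul1r. Qed.

Lemma smooth_bump01 : smooth bump01.
Proof. by rewrite bump01E; exact: smooth_bump_sum. Qed.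

Lemma bump01_ge0 x : 0 <= bump01 x.
Proof. by rewrite mulr_ge0 ?exp_bump_ge0. Qed.

Lemma bump01_eq0 x : ~~ (0 < x < 1) -> bump01 x = 0.
Proof.
rewrite negb_and -!leNgt => /orP[h|h]; rewrite /bump01.
  by rewrite exp_bump_eq0// mul0r.
by rewrite (exp_bump_eq0 _ (_ : 1 - x <= 0)) ?mulr0// subr_le0.
Qed.

Lemma smooth_continuous f : smooth f -> continuous f.
Proof.
by move=> sf x; apply: differentiable_continuous; apply/derivable1_diffP; exact: (sf 0%N).
Qed.

Lemma int01_bump01_gt0 : 0 < int01 bump01.
Proof.
have ib a b : ig `[a, b] bump01 by apply: ig_continuousT; exact: smooth_continuous smooth_bump01.
have h a b : 0 <= \int[@lebesgue_measure R]_(x in `[a, b]) bump01 x.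
  by apply: Rintegral_ge0 => x _; exact: bump01_ge0.
rewrite /int01 (@Rintegral_setU_itv R 0 (4^-1) 1)//; last by apply/andP; split; lra.
rewrite (@Rintegral_setU_itv R (4^-1) (2^-1) 1)//; last by apply/andP; split; lra.
suff : 0 < \int[@lebesgue_measure R]_(x in `[4^-1, 2^-1]) bump01 x.
  by move=> hb; apply: ltr_wpDl; [exact: h|apply: ltr_pwDl; [exact: hb|exact: h]].
have e0 : 0 < expR (- 8) :> R by exact: expR_gt0.
apply: (@lt_le_trans _ _ (\int[@lebesgue_measure R]_(x in `[4^-1, 2^-1]) expR (- 8))).
  rewrite Rintegral_cst//= lebesgue_measure_itv/= lte_fin ifT; last by lra.
  by rewrite -EFinB/= mulr_gt0//; lra.
apply: le_Rintegral => //.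
  by apply: ig_continuousT => x; exact: cvg_cst.
  exact: ib.
move=> x /=; rewrite in_itv/= => /andP[x1 x2].
have x0 : 0 < x by lra.
have y0 : 0 < 1 - x by lra.
rewrite /bump01 /exp_bump x0 y0 !expr0 !mul1r -expRD ler_expR.
have a1 : x^-1 <= 4 by rewrite -[leRHS]invrK lef_pV2 ?posrE//; lra.
have a2 : (1 - x)^-1 <= 4 by rewrite -[leRHS]invrK lef_pV2 ?posrE//; lra.
lra.
Qed.
End SmoothFunctions.

(** * Oscillation of a function through its weak derivative *)

Section BumpAverages.
Variable R : realType.
Notation mu := (@lebesgue_measure R).
Notation I01 := (`[0%R, 1%R]%classic : set R).
Implicit Types (f g h r : R -> R) (x c d : R).

Definition bump c d x : R := (d * int01 (@bump01 R))^-1 * bump01 (d^-1 * x + - (c / d)).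

Lemma smooth_bump c d : smooth (bump c d).
Proof. by apply: smooth_affine; exact: smooth_bump01. Qed.

Lemma continuous_bump c d : continuous (bump c d).
Proof. by apply: smooth_continuous; exact: smooth_bump. Qed.

Lemma continuous_bump01 : continuous (@bump01 R).
Proof. by apply: smooth_continuous; exact: smooth_bump01. Qed.

Lemma bump_ge0 c d x : 0 < d -> 0 <= bump c d x.
Proof. by move=> d0; rewrite mulr_ge0 ?bump01_ge0// invr_ge0 mulr_ge0 ?ltW// int01_bump01_gt0. Qed.

Lemma bump_eq0 c d x : 0 < d -> ~~ (c < x < c + d) -> bump c d x = 0.
Proof.
move=> d0 H; rewrite /bump bump01_eq0 ?mulr0//; apply: contra H => /andP[h1 h2].
have e : d^-1 * x + - (c / d) = (x - c) / d by lra.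
rewrite e in h1 h2; rewrite ltr_pdivrMr// mul1r in h2.
have h3 : 0 < x - c by rewrite -(pmulr_lgt0 _ (_ : 0 < d^-1)) ?invr_gt0.
by apply/andP; split; lra.
Qed.

Lemma ig_bump c d a b : ig `[a, b] (bump c d).
Proof. by apply: ig_continuousT; exact: continuous_bump. Qed.

Lemma Rintegral_bump c d : 0 < d -> \int[mu]_(x in `[c, c + d]) bump c d x = 1.
Proof.
move=> d0; have dn0 : d != 0 by rewrite gt_eqF.
have m0 := int01_bump01_gt0 R.
rewrite (Rintegral_shift c (ig_bump c d c (c + d))) subrr [c + d]addrC addrK.
have ib : ig `[0, d * 1] (fun x => bump c d (x + c)).
  have := ig_shift c (ig_bump c d c (c + d)).
  by rewrite subrr [c + d]addrC addrK mulr1.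
rewrite -[X in `[0, X]](mulr1 d) (Rintegral_scale d0 ib).
rewrite (_ : \int[mu]_(x in `[0, 1]) bump c d (d * x + c) =
   int01 (fun x => (d * int01 (@bump01 R))^-1 * bump01 x)).
  rewrite int01Z; last by apply: ig_continuousT; exact: continuous_bump01.
  by rewrite invfM mulrA mulrA mulfV// mul1r mulVf// gt_eqF.
apply: eq_Rintegral => x _; rewrite /bump; congr (_ * bump01 _).
rewrite mulrDr mulrA mulVf//; lra.
Qed.

Lemma Rintegral_zero a b f : (forall x, a <= x <= b -> f x = 0) -> \int[mu]_(x in `[a, b]) f x = 0.
Proof.
move=> H; rewrite (_ : \int[mu]_(x in `[a, b]) f x = \int[mu]_(x in `[a, b]) 0); last first.
  by apply: eq_Rintegral => x; rewrite inE/= in_itv/=; exact: H.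
by rewrite Rintegral_cst// mul0r.
Qed.

(** For [c >= 0] the base point -1 lies to the left of the support of the bump: the primitive rises
    from 0 to 1 on [[c, c + d]], and it is differentiable at 0 by the fundamental theorem. *)
Definition step c d x : R := \int[mu]_(t in `[-1, x]) bump c d t.

Lemma step_le c d x : 0 <= c -> 0 < d -> x <= c -> step c d x = 0.
Proof.
move=> c0 d0 xc; apply: Rintegral_zero => t /andP[_ tx]; apply: bump_eq0 => //.
by rewrite negb_and -!leNgt (le_trans tx).
Qed.

Lemma step_mid c d x : 0 <= c -> 0 < d -> c <= x ->
  step c d x = \int[mu]_(t in `[c, x]) bump c d t.
Proof.
move=> c0 d0 cx; rewrite /step (@Rintegral_setU_itv R (-1) c x); last exact: ig_bump.
  by rewrite -/(step c d c) step_le// add0r.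
by apply/andP; split=> //; lra.
Qed.

Lemma step_ge c d x : 0 <= c -> 0 < d -> c + d <= x -> step c d x = 1.
Proof.
move=> c0 d0 cx; rewrite step_mid//; last by lra.
rewrite (@Rintegral_setU_itv R c (c + d) x); last exact: ig_bump.
  rewrite Rintegral_bump// Rintegral_zero ?addr0// => t /andP[ct _].
  by apply: bump_eq0 => //; rewrite negb_and -!leNgt ct orbT.
by apply/andP; split=> //; lra.
Qed.

Lemma step_itv c d x : 0 <= c -> 0 < d -> 0 <= step c d x <= 1.
Proof.
move=> c0 d0; case: (leP x c) => [xc|cx]; first by rewrite step_le// lexx ler01.
have p a b : 0 <= \int[mu]_(t in `[a, b]) bump c d t.
  by apply: Rintegral_ge0 => t _; exact: bump_ge0.
rewrite p/=; case: (leP (c + d) x) => [h|h]; first by rewrite step_ge.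
rewrite step_mid ?(ltW cx)// -[leRHS](Rintegral_bump c d0).
rewrite (@Rintegral_setU_itv R c x (c + d)); last exact: ig_bump.
  by rewrite lerDl p.
by apply/andP; split; lra.
Qed.

Lemma is_derive_step c d x : 0 <= c -> 0 < d -> is_derive x 1 (step c d) (bump c d x).
Proof.
move=> c0 d0; case: (ltP (-1) x) => [x1|x1].
  have cb : {for x, continuous (bump c d)} by exact: continuous_bump.
  have xu : x < x + 1 by lra.
  have [h1 h2] := @continuous_FTC1_closed R (bump c d) (-1) x (x + 1) xu (ig_bump c d (-1) (x + 1)) x1 cb.
  by apply: DeriveDef; [exact: h1|rewrite -derive1E].
have b0 : bump c d x = 0.
  by apply: bump_eq0 => //; rewrite negb_and -!leNgt; apply/orP; left; lra.
rewrite b0; have h : is_derive x 1 (cst 0 : R -> R) 0 by exact: is_derive_cst.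
apply: near_eq_is_derive h; near=> y; rewrite step_le//.
have : y < 0 by near: y; apply: lt_nbhsl; lra.
by lra.
Unshelve. all: by end_near. Qed.

(** Both primitives end at 1, so their difference has compact support; its derivative is a
    difference of two unit masses near [c1] and [c2]. *)
Lemma test_function_stepB c1 c2 d : 0 < c1 -> 0 < c2 -> 0 < d -> c1 + d < 1 -> c2 + d < 1 ->
  test_function (fun x => step c1 d x - step c2 d x).
Proof.
move=> c10 c20 d0 h1 h2; split.
  apply: (@smooth_primitive R _ (fun x => bump c1 d x - bump c2 d x)).
    by move=> x; apply: is_deriveB; apply: is_derive_step => //; exact: ltW.
  by apply: smoothB; exact: smooth_bump.
exists (Num.min c1 c2), (Num.max (c1 + d) (c2 + d)); split.
- by rewrite lt_min c10.
- by rewrite gt_max h1.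
move=> x /negP; rewrite negb_and -!ltNge => /orP[|].
  by rewrite lt_min => /andP[a b]; rewrite !step_le ?ltW// subrr.
by rewrite gt_max => /andP[a b]; rewrite !step_ge ?ltW// subrr.
Qed.

Lemma int01_bump_average h c d e : 0 <= c -> 0 < d -> c + d <= 1 -> {within I01, continuous h} ->
  (forall t, c <= t <= c + d -> `|h t - h c| <= e) ->
  `|int01 (fun t => h t * bump c d t) - h c| <= e.
Proof.
move=> c0 d0 cd ch H.
have cb := @continuous_bump c d.
have b1 : int01 (bump c d) = 1.
  rewrite /int01 (@Rintegral_setU_itv R 0 c 1); [|by apply/andP; split; lra|exact: ig_bump].
  rewrite (@Rintegral_setU_itv R c (c + d) 1); [|by apply/andP; split; lra|exact: ig_bump].
  rewrite Rintegral_bump// !Rintegral_zero ?addr0 ?add0r// => t /andP[t0 t1];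
    by apply: bump_eq0 => //; rewrite negb_and -!leNgt ?t0 ?t1 ?orbT.
have i1 : ig I01 (fun t => h t * bump c d t).
  by apply: ig_continuous; apply: within_continuousM => //; exact: within_continuousT.
have i2 : ig I01 (fun t => h c * bump c d t) by apply: igZ => //; exact: ig_bump.
rewrite -[X in _ - X]mulr1 -b1 -int01Z; last exact: ig_bump.
rewrite -int01B//.
have i3 : ig I01 (fun t => e * bump c d t) by apply: igZ => //; exact: ig_bump.
have i4 : ig I01 (fun t => h t * bump c d t - h c * bump c d t) by exact: igB.
apply: le_trans (le_normr_Rintegral _ i4) _ => //.
rewrite -[leRHS]mulr1 -[X in _ <= e * X]b1 -int01Z; last exact: ig_bump.
apply: le_Rintegral => //; first exact: (integrable_norm i4).
move=> t _; rewrite -mulrBl normrM (ger0_norm (bump_ge0 _ _ d0)).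
have [tc|tc] := boolP (c < t < c + d).
  by apply: ler_wpM2r; [exact: bump_ge0|apply: H; case/andP: tc => *; apply/andP; split; exact: ltW].
by rewrite (bump_eq0 d0 tc) !mulr0.
Qed.

Lemma derive1_stepB c1 c2 d : 0 <= c1 -> 0 <= c2 -> 0 < d ->
  derive1 (fun x => step c1 d x - step c2 d x) = fun x => bump c1 d x - bump c2 d x.
Proof.
move=> c10 c20 d0; apply/funext => x; rewrite derive1E.
have h : is_derive x 1 (fun x => step c1 d x - step c2 d x) (bump c1 d x - bump c2 d x).
  by apply: is_deriveB; exact: is_derive_step.
by rewrite derive_val.
Qed.

Lemma continuous_step c d : 0 <= c -> 0 < d -> continuous (step c d).
Proof.
move=> c0 d0 x; apply: differentiable_continuous; apply/derivable1_diffP.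
by have := is_derive_step x c0 d0 => ?; exact: ex_derive.
Qed.

(** Testing with a difference of steps equates the difference of the averages of [h] near [x] and
    near [y] with an integral of [r] against a function bounded by 1. The averages approach [h x]
    and [h y] as the width [d] shrinks. *)
Lemma weak_derivative_interior h r : {within I01, continuous h} -> ig I01 r ->
  is_weak_derivative h r -> forall x y, 0 < x < 1 -> 0 < y < 1 ->
  `|h x - h y| <= int01 (fun t => `|r t|).
Proof.
move=> ch ir wd x y /andP[x0 x1] /andP[y0 y1].
apply/ler_addgt0Pr => e e0.
have e2 : 0 < e / 2 by rewrite divr_gt0.
have x01 : 0 <= x <= 1 by apply/andP; split; exact: ltW.
have y01 : 0 <= y <= 1 by apply/andP; split; exact: ltW.
have /within_continuousP cc := ch.
have [d1 d10 H1] := cc x x01 _ e2; have [d2 d20 H2] := cc y y01 _ e2.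
pose d := Num.min (Num.min (d1 / 2) (d2 / 2)) (Num.min ((1 - x) / 2) ((1 - y) / 2)).
have d0 : 0 < d by clear -d10 d20 x1 y1; rewrite !lt_min; apply/andP; split; apply/andP; split; lra.
have : d <= d by [].
rewrite {2}/d !le_min => /andP[/andP[q1 q2] /andP[q3 q4]]; clearbody d.
have xd : x + d < 1 by clear -q3 x1; lra.
have yd : y + d < 1 by clear -q4 y1; lra.
have tf := test_function_stepB x0 y0 d0 xd yd.
have := wd _ tf; rewrite (derive1_stepB (ltW x0) (ltW y0) d0) => E.
have cb c := @continuous_bump c d.
have ihb c : ig I01 (fun t => h t * bump c d t).
  by apply: ig_continuous; apply: within_continuousM => //; exact: within_continuousT.
have E2 : int01 (fun t => h t * (bump x d t - bump y d t)) =
   int01 (fun t => h t * bump x d t) - int01 (fun t => h t * bump y d t).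
  by rewrite -int01B//; congr int01; apply/funext => t; rewrite mulrBr.
have a1 : `|int01 (fun t => h t * bump x d t) - h x| <= e / 2.
  apply: int01_bump_average => //; [exact: ltW|exact: ltW|].
  move=> t /andP[t0 t1]; rewrite distrC; apply/ltW/H1; first by clear -t0 t1 x0 xd; apply/andP; split; lra.
  by clear -t0 t1 q1 d10 d0; rewrite ltr_norml; apply/andP; split; lra.
have a2 : `|int01 (fun t => h t * bump y d t) - h y| <= e / 2.
  apply: int01_bump_average => //; [exact: ltW|exact: ltW|].
  move=> t /andP[t0 t1]; rewrite distrC; apply/ltW/H2; first by clear -t0 t1 y0 yd; apply/andP; split; lra.
  by clear -t0 t1 q2 d20 d0; rewrite ltr_norml; apply/andP; split; lra.
have iw : ig I01 (fun t => r t * (step x d t - step y d t)).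
  apply: (@ig_le _ _ _ (fun t => `|r t|)) => //.
  - apply: measurable_funM; first exact: measurable_ig.
    apply: measurable_funTS; apply: continuous_measurable_fun => t.
    by apply: cvgB; apply: continuous_step => //; exact: ltW.
  - move=> t _; rewrite normrM ler_piMr//.
    have /andP[s1 s2] := step_itv t (ltW x0) d0; have /andP[s3 s4] := step_itv t (ltW y0) d0.
    move: (step x d t) (step y d t) s1 s2 s3 s4 => A B s1 s2 s3 s4; clear -s1 s2 s3 s4.
    by rewrite ler_norml; apply/andP; split; lra.
  - exact: (integrable_norm ir).
have a3 : `|int01 (fun t => r t * (step x d t - step y d t))| <= int01 (fun t => `|r t|).
  apply: le_trans (le_normr_Rintegral _ iw) _ => //.
  apply: le_Rintegral => //; [exact: (integrable_norm iw)|exact: (integrable_norm ir)|].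
  move=> t _; rewrite normrM ler_piMr//.
  have /andP[s1 s2] := step_itv t (ltW x0) d0; have /andP[s3 s4] := step_itv t (ltW y0) d0.
    move: (step x d t) (step y d t) s1 s2 s3 s4 => A B s1 s2 s3 s4; clear -s1 s2 s3 s4.
  by rewrite ler_norml; apply/andP; split; lra.
rewrite E2 in E.
move: a1 a2 a3 E; clear; move: (int01 _) (int01 _) (int01 _) (int01 _) (h x) (h y) => A B C D p q.
rewrite !ler_norml => /andP[? ?] /andP[? ?] /andP[? ?] E.
by apply/andP; split; lra.
Qed.

Lemma weak_derivative_dist_le h r : {within I01, continuous h} -> ig I01 r ->
  is_weak_derivative h r -> forall x y, 0 <= x <= 1 -> 0 <= y <= 1 ->
  `|h x - h y| <= int01 (fun t => `|r t|).
Proof.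
move=> ch ir wd x y x01 y01; apply/ler_addgt0Pr => e e0.
have e2 : 0 < e / 2 by rewrite divr_gt0.
have /within_continuousP cc := ch.
have int z : 0 <= z <= 1 -> exists2 z', 0 < z' < 1 & `|h z - h z'| <= e / 2.
  move=> z01; have [d d0 H] := cc z z01 _ e2.
  pose t := Num.min (d / 2) (4^-1).
  have t0 : 0 < t by rewrite lt_min; apply/andP; split; lra.
  have : t <= t by []. rewrite {2}/t le_min => /andP[q1 q2].
  case/andP: z01 => z0 z1; case: (leP z (2^-1)) => hz.
    exists (z + t); first by apply/andP; split; lra.
    apply/ltW/H; first by apply/andP; split; lra.
    by rewrite ltr_norml; apply/andP; split; lra.
  exists (z - t); first by apply/andP; split; lra.
  apply/ltW/H; first by apply/andP; split; lra.
  by rewrite ltr_norml; apply/andP; split; lra.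
have [x' x'01 hx] := int x x01; have [y' y'01 hy] := int y y01.
have := weak_derivative_interior ch ir wd x'01 y'01.
move: hx hy; clear; move: (int01 _) (h x) (h y) (h x') (h y') => A p q p' q'.
rewrite !ler_norml => /andP[? ?] /andP[? ?] /andP[? ?].
by apply/andP; split; lra.
Qed.
End BumpAverages.

(** * Uniform approximation by cosine polynomials *)

Section CosineWeierstrass.
Local Arguments trig {R} s k x : simpl never.
Variable R : realType.
Notation I01 := (`[0%R, 1%R]%classic : set R).
Implicit Types (h : R -> R) (phi psi : nat -> R) (x y : R).

(* The expectation of [phi] under the binomial distribution with parameters [n] and [y]. *)
Fixpoint bernstein (n : nat) phi y : R :=
  if n is m.+1 then y * bernstein m (fun k => phi k.+1) y + (1 - y) * bernstein m phi y
  else phi 0%N.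

Lemma bernstein_le n phi psi y : 0 <= y <= 1 -> (forall k, phi k <= psi k) ->
  bernstein n phi y <= bernstein n psi y.
Proof.
move=> /andP[y0 y1]; elim: n phi psi => [|n IH] phi psi H /=; first exact: H.
apply: lerD; apply: ler_wpM2l; rewrite ?subr_ge0//; apply: IH => // k; exact: H.
Qed.

Lemma bernstein_cst n c y : bernstein n (fun=> c) y = c.
Proof. by elim: n => [//|n IH] /=; rewrite IH; lra. Qed.

Lemma bernsteinD n phi psi y :
  bernstein n (fun k => phi k + psi k) y = bernstein n phi y + bernstein n psi y.
Proof. by elim: n phi psi => [//|n IH] phi psi /=; rewrite (IH (fun k => phi k.+1)) IH; lra. Qed.

Lemma bernsteinZ n c phi y : bernstein n (fun k => c * phi k) y = c * bernstein n phi y.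
Proof. by elim: n phi => [//|n IH] phi /=; rewrite (IH (fun k => phi k.+1)) IH; lra. Qed.

Lemma bernstein_sqr n c y : bernstein n (fun k => (k%:R - c) ^+ 2) y =
  n%:R * (y * (1 - y)) + (n%:R * y - c) ^+ 2.
Proof.
elim: n c => [|n IH] c /=; first by rewrite !expr2; lra.
rewrite (_ : (fun k : nat => (k.+1%:R - c) ^+ 2) = (fun k : nat => (k%:R - (c - 1)) ^+ 2)); last first.
  by apply/funext => k; congr (_ ^+ 2); rewrite -natr1; lra.
by rewrite !IH -natr1 !expr2; lra.
Qed.

(** A change of variable of [[0, 1]] in which algebraic polynomials become cosine polynomials. *)
Definition half_cos x : R := (1 - cos (pi * x)) / 2.

Lemma half_cos_itv x : 0 <= half_cos x <= 1.
Proof.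
by have := cos_le1 (pi * x); have := cos_geN1 (pi * x); rewrite /half_cos => ? ?; apply/andP; split; lra.
Qed.

Lemma half_cos_surj (t : R) : 0 <= t <= 1 -> exists2 x, 0 <= x <= 1 & half_cos x = t.
Proof.
move=> /andP[t0 t1]; have p0 := @pi_gt0 R.
have a1 : -1 <= 1 - 2 * t <= 1 by apply/andP; split; lra.
exists (acos (1 - 2 * t) / pi).
  by rewrite (divr_ge0 (acos_ge0 a1) (ltW p0))/= ler_pdivrMr// mul1r acos_lepi.
rewrite /half_cos mulrCA divff ?gt_eqF// mulr1 acosK ?in_itv//=; lra.
Qed.

(** The difference equals [sin (pi * (x + y) / 2) * sin (pi * (x - y) / 2)]. With [d <= x - y], the
    midpoint is at distance at least [d / 2] from both endpoints, so each sine is at least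
    [d / 2]. *)
Lemma half_cos_dist_ge x y d : 0 <= x <= 1 -> 0 <= y <= 1 -> 0 < d -> d <= `|x - y| ->
  d ^+ 2 / 4 <= `|half_cos x - half_cos y|.
Proof.
wlog yx : x y / y <= x => [H|/andP[x0 x1] /andP[y0 y1] d0].
  case: (leP y x) => [|/ltW] h; first exact: H.
  by move=> x01 y01 d0 dx; rewrite distrC; apply: H => //; rewrite distrC.
rewrite ger0_norm ?subr_ge0// => dxy; have p2 := @pi_ge2 R.
have -> : half_cos x - half_cos y = sin (pi * ((x + y) / 2)) * sin (pi * ((x - y) / 2)).
  rewrite /half_cos.
  have -> : pi * x = pi * ((x + y) / 2) + pi * ((x - y) / 2) by lra.
  have -> : pi * y = pi * ((x + y) / 2) - pi * ((x - y) / 2) by lra.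
  by rewrite !(cosD, cosN, sinN); lra.
have sge (s : R) : d / 2 <= s <= 1 - d / 2 -> d / 2 <= sin (pi * s).
  move=> /andP[s0 s1]; case: (leP s (2^-1)) => hs.
    apply: le_trans (sin_ge_half _); first nra.
    by apply/andP; split; nra.
  have -> : sin (pi * s) = sin (pi * (1 - s)).
    have -> : pi * s = - (pi * (1 - s)) + pi by lra.
    by rewrite sinDpi sinN opprK.
  apply: le_trans (sin_ge_half _); first nra.
  by apply/andP; split; nra.
have a1 : d / 2 <= sin (pi * ((x + y) / 2)) by apply: sge; apply/andP; split; lra.
have a2 : d / 2 <= sin (pi * ((x - y) / 2)).
  apply: le_trans (sin_ge_half _); first nra.
  by apply/andP; split; nra.
have d2 : 0 <= d / 2 by lra.
rewrite normrM !ger0_norm ?(le_trans d2)//.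
have -> : d ^+ 2 / 4 = d / 2 * (d / 2) by rewrite expr2; lra.
exact: ler_pM.
Qed.

Lemma within_continuous_bounded h : {within I01, continuous h} ->
  exists2 M, 0 <= M & forall x, 0 <= x <= 1 -> `|h x| <= M.
Proof.
move=> ch; have [a _ Ha] := EVT_max ler01 ch; have [b _ Hb] := EVT_min ler01 ch.
exists (`|h a| + `|h b|); first by rewrite addr_ge0.
move=> x x01; have := Ha x; have := Hb x; rewrite in_itv/= => /(_ x01) h1 /(_ x01) h2.
rewrite ler_norml; have := ler_norm (h a); have := ler_norm (- h b); rewrite normrN.
have := normr_ge0 (h a); have := normr_ge0 (h b).
by move=> ? ? ? ?; apply/andP; split; lra.
Qed.

Lemma within_continuous_unifcont h e : {within I01, continuous h} -> 0 < e ->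
  exists2 d : R, 0 < d & forall x y, 0 <= x <= 1 -> 0 <= y <= 1 -> `|x - y| < d -> `|h x - h y| <= e.
Proof.
move=> /within_continuousP ch e0; apply: contrapT => nd.
have e2 : 0 < e / 2 by rewrite divr_gt0.
have bad n : {p : R * R | [/\ 0 <= p.1 <= 1, 0 <= p.2 <= 1, `|p.1 - p.2| < n.+1%:R^-1 & e < `|h p.1 - h p.2|]}.
  apply: cid; apply: contrapT => H; apply: nd; exists n.+1%:R^-1; first by rewrite invr_gt0.
  move=> x y x01 y01 xy; rewrite leNgt; apply/negP => hxy; apply: H; exists (x, y); split => //.
pose u n := (projT1 (bad n)).1; pose v n := (projT1 (bad n)).2.
have Hu n : 0 <= u n <= 1 by have [] := projT2 (bad n).
have Hv n : 0 <= v n <= 1 by have [] := projT2 (bad n).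
have Huv n : `|u n - v n| < n.+1%:R^-1 by have [] := projT2 (bad n).
have Hh n : e < `|h (u n) - h (v n)| by have [] := projT2 (bad n).
have bu : bounded_fun u.
  exists 1; split; first exact: num_real.
  by move=> M M1 n _ /=; have /andP[a b] := Hu n; rewrite ger0_norm//; apply: le_trans b (ltW M1).
have [f incf cuf] := bolzano_weierstrass bu.
have fn n : (n <= f n)%N.
  elim: n => [//|n IH]; apply: leq_ltn_trans IH _.
  have := incf n n.+1; have := incf n.+1 n; rewrite !leEnat leqnSn ltnn.
  by move=> a b; rewrite ltnNge a.
set l := limn (u \o f) in cuf.
have l01 : 0 <= l <= 1.
  by apply/andP; split; [apply: limr_ge|apply: limr_le] => //; near=> n; case/andP: (Hu (f n)).
have [d d0 Hd] := ch l l01 _ e2.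
have d2 : 0 < d / 2 by rewrite divr_gt0.
have /cvgrPdist_lt /(_ _ d2) [N1 _ H1] : (u \o f) @ \oo --> l by exact: cuf.
have [N2 HN2] : exists N2 : nat, forall n, (N2 <= n)%N -> n.+1%:R^-1 <= d / 2 :> R.
  exists (Num.bound (d / 2)^-1) => n Nn; rewrite -[leRHS]invrK lef_pV2 ?posrE ?invr_gt0//.
  apply: ltW; apply: lt_le_trans (archi_boundP _) _; first by rewrite invr_ge0 ltW.
  by rewrite ler_nat (leq_trans Nn).
pose N := maxn N1 N2.
have h1 := H1 N (leq_maxl _ _).
have h2 := HN2 (f N) (leq_trans (leq_maxr N1 N2) (fn N)).
have h3 := Huv (f N); have h4 := Hh (f N).
have h5 := Hd _ (Hu (f N)); have h6 := Hd _ (Hv (f N)).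
move: h1 h2 h3 h4 h5 h6 => /=.
move: (u (f N)) (v (f N)) ((f N).+1%:R^-1) => a b q h1 h2 h3 h4 h5 h6.
have {}h5 : `|h l - h a| < e / 2 by apply: h5; apply: lt_trans h1 _; clear -d0; lra.
have {}h6 : `|h l - h b| < e / 2.
  apply: h6; move: h1 h3; rewrite !ltr_norml => /andP[p1 p2] /andP[p3 p4]; clear -h2 p1 p2 p3 p4; apply/andP; split; lra.
move: h4; apply/negP; rewrite -leNgt; move: h5 h6; rewrite !ltr_norml ler_norml.
by move=> /andP[? ?] /andP[? ?]; apply/andP; split; lra.
Unshelve. all: by end_near. Qed.

Definition trig_sum (b : bool) (s : seq (R * nat)) x : R := \sum_(t <- s) t.1 * trig b t.2 x.

Lemma trig_sum_cat b s1 s2 x : trig_sum b (s1 ++ s2) x = trig_sum b s1 x + trig_sum b s2 x.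
Proof. by rewrite /trig_sum big_cat. Qed.

Lemma trig_sumZ b (c : R) s x : trig_sum b [seq (c * t.1, t.2) | t <- s] x = c * trig_sum b s x.
Proof. by rewrite /trig_sum big_map mulr_sumr; apply: eq_bigr => t _ /=; rewrite mulrA. Qed.

Lemma trig_mul_cos k x : trig false k x * cos (pi * x) =
  2^-1 * trig false k.+1 x + 2^-1 * trig false (if k == 0%N then 1%N else k.-1) x.
Proof.
rewrite /trig; case: k => [|k] /=; first by rewrite !mul0r cos0 !mul1r; lra.
have -> : k.+2%:R * pi * x = k.+1%:R * pi * x + pi * x by rewrite -[k.+2%:R]natr1; lra.
have -> : k%:R * pi * x = k.+1%:R * pi * x - pi * x by rewrite -[k.+1%:R]natr1; lra.
by rewrite !(cosD, cosN, sinN); lra.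
Qed.

Lemma trig_mul_sin k x : trig false k x * sin (pi * x) =
  if k == 0%N then trig true 1 x else 2^-1 * trig true k.+1 x - 2^-1 * trig true k.-1 x.
Proof.
rewrite /trig; case: k => [|k] /=; first by rewrite !mul0r cos0 !mul1r.
have -> : k.+2%:R * pi * x = k.+1%:R * pi * x + pi * x by rewrite -[k.+2%:R]natr1; lra.
have -> : k%:R * pi * x = k.+1%:R * pi * x - pi * x by rewrite -[k.+1%:R]natr1; lra.
by rewrite !(sinD, cosN, sinN); lra.
Qed.

Lemma trig_sum_mul_cos s : exists s', forall x, trig_sum false s' x = trig_sum false s x * cos (pi * x).
Proof.
exists (flatten [seq [:: (t.1 / 2, t.2.+1); (t.1 / 2, if t.2 == 0%N then 1%N else t.2.-1)] | t <- s]) => x.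
rewrite /trig_sum mulr_suml; elim: s => [|t s IH] /=; first by rewrite !big_nil.
by rewrite !big_cons IH -mulrA trig_mul_cos /=; lra.
Qed.

Lemma trig_sum_mul_sin s : exists s', forall x, trig_sum true s' x = trig_sum false s x * sin (pi * x).
Proof.
exists (flatten [seq (if t.2 == 0%N then [:: (t.1, 1%N)] else [:: (t.1 / 2, t.2.+1); (- (t.1 / 2), t.2.-1)]) | t <- s]) => x.
rewrite /trig_sum mulr_suml; elim: s => [|t s IH] /=; first by rewrite !big_nil.
rewrite big_cat IH big_cons -mulrA trig_mul_sin; case: ifP => _ /=.
  by rewrite big_seq1.
by rewrite !big_cons big_nil /=; lra.
Qed.

Lemma trig_sumP b s : exists N c, forall x, trig_sum b s x = trigp N b c x.
Proof.
pose n := (\max_(t <- s) t.2).+1.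
have nP (t : R * nat) : t \in s -> (t.2 < n)%N.
  by move=> ts; rewrite ltnS; apply: (@leq_bigmax_seq _ s xpredT (fun t => t.2)).
clearbody n; exists n, (fun k => \sum_(t <- s | t.2 == k) t.1) => x.
rewrite /trig_sum /trigp.
transitivity (\sum_(k <- iota 0 n) \sum_(t <- s | t.2 == k) t.1 * trig b t.2 x).
  rewrite (exchange_big_dep xpredT)// big_seq [RHS]big_seq; apply: eq_bigr => t ts.
  rewrite -big_filter (_ : [seq i <- iota 0 n | _] = [:: t.2]) ?big_seq1//.
  rewrite (eq_filter (a2 := pred1 t.2)); last by move=> i; rewrite /= eq_sym.
  by rewrite filter_pred1_uniq// ?iota_uniq// mem_iota nP.
apply: eq_bigr => k _; rewrite mulr_suml; apply: eq_bigr => t /eqP ->.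
by [].
Qed.

(** By the recursion defining [bernstein], it suffices that multiplication by [cos (pi * x)]
    preserves cosine sums. *)
Lemma bernstein_trig_sum n phi : exists s, forall x, trig_sum false s x = bernstein n phi (half_cos x).
Proof.
elim: n phi => [|n IH] phi.
  exists [:: (phi 0%N, 0%N)] => x; rewrite /trig_sum big_seq1 /= /trig !mul0r cos0 mulr1//.
have [s1 H1] := IH (fun k => phi k.+1); have [s2 H2] := IH phi.
have [s3 H3] := trig_sum_mul_cos s1; have [s4 H4] := trig_sum_mul_cos s2.
exists ([seq (2^-1 * t.1, t.2) | t <- s1 ++ s2] ++ ([seq (- 2^-1 * t.1, t.2) | t <- s3] ++ [seq (2^-1 * t.1, t.2) | t <- s4])) => x.
have hc : cos (pi * x) = 1 - 2 * half_cos x by rewrite /half_cos; lra.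
rewrite !trig_sum_cat !trig_sumZ trig_sum_cat H3 H4 H1 H2 /= hc.
by move: (bernstein n phi (half_cos x)) (bernstein n (fun k => phi k.+1) (half_cos x)) (half_cos x); clear; move=> ? ? ?; lra.
Qed.

(** Bernstein's proof: uniform continuity gives [|h x - h y| <= e / 2 + C * (half_cos x - half_cos
    y) ^ 2], and averaging over the binomial law turns the square into a variance of order
    [1 / n]. *)
Lemma cos_weierstrass h e : {within I01, continuous h} -> 0 < e ->
  exists s, forall x, 0 <= x <= 1 -> `|h x - trig_sum false s x| <= e.
Proof.
move=> ch e0; have e2 : 0 < e / 2 by rewrite divr_gt0.
have [M M0 HM] := within_continuous_bounded ch.
have [d d0 Hd] := within_continuous_unifcont ch e2.
(* Chosen so that [C * (d ^ 2 / 4) ^ 2 = 2 * M], the trivial bound for points at distance at least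
   [d]. *)
pose C := 32 * M / d ^+ 4.
have C0 : 0 <= C by apply: divr_ge0; [exact: mulr_ge0|by rewrite exprn_ge0// ltW].
have mod x y : 0 <= x <= 1 -> 0 <= y <= 1 -> `|h x - h y| <= e / 2 + C * (half_cos x - half_cos y) ^+ 2.
  move=> x01 y01; case: (ltP `|x - y| d) => [xy|dxy].
    apply: le_trans (Hd x y x01 y01 xy) _.
    by rewrite lerDl mulr_ge0// sqr_ge0.
  have := half_cos_dist_ge x01 y01 d0 dxy => h1.
  have h2 : (d ^+ 2 / 4) ^+ 2 <= (half_cos x - half_cos y) ^+ 2.
    rewrite -[leRHS]real_normK ?num_real//; apply: lerXn2r => //; rewrite nnegrE//.
    by rewrite divr_ge0// sqr_ge0.
  have h3 : 2 * M <= C * (half_cos x - half_cos y) ^+ 2.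
    apply: le_trans (ler_wpM2l C0 h2); rewrite /C.
    have -> : 32 * M / d ^+ 4 * (d ^+ 2 / 4) ^+ 2 = 2 * M * (d ^+ 4 / d ^+ 4) by rewrite !exprS expr0; lra.
    by rewrite divff ?mulr1// gt_eqF// exprn_gt0.
  apply: le_trans (ler_normB _ _) _; have := HM x x01; have := HM y y01.
  by move: h3 e2; move: (C * _) `|h x| `|h y| => a b c ? ? ? ?; lra.
pose n := (Num.bound (C / e)).+1.
have n0 : 0 < n%:R :> R by rewrite ltr0n.
have Cn : C / n%:R <= e.
  rewrite ler_pdivrMr// mulrC -ler_pdivrMr//; apply: ltW.
  apply: lt_le_trans (archi_boundP _) _; first by rewrite divr_ge0// ltW.
  by rewrite ler_nat.
(* The comparison [bernstein_le] ranges over all [k], also beyond [n]; the cap keeps the nodes in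
   the range of [half_cos]. *)
pose t k : R := Num.min (k%:R / n%:R) 1.
have t01 k : 0 <= t k <= 1.
  by rewrite /t le_min divr_ge0//= ler01/= ge_min lexx orbT.
have ch' k : {z | 0 <= z <= 1 & half_cos z = t k}.
  by apply: cid2; exact: half_cos_surj.
pose z k : R := s2val (ch' k).
have z01 k : 0 <= z k <= 1 by exact: s2valP (ch' k).
have zt k : half_cos (z k) = t k by exact: s2valP' (ch' k).
have [s Hs] := bernstein_trig_sum n (h \o z).
exists s => x x01; rewrite Hs.
set y := half_cos x; have y01 : 0 <= y <= 1 by exact: half_cos_itv.
have tk k : (t k - y) ^+ 2 <= n%:R ^- 2 * (k%:R - n%:R * y) ^+ 2.
  have -> : n%:R ^- 2 * (k%:R - n%:R * y) ^+ 2 = (k%:R / n%:R - y) ^+ 2.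
    rewrite -exprVn -exprMn mulrBr; congr (_ ^+ 2); rewrite mulrA mulVf ?gt_eqF// mul1r mulrC//.
  rewrite /t minEle; case: ifPn => // /negbTE h1.
  have {}h1 : 1 < k%:R / n%:R :> R by rewrite ltNge h1.
  by case/andP: y01 => ? ?; apply: lerXn2r; rewrite ?nnegrE; lra.
have bd k : `|h x - h (z k)| <= e / 2 + (C * n%:R ^- 2) * (k%:R - n%:R * y) ^+ 2.
  apply: le_trans (mod x (z k) x01 (z01 k)) _; rewrite lerD2l zt -mulrA.
  apply: ler_wpM2l => //; apply: le_trans (tk k); rewrite -/y !expr2; lra.
have B : bernstein n (fun k => e / 2 + (C * n%:R ^- 2) * (k%:R - n%:R * y) ^+ 2) y <= e.
  rewrite bernsteinD bernstein_cst bernsteinZ bernstein_sqr subrr expr0n/= addr0.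
  have -> : C * n%:R ^- 2 * (n%:R * (y * (1 - y))) = C / n%:R * (n%:R / n%:R) * (y * (1 - y)).
    by rewrite -exprVn expr2; lra.
  rewrite divff ?gt_eqF// mulr1.
  have : C / n%:R * (y * (1 - y)) <= e * 2^-1.
    case/andP: y01 => ? ?; apply: ler_pM => //; [exact: divr_ge0|by rewrite mulr_ge0// subr_ge0|].
    by have := sqr_ge0 (1 - y *+ 2); clear; rewrite expr2 mulr2n; lra.
  by lra.
rewrite ler_norml; apply/andP; split.
  rewrite -subr_ge0 opprK.
  have := bernstein_le n y01 (phi := h \o z) (psi := fun k => h x + (e / 2 + (C * n%:R ^- 2) * (k%:R - n%:R * y) ^+ 2)).
  rewrite (bernsteinD n (fun=> h x)) bernstein_cst => H.
  have {}H := H (fun k => ltac:(have := bd k; rewrite ler_norml => /andP[] /=; clear; lra)).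
  by move: H B; move: (bernstein _ _ _) (bernstein _ _ _) (h x); clear; move=> ? ? ?; lra.
have := bernstein_le n y01 (phi := fun=> h x) (psi := fun k => h (z k) + (e / 2 + (C * n%:R ^- 2) * (k%:R - n%:R * y) ^+ 2)).
rewrite (bernsteinD n (fun k => h (z k))) bernstein_cst => H.
have {}H := H (fun k => ltac:(have := bd k; rewrite ler_norml => /andP[] /=; clear; lra)).
by move: H B; rewrite /comp; move: (bernstein _ _ _) (bernstein _ _ _) (h x); clear; move=> ? ? ?; lra.
Qed.
End CosineWeierstrass.

Section SquareIntegrable.
Variable R : realType.
Notation mu := (@lebesgue_measure R).
Notation I01 := (`[0%R, 1%R]%classic : set R).
Implicit Types (f g h : R -> R).

Lemma sqi_within_continuous f : {within I01, continuous f} -> square_integrable f.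
Proof.
move=> cf; split; first exact: measurable_ig (ig_continuous cf).
apply: ig_continuous; rewrite (_ : (fun x => f x ^+ 2) = fun x => f x * f x); first exact: within_continuousM.
by apply/funext => x; rewrite expr2.
Qed.

Lemma ig_sqiM f g : square_integrable f -> square_integrable g -> ig I01 (fun x => f x * g x).
Proof.
move=> [mf if2] [mg ig2].
apply: (@ig_le _ _ _ (fun x => f x ^+ 2 + g x ^+ 2)) => //; last exact: igD.
  exact: measurable_funM.
move=> x _; rewrite normrM -[f x ^+ 2]real_normK ?num_real// -[g x ^+ 2]real_normK ?num_real//.
move: `|f x| `|g x| => a b; have := sqr_ge0 (a - b); have := sqr_ge0 (a + b).
by rewrite !expr2; lra.
Qed.

Lemma sqiZ c f : square_integrable f -> square_integrable (fun x => c * f x).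
Proof.
move=> [mf if2]; split; first by apply: measurable_funM => //; exact: measurable_cst.
by apply: ig_ext (@igZ _ _ (c ^+ 2) _ _ if2) => // x; rewrite exprMn.
Qed.

Lemma sqiD f g : square_integrable f -> square_integrable g -> square_integrable (fun x => f x + g x).
Proof.
move=> sf sg; have [mf if2] := sf; have [mg ig2] := sg; split; first exact: measurable_funD.
have i := ig_sqiM sf sg.
apply: ig_ext (_ : ig I01 (fun x => (f x ^+ 2 + g x ^+ 2) + 2 * (f x * g x))).
  by move=> x; rewrite !expr2; lra.
by apply: igD => //; [exact: igD|exact: igZ].
Qed.

Lemma sqiB f g : square_integrable f -> square_integrable g -> square_integrable (fun x => f x - g x).
Proof.
move=> sf sg; have := sqiD sf (@sqiZ (-1) _ sg).
by rewrite (_ : (fun x => f x + -1 * g x) = (fun x => f x - g x))//; apply/funext => x; rewrite mulN1r.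
Qed.

Lemma sqi_ig f : square_integrable f -> ig I01 f.
Proof.
move=> sf; have s1 : square_integrable (fun=> 1 : R).
  by apply: sqi_within_continuous; apply: within_continuousT => x; exact: cvg_cst.
by apply: ig_ext (ig_sqiM sf s1) => x; rewrite mulr1.
Qed.

Lemma int01_ge0 f : (forall x, 0 <= f x) -> 0 <= int01 f.
Proof. by move=> f0; apply: Rintegral_ge0. Qed.

Lemma le_int01 f g : ig I01 f -> ig I01 g -> (forall x, 0 <= x <= 1 -> f x <= g x) -> int01 f <= int01 g.
Proof. by move=> h1 h2 H; apply: le_Rintegral => // x /=; rewrite in_itv; exact: H. Qed.

Lemma int01_cst c : int01 (fun=> c) = c :> R.
Proof. by rewrite /int01 Rintegral_cst//= lebesgue_measure_itv/= lte_fin ltr01 -EFinB subr0 mulr1. Qed.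

Lemma int01_sqB_le f g h : square_integrable f -> square_integrable g -> square_integrable h ->
  int01 (fun x => (f x - h x) ^+ 2) <=
  2 * int01 (fun x => (f x - g x) ^+ 2) + 2 * int01 (fun x => (g x - h x) ^+ 2).
Proof.
move=> sf sg sh; have [_ i1] := sqiB sf sh; have [_ i2] := sqiB sf sg; have [_ i3] := sqiB sg sh.
rewrite -!int01Z// -int01D; [|exact: igZ|exact: igZ].
apply: le_int01 => //; first by apply: igD => //; exact: igZ.
move=> x _; have := sqr_ge0 ((f x - g x) - (g x - h x)); move: (f x) (g x) (h x) => a b c.
by clear; rewrite !expr2; lra.
Qed.

Lemma int01_dct0 (F : nat -> R -> R) (G : R -> R) :
  (forall n, measurable_fun (I01 : set (measurableTypeR R)) (F n)) ->
  (forall x, 0 < x < 1 -> F n x @[n --> \oo] --> 0) -> ig I01 G ->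
  (forall n x, 0 <= x <= 1 -> `|F n x| <= G x) ->
  int01 (F n) @[n --> \oo] --> 0.
Proof.
move=> mF F0 iG FG.
have sub : `]0%R, 1%R[%classic `<=` I01 by move=> x /=; exact: subset_itv_oo_cc.
have mF' n : measurable_fun (`]0%R, 1%R[%classic : set (measurableTypeR R)) (fun x => (F n x)%:E).
  by apply/measurable_EFinP; apply: measurable_funS (mF n).
have iG' : ig `]0%R, 1%R[ G by apply: ig_sub iG.
have aF0 : {ae mu, forall x, (`]0%R, 1%R[%classic : set (measurableTypeR R)) x ->
    (fun n => (F n x)%:E) @ \oo --> 0%E}.
  apply: aeW => x /=; rewrite in_itv/= => x01.
  by apply: cvg_EFin; [exact: nearW|exact: F0].
have aFG : {ae mu, forall x n, (`]0%R, 1%R[%classic : set (measurableTypeR R)) x ->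
    (`|(F n x)%:E| <= (G x)%:E)%E}.
  apply: aeW => x n /=; rewrite in_itv/= => /andP[x0 x1]; rewrite lee_fin.
  by apply: FG; rewrite !ltW.
have [_ _ ] := @dominated_convergence _ _ R mu _ (measurable_itv _) _ _ _ mF' (measurable_cst _) aF0 iG' aFG.
rewrite integral0 => H.
have e n : int01 (F n) = fine (\int[mu]_(x in `]0%R, 1%R[) (F n x)%:E)%E.
  by rewrite /int01 /Rintegral (integral_itv_bndoo true false (mF' n)).
under eq_fun do rewrite e.
exact: (fine_cvg H).
Qed.

(** Truncation to [[- M, M]] for [M >= 0]. Absolute values make continuity immediate and reduce the
    contraction estimates to sign cases. *)
Definition clip (M x : R) : R := (`|x + M| - `|x - M|) / 2.

Lemma clip_norm_le M x : 0 <= M -> `|clip M x| <= M.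
Proof.
move=> M0; rewrite /clip ler_norml.
by case: (ger0P (x + M)) => h1; case: (ger0P (x - M)) => h2; apply/andP; split; lra.
Qed.

Lemma clip_id M x : `|x| <= M -> clip M x = x.
Proof.
rewrite ler_norml => /andP[h1 h2]; rewrite /clip ger0_norm; last by lra.
by rewrite ler0_norm; lra.
Qed.

Lemma clip_dist M x y : 0 <= M -> `|clip M x - clip M y| <= `|x - y|.
Proof.
move=> M0; wlog xy : x y / x <= y => [H|].
  by case: (leP x y) => [|/ltW]; [exact: H|move=> h; rewrite distrC [leRHS]distrC; exact: H].
rewrite [leRHS]distrC [leRHS]ger0_norm ?subr_ge0// /clip ler_norml.
case: (ger0P (x + M)) => h1; case: (ger0P (x - M)) => h2;
case: (ger0P (y + M)) => h3; case: (ger0P (y - M)) => h4; by apply/andP; split; lra.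
Qed.

Lemma clip_residual_le M x : 0 <= M -> `|x - clip M x| <= `|x|.
Proof.
move=> M0; rewrite /clip ler_norml.
case: (ger0P (x + M)) => h1; case: (ger0P (x - M)) => h2; case: (ger0P x) => h3; by apply/andP; split; lra.
Qed.

Lemma continuous_clip M : continuous (clip M).
Proof.
move=> x; apply: cvgM; last exact: cvg_cst.
apply: cvgB; apply: cvg_norm.
  by apply: cvgD; [exact: cvg_id|exact: cvg_cst].
by apply: cvgB; [exact: cvg_id|exact: cvg_cst].
Qed.

Lemma measurable_clip M f : measurable_fun (I01 : set (measurableTypeR R)) f ->
  measurable_fun (I01 : set (measurableTypeR R)) (fun x => clip M (f x)).
Proof.
move=> mf; apply: (@measurableT_comp _ _ _ _ _ _ (clip M)) => //.
by apply: continuous_measurable_fun; exact: continuous_clip.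
Qed.

Lemma sqi_approx_clip g e : square_integrable g -> 0 < e -> exists n : nat,
  int01 (fun x => (g x - clip n%:R (g x)) ^+ 2) <= e.
Proof.
move=> [mg ig2] e0.
have H : int01 (fun x => (g x - clip n%:R (g x)) ^+ 2) @[n --> \oo] --> 0.
  apply: int01_dct0 ig2 _ => [n|x _|n x _].
  - by apply: measurable_funX; apply: measurable_funB => //; exact: measurable_clip.
  - apply: cvg_near_cst; exists (Num.bound `|g x|) => // n /= hn.
    rewrite clip_id ?subrr ?expr0n//; apply: ltW; apply: lt_le_trans (archi_boundP _) _ => //.
    by rewrite ler_nat.
  - rewrite normrX -[g x ^+ 2]real_normK ?num_real//.
    by apply: lerXn2r; rewrite ?nnegrE// clip_residual_le.
have /cvgrPdist_le /(_ e e0) [n _ Hn] := H.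
exists n; have := Hn n (leqnn n); rewrite sub0r normrN; exact: le_trans (ler_norm _).
Qed.

(** Continuous functions are dense in the integrable ones; clipping the approximant at [M] gives
    [(g - h) ^ 2 <= 2 * M * |g - u n|], so convergence in mean yields mean-square convergence. *)
Lemma sqi_bounded_approx g M e : measurable_fun (I01 : set (measurableTypeR R)) g ->
  0 < M -> (forall x, `|g x| <= M) -> 0 < e ->
  exists h, [/\ continuous h, forall x, `|h x| <= M &
    int01 (fun x => (g x - h x) ^+ 2) <= e].
Proof.
move=> mg M0 gM e0.
have ig1 : ig I01 g.
  apply: (@ig_le _ _ _ (fun=> M)) => //; apply: ig_continuousT => x; exact: cvg_cst.
have muI : (mu I01 < +oo)%E by rewrite /= lebesgue_measure_itv/= lte_fin ltr01 -EFinB ltry.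
have [u [cu iu ucv]] := approximation_continuous_integrable (measurable_itv _) muI ig1.
have q0 : 0 < e / (2 * M) by rewrite divr_gt0// mulr_gt0.
have e0' : ((0 : R)%:E < (e / (2 * M))%:E)%E by rewrite lte_fin.
have [n Hn] : exists n, (\int[mu]_(z in I01) `|(g z - u n z)%:E| < (e / (2 * M))%:E)%E.
  have : \forall n \near \oo, (\int[mu]_(z in I01) `|(g z - u n z)%:E| < (e / (2 * M))%:E)%E.
    exact: (ucv [set y | (y < (e / (2 * M))%:E)%E] (open_nbhs_nbhs (conj (@open_ereal_lt_ereal _ _) e0'))).
  by move=> [n _ Hn]; exists n; exact: (Hn n (leqnn n)).
exists (fun x => clip M (u n x)); split.
- by move=> x; apply: continuous_comp; [exact: cu|exact: continuous_clip].
- by move=> x; apply: clip_norm_le; exact: ltW.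
have ch : continuous (fun x => clip M (u n x)).
  by move=> x; apply: continuous_comp; [exact: cu|exact: continuous_clip].
have id : ig I01 (fun x => g x - u n x) by apply: igB => //; exact: iu.
have idn := integrable_norm id.
have h1 : int01 (fun x => `|g x - u n x|) <= e / (2 * M).
  rewrite /int01 /Rintegral -lee_fin fineK; first exact: ltW.
  exact: integrable_fin_num idn.
apply: (@le_trans _ _ (2 * M * int01 (fun x => `|g x - u n x|))); last first.
  by rewrite mulrC -ler_pdivlMr// mulr_gt0.
rewrite -int01Z//; apply: le_int01; last 1 first.
- move=> x _; rewrite -real_normK ?num_real// expr2; apply: ler_pM => //.
    apply: le_trans (ler_normB _ _) _; have := gM x; have := @clip_norm_le M (u n x) (ltW M0).
    by clear; lra.
  by rewrite -[X in `|X - _|](@clip_id M (g x))//; apply: clip_dist; exact: ltW.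
- apply: (@ig_le _ _ _ (fun=> (2 * M) ^+ 2)) => //.
  + by apply: measurable_funX; apply: measurable_funB => //; apply: measurable_funTS; exact: continuous_measurable_fun.
  + move=> x _; rewrite normrX; apply: lerXn2r; rewrite ?nnegrE//; first by rewrite mulr_ge0// ltW.
    apply: le_trans (ler_normB _ _) _; have := gM x; have := @clip_norm_le M (u n x) (ltW M0).
    by clear; lra.
  + by apply: ig_continuousT => x; exact: cvg_cst.
- exact: igZ.
Qed.

(** The cutoff function is a continuous function times [sin (pi * x)], which prepares the expansion
    into sines. As [d] tends to 0 the factor tends to 1 inside the interval, and dominated
    convergence applies. *)
Lemma sine_cutoff_approx h M e : continuous h -> 0 <= M -> (forall x, `|h x| <= M) -> 0 < e ->
  exists2 d : R, 0 < d & int01 (fun x => (h x - h x * sin (pi * x) ^+ 2 / (sin (pi * x) ^+ 2 + d)) ^+ 2) <= e.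
Proof.
move=> ch M0 hM e0.
pose F (n : nat) x : R := (h x - h x * sin (pi * x) ^+ 2 / (sin (pi * x) ^+ 2 + n.+1%:R^-1)) ^+ 2.
have s0 x : 0 <= sin (pi * x) ^+ 2 :> R by exact: sqr_ge0.
have d0 n : 0 < n.+1%:R^-1 :> R by rewrite invr_gt0.
have sd n x : 0 < sin (pi * x) ^+ 2 + n.+1%:R^-1 :> R by apply: ltr_wpDl.
have FE n x : F n x = (h x * (n.+1%:R^-1 / (sin (pi * x) ^+ 2 + n.+1%:R^-1))) ^+ 2.
  rewrite /F; congr (_ ^+ 2); have := sd n x; move: (sin _ ^+ 2) (n.+1%:R^-1) (h x) => a b c ab.
  have ab0 : a + b != 0 by rewrite gt_eqF.
  have {1}-> : c = c * ((a + b) / (a + b)) by rewrite divff ?mulr1.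
  lra.
have cs : continuous (fun x : R => sin (pi * x) ^+ 2).
  by move=> x; apply: cvgM; exact: continuous_sin_scale.
have cF n : continuous (F n).
  move=> x; rewrite (_ : F n = fun x => (h x * (n.+1%:R^-1 / (sin (pi * x) ^+ 2 + n.+1%:R^-1))) * (h x * (n.+1%:R^-1 / (sin (pi * x) ^+ 2 + n.+1%:R^-1)))); last first.
    by apply/funext => y; rewrite FE expr2.
  have c1 : {for x, continuous (fun x : R => h x * (n.+1%:R^-1 / (sin (pi * x) ^+ 2 + n.+1%:R^-1)))}.
    apply: cvgM; first exact: ch.
    apply: cvgM; first exact: cvg_cst.
    apply: cvgV; first by rewrite gt_eqF.
    by apply: cvgD; [exact: cs|exact: cvg_cst].
  exact: cvgM.
have H : int01 (F n) @[n --> \oo] --> 0.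
  apply: (@int01_dct0 F (fun=> M ^+ 2)) => [n|x /andP[x0 x1]||n x _].
  - by apply: measurable_funTS; exact: continuous_measurable_fun.
  - have sx : 0 < sin (pi * x) ^+ 2 :> R.
      rewrite exprn_gt0//; apply: sin_gt0_pi; have := @pi_gt0 R => p0.
      by rewrite mulr_gt0//= gtr_pMr.
    rewrite (_ : (fun n => F n x) = (fun n => (h x * (n.+1%:R^-1 / (sin (pi * x) ^+ 2 + n.+1%:R^-1))) * (h x * (n.+1%:R^-1 / (sin (pi * x) ^+ 2 + n.+1%:R^-1))))); last first.
      by apply/funext => n; rewrite FE expr2.
    have c1 : h x * (n.+1%:R^-1 / (sin (pi * x) ^+ 2 + n.+1%:R^-1)) @[n --> \oo] --> h x * (0 / (sin (pi * x) ^+ 2 + 0)).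
      apply: cvgM; first exact: cvg_cst.
      apply: cvgM; first exact: cvg_harmonic.
      apply: cvgV; first by rewrite addr0 gt_eqF.
      by apply: cvgD; [exact: cvg_cst|exact: cvg_harmonic].
    have e1 : h x * (0 / (sin (pi * x) ^+ 2 + 0)) = 0 by rewrite mul0r mulr0.
    have e2 : (h x * (0 / (sin (pi * x) ^+ 2 + 0))) * (h x * (0 / (sin (pi * x) ^+ 2 + 0))) = 0 by rewrite e1 mulr0.
    have c2 := cvgM c1 c1.
    rewrite e2 in c2.
    exact: c2.
  - by apply: ig_continuousT => x; exact: cvg_cst.
  - rewrite FE normrX; apply: lerXn2r; rewrite ?nnegrE// normrM -[leRHS]mulr1.
    apply: ler_pM => //; rewrite ger0_norm; last by rewrite divr_ge0// ltW.
    by rewrite ler_pdivrMr// mul1r lerDr.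
have /cvgrPdist_le /(_ e e0) [n _ Hn] := H.
exists n.+1%:R^-1 => //; have := Hn n (leqnn n); rewrite sub0r normrN; exact: le_trans (ler_norm _).
Qed.

(** Clip, replace by a continuous function, cut off to [q x * sin (pi * x)], approximate [q] by a
    cosine polynomial: its product with the sine is a sine polynomial. *)
Lemma sqi_sine_approx g e : square_integrable g -> 0 < e -> exists N c,
  int01 (fun x => (g x - trigp N true c x) ^+ 2) <= e.
Proof.
(* Three uses of [int01_sqB_le] weight the four errors by 2, 4, 8 and 8; the sum 22 is below 40. *)
move=> sg e0; have e20 : 0 < e / 40 by rewrite divr_gt0.
have [n Hn] := sqi_approx_clip sg e20.
pose g1 x := clip n%:R (g x); pose M : R := n%:R + 1.
have M0 : 0 < M by rewrite /M; have := ler0n R n; lra.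
have mg1 : measurable_fun (I01 : set (measurableTypeR R)) g1 by apply: measurable_clip; case: sg.
have g1M x : `|g1 x| <= M.
  by apply: le_trans (clip_norm_le _ _) _ => //; rewrite /M; lra.
have [h [ch hM Hh]] := sqi_bounded_approx mg1 M0 g1M e20.
have [d d0 Hd] := sine_cutoff_approx ch (ltW M0) hM e20.
pose q x := h x * sin (pi * x) / (sin (pi * x) ^+ 2 + d).
have s0 x : 0 <= sin (pi * x) ^+ 2 :> R by exact: sqr_ge0.
have sd x : 0 < sin (pi * x) ^+ 2 + d by have := s0 x; lra.
have cs : continuous (fun x : R => sin (pi * x)) by exact: continuous_sin_scale.
have cq : continuous q.
  move=> x; apply: cvgM; first by apply: cvgM; [exact: ch|exact: cs].
  apply: cvgV; first by rewrite gt_eqF.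
  by apply: cvgD; [apply: cvgM; exact: cs|exact: cvg_cst].
pose t : R := Num.min 1 (e / 40).
have t0 : 0 < t by rewrite lt_min ltr01.
have tt : t ^+ 2 <= e / 40.
  apply: le_trans (_ : t <= _); last by rewrite /t ge_min lexx orbT.
  by rewrite expr2 ler_piMr ?(ltW t0)// /t ge_min lexx.
have [s Hs] := cos_weierstrass (continuous_subspaceT cq) t0.
have [s' Hs'] := trig_sum_mul_sin s.
have [N [c Hc]] := trig_sumP true s'.
exists N, c.
pose h2 x := h x * sin (pi * x) ^+ 2 / (sin (pi * x) ^+ 2 + d).
have S1 : square_integrable g1.
  split => //; apply: (@ig_le _ _ _ (fun=> M ^+ 2)) => //.
  - exact: measurable_funX.
  - by move=> x _; rewrite normrX; apply: lerXn2r; rewrite ?nnegrE// ltW.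
  - by apply: ig_continuousT => x; exact: cvg_cst.
have Sh : square_integrable h by apply: sqi_within_continuous; exact: within_continuousT.
have Sh2 : square_integrable h2.
  apply: sqi_within_continuous; apply: within_continuousT => x.
  apply: cvgM; first by apply: cvgM; [exact: ch|apply: cvgM; exact: cs].
  apply: cvgV; first by rewrite gt_eqF.
  by apply: cvgD; [apply: cvgM; exact: cs|exact: cvg_cst].
have St : square_integrable (trigp N true c).
  by apply: sqi_within_continuous; apply: within_continuousT; exact: continuous_trigp.
have H4 : int01 (fun x => (h2 x - trigp N true c x) ^+ 2) <= e / 40.
  apply: le_trans tt; rewrite -(int01_cst (t ^+ 2)); apply: le_int01.
  - by have [] := sqiB Sh2 St.
  - by apply: ig_continuousT => x; exact: cvg_cst.
  move=> x x01; rewrite -Hc Hs'.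
  have -> : h2 x - trig_sum false s x * sin (pi * x) = (q x - trig_sum false s x) * sin (pi * x).
    by rewrite /h2 /q; lra.
  rewrite exprMn -[leRHS]mulr1; apply: ler_pM; [exact: sqr_ge0|exact: sqr_ge0| |].
    by rewrite -real_normK ?num_real//; apply: lerXn2r; rewrite ?nnegrE ?(ltW t0)// Hs.
  by rewrite sin2cos2 lerBlDr lerDl sqr_ge0.
have A1 := int01_sqB_le sg S1 St; have A2 := int01_sqB_le S1 Sh St; have A3 := int01_sqB_le Sh Sh2 St.
apply: le_trans A1 _.
move: Hn Hh Hd H4 A2 A3; rewrite -/(g1 _) => Hn Hh Hd H4 A2 A3.
have {}Hn : int01 (fun x => (g x - g1 x) ^+ 2) <= e / 40 by exact: Hn.
have {}Hd : int01 (fun x => (h x - h2 x) ^+ 2) <= e / 40 by exact: Hd.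
move: Hn Hh Hd H4 A2 A3 e0.
move: (int01 (fun x => (g x - g1 x) ^+ 2)) (int01 (fun x => (g1 x - h x) ^+ 2))
  (int01 (fun x => (h x - h2 x) ^+ 2)) (int01 (fun x => (h2 x - trigp N true c x) ^+ 2))
  (int01 (fun x => (g1 x - trigp N true c x) ^+ 2)) (int01 (fun x => (h x - trigp N true c x) ^+ 2)).
by clear; move=> *; lra.
Qed.
End SquareIntegrable.

(** * Density of cosine polynomials in the first-order space *)

Section FirstOrder.
Variable R : realType.
Notation mu := (@lebesgue_measure R).
Notation I01 := (`[0%R, 1%R]%classic : set R).
Implicit Types (f g h psi : R -> R) (c : nat -> R).

Lemma test_function_continuous psi : test_function psi ->
  [/\ forall x : R, is_derive x 1 psi (derive1 psi x), continuous psi, continuous (derive1 psi),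
      psi 0 = 0 & psi 1 = 0].
Proof.
move=> [dpsi [a [b [a0 b1 psi0]]]].
have cn n : continuous (derive1n n psi).
  by move=> x; apply: differentiable_continuous; apply/derivable1_diffP; exact: dpsi.
split.
- by move=> x; rewrite derive1E; apply: DeriveDef => //; exact: (dpsi 0%N).
- exact: (cn 0%N).
- exact: (cn 1%N).
- by apply: psi0 => /andP[h _]; lra.
- by apply: psi0 => /andP[_ h]; lra.
Qed.

Lemma weak_derivative_C1 f g : (forall x : R, is_derive x 1 f (g x)) -> continuous g ->
  is_weak_derivative f g.
Proof.
move=> fg cg psi tpsi; have [dpsi cpsi cdpsi psi0 psi1] := test_function_continuous tpsi.
have cf : continuous f.
  by move=> x; apply: differentiable_continuous; apply/derivable1_diffP; have := fg x => ?; exact: ex_derive.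
have lr (u : R -> R) : (forall x, derivable u x 1) -> continuous u -> derivable_oo_LRcontinuous u 0 1.
  move=> du cu; split=> [x _||]; [exact: du|apply: cvg_at_right_filter; exact: cu|apply: cvg_at_left_filter; exact: cu].
rewrite /int01 (@Rintegration_by_parts R f psi g (derive1 psi) 0 1)//.
- by rewrite psi0 psi1 !mulr0 subrr sub0r.
- exact: within_continuousT.
- by apply: lr cf => x; have h := fg x; exact: (@ex_derive _ _ _ _ _ _ _ h).
- by move=> x _; rewrite derive1E; have := fg x => ?; rewrite derive_val.
- exact: within_continuousT.
- by apply: lr cpsi => x; have h := dpsi x; exact: (@ex_derive _ _ _ _ _ _ _ h).
Qed.

Lemma within_continuousB f g : {within I01, continuous f} -> {within I01, continuous g} ->
  {within I01, continuous (fun x => f x - g x)}.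
Proof. by move=> cf cg x; apply: cvgB; [exact: cf|exact: cg]. Qed.

Lemma weak_derivativeB f f' g g' : {within I01, continuous f} -> {within I01, continuous g} ->
  ig I01 f' -> ig I01 g' -> is_weak_derivative f f' -> is_weak_derivative g g' ->
  is_weak_derivative (fun x => f x - g x) (fun x => f' x - g' x).
Proof.
move=> cf cg if' ig' wf wg psi tpsi.
have [dpsi cpsi cdpsi psi0 psi1] := test_function_continuous tpsi.
have ic h : {within I01, continuous h} -> ig I01 (fun x => h x * derive1 psi x).
  by move=> ch; apply: ig_continuous; apply: within_continuousM => //; exact: within_continuousT.
have [M M0 psiM] : exists2 M, 0 <= M & forall x, 0 <= x <= 1 -> `|psi x| <= M.
  exact: within_continuous_bounded (within_continuousT cpsi).
have iw h : ig I01 h -> ig I01 (fun x => h x * psi x).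
  move=> ih; apply: (@ig_le _ _ _ (fun x => M * `|h x|)) => //.
  - apply: measurable_funM; first exact: measurable_ig.
    by apply: measurable_funTS; exact: continuous_measurable_fun.
  - by move=> x; rewrite /= in_itv => x01; rewrite normrM mulrC ler_wpM2r// psiM.
  - by apply: igZ => //; exact: (integrable_norm ih).
have -> : (fun x => (f x - g x) * derive1 psi x) = fun x => f x * derive1 psi x - g x * derive1 psi x.
  by apply/funext => x; rewrite mulrBl.
have -> : (fun x => (f' x - g' x) * psi x) = fun x => f' x * psi x - g' x * psi x.
  by apply/funext => x; rewrite mulrBl.
rewrite int01B; [|exact: ic|exact: ic].
by rewrite int01B; [rewrite (wf _ tpsi) (wg _ tpsi); lra|exact: iw|exact: iw].
Qed.

Definition cos_primitive (K : R) c (k : nat) : R :=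
  if k == 0%N then K else - (c k / (cos_scale R k * (k%:R * pi))).

Lemma derive1_cos_primitive N K c : derive1 (cosp N (cos_primitive K c)) = trigp N true c.
Proof.
rewrite derive1_cosp; apply/funext => x; apply: eq_bigr => -[|k] _.
  by rewrite /trig !mul0r sin0 !mulr0.
rewrite /dcoef /cos_primitive /=; congr (_ * _).
have nz : cos_scale R k.+1 * (k.+1%:R * pi) != 0.
  rewrite !mulf_neq0// ?pnatr_eq0//; last by rewrite gt_eqF// pi_gt0.
  by rewrite /cos_scale /= gt_eqF// sqrtr_gt0.
by rewrite -mulrA mulNr opprK divfK.
Qed.

Lemma cosp_cos_primitive N K c x :
  cosp N.+1 (cos_primitive K c) x = K + cosp N.+1 (cos_primitive 0 c) x.
Proof.
rewrite /cosp !big_cons /= /cos_primitive /= /cos_basis /= mulr1 mul0r add0r; congr (_ + _).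
by rewrite big_seq [RHS]big_seq; apply: eq_bigr => -[|k]; rewrite mem_iota.
Qed.

Lemma sqi_trigp N s c : square_integrable (trigp N s c).
Proof. by apply: sqi_within_continuous; apply: within_continuousT; exact: continuous_trigp. Qed.

(** Approximate the weak derivative by a sine polynomial in mean square and integrate termwise. The
    difference from [f] has a weak derivative small in mean, hence small oscillation by
    [weak_derivative_dist_le]. *)
Lemma weak_cos_approx f f' e : {within I01, continuous f} -> square_integrable f' -> is_weak_derivative f f' ->
  0 < e -> exists N c, (forall x, 0 <= x <= 1 -> `|cosp N c x - f x| <= e) /\
    int01 (fun x => (derive1 (cosp N c) x - f' x) ^+ 2) <= e ^+ 2.
Proof.
move=> cf sf wf e0; have e20 : 0 < e ^+ 2 by rewrite exprn_gt0.
(* The successor makes room for the constant term of the primitive. *)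
have [N [c Hc]] : exists N c, int01 (fun x => (f' x - trigp N.+1 true c x) ^+ 2) <= e ^+ 2.
  have [[|N] [c Hc]] := sqi_sine_approx sf e20; last by exists N, c.
  exists 0%N, c; apply: le_trans Hc; rewrite le_eqVlt; apply/orP; left; apply/eqP; congr int01; apply/funext => x.
  by rewrite /trigp /= big_nil big_seq1 /trig !mul0r sin0 mulr0.
pose P := cosp N.+1 (cos_primitive 0 c); pose S := trigp N.+1 true c.
have cP : continuous P by exact: continuous_cosp.
have dP : derive1 P = S by exact: derive1_cos_primitive.
have wP : is_weak_derivative P S.
  apply: weak_derivative_C1; last exact: continuous_trigp.
  by move=> x; have := is_derive_cosp N.+1 (cos_primitive 0 c) x; rewrite -derive1_cosp derive1_cos_primitive.
have sS : square_integrable S by exact: sqi_trigp.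
have sr := sqiB sf sS.
have wh := weak_derivativeB cf (within_continuousT cP) (sqi_ig sf) (sqi_ig sS) wf wP.
have ch := within_continuousB cf (within_continuousT cP).
have D := weak_derivative_dist_le ch (sqi_ig sr) wh.
have L1 : int01 (fun x => `|f' x - S x|) <= e.
  have i1 : ig I01 (fun x => `|f' x - S x|) by exact: (integrable_norm (sqi_ig sr)).
  have [_ i2] := sr.
  have i3 : ig I01 (fun=> (2 * e)^-1 * e ^+ 2) by apply: ig_continuousT => x; exact: cvg_cst.
  have i4 := @igZ _ _ ((2 * e)^-1) _ (measurable_itv _) i2.
  apply: (@le_trans _ _ (int01 (fun x => (2 * e)^-1 * e ^+ 2 + (2 * e)^-1 * (f' x - S x) ^+ 2))).
    apply: le_int01 => //; first exact: igD.
    move=> x _; rewrite -[X in _ + _ * X]real_normK ?num_real//; move: `|_| => r.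
    rewrite -mulrDr ler_pdivlMl ?mulr_gt0//; have := sqr_ge0 (e - r); rewrite !expr2; lra.
  rewrite int01D// int01_cst int01Z//.
  have {}Hc : int01 (fun x => (f' x - S x) ^+ 2) <= e ^+ 2 by exact: Hc.
  have : (2 * e)^-1 * int01 (fun x => (f' x - S x) ^+ 2) <= e / 2.
    rewrite ler_pdivrMl ?mulr_gt0//; apply: le_trans Hc _; rewrite expr2; lra.
  have : (2 * e)^-1 * e ^+ 2 <= e / 2.
    by rewrite ler_pdivrMl ?mulr_gt0// expr2; lra.
  by move: (_ * int01 _) (_ * _) => A B; clear; lra.
(* The additive constant forces agreement with [f] at the midpoint; the error elsewhere is then an
   oscillation. *)
exists N.+1, (cos_primitive (f 2^-1 - P 2^-1) c); split; last first.
  rewrite derive1_cos_primitive; apply: le_trans Hc; rewrite le_eqVlt; apply/orP; left; apply/eqP; congr int01; apply/funext => x.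
  by rewrite -sqrrN opprB.
move=> x x01; rewrite cosp_cos_primitive -/P.
have h : (0 : R) <= (2^-1 : R) <= 1.
  by apply/andP; split; lra.
apply: le_trans L1; apply: le_trans (D _ _ h x01); rewrite le_eqVlt; apply/orP; left; apply/eqP; congr (`|_|).
by lra.
Qed.

End FirstOrder.

Section SobolevCosine.
Variable R : realType.
Notation mu := (@lebesgue_measure R).
Notation I01 := (`[0%R, 1%R]%classic : set R).
Implicit Types (f g u v : R -> R) (alpha gamma e : R).

Lemma normM_le_sqr e (a b : R) : 0 < e -> `|a * b| <= (2 * e)^-1 * a ^+ 2 + e / 2 * b ^+ 2.
Proof.
move=> e0; rewrite normrM -[a ^+ 2]real_normK ?num_real// -[b ^+ 2]real_normK ?num_real//.
move: `|a| `|b| => {}a {}b.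
have -> : e / 2 * b ^+ 2 = (2 * e)^-1 * (e ^+ 2 * b ^+ 2).
  have ee : e * e^-1 = 1 by rewrite divff// gt_eqF.
  rewrite invfM (expr2 e); transitivity (e / 2 * (e * e^-1) * b ^+ 2); first by rewrite ee mulr1.
  by lra.
rewrite -mulrDr ler_pdivlMl ?mulr_gt0//; have := sqr_ge0 (a - e * b); rewrite !expr2; lra.
Qed.

Lemma int01M_dist_le f g u v e : square_integrable f -> square_integrable g -> square_integrable u -> square_integrable v -> 0 < e <= 1 ->
  int01 (fun x => (u x - f x) ^+ 2) <= e ^+ 2 -> int01 (fun x => (v x - g x) ^+ 2) <= e ^+ 2 ->
  `|int01 (fun x => u x * v x) - int01 (fun x => f x * g x)| <=
  e * (2 + int01 (fun x => f x ^+ 2) + int01 (fun x => g x ^+ 2)).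
Proof.
move=> sf sg su sv /andP[e0 e1] Hu Hv.
have [_ i1] := sqiB su sf; have [_ i2] := sqiB sv sg; have [_ i3] := sf; have [_ i4] := sg.
have i5 := igB (measurable_itv _) (ig_sqiM su sv) (ig_sqiM sf sg).
have mI : measurable (I01 : set (measurableTypeR R)) by exact: measurable_itv.
set k := (2 * e)^-1 + 2^-1.
have i6 : ig I01 (fun x => k * ((u x - f x) ^+ 2 + (v x - g x) ^+ 2)) by apply: igZ => //; exact: igD.
have i7 : ig I01 (fun x => e / 2 * (f x ^+ 2 + g x ^+ 2)) by apply: igZ => //; exact: igD.
rewrite -int01B; [|exact: ig_sqiM|exact: ig_sqiM].
apply: le_trans (le_normr_Rintegral _ i5) _ => //.
apply: (@le_trans _ _ (int01 (fun x => k * ((u x - f x) ^+ 2 + (v x - g x) ^+ 2) +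
    e / 2 * (f x ^+ 2 + g x ^+ 2)))).
  apply: le_int01; [exact: (integrable_norm i5)|exact: igD|move=> x _].
  have -> : u x * v x - f x * g x = (u x - f x) * g x + (v x - g x) * f x + (u x - f x) * (v x - g x).
    by lra.
  have h1 := normM_le_sqr (u x - f x) (g x) e0; have h2 := normM_le_sqr (v x - g x) (f x) e0.
  have h3 := normM_le_sqr (u x - f x) (v x - g x) ltr01.
  apply: le_trans (ler_normD _ _) _; apply: le_trans (lerD (ler_normD _ _) (lexx _)) _.
  move: h1 h2 h3; rewrite /k mulr1; move: (2 * e)^-1 `|_| `|_| `|_| => K A B C.
  move: ((u x - f x) ^+ 2) ((v x - g x) ^+ 2) (f x ^+ 2) (g x ^+ 2) => a b c d; clear; lra.
rewrite int01D// !int01Z//; [|exact: igD|exact: igD].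
rewrite !int01D//.
have h1 : k * (int01 (fun x => (u x - f x) ^+ 2) + int01 (fun x => (v x - g x) ^+ 2)) <= 2 * e.
  apply: (@le_trans _ _ (k * (2 * e ^+ 2))).
    by rewrite ler_wpM2l//; [rewrite /k addr_ge0// invr_ge0 mulr_ge0// ltW|move: Hu Hv; clear; lra].
  rewrite /k mulrDl invfM.
  have -> : 2^-1 / e * (2 * e ^+ 2) = e.
    have ee : e * e^-1 = 1 by rewrite divff// gt_eqF.
    by rewrite expr2; transitivity (e * (e * e^-1)); [lra|rewrite ee mulr1].
  have : e ^+ 2 <= e by rewrite expr2 ler_piMr// ltW.
  by lra.
have F0 : 0 <= int01 (fun x => f x ^+ 2) by apply: int01_ge0 => x; exact: sqr_ge0.
have G0 : 0 <= int01 (fun x => g x ^+ 2) by apply: int01_ge0 => x; exact: sqr_ge0.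
have : 0 <= e * (int01 (fun x => f x ^+ 2) + int01 (fun x => g x ^+ 2)).
  by rewrite mulr_ge0// ?addr_ge0// ltW.
move: h1; clear; move: (k * (int01 _ + int01 _)) (int01 (fun x => f x ^+ 2)) (int01 (fun x => g x ^+ 2)) => A B C; lra.
Qed.

Lemma weak_derivativeP f : sob1_mem f ->
  square_integrable (weak_derivative f) /\ is_weak_derivative f (weak_derivative f).
Proof. by move=> [_ [f' [s w]]]; rewrite /weak_derivative; case: xgetP => [g _ []//|/(_ f')]; case. Qed.

Lemma sob1_mem_approx f : sob1_mem f -> exists u : nat -> R -> R,
  [/\ forall m, cos_poly (u m), forall m x, 0 <= x <= 1 -> `|u m x - f x| <= m.+1%:R^-1 &
   forall m, int01 (fun x => (derive1 (u m) x - weak_derivative f x) ^+ 2) <= m.+1%:R^-1 ^+ 2].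
Proof.
move=> hf; have [cf _] := hf; have [sf wf] := weak_derivativeP hf.
have H m : {p : R -> R | [/\ cos_poly p, forall x, 0 <= x <= 1 -> `|p x - f x| <= m.+1%:R^-1 &
   int01 (fun x => (derive1 p x - weak_derivative f x) ^+ 2) <= m.+1%:R^-1 ^+ 2]}.
  apply/cid; have e0 : 0 < m.+1%:R^-1 :> R by rewrite invr_gt0.
  have [N [c [h1 h2]]] := weak_cos_approx cf sf wf e0.
  by exists (cosp N c); split => //; apply/cos_polyP; exists N, c.
by exists (fun m => sval (H m)); split=> m; case: (svalP (H m)).
Qed.

Lemma sqi_derive1_cos_poly f : cos_poly f -> square_integrable (derive1 f).
Proof. by move=> /cos_polyP[N [c ->]]; rewrite derive1_cosp; exact: sqi_trigp. Qed.

Lemma ip_h1_cvg gamma f g (u v : nat -> R -> R) : sob1_mem f -> sob1_mem g ->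
  (forall m, cos_poly (u m)) -> (forall m, cos_poly (v m)) ->
  unif_cvg01 u f -> unif_cvg01 v g ->
  (forall m, int01 (fun x => (derive1 (u m) x - weak_derivative f x) ^+ 2) <= m.+1%:R^-1 ^+ 2) ->
  (forall m, int01 (fun x => (derive1 (v m) x - weak_derivative g x) ^+ 2) <= m.+1%:R^-1 ^+ 2) ->
  ip_h1 gamma (u m) (v m) @[m --> \oo] --> ip_eq1 gamma f g.
Proof.
move=> hf hg pu pv uf vg Du Dv.
have [sf _] := weak_derivativeP hf; have [sg _] := weak_derivativeP hg.
have cc p : cos_poly p -> {within I01, continuous p}.
  by move=> pp; apply: within_continuousT; exact: continuous_cos_poly.
apply: cvgD.
  by apply: cvgM; apply: int01_cvg => // m; exact: cc.
apply: cvgM; first exact: cvg_cst.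
set K := 2 + int01 (fun x => weak_derivative f x ^+ 2) + int01 (fun x => weak_derivative g x ^+ 2).
apply/cvgrPdist_le => e e0.
have h : m.+1%:R^-1 * K @[m --> \oo] --> 0 * K by apply: cvgM; [exact: cvg_harmonic|exact: cvg_cst].
rewrite mul0r in h; have /cvgrPdist_le /(_ e e0) [M _ HM] := h.
exists M => // m /= Mm; rewrite distrC.
apply: le_trans (@int01M_dist_le _ _ _ _ m.+1%:R^-1 sf sg _ _ _ (Du m) (Dv m)) _.
- exact: sqi_derive1_cos_poly.
- exact: sqi_derive1_cos_poly.
- by rewrite invr_gt0 ltr0Sn invf_le1// ler1n.
by have := HM m Mm; rewrite sub0r normrN; exact: le_trans (ler_norm _).
Qed.

Lemma ip_h1_sqdist gamma p q : cos_poly p -> cos_poly q ->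
  sqdist (ip_h1 gamma) p q = (int01 p - int01 q) ^+ 2 +
    (gamma ^+ 2)^-1 * int01 (fun x => (derive1 p x - derive1 q x) ^+ 2).
Proof.
move=> hp hq; have sp := sqi_derive1_cos_poly hp; have sq := sqi_derive1_cos_poly hq.
have mI : measurable (I01 : set (measurableTypeR R)) by exact: measurable_itv.
have i1 := ig_sqiM sp sp; have i2 := ig_sqiM sp sq; have i3 := ig_sqiM sq sq.
have i4 := @igZ _ _ 2 _ mI i2.
rewrite (_ : (fun x => (derive1 p x - derive1 q x) ^+ 2) = fun x =>
  (derive1 p x * derive1 p x - 2 * (derive1 p x * derive1 q x)) + derive1 q x * derive1 q x); last first.
  by apply/funext => x; rewrite expr2; lra.
rewrite int01D//; last exact: igB.
rewrite int01B// int01Z// /sqdist /ip_h1.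
move: (int01 _) (int01 _) (int01 _) (int01 _) (int01 _) (_^-1) => *; clear; rewrite expr2; lra.
Qed.

Lemma sob1_mem_represents gamma f : sob1_mem f ->
  exists u : nat -> R -> R, represents I01 (@cos_poly R) id (ip_h1 gamma) u f /\
   forall m, int01 (fun x => (derive1 (u m) x - weak_derivative f x) ^+ 2) <= m.+1%:R^-1 ^+ 2.
Proof.
move=> hf; have [u [pu uf Du]] := sob1_mem_approx hf; exists u; split => //.
have uuf : unif_cvg01 u f.
  move=> e e0; have /cvgrPdist_lt /(_ e e0) [M _ HM] := @cvg_harmonic R.
  exists M => // m /= Mm x; rewrite /= in_itv => x01.
  have := HM m Mm; rewrite sub0r normrN; apply: le_lt_trans; apply: le_trans (uf m x x01) (ler_norm _).
split => // e e0.
have [sf _] := weak_derivativeP hf.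
have /cvgrPdist_le H1 : int01 (u m) @[m --> \oo] --> int01 f.
  by apply: int01_cvg => // m; apply: within_continuousT; exact: continuous_cos_poly.
set G := (gamma ^+ 2)^-1; have G0 : 0 <= G by rewrite invr_ge0 sqr_ge0.
pose t : R := Num.min 1 (e / (8 * (1 + G))).
have G1 : 0 < 8 * (1 + G) by rewrite mulr_gt0// ltr_wpDr.
have t0 : 0 < t by rewrite lt_min ltr01 divr_gt0.
have [M1 _ HM1] := H1 t t0.
have /cvgrPdist_le /(_ t t0) [M2 _ HM2] := @cvg_harmonic R.
exists (maxn M1 M2) => m n; rewrite !geq_max => /andP[m1 m2] /andP[n1 n2].
rewrite ip_h1_sqdist// -/G.
have [i1 i2] : `|int01 f - int01 (u m)| <= t /\ `|int01 f - int01 (u n)| <= t by split; exact: HM1.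
have tt k : (M2 <= k)%N -> int01 (fun x => (derive1 (u k) x - weak_derivative f x) ^+ 2) <= t ^+ 2.
  move=> Mk; apply: le_trans (Du k) _; apply: lerXn2r; rewrite ?nnegrE ?(ltW t0)//.
  by have := HM2 k Mk; rewrite sub0r normrN; exact: le_trans (ler_norm _).
have t2 : t ^+ 2 <= t by rewrite expr2 ler_piMr ?(ltW t0)// /t ge_min lexx.
have te : 8 * (1 + G) * t <= e by rewrite mulrC -ler_pdivlMr// /t ge_min lexx orbT.
have A1 : (int01 (u m) - int01 (u n)) ^+ 2 <= 4 * t ^+ 2.
  rewrite -real_normK ?num_real// (_ : 4 * t ^+ 2 = (2 * t) ^+ 2); last by rewrite !expr2; lra.
  apply: lerXn2r; rewrite ?nnegrE ?mulr_ge0 ?(ltW t0)//.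
  move: i1 i2; move: (int01 f) (int01 (u m)) (int01 (u n)) => a b c; rewrite !ler_norml; clear.
  by move=> /andP[? ?] /andP[? ?]; apply/andP; split; lra.
have A2 := int01_sqB_le (sqi_derive1_cos_poly (pu m)) sf (sqi_derive1_cos_poly (pu n)).
have A3 : int01 (fun x => (weak_derivative f x - derive1 (u n) x) ^+ 2) <= t ^+ 2.
  apply: le_trans (tt n n2); rewrite le_eqVlt; apply/orP; left; apply/eqP; congr int01; apply/funext => x.
  by rewrite -sqrrN opprB.
have A4 := tt m m2.
apply: (@le_lt_trans _ _ (4 * t + G * (4 * t))).
  apply: lerD; first by move: A1 t2; clear; lra.
  by apply: ler_wpM2l => //; move: A2 A3 A4 t2; clear; move: (int01 _) (int01 _) (int01 _) => A B C; lra.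
move: te t0 G0; clear; move=> te t0 G0.
have : 0 <= G * t by rewrite mulr_ge0// ltW.
by lra.
Qed.

(** Brings the three ranges of [alpha] to a common form. At [alpha = 1] the inner products agree
    because [ip_h1] converges to both along the approximants of [sob1_mem_represents]. *)
Lemma sob1_completion alpha gamma : 2^-1 < alpha < 2 -> exists ip,
  [/\ forall N c d, ip (cosp N c) (cosp N d) = dform (sob_weight alpha gamma) N c d,
   fmem (sob1 alpha gamma) `<=` fmem (completion I01 (@cos_poly R) id ip) &
   forall f g, fmem (sob1 alpha gamma) f -> fmem (sob1 alpha gamma) g ->
    fip (sob1 alpha gamma) f g = fip (completion I01 (@cos_poly R) id ip) f g].
Proof.
move=> /andP[a0 a2]; rewrite /sob1; case: ltP => a1.
  by exists (ip_lt1 alpha gamma); split => // N c d; apply: ip_lt1_cosp; rewrite a0.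
case: eqP => [a1'|an1]; last first.
  exists (ip_gt1 alpha gamma); split => // N c d; apply: ip_gt1_cosp.
  by rewrite a2 andbT lt_neqAle a1 andbT eq_sym; apply/eqP.
subst alpha; exists (ip_h1 gamma); split => [N c d||f g hf hg].
- exact: ip_h1_cosp.
- by move=> f /(sob1_mem_represents gamma) [u [ru _]]; exists u.
have [u [ru Du]] := sob1_mem_represents gamma hf; have [v [rv Dv]] := sob1_mem_represents gamma hg.
have w0 k : 0 <= sob_weight 1 gamma k :> R.
  rewrite /sob_weight ltxx eqxx; case: eqP => // _; by rewrite mulr_ge0 ?invr_ge0 ?sqr_ge0.
have h1 := cos_completion_ip_cvg w0 (ip_h1_cosp gamma) ru rv.
have [pu _ uf] := ru; have [pv _ vg] := rv.
have h2 := @ip_h1_cvg gamma f g u v hf hg pu pv uf vg Du Dv.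
exact: cvg_unique h2 h1.
Qed.

End SobolevCosine.

Section SobolevOneDim.
Variable R : realType.
Notation I01 := (`[0%R, 1%R]%classic : set R).
Variables (alpha gamma : R).
Hypothesis alpha_itv : 2^-1 < alpha < 2.
Implicit Types (f g : R -> R).
Notation H := (sob1 alpha gamma).
Notation w := (sob_weight alpha gamma).
Notation W := (wform (iota 0) w).

Lemma sob_weight0 : w 0%N = 1.
Proof. by rewrite /sob_weight eqxx. Qed.

Lemma sob_weight_ge0 k : 0 <= w k.
Proof.
case: k => [|k]; first by rewrite sob_weight0.
apply: le_trans (sob_weight_ge gamma alpha_itv (ltn0Sn k)).
by rewrite mulr_ge0 ?powR_ge0// divr_ge0 ?sqr_ge0// kappa_ge0.
Qed.

Lemma sob1_coef_cvg f g : fmem H f -> fmem H g ->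
  W N (cos_coef f) (cos_coef g) @[N --> \oo] --> fip H f g.
Proof.
have [ip [ipE sub fipE]] := sob1_completion gamma alpha_itv => hf hg.
by rewrite fipE//; apply: (cos_completion_coef_cvg sob_weight_ge0 ipE); exact: sub.
Qed.

Lemma sob1_approx : exists appr : (R -> R) -> nat -> R -> R,
  (forall f, fmem H f -> (forall m, cos_poly (appr f m)) /\ unif_cvg01 (appr f) f) /\
  (forall f g, fmem H f -> fmem H g ->
     limn (fun N => W N (cos_coef (appr f m)) (cos_coef (appr g m))) @[m --> \oo] --> fip H f g).
Proof.
have [ip [ipE sub fipE]] := sob1_completion gamma alpha_itv.
have [appr [h1 h2]] := cos_completion_approx sob_weight_ge0 ipE.
exists appr; split=> [f hf|f g hf hg]; first by apply: h1; exact: sub.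
by rewrite fipE//; apply: h2; exact: sub.
Qed.

Lemma wform_cos_poly_cvgn f g : cos_poly f -> cos_poly g ->
  cvgn (fun N => W N (cos_coef f) (cos_coef g)).
Proof.
have [ip [ipE _ _]] := sob1_completion gamma alpha_itv => hf hg.
by apply/cvg_ex; exists (ip f g); exact: ip_cos_coef.
Qed.

Lemma sob1_continuous f : fmem H f -> {within I01, continuous f}.
Proof.
have [appr [h1 _]] := sob1_approx => hf; have [pu uf] := h1 f hf.
apply: (unif_cvg01_continuous _ uf) => m.
by apply: within_continuousT; exact: continuous_cos_poly.
Qed.

End SobolevOneDim.

(** * Tensor products *)

Section Tensors.
Variable R : realType.
Notation I01 := (`[0%R, 1%R]%classic : set R).

(** The explicit coefficient absorbs the value of the first factor when that variable is fixed, as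
    needed for induction on the dimension. *)
Definition wtensor_eval d (t : seq (R * ('I_d -> R -> R))) (x : 'rV[R]_d) : R :=
  \sum_(a <- t) a.1 * \prod_(j < d) a.2 j (x 0 j).

Definition wtensor_int d (t : seq (R * ('I_d -> R -> R))) : R :=
  \sum_(a <- t) a.1 * \prod_(j < d) int01 (a.2 j).

Definition wtensor_continuous d (t : seq (R * ('I_d -> R -> R))) :=
  forall a, a \in t -> forall j, {within I01, continuous (a.2 j)}.

(** A class of functions on the cube that is stable under fixing a variable, and on which every
    stage of the iterated integral is continuous, hence integrable. *)
Definition tensor_limit d (f : 'rV[R]_d -> R) := forall e : R, 0 < e ->
  exists2 t, wtensor_continuous t & forall x, cube x -> `|f x - wtensor_eval t x| <= e.

Lemma cube_row_mx d (s : R) (x : 'rV[R]_d) : 0 <= s <= 1 -> cube x -> cube (row_mx (s%:M : 'M[R]_1) x).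
Proof.
move=> s01 cx j; case: (split_ordP j) => k ->; rewrite ?row_mxEl ?row_mxEr//.
by rewrite ord1 mxE eqxx.
Qed.

Definition slice d (s : R) (a : R * ('I_d.+1 -> R -> R)) : R * ('I_d -> R -> R) :=
  (a.1 * a.2 ord0 s, fun j => a.2 (lift ord0 j)).

Lemma wtensor_eval_slice d t (s : R) (x : 'rV[R]_d) :
  wtensor_eval t (row_mx (s%:M : 'M[R]_1) x) = wtensor_eval (map (slice s) t) x.
Proof.
rewrite /wtensor_eval big_map; apply: eq_bigr => a _; rewrite big_ord_recl -mulrA /=; congr (_ * (_ * _)).
  congr (a.2 _ _); have -> : ord0 = lshift d (ord0 : 'I_1) by apply/val_inj.
  by rewrite row_mxEl mxE.
apply: eq_bigr => j _; congr (a.2 _ _).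
have -> : lift ord0 j = rshift 1 j by apply/val_inj.
by rewrite row_mxEr.
Qed.

(** Induction on the dimension: integrating out the other variables of [f] yields a uniform limit of
    continuous functions of the first variable. The premise [tensor_limit f] provides approximations
    of every accuracy for this, whereas [t] has the fixed accuracy [e]. *)
Lemma cube_integral_dist_le d (f : 'rV[R]_d -> R) t e : tensor_limit f -> wtensor_continuous t ->
  (forall x, cube x -> `|f x - wtensor_eval t x| <= e) ->
  `|cube_integral f - wtensor_int t| <= e.
Proof.
elim: d f t e => [|d IH] f t e Lf ct fe /=.
  have c0 : @cube R 0 0 by case.
  have := fe _ c0; congr (`|_ - _| <= _); apply: eq_bigr => a _; by rewrite !big_ord0.
pose fs s : 'rV[R]_d -> R := fun x => f (row_mx (s%:M : 'M[R]_1) x).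
have cs u s : wtensor_continuous u -> wtensor_continuous (map (@slice d s) u).
  by move=> cu _ /mapP[a au ->] j; exact: cu.
have Lfs s : 0 <= s <= 1 -> tensor_limit (fs s).
  move=> s01 e' e'0; have [u cu fu] := Lf e' e'0; exists (map (slice s) u); first exact: cs.
  by move=> x cx; rewrite -wtensor_eval_slice; apply: fu; exact: cube_row_mx.
pose G (u : seq (R * ('I_d.+1 -> R -> R))) s := wtensor_int (map (@slice d s) u).
have GE u s : G u s = \sum_(a <- u) (a.1 * \prod_(j < d) int01 (a.2 (lift ord0 j))) * a.2 ord0 s.
  by rewrite /G /wtensor_int big_map; apply: eq_bigr => a _ /=; rewrite mulrAC.
have key u e' : wtensor_continuous u -> (forall x, cube x -> `|f x - wtensor_eval u x| <= e') ->
    forall s, 0 <= s <= 1 -> `|cube_integral (fs s) - G u s| <= e'.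
  move=> cu fu s s01; apply: IH; [exact: Lfs|exact: cs|move=> x cx].
  by rewrite -wtensor_eval_slice; apply: fu; exact: cube_row_mx.
have cG u : wtensor_continuous u -> {within I01, continuous (G u)}.
  move=> cu; rewrite (_ : G u = fun s => \sum_(a <- u) (a.1 * \prod_(j < d) int01 (a.2 (lift ord0 j))) * a.2 ord0 s); last first.
    by apply/funext => s; rewrite GE.
  elim: u cu => [|a u IHu] cu.
    rewrite (_ : (fun s => _) = fun=> 0); last by apply/funext => s; rewrite big_nil.
    by apply: within_continuousT => x; exact: cvg_cst.
  rewrite (_ : (fun s => _) = fun s => (a.1 * \prod_(j < d) int01 (a.2 (lift ord0 j))) * a.2 ord0 s +
    \sum_(a <- u) (a.1 * \prod_(j < d) int01 (a.2 (lift ord0 j))) * a.2 ord0 s); last first.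
    by apply/funext => s; rewrite big_cons.
  apply: within_continuousD; last by apply: IHu => b bu; apply: cu; rewrite inE bu orbT.
  by apply: within_continuousZ; apply: cu; rewrite mem_head.
have cI : {within I01, continuous (fun s => cube_integral (fs s))}.
  apply: within_continuous_unif => e' e'0; have [u cu fu] := Lf e' e'0.
  by exists (G u); [exact: cG|move=> s s01; rewrite distrC; exact: key].
have -> : wtensor_int t = int01 (G t).
  transitivity (int01 (fun s => \sum_(a <- t) (a.1 * \prod_(j < d) int01 (a.2 (lift ord0 j))) * a.2 ord0 s)); last first.
    by congr int01; apply/funext => s; rewrite GE.
  rewrite /wtensor_int; elim: t ct {fe} => [|a t IHt] ct.
    rewrite big_nil (_ : (fun s => _) = fun=> 0); last by apply/funext => s; rewrite big_nil.
    by rewrite /int01 Rintegral_cst// mul0r.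
  have ca : {within I01, continuous (a.2 ord0)} by apply: ct; rewrite mem_head.
  have ct' : wtensor_continuous t by move=> b bu; apply: ct; rewrite inE bu orbT.
  rewrite big_cons IHt//.
  rewrite (_ : (fun s => \sum_(_ <- _ :: _) _) = fun s => (a.1 * \prod_(j < d) int01 (a.2 (lift ord0 j))) * a.2 ord0 s +
    \sum_(a <- t) (a.1 * \prod_(j < d) int01 (a.2 (lift ord0 j))) * a.2 ord0 s); last first.
    by apply/funext => s; rewrite big_cons.
  rewrite int01D.
  - rewrite int01Z; last exact: ig_continuous.
    by rewrite big_ord_recl; congr (_ + _); lra.
  - by apply: igZ => //; exact: ig_continuous.
  - by apply: ig_ext (ig_continuous (cG _ ct')) => s; rewrite GE.
apply: int01_dist_le; [exact: ig_continuous|by apply: ig_continuous; exact: cG|exact: key].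
Qed.

End Tensors.

Section Boxes.
Variables (R : realType) (d : nat).
Implicit Types (F : ('I_d -> nat) -> R).

Definition box (N : nat) : seq ('I_d -> nat) :=
  [seq (fun j => nat_of_ord (k j)) | k : {ffun 'I_d -> 'I_N}].

Lemma big_box F N : \sum_(k <- box N) F k = \sum_(k : {ffun 'I_d -> 'I_N}) F (fun j => k j).
Proof. by rewrite /box /image_mem big_map big_enum. Qed.

Lemma big_box_prod (F : 'I_d -> nat -> R) N :
  \sum_(k <- box N) \prod_(j < d) F j (k j) = \prod_(j < d) \sum_(k <- iota 0 N) F j k.
Proof.
rewrite big_box -(bigA_distr_bigA (fun j (k : 'I_N) => F j k)); apply: eq_bigr => j _.
by rewrite -[in RHS](subn0 N) -/(index_iota 0 N) big_mkord.
Qed.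

Lemma box_mono F : (forall k, 0 <= F k) ->
  forall N, \sum_(k <- box N) F k <= \sum_(k <- box N.+1) F k.
Proof.
move=> F0 N; rewrite !big_box.
pose h (k : {ffun 'I_d -> 'I_N}) : {ffun 'I_d -> 'I_N.+1} := [ffun j => widen_ord (leqnSn N) (k j)].
have hi : injective h.
  move=> k l /ffunP kl; apply/ffunP => j; have := kl j; rewrite !ffunE => /(congr1 val)/= e; exact: val_inj.
have -> : \sum_(k : {ffun 'I_d -> 'I_N}) F (fun j => k j) =
    \sum_(k in h @: [set: {ffun 'I_d -> 'I_N}]%SET) F (fun j => k j).
  rewrite big_imset/=; last by move=> k l _ _; exact: hi.
  apply: eq_big => k; first by rewrite finset.in_setT.
  by move=> _; congr F; apply/funext => j; rewrite ffunE.
rewrite [leRHS](bigID (mem (h @: [set: {ffun 'I_d -> 'I_N}]%SET)))/= lerDl.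
by apply: sumr_ge0 => k _.
Qed.

Lemma box0 k N : (forall j, (k j < N)%N) -> \sum_(l <- box N) (l == k)%:R = 1 :> R.
Proof.
move=> kN; rewrite big_box (bigD1 [ffun j => Ordinal (kN j)])//= big1 ?addr0.
  by rewrite (_ : (_ == k) = true)//; apply/eqP/funext => j; rewrite ffunE.
move=> l lk; case: eqP => // e; case/eqP: lk; apply/ffunP => j; rewrite ffunE; apply/val_inj => /=.
by rewrite -e.
Qed.

End Boxes.

Section TensorCoefficients.
Variables (R : realType) (d : nat) (alpha : R) (gamma : 'I_d -> R).
Hypothesis alpha_itv : 2^-1 < alpha < 2.
Notation I01 := (`[0%R, 1%R]%classic : set R).
Notation H := (fun j => sob1 alpha (gamma j)).
Implicit Types (t u : tensor R d) (k : 'I_d -> nat).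

Definition cos_basis_prod k (x : 'rV[R]_d) : R := \prod_(j < d) cos_basis (k j) (x 0 j).

Definition tensor_coef t k : R := \sum_(a <- t) \prod_(j < d) cos_coef (a j) (k j).

Definition sob_weights k : R := \prod_(j < d) sob_weight alpha (gamma j) (k j).

Definition cube_coef (f : 'rV[R]_d -> R) k : R := cube_integral (fun x => f x * cos_basis_prod k x).

Lemma sob_weights_ge0 k : 0 <= sob_weights k.
Proof. by apply: prodr_ge0 => j _; exact: sob_weight_ge0. Qed.

(** A box is a product of initial segments, so the truncated form factorizes over elementary tensors
    before any limit is taken. *)
Lemma wform_tensor_coef N t u : wform (@box d) sob_weights N (tensor_coef t) (tensor_coef u) =
  \sum_(a <- t) \sum_(b <- u) \prod_(j < d)
    wform (iota 0) (sob_weight alpha (gamma j)) N (cos_coef (a j)) (cos_coef (b j)).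
Proof.
have e a b : \prod_(j < d) wform (iota 0) (sob_weight alpha (gamma j)) N (cos_coef (a j)) (cos_coef (b j)) =
    \sum_(k <- box d N) \prod_(j < d) (sob_weight alpha (gamma j) (k j) * cos_coef (a j) (k j) * cos_coef (b j) (k j)).
  by rewrite (big_box_prod (fun j (k : nat) => sob_weight alpha (gamma j) k * cos_coef (a j) k * cos_coef (b j) k)).
under [RHS]eq_bigr do under eq_bigr do rewrite e.
under [RHS]eq_bigr do rewrite exchange_big.
rewrite exchange_big /wform; apply: eq_bigr => k _.
rewrite /tensor_coef -mulrA big_distrlr mulr_sumr; apply: eq_bigr => a _.
rewrite /= mulr_sumr; apply: eq_bigr => b _; rewrite /sob_weights -!big_split /=.
by apply: eq_bigr => j _; rewrite mulrA.
Qed.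

Lemma cvg_bigprod (I J : Type) (s : seq I) (F : set_system J) {FF : Filter F} (g : I -> J -> R) (l : I -> R) :
  (forall i, g i n @[n --> F] --> l i) -> \prod_(i <- s) g i n @[n --> F] --> \prod_(i <- s) l i.
Proof.
move=> H; elim: s => [|i s IH].
  by under eq_fun do rewrite big_nil; rewrite big_nil; exact: cvg_cst.
by under eq_fun do rewrite big_cons; rewrite big_cons; apply: cvgM.
Qed.

Lemma cvg_bigsum_in (I : eqType) (J : Type) (s : seq I) (F : set_system J) {FF : Filter F} (g : I -> J -> R) (l : I -> R) :
  (forall i, i \in s -> g i n @[n --> F] --> l i) -> \sum_(i <- s) g i n @[n --> F] --> \sum_(i <- s) l i.
Proof.
elim: s => [|i s IH] H.
  by under eq_fun do rewrite big_nil; rewrite big_nil; exact: cvg_cst.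
under eq_fun do rewrite big_cons; rewrite big_cons; apply: cvgD; first by apply: H; rewrite mem_head.
by apply: IH => j js; apply: H; rewrite inE js orbT.
Qed.

Lemma tensor_ip_coef t u : tensor_mem H t -> tensor_mem H u ->
  wform (@box d) sob_weights N (tensor_coef t) (tensor_coef u) @[N --> \oo] --> tensor_ip H t u.
Proof.
move=> ht hu; under eq_fun do rewrite wform_tensor_coef.
apply: cvg_bigsum_in => a ha; apply: cvg_bigsum_in => b hb; apply: cvg_bigprod => j.
by apply: sob1_coef_cvg => //; [exact: ht|exact: hu].
Qed.

Definition tensor_mul (b : 'I_d -> R -> R) t : seq (R * ('I_d -> R -> R)) :=
  [seq (1, fun j x => a j x * b j x) | a <- t].

Lemma tensor_mul_eval b t x :
  wtensor_eval (tensor_mul b t) x = tensor_eval t x * \prod_(j < d) b j (x 0 j).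
Proof.
rewrite /wtensor_eval big_map /tensor_eval mulr_suml; apply: eq_bigr => a _ /=.
by rewrite mul1r -big_split.
Qed.

Lemma tensor_mul_continuous b t : tensor_mem H t -> (forall j, continuous (b j)) ->
  wtensor_continuous (tensor_mul b t).
Proof.
move=> ht cb _ /mapP[a ha ->] j /=; apply: within_continuousM; last exact: within_continuousT.
by apply: (sob1_continuous alpha_itv (gamma := gamma j)); exact: ht.
Qed.

Lemma cos_basis_prod_le k x : `|cos_basis_prod k x| <= 2 ^+ d.
Proof.
rewrite normr_prod -[X in _ ^+ X]card_ord -prodr_const; apply: ler_prod => j _.
by rewrite normr_ge0 cos_basis_le2.
Qed.

Lemma represents_cube_coef (u : nat -> tensor R d) f :
  represents (@cube R d) (tensor_mem H) (@tensor_eval R d) (tensor_ip H) u f ->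
  forall k, tensor_coef (u m) k @[m --> \oo] --> cube_coef f k.
Proof.
move=> [Vu _ uf] k.
pose T m := tensor_mul (fun j => cos_basis (k j)) (u m).
have cT m : wtensor_continuous (T m).
  by apply: tensor_mul_continuous => // j; exact: continuous_cos_basis.
have TE m : wtensor_int (T m) = tensor_coef (u m) k.
  by rewrite /wtensor_int big_map; apply: eq_bigr => a _; rewrite /= mul1r.
have close e : 0 < e -> exists M, forall m, (M <= m)%N -> forall x, cube x ->
    `|f x * cos_basis_prod k x - wtensor_eval (T m) x| <= e.
  move=> e0; have p0 : 0 < 2 ^+ d :> R by rewrite exprn_gt0.
  have e0' : 0 < e / 2 ^+ d by rewrite divr_gt0.
  have [M _ HM] := uf _ e0'; exists M => m Mm x cx.
  rewrite tensor_mul_eval -mulrBl normrM -[leRHS](divfK (lt0r_neq0 p0)); apply: ler_pM => //.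
    by rewrite distrC; apply/ltW; exact: HM.
  exact: cos_basis_prod_le.
have L : tensor_limit (fun x => f x * cos_basis_prod k x).
  by move=> e e0; have [M HM] := close e e0; exists (T M) => // x cx; exact: HM.
apply/cvgrPdist_le => e e0; have [M HM] := close e e0; exists M => // m /= Mm.
by rewrite -TE; apply: cube_integral_dist_le => //; exact: HM.
Qed.

Lemma sob_ip_cvg (u : nat -> tensor R d) f : represents (@cube R d) (tensor_mem H) (@tensor_eval R d) (tensor_ip H) u f ->
  tensor_ip H (u m) (u m) @[m --> \oo] --> fip (sob alpha gamma) f f.
Proof.
move=> uf.
exact: (completion_ip_cvg sob_weights_ge0 (@box_mono R d) tensor_ip_coef represents_cube_coef uf uf).
Qed.

End TensorCoefficients.

Section UniformConvergence.
Variables (R : realType) (T : Type) (D : set T).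
Implicit Types (u v : nat -> T -> R) (f g : T -> R).

Definition ucvg u f := forall e : R, 0 < e -> exists M, forall m, (M <= m)%N ->
  forall x, D x -> `|u m x - f x| <= e.

Definition ubounded f := exists2 B : R, 0 <= B & forall x, D x -> `|f x| <= B.

Lemma ucvgM u v f g : ucvg u f -> ucvg v g -> ubounded f -> ubounded g ->
  ucvg (fun m x => u m x * v m x) (fun x => f x * g x).
Proof.
move=> uf vg [A A0 fA] [B B0 gB] e e0.
pose t : R := Num.min 1 (e / (A + B + 1)).
have AB : 0 < A + B + 1 by rewrite ltr_wpDl// addr_ge0.
have t0 : 0 < t by rewrite lt_min ltr01 divr_gt0.
have t1 : t <= 1 by rewrite /t ge_min lexx.
have te : t * (A + B + 1) <= e by rewrite -ler_pdivlMr// /t ge_min lexx orbT.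
have [M1 H1] := uf t t0; have [M2 H2] := vg t t0; exists (maxn M1 M2) => m.
rewrite geq_max => /andP[m1 m2] x Dx.
have h1 := H1 m m1 x Dx; have h2 := H2 m m2 x Dx; have h3 := fA x Dx; have h4 := gB x Dx.
have -> : u m x * v m x - f x * g x = (u m x - f x) * g x + f x * (v m x - g x) + (u m x - f x) * (v m x - g x).
  by lra.
apply: le_trans (ler_normD _ _) _; apply: le_trans (lerD (ler_normD _ _) (lexx _)) _.
rewrite !normrM; apply: le_trans te.
have p1 : `|u m x - f x| * `|g x| <= t * B by apply: ler_pM.
have p2 : `|f x| * `|v m x - g x| <= A * t by apply: ler_pM.
have p3 : `|u m x - f x| * `|v m x - g x| <= t * 1.
  by apply: ler_pM => //; exact: le_trans t1.
move: p1 p2 p3; rewrite !mulrDr mulr1 (mulrC A) => p1 p2 p3.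
by rewrite [X in _ <= X + _]addrC; apply: lerD => //; apply: lerD.
Qed.

Lemma uboundedM f g : ubounded f -> ubounded g -> ubounded (fun x => f x * g x).
Proof.
move=> [A A0 fA] [B B0 gB]; exists (A * B); first by rewrite mulr_ge0.
by move=> x Dx; rewrite normrM; apply: ler_pM => //; [exact: fA|exact: gB].
Qed.

Lemma ucvg_prod (I : Type) (s : seq I) (u : I -> nat -> T -> R) (f : I -> T -> R) :
  (forall i, ucvg (u i) (f i)) -> (forall i, ubounded (f i)) ->
  ucvg (fun m x => \prod_(i <- s) u i m x) (fun x => \prod_(i <- s) f i x).
Proof.
move=> uf bf.
have cst : ubounded (fun=> 1) by exists 1 => // x _; rewrite normr1.
have [] : ucvg (fun m x => \prod_(i <- s) u i m x) (fun x => \prod_(i <- s) f i x) /\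
    ubounded (fun x => \prod_(i <- s) f i x); last by [].
elim: s => [|i s [IH1 IH2]].
  split; last by case: cst => B B0 H; exists B => // x /H; rewrite big_nil.
  by move=> e e0; exists 0%N => m _ x _; rewrite !big_nil subrr normr0 ltW.
have e1 : (fun m x => \prod_(j <- i :: s) u j m x) = fun m x => u i m x * \prod_(j <- s) u j m x.
  by apply/funext => m; apply/funext => x; rewrite big_cons.
have e2 : (fun x => \prod_(j <- i :: s) f j x) = fun x => f i x * \prod_(j <- s) f j x.
  by apply/funext => x; rewrite big_cons.
rewrite e1 e2; split; [exact: ucvgM|exact: uboundedM].
Qed.

Lemma ucvg_sum_in (I : eqType) (s : seq I) (u : I -> nat -> T -> R) (f : I -> T -> R) :
  (forall i, i \in s -> ucvg (u i) (f i)) ->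
  ucvg (fun m x => \sum_(i <- s) u i m x) (fun x => \sum_(i <- s) f i x).
Proof.
elim: s => [|i s IH] uf e e0; first by exists 0%N => m _ x _; rewrite !big_nil subrr normr0 ltW.
have e2 : 0 < e / 2 by rewrite divr_gt0.
have [M1 H1] := uf i (mem_head _ _) _ e2.
have [M2 H2] : exists M, forall m, (M <= m)%N -> forall x, D x ->
    `|\sum_(i <- s) u i m x - \sum_(i <- s) f i x| <= e / 2.
  by apply: IH => // j js; apply: uf; rewrite inE js orbT.
exists (maxn M1 M2) => m; rewrite geq_max => /andP[m1 m2] x Dx; rewrite !big_cons.
rewrite opprD addrACA; apply: le_trans (ler_normD _ _) _.
by have := H1 m m1 x Dx; have := H2 m m2 x Dx; move: (`|_|) (`|_|) => a b; clear; lra.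
Qed.

End UniformConvergence.

(** * Tent-transformed lattice averages *)

Section TentLattice.
Variable R : realType.

Lemma cos_periodz (m : int) (x : R) : cos (x + m%:~R * (2 * pi)) = cos x.
Proof.
have c2 (y : R) : cos (y + 2 * pi) = cos y by rewrite mulr_natl cosD2pi.
have cn (n : nat) (y : R) : cos (y + n%:R * (2 * pi)) = cos y.
  elim: n y => [|n IH] y; first by rewrite mul0r addr0.
  by rewrite -natr1 mulrDl mul1r addrA c2 IH.
case: m => n; first exact: cn.
by rewrite NegzE mulrNz mulNr -[LHS](cn n.+1) subrK.
Qed.

Lemma frac_itv (x : R) : 0 <= Defs.frac x < 1.
Proof. by rewrite /Defs.frac subr_ge0 floor_le_tmp ltrBlDl; have := lt_succ_floor x; rewrite intrD addrC. Qed.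

Lemma tent_itv (x : R) : 0 <= x <= 1 -> 0 <= tent x <= 1.
Proof.
move=> /andP[x0 x1]; rewrite /tent; case: (ger0P (2 * x - 1)) => h; apply/andP; split; lra.
Qed.

(** For [k > 0] this is the sum of the two exponentials with frequencies [k] and [- k]; averages of
    products of waves therefore count sign patterns. *)
Definition wave (k : nat) (y : R) : R := if k == 0%N then 1 else 2 * cos (2 * pi * k%:R * y).

(** On the second half of the period the tent is [2 - 2 * y]; evenness and periodicity of the cosine
    remove the case distinction, so the lattice rule sees a genuine periodic wave. *)
Lemma cos_basis_tent k (y : R) : cos_basis k (tent (Defs.frac y)) = (cos_scale R k)^-1 * wave k y.
Proof.
rewrite cos_basisE /wave /trig; case: (altP (k =P 0%N)) => [->|k0].
  by rewrite /cos_scale /= invr1 !mul0r cos0 !mulr1.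
have -> : cos (k%:R * pi * tent (Defs.frac y)) = cos (2 * pi * k%:R * Defs.frac y).
  rewrite /tent; case: (ger0P (2 * Defs.frac y - 1)) => _.
    rewrite -(cosN (2 * _ * _ * _)) -(cos_periodz k%:Z (- _)); congr cos.
    by rewrite -pmulrn; lra.
  by congr cos; lra.
have -> : cos (2 * pi * k%:R * Defs.frac y) = cos (2 * pi * k%:R * y).
  rewrite -(cos_periodz (k%:Z * Num.floor y)); congr cos.
  by rewrite /Defs.frac intrM -pmulrn; move: (_%:~R) => F; lra.
have s2 : (Num.sqrt 2 : R) ^+ 2 = 2 by rewrite sqr_sqrtr.
rewrite /cos_scale (negPf k0) mulrA; congr (_ * _).
have n0 : (Num.sqrt 2 : R) != 0 by rewrite gt_eqF// sqrtr_gt0.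
by apply: (mulfI n0); rewrite mulVKf// -expr2.
Qed.

Definition avg d (n : nat) (z : 'I_d -> nat) (k : 'I_d -> nat) : R :=
  n%:R^-1 * \sum_(i < n) \prod_(j < d) wave (k j) ((i * z j)%:R / n%:R).

Definition scale_prod d (k : 'I_d -> nat) : R := \prod_(j < d) cos_scale R (k j).

Lemma tent_lattice_rule_cos d n z (k : 'I_d -> nat) :
  tent_lattice_rule n z (cos_basis_prod k) = (scale_prod k)^-1 * avg n z k.
Proof.
rewrite /tent_lattice_rule /avg mulrCA; congr (_ * _); rewrite mulr_sumr; apply: eq_bigr => i _.
rewrite /cos_basis_prod /scale_prod -prodfV -big_split; apply: eq_bigr => j _ /=.
by rewrite !mxE cos_basis_tent.
Qed.

Lemma lattice_point_cube d n (z : 'I_d -> nat) i : cube (map_mx (@tent R) (lattice_point R n z i)).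
Proof. by move=> j; rewrite !mxE; apply: tent_itv; have /andP[h1 h2] := frac_itv ((i * z j)%:R / n%:R); rewrite h1 ltW. Qed.

Lemma tent_lattice_rule_dist_le d n z (f g : 'rV[R]_d -> R) e : 0 <= e ->
  (forall x, cube x -> `|f x - g x| <= e) ->
  `|tent_lattice_rule n z f - tent_lattice_rule n z g| <= e.
Proof.
move=> e0 fg; rewrite /tent_lattice_rule -mulrBr -sumrB normrM ger0_norm ?invr_ge0//.
case: n => [|n]; first by rewrite big_ord0 normr0 mulr0.
rewrite ler_pdivrMl ?ltr0n//; apply: le_trans (ler_norm_sum _ _ _) _.
rewrite mulr_natl -[X in _ *+ X]card_ord -sumr_const.
by apply: ler_sum => i _; apply: fg; exact: lattice_point_cube.
Qed.

End TentLattice.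

Section CharacterSums.
Variable R : realType.

Lemma cos_2pi_eq1 (n : nat) (m : int) : (0 < n)%N ->
  cos (2 * pi * (m%:~R / n%:R)) = 1 :> R -> (n %| m)%Z.
Proof.
move=> n0; have n0' : (n%:R : R) != 0 by rewrite pnatr_eq0 -lt0n.
have nz : n%:Z != 0 by rewrite -[_ == _]/(n == 0%N) -lt0n.
have e : (m%:~R : R) / n%:R = (m %% n)%Z%:~R / n%:R + (m %/ n)%Z%:~R.
  rewrite {1}(divz_eq m n) intrD intrM -pmulrn mulrDl mulfK// addrC//.
rewrite e mulrDr [2 * pi * _%:~R]mulrC cos_periodz => h.
apply/dvdz_mod0P.
have r0 := modz_ge0 m nz; have r1 := ltz_mod m nz.
apply/eqP; rewrite eq_le r0 andbT leNgt; apply/negP => rp.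
move: h; set x : R := _ / _.
have x0 : 0 < x by rewrite divr_gt0 ?ltr0n ?ltr0z.
have x1 : x < 1.
  by rewrite ltr_pdivrMr ?ltr0n// mul1r (pmulrn _ n) ltr_int; exact: r1.
have p0 := @pi_gt0 R.
have s0 : 0 < sin (pi * x) by apply: sin_gt0_pi; rewrite mulr_gt0//= gtr_pMr.
have -> : 2 * pi * x = pi * x *+ 2 by rewrite mulr2n; lra.
rewrite mulr2n cosD -!expr2 cos2sin2.
have : 0 < sin (pi * x) ^+ 2 by rewrite exprn_gt0.
by move: (sin _ ^+ 2) => a a0; lra.
Qed.

(** The geometric sum in real form. Shifting the index rotates the pair of cosine and sine sums by
    the angle [a] without changing it; the rotation minus the identity has determinant
    [2 * (1 - cos a)], nonzero unless [n] divides [m]. *)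
Lemma sum_cos (n : nat) (m : int) : (0 < n)%N ->
  \sum_(i < n) cos (2 * pi * (m%:~R * i%:R / n%:R)) = if (n %| m)%Z then n%:R else 0 :> R.
Proof.
move=> n0; have n0' : (n%:R : R) != 0 by rewrite pnatr_eq0 -lt0n.
case: ifPn => [/dvdzP[q ->]|ndvd].
  rewrite (eq_bigr (fun=> 1)) ?sumr_const ?card_ord// => i _.
  rewrite intrM -pmulrn; have -> : q%:~R * n%:R * i%:R / n%:R = (q * i%:Z)%:~R :> R.
    by rewrite intrM -pmulrn mulrAC mulfK.
  by rewrite mulrC -[X in cos X]add0r cos_periodz cos0.
pose a : R := 2 * pi * (m%:~R / n%:R).
have ea i : 2 * pi * (m%:~R * i%:R / n%:R) = a * i%:R by rewrite /a; lra.
under eq_bigr do rewrite ea.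
have shift (F : R -> R) : F (a * n%:R) = F 0 ->
    \sum_(i < n) F (a * i.+1%:R) = \sum_(i < n) F (a * i%:R).
  move=> Fn; rewrite -!(big_mkord xpredT (fun i => F (a * i%:R))) -(big_mkord xpredT (fun i => F (a * i.+1%:R))).
  rewrite -(big_add1 _ _ 0 n.+1 xpredT (fun i => F (a * i%:R))).
  by rewrite big_nat_recr//= [RHS]big_ltn// Fn mulr0 addrC.
have an : a * n%:R = m%:~R * (2 * pi).
  by rewrite /a -mulrA divfK// mulrC.
have cn : cos (a * n%:R) = cos 0 by rewrite an -[X in cos X = _]add0r cos_periodz.
have sn : sin (a * n%:R) = sin 0.
  rewrite an -[LHS]cosBpihalf -[RHS]cosBpihalf.
  by rewrite addrC cos_periodz sub0r.
have eC : \sum_(i < n) cos (a * i.+1%:R) = \sum_(i < n) cos (a * i%:R) * cos a - \sum_(i < n) sin (a * i%:R) * sin a.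
  by rewrite -sumrB; apply: eq_bigr => i _; rewrite -natr1 mulrDr mulr1 cosD.
have eS : \sum_(i < n) sin (a * i.+1%:R) = \sum_(i < n) sin (a * i%:R) * cos a + \sum_(i < n) cos (a * i%:R) * sin a.
  by rewrite -big_split; apply: eq_bigr => i _; rewrite -natr1 mulrDr mulr1 sinD.
have := shift cos cn; have := shift sin sn; rewrite eC eS -!mulr_suml.
move: (\sum_(i < n) cos _) (\sum_(i < n) sin _) => C S.
have c1 : cos a != 1.
  by apply: contra ndvd => /eqP; exact: cos_2pi_eq1.
have := cos2Dsin2 a.
move: (cos a) (sin a) c1 => c s c1; rewrite !expr2 => cs e1 e2.
have : C * (2 * (1 - c)) = 0 by nra.
move/eqP; rewrite mulf_eq0 => /orP[/eqP//|]; rewrite mulf_eq0 pnatr_eq0/= subr_eq0 eq_sym.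
by rewrite (negPf c1).
Qed.

End CharacterSums.

Section Averages.
Variables (R : realType) (d : nat).
Implicit Types (z k : 'I_d -> nat).

Definition twos k : nat := \prod_(j < d) (if k j == 0%N then 1 else 2)%N.

Fixpoint signed_sums z k (s : seq 'I_d) : seq int :=
  if s is j :: s' then
    if k j == 0%N then signed_sums z k s'
    else [seq (k j * z j)%N%:Z + m | m <- signed_sums z k s'] ++
         [seq m - (k j * z j)%N%:Z | m <- signed_sums z k s']
  else [:: 0].

Lemma prod_wave_signed_sums n z k (s : seq 'I_d) (i : nat) :
  \prod_(j <- s) wave (k j) ((i * z j)%:R / n%:R) = 
  \sum_(m <- signed_sums z k s) cos (2 * pi * (m%:~R * i%:R / n%:R)) :> R.
Proof.
elim: s => [|j s IH]; first by rewrite big_nil big_seq1 !mul0r mulr0 cos0.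
rewrite big_cons IH /= /wave; case: ifP => [_|_]; first by rewrite mul1r.
rewrite big_cat /= !big_map -big_split mulr_sumr; apply: eq_bigr => m _ /=.
set b := 2 * pi * (m%:~R * i%:R / n%:R); set a := 2 * pi * (k j)%:R * _.
have -> : 2 * pi * (((k j * z j)%N%:Z + m)%:~R * i%:R / n%:R) = b + a.
  by rewrite intrD -pmulrn /a /b !natrM; lra.
have -> : 2 * pi * ((m - (k j * z j)%N%:Z)%:~R * i%:R / n%:R) = b - a.
  by rewrite intrB -pmulrn /a /b !natrM; lra.
by rewrite cosD cosB; lra.
Qed.

Lemma size_signed_sums z k s :
  size (signed_sums z k s) = (\prod_(j <- s) (if k j == 0%N then 1 else 2))%N.
Proof.
elim: s => [|j s IH]; first by rewrite big_nil.
by rewrite big_cons /=; case: ifP => _; rewrite ?mul1n// size_cat !size_map IH mul2n addnn.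
Qed.

(* Expanding each cosine over its two signs turns the lattice average into the number of sign patterns
   of [k] orthogonal to [z] modulo [n]. Integrality yields [avg ^ p <= avg] for [0 < p <= 1]. *)
Lemma avg_nat n z k : (0 < n)%N -> exists2 A : nat, avg R n z k = A%:R & (A <= twos k)%N.
Proof.
move=> n0; exists (count (fun m : int => (n %| m)%Z) (signed_sums z k (index_enum 'I_d))).
  rewrite /avg; under eq_bigr do rewrite prod_wave_signed_sums.
  rewrite exchange_big /=; under eq_bigr do rewrite sum_cos//.
  rewrite -big_mkcond /= big_const_seq iter_addr addr0 mulrnAr mulVf ?pnatr_eq0 -?lt0n//.
by apply: leq_trans (count_size _ _) _; rewrite size_signed_sums.
Qed.

Lemma avg_ge0 n z k : 0 <= avg R n z k.
Proof.
case: n => [|n]; first by rewrite /avg big_ord0 mulr0.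
by have [A -> _] := avg_nat z k (ltn0Sn n).
Qed.

Lemma avg_le_twos n z k : avg R n z k <= (twos k)%:R.
Proof.
case: n => [|n]; first by rewrite /avg big_ord0 mulr0.
by have [A -> h] := avg_nat z k (ltn0Sn n); rewrite ler_nat.
Qed.

Lemma avg0 n z k : (0 < n)%N -> (forall j, k j = 0%N) -> avg R n z k = 1.
Proof.
move=> n0 k0; rewrite /avg (eq_bigr (fun=> 1)); last first.
  by move=> i _; rewrite big1// => j _; rewrite /wave k0.
by rewrite sumr_const card_ord mulVf// pnatr_eq0 -lt0n.
Qed.

Definition update z (s : 'I_d) (v : nat) : 'I_d -> nat := fun j => if j == s then v else z j.

Lemma sum_wave n (k i : nat) : prime n -> ~~ (n %| k)%N -> (i < n)%N ->
  \sum_(v < n) wave k ((i * v)%:R / n%:R) = if i == 0%N then 2 * n%:R else 0 :> R.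
Proof.
move=> pn nk lin; have n0 := prime_gt0 pn.
have k0 : k != 0%N by apply: contra nk => /eqP ->; exact: dvdn0.
rewrite /wave (negPf k0) -mulr_sumr.
have e (v : 'I_n) : 2 * pi * k%:R * ((i * v)%:R / n%:R) = 2 * pi * ((k * i)%N%:Z%:~R * v%:R / n%:R) :> R.
  by rewrite -pmulrn !natrM; lra.
under eq_bigr do rewrite e.
rewrite sum_cos// (_ : (n %| (k * i)%N%:Z)%Z = (n %| k * i)%N)// Euclid_dvdM// (negPf nk) /=.
case: i lin {e} => [|i] lin; first by rewrite dvdn0.
by rewrite gtnNdvd// mulr0.
Qed.

(** Summing over all residues [v] annihilates every node except [i = 0], where each wave attains its
    maximum. *)
Lemma sum_avg_update n z k s : prime n -> ~~ (n %| k s)%N ->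
  \sum_(v < n) avg R n (update z s v) k = (twos k)%:R.
Proof.
move=> pn nk; have n0 := prime_gt0 pn; have n0' : (n%:R : R) != 0 by rewrite pnatr_eq0 -lt0n.
rewrite /avg -mulr_sumr exchange_big /=.
pose X (i : nat) : R := \prod_(j < d | j != s) wave (k j) ((i * z j)%:R / n%:R).
have e (i : 'I_n) : \sum_(v < n) \prod_(j < d) wave (k j) ((i * update z s v j)%:R / n%:R) =
    X i * (if i == 0%N :> nat then 2 * n%:R else 0).
  rewrite -(sum_wave pn nk (ltn_ord i)) mulr_sumr; apply: eq_bigr => v _.
  rewrite (bigD1 s)//= /update eqxx mulrC; congr (_ * _); apply: eq_bigr => j js.
  by rewrite (negPf js).
under eq_bigr do rewrite e.
rewrite (bigD1 (Ordinal n0))//= big1 ?addr0; last first.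
  by move=> i i0; rewrite (_ : (i == 0%N :> nat) = false) ?mulr0//; apply/negbTE.
rewrite (mulrC 2) mulrCA mulKf//; rewrite /twos natr_prod (bigD1 s)//=.
have -> : k s == 0%N = false.
  by apply/negbTE; apply: contra nk => /eqP ->; exact: dvdn0.
rewrite mulrC; congr (_ * _); apply: eq_bigr => j js; rewrite /wave; case: ifP => // _.
by rewrite mul0n mul0r mulr0 cos0 mulr1.
Qed.

End Averages.

Section CosineTensors.
Variables (R : realType) (d : nat).
Implicit Types (t : tensor R d).

Definition nonzero (k : 'I_d -> nat) : bool := [exists j, k j != 0%N].

Lemma nonzeroPn k : ~~ nonzero k -> k = fun=> 0%N.
Proof. by rewrite negb_exists => /forallP h; apply/funext => j; apply/eqP; have := h j; rewrite negbK. Qed.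

Lemma cos_poly_expansion (a : R -> R) : cos_poly a -> exists M, forall N, (M <= N)%N ->
  forall x, a x = \sum_(k <- iota 0 N) cos_coef a k * cos_basis k x.
Proof.
move=> /cos_polyP[M [c ->]]; exists M => N MN x; rewrite /cosp -(@big_iota_widen _ M N)//.
  rewrite big_seq [RHS]big_seq; apply: eq_bigr => k; rewrite mem_iota => /andP[_ kM].
  by rewrite cos_coef_cosp /trunc_coef kM.
by move=> k Mk; rewrite cos_coef_cosp /trunc_coef ltnNge Mk mul0r.
Qed.

Lemma cos_tensor_expansion t : (forall a, a \in t -> forall j, cos_poly (a j)) ->
  exists M, forall N, (M <= N)%N -> forall x,
    tensor_eval t x = \sum_(k <- box d N) tensor_coef t k * cos_basis_prod k x.
Proof.
move=> ht; have [M HM] : exists M, forall N, (M <= N)%N -> forall a, a \in t -> forall j x,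
    a j x = \sum_(k <- iota 0 N) cos_coef (a j) k * cos_basis k x.
  elim: t ht => [|a t IH] ht; first by exists 0%N.
  have [M1 HM1] := IH (fun b bt => ht b (@mem_behead _ (a :: t) b bt)).
  have [m Hm] := choice (fun j => cos_poly_expansion (ht a (mem_head _ _) j)).
  exists (maxn M1 (\max_(j < d) m j)) => N; rewrite geq_max => /andP[h1 h2] b; rewrite inE => /predU1P[->|bt] j x.
    by apply: Hm; apply: leq_trans h2; exact: leq_bigmax.
  exact: HM1.
exists M => N MN x; rewrite /tensor_eval /tensor_coef.
under [RHS]eq_bigr do rewrite mulr_suml; rewrite exchange_big /=.
rewrite big_seq [RHS]big_seq; apply: eq_bigr => a ha.
transitivity (\prod_(j < d) \sum_(k <- iota 0 N) cos_coef (a j) k * cos_basis k (x 0 j)).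
  by apply: eq_bigr => j _; exact: HM.
rewrite -(big_box_prod (fun j k => cos_coef (a j) k * cos_basis k (x 0 j))).
by apply: eq_bigr => k _; rewrite big_split.
Qed.

Lemma cube_integral_tensor t : (forall a, a \in t -> forall j, {within `[0, 1], continuous (a j)}) ->
  cube_integral (tensor_eval t) = tensor_coef t (fun=> 0%N).
Proof.
move=> ht; pose T : seq (R * ('I_d -> R -> R)) := [seq (1, a) | a <- t].
have cT : wtensor_continuous T by move=> _ /mapP[a ha ->] j; exact: ht.
have TE x : wtensor_eval T x = tensor_eval t x.
  by rewrite /wtensor_eval big_map; apply: eq_bigr => a _; rewrite mul1r.
have TI : wtensor_int T = tensor_coef t (fun=> 0%N).
  rewrite /wtensor_int big_map; apply: eq_bigr => a _; rewrite mul1r; apply: eq_bigr => j _ /=.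
  by rewrite /cos_coef; congr int01; apply/funext => x; rewrite /cos_basis mulr1.
apply/eqP; rewrite -subr_eq0 -normr_le0 -TI; apply: cube_integral_dist_le => //.
  by move=> e e0; exists T => // x _; rewrite TE subrr normr0 ltW.
by move=> x _; rewrite TE subrr normr0.
Qed.

Lemma tent_lattice_rule_sum n z (I : Type) (s : seq I) (c : I -> R) (F : I -> 'rV[R]_d -> R) :
  tent_lattice_rule n z (fun x => \sum_(i <- s) c i * F i x) =
  \sum_(i <- s) c i * tent_lattice_rule n z (F i).
Proof.
rewrite /tent_lattice_rule exchange_big mulr_sumr; apply: eq_bigr => i _.
by rewrite -mulr_sumr mulrCA.
Qed.

Lemma scale_prod_gt0 (k : 'I_d -> nat) : 0 < scale_prod R k.
Proof.
apply: prodr_gt0 => j _; rewrite /cos_scale; by case: ifP => // _; rewrite ?sqrtr_gt0.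
Qed.

(** The rule is exact on the constant term; at a nonzero frequency it returns the lattice average
    divided by the normalization [scale_prod k]. *)
Lemma tensor_cos_error_le t : (forall a, a \in t -> forall j, cos_poly (a j)) ->
  exists M, forall N, (M <= N)%N -> forall n z, (0 < n)%N ->
  `|cube_integral (tensor_eval t) - tent_lattice_rule n z (tensor_eval t)| <=
  \sum_(k <- box d N | nonzero k) `|tensor_coef t k| * (avg R n z k / scale_prod R k).
Proof.
(* With the successor, the boxes contain the zero frequency. *)
move=> ht; have [M HM] := cos_tensor_expansion ht; exists M.+1 => N MN n z n0.
rewrite cube_integral_tensor; last first.
  by move=> a ha j; apply: within_continuousT; apply: continuous_cos_poly; exact: ht.
have -> : tensor_eval t = fun x => \sum_(k <- box d N) tensor_coef t k * cos_basis_prod k x.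
  by apply/funext => x; apply: HM; lia.
rewrite tent_lattice_rule_sum (bigID nonzero)/=.
have -> : \sum_(k <- box d N | ~~ nonzero k)
     tensor_coef t k * tent_lattice_rule n z (cos_basis_prod k) = tensor_coef t (fun=> 0%N).
  rewrite big_mkcond (eq_bigr (fun k => (k == (fun=> 0%N))%:R * tensor_coef t (fun=> 0%N))) /=; last first.
    move=> k _; case: (boolP (nonzero k)) => [/existsP[j kj]|/nonzeroPn ->] /=.
      by case: eqP => [e|_]; [rewrite e eqxx in kj|rewrite mul0r].
    rewrite eqxx tent_lattice_rule_cos avg0// mul1r mulr1 /scale_prod big1 ?invr1 ?mulr1//.
  by rewrite -mulr_suml box0 ?mul1r// => j; exact: leq_ltn_trans MN.
rewrite opprD addrCA addrN addr0 normrN; apply: le_trans (ler_norm_sum _ _ _) _.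
apply: ler_sum => k _; rewrite tent_lattice_rule_cos normrM ler_wpM2l//.
by rewrite mulrC ger0_norm// divr_ge0 ?avg_ge0// ltW// scale_prod_gt0.
Qed.

End CosineTensors.

(** * From a spectral bound to the randomized error *)

Section MeanError.
Variables (R : realType) (d : nat) (alpha : R) (gamma : 'I_d -> R).
Hypothesis alpha_itv : 2^-1 < alpha < 2.
Variables (Omega : finType) (P : Omega -> R) (nn : Omega -> nat) (zz : Omega -> 'I_d -> nat).
Hypothesis P_ge0 : forall o, 0 <= P o.
Hypothesis nn_gt0 : forall o, P o != 0 -> (0 < nn o)%N.
Variables (B : R) (rho : ('I_d -> nat) -> R).
Hypothesis B_gt0 : 0 < B.
Notation H := (fun j => sob1 alpha (gamma j)).
Notation w := (sob_weights alpha gamma).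
Notation I01 := (`[0%R, 1%R]%classic : set R).
Implicit Types (t : tensor R d) (f : 'rV[R]_d -> R) (k : 'I_d -> nat).

Definition mean_avg k : R := \sum_o P o * avg R (nn o) (zz o) k.

Definition mean_error f : R :=
  \sum_o P o * `|cube_integral f - tent_lattice_rule (nn o) (zz o) f|.

Hypothesis rho_weight : forall k, 1 <= rho k * w k.
Hypothesis spectrum_le : forall N,
  \sum_(k <- box d N | nonzero k) (mean_avg k / scale_prod R k) ^+ 2 * rho k <= B ^+ 2.

(** A uniform change by [e1] moves the integral and each rule by at most [e1], so bounds on the mean
    error survive uniform limits; no norm of [f] is involved. *)
Lemma mean_error_tensor_limit f (T : nat -> tensor R d) (c : nat -> R) (L : R) :
  (forall m a, a \in T m -> forall j, {within I01, continuous (a j)}) ->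
  ucvg (@cube R d) (fun m => tensor_eval (T m)) f ->
  (forall m, mean_error (tensor_eval (T m)) <= c m) -> c m @[m --> \oo] --> L ->
  mean_error f <= L.
Proof.
move=> cT Tf Tc cL; apply/ler_addgt0Pr => e e0.
pose p := \sum_o P o; have p0 : 0 <= p by exact: sumr_ge0.
pose e1 := e / (2 * p + 1).
have e10 : 0 < e1 by rewrite divr_gt0// ltr_wpDl// mulr_ge0.
have ep : 2 * p * e1 <= e - e1.
  have : (2 * p + 1) * e1 = e by rewrite mulrC divfK// gt_eqF// ltr_wpDl// mulr_ge0.
  by rewrite mulrDl mul1r; lra.
pose U m : seq (R * ('I_d -> R -> R)) := [seq (1, a) | a <- T m].
have cU m : wtensor_continuous (U m) by move=> _ /mapP[a ha ->] j; exact: (cT m a ha j).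
have UE m x : wtensor_eval (U m) x = tensor_eval (T m) x.
  by rewrite /wtensor_eval big_map; apply: eq_bigr => a _; rewrite mul1r.
have Lf : tensor_limit f.
  move=> e' e'0; have [M HM] := Tf e' e'0; exists (U M) => // x cx.
  by rewrite UE distrC HM.
have LU m : tensor_limit (tensor_eval (T m)).
  by move=> e' e'0; exists (U m) => // x _; rewrite UE subrr normr0 ltW.
have [M1 HM1] := Tf e1 e10; have /cvgrPdist_le /(_ e1 e10) [M2 _ HM2] := cL.
pose m := maxn M1 M2.
have close x : cube x -> `|f x - tensor_eval (T m) x| <= e1.
  by move=> cx; rewrite distrC; apply: HM1 => //; rewrite leq_maxl.
have I1 : `|cube_integral f - wtensor_int (U m)| <= e1.
  by apply: cube_integral_dist_le => // x cx; rewrite UE; exact: close.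
have I2 : `|cube_integral (tensor_eval (T m)) - wtensor_int (U m)| <= 0.
  by apply: cube_integral_dist_le => // x cx; rewrite UE subrr normr0.
move: I2; rewrite normr_le0 subr_eq0 => /eqP I2; rewrite -I2 in I1.
have step : mean_error f <= mean_error (tensor_eval (T m)) + 2 * p * e1.
  rewrite /mean_error /p mulr_sumr mulr_suml -big_split; apply: ler_sum => o _ /=.
  have -> : 2 * P o * e1 = P o * (2 * e1) by lra.
  rewrite -mulrDr ler_wpM2l//.
  have J := tent_lattice_rule_dist_le (nn o) (zz o) (ltW e10) close.
  move: I1 J; set a := cube_integral f; set b := cube_integral _.
  set c' := tent_lattice_rule _ _ f; set d' := tent_lattice_rule _ _ _ => I1 J.
  have -> : a - c' = (b - d') + (a - b) - (c' - d') by lra.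
  apply: le_trans (ler_normB _ _) _; apply: le_trans (lerD (ler_normD _ _) (lexx _)) _.
  by rewrite -addrA lerD2l (_ : 2 * e1 = e1 + e1) ?lerD//; lra.
have := HM2 m (leq_maxr _ _); have := Tc m; rewrite ler_norml => h /andP[h1 _].
by move: step ep h h1; move: (mean_error _) (mean_error _) (c m) => x y z; lra.
Qed.

(** Cauchy-Schwarz in the form of Young's inequality with parameter [B] at each frequency, using
    [1 <= rho k * w k]. The result is affine in the squared norm, hence stable under limits, and it
    equals [B] when that norm is 1. *)
Lemma mean_error_cos_tensor t : (forall a, a \in t -> forall j, cos_poly (a j)) ->
  exists M, forall N, (M <= N)%N ->
  mean_error (tensor_eval t) <= (B * wform (@box d) w N (tensor_coef t) (tensor_coef t) + B) / 2.
Proof.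
move=> ht; have [M HM] := tensor_cos_error_le ht; exists M => N MN.
apply: (@le_trans _ _ (\sum_(k <- box d N | nonzero k) `|tensor_coef t k| * (mean_avg k / scale_prod R k))).
  under [leRHS]eq_bigr do rewrite /mean_avg mulr_suml mulr_sumr.
  rewrite exchange_big; apply: ler_sum => o _ /=.
  have [->|o0] := eqVneq (P o) 0.
    by rewrite mul0r; apply: sumr_ge0 => k _; rewrite !mul0r mulr0.
  apply: le_trans (ler_wpM2l (P_ge0 o) (HM N MN _ (zz o) (nn_gt0 o0))) _.
  by rewrite mulr_sumr; apply: ler_sum => k _; rewrite le_eqVlt; apply/orP; left; apply/eqP; lra.
have young k : `|tensor_coef t k| * (mean_avg k / scale_prod R k) <=
    (B * (w k * tensor_coef t k * tensor_coef t k) + (mean_avg k / scale_prod R k) ^+ 2 * rho k / B) / 2.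
  have -> : w k * tensor_coef t k * tensor_coef t k = w k * `|tensor_coef t k| ^+ 2.
    by rewrite real_normK ?num_real// expr2 mulrA.
  move: (`|tensor_coef t k|) (mean_avg k / _) => x y.
  have := rho_weight k; have := sob_weights_ge0 gamma alpha_itv k; move: (rho k) (w k) => r v v0 rv.
  have v1 : 0 < v by rewrite lt_neqAle v0 andbT; apply: contraTneq rv => <-; rewrite mulr0 ler10.
  rewrite ler_pdivlMr//.
  have Bv : 0 < B * v by rewrite mulr_gt0.
  rewrite -subr_ge0 -(pmulr_rge0 _ Bv).
  have -> : B * v * (B * (v * x ^+ 2) + y ^+ 2 * r / B - x * y * 2) =
      (B * v * x - y) ^+ 2 + (r * v - 1) * y ^+ 2 + r * v * y ^+ 2 * (B / B - 1).
    by rewrite !expr2; lra.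
  rewrite divff ?gt_eqF// subrr mulr0 addr0 addr_ge0 ?sqr_ge0// mulr_ge0 ?sqr_ge0// subr_ge0//.
apply: le_trans (ler_sum _ (fun k _ => young k)) _.
rewrite -mulr_suml ler_pM2r ?invr_gt0// big_split /= lerD//.
  rewrite -mulr_sumr ler_pM2l// big_mkcond; apply: ler_sum => k _; case: ifP => // _.
  by rewrite -mulrA mulr_ge0 ?(sob_weights_ge0 gamma alpha_itv)// -expr2 sqr_ge0.
by rewrite -mulr_suml ler_pdivrMr// -expr2.
Qed.

(** Each factor is replaced by its cosine polynomial approximant; products of one-dimensional inner
    products converge, and the evaluations converge uniformly on the cube. *)
Lemma mean_error_tensor t : tensor_mem H t ->
  mean_error (tensor_eval t) <= (B * tensor_ip H t t + B) / 2.
Proof.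
move=> ht.
have [appr Happr] := choice (fun j : 'I_d => sob1_approx (gamma j) alpha_itv).
pose T m : tensor R d := [seq (fun j => appr j (a j) m) | a <- t].
have cpT m a : a \in T m -> forall j, cos_poly (a j).
  by move=> /mapP[b hb ->] j; have [h _] := Happr j; have [] := h _ (ht b hb j).
pose Wl m (a b : 'I_d -> R -> R) := \prod_(j < d) limn (fun N => wform (iota 0) (sob_weight alpha (gamma j)) N
  (cos_coef (appr j (a j) m)) (cos_coef (appr j (b j) m))).
have Tbound m : mean_error (tensor_eval (T m)) <=
    (B * (\sum_(a <- t) \sum_(b <- t) Wl m a b) + B) / 2.
  have [M HM] := mean_error_cos_tensor (cpT m).
  have h : (B * wform (@box d) w N (tensor_coef (T m)) (tensor_coef (T m)) + B) / 2 @[N --> \oo] -->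
      (B * (\sum_(a <- t) \sum_(b <- t) Wl m a b) + B) / 2.
    apply: cvgM; last exact: cvg_cst.
    apply: cvgD; last exact: cvg_cst.
    apply: cvgM; first exact: cvg_cst.
    under eq_fun do rewrite wform_tensor_coef big_map.
    apply: cvg_bigsum_in => a ha; under eq_fun do rewrite big_map.
    apply: cvg_bigsum_in => b hb; apply: cvg_bigprod => j.
    have [hj _] := Happr j; have [ca _] := hj _ (ht a ha j); have [cb _] := hj _ (ht b hb j).
    exact: (@wform_cos_poly_cvgn R alpha (gamma j) alpha_itv _ _ (ca m) (cb m)).
  rewrite -(cvg_lim (@Rhausdorff R) h); apply: limr_ge; first by apply/cvg_ex; eexists; exact: h.
  by exists M => // N /= MN; exact: HM.
apply: (mean_error_tensor_limit _ _ Tbound).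
- by move=> m a ha j; apply: within_continuousT; apply: continuous_cos_poly; exact: cpT ha j.
- have -> : (fun m => tensor_eval (T m)) =
      fun m x => \sum_(a <- t) \prod_(j < d) appr j (a j) m (x 0 j).
    by apply/funext => m; apply/funext => x; rewrite /tensor_eval big_map.
  rewrite (_ : tensor_eval t = fun x => \sum_(a <- t) \prod_(j < d) a j (x 0 j))//.
  have key a : a \in t -> ucvg (@cube R d) (fun m (x : 'rV[R]_d) => \prod_(j < d) appr j (a j) m (x 0 j))
      (fun x => \prod_(j < d) a j (x 0 j)); last exact: (ucvg_sum_in key).
  move=> ha.
  apply: (@ucvg_prod _ _ _ _ _ (fun j m (x : 'rV[R]_d) => appr j (a j) m (x 0 j)) (fun j x => a j (x 0 j))) => j.
    move=> e e0; have [hj _] := Happr j; have [_ uj] := hj _ (ht a ha j).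
    have [M _ HM] := uj e e0; exists M => m Mm x cx; apply/ltW/HM => //=.
    by rewrite in_itv; exact: cx.
  have [K K0 HK] := within_continuous_bounded (sob1_continuous alpha_itv (ht a ha j)).
  by exists K => // x cx; apply: HK; exact: cx.
- apply: cvgM; last exact: cvg_cst.
  apply: cvgD; last exact: cvg_cst.
  apply: cvgM; first exact: cvg_cst.
  apply: cvg_bigsum_in => a ha; apply: cvg_bigsum_in => b hb; apply: cvg_bigprod => j.
  by have [_ hj] := Happr j; apply: hj; exact: ht.
Qed.

Lemma mean_error_le f : unit_ball (sob alpha gamma) f -> mean_error f <= B.
Proof.
move=> [[u uf] nf]; have [Vu _ uuf] := uf.
have f1 : fip (sob alpha gamma) f f <= 1.
  move: nf; rewrite /fnorm => nf; rewrite leNgt; apply/negP => h.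
  by move: nf; rewrite leNgt => /negP; apply; rewrite -sqrtr1 ltr_sqrt// (lt_trans ltr01).
apply: (@le_trans _ _ ((B * fip (sob alpha gamma) f f + B) / 2)); last first.
  have : B * fip (sob alpha gamma) f f <= B * 1 by rewrite ler_pM2l.
  by move: (B * fip _ _ _) => x; lra.
apply: (@mean_error_tensor_limit f u (fun m => (B * tensor_ip H (u m) (u m) + B) / 2)).
- by move=> m a ha j; apply: (sob1_continuous alpha_itv (gamma := gamma j)); exact: (Vu m a ha j).
- move=> e e0; have [M _ HM] := uuf e e0; exists M => m Mm x cx.
  by apply: ltW; exact: HM.
- by move=> m; exact: mean_error_tensor.
- apply: cvgM; last exact: cvg_cst.
  apply: cvgD; last exact: cvg_cst.
  apply: cvgM; first exact: cvg_cst.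
  exact: sob_ip_cvg.
Qed.

Lemma ran_error_le :
  (ran_error (sob alpha gamma) (@cube_integral R d) P
    (fun o => tent_lattice_rule (nn o) (zz o)) <= B%:E)%E.
Proof. by apply: ub_ereal_sup => _ [f hf <-]; rewrite lee_fin; exact: mean_error_le. Qed.

End MeanError.

(** * Sequential draws *)

Section SequentialExpectation.
Variables (R : realType) (d D : nat).
Notation T := {ffun 'I_d -> 'I_D.+1}.
Variable p : 'I_d -> T -> 'I_D.+1 -> R.
Implicit Types (z : T) (s j : 'I_d) (v : 'I_D.+1) (F G : T -> R).

Definition upd z s v : T := [ffun j => if j == s then v else z j].

Hypothesis p_ge0 : forall s z v, 0 <= p s z v.
Hypothesis p_le1 : forall s z, \sum_v p s z v <= 1.
Hypothesis p_local : forall s z j v u, (s <= j)%N -> p s (upd z j v) u = p s z u.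

(** Exchanging [z s] with the fresh value [v] is an involution on pairs: resampling one coordinate
    preserves the uniform measure. *)
Lemma sum_upd F s : \sum_z \sum_v D.+1%:R^-1 * F (upd z s v) = \sum_z F z.
Proof.
rewrite pair_big /=.
pose h (t : T * 'I_D.+1) := (upd t.1 s t.2, t.1 s).
have hK : involutive h.
  case=> z v; rewrite /h /= ffunE eqxx; congr (_, _); apply/ffunP => j; rewrite !ffunE.
  by case: eqP => // ->.
rewrite (reindex_inj (inv_inj hK)) /=.
transitivity (\sum_(t : T * 'I_D.+1) D.+1%:R^-1 * F t.1).
  apply: eq_bigr => -[z v] _ /=; congr (_ * F _); apply/ffunP => j; rewrite !ffunE.
  by case: eqP => // ->.
rewrite -(pair_big xpredT xpredT (fun z (v : 'I_D.+1) => D.+1%:R^-1 * F z)) /=.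
apply: eq_bigr => z _; by rewrite sumr_const card_ord -mulrnAl -[_ *+ _]mulr_natr mulVf ?mul1r// pnatr_eq0.
Qed.

(* The coordinates of index [>= m], not drawn yet, are averaged uniformly over their range;
   locality of [p] makes their law irrelevant. *)
Definition partial_exp (m : nat) G : R :=
  \sum_z (\prod_(j < d) (if (j < m)%N then p j z (z j) else D.+1%:R^-1)) * G z.

Lemma partial_exp_le m F G : (forall z, F z <= G z) -> partial_exp m F <= partial_exp m G.
Proof.
move=> FG; apply: ler_sum => z _; apply: ler_wpM2l => //; apply: prodr_ge0 => j _.
by case: ifP => // _; rewrite invr_ge0.
Qed.

(** Coordinate [s] is resampled by [sum_upd]. Locality lets the laws of coordinates up to [s] be
    read at the old [z]; the later coordinates enter only through [G]. *)
Lemma partial_expS s G :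
  partial_exp s.+1 G = partial_exp s (fun z => \sum_v p s z v * G (upd z s v)).
Proof.
rewrite /partial_exp -(sum_upd _ s); apply: eq_bigr => z _; rewrite mulr_sumr; apply: eq_bigr => v _.
rewrite (bigD1 s)//= [in RHS](bigD1 s)//= ltnS leqnn ltnn.
have -> : upd z s v s = v by rewrite ffunE eqxx.
rewrite (p_local z v v (leqnn s)).
have -> : \prod_(i < d | i != s) (if (i < s.+1)%N then p i (upd z s v) (upd z s v i) else D.+1%:R^-1) =
    \prod_(i < d | i != s) (if (i < s)%N then p i z (z i) else D.+1%:R^-1).
  apply: eq_bigr => j js; rewrite ltnS leq_eqVlt (_ : (j == s :> nat) = false) /=; last exact/negbTE.
  by case: ltnP => // jls; rewrite p_local ?(ltnW jls)// ffunE (negPf js).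
by rewrite [p s z v * \prod_(i < d | _) _]mulrC !mulrA.
Qed.

Lemma partial_exp_const m c : 0 <= c -> (m <= d)%N -> partial_exp m (fun=> c) <= c.
Proof.
move=> c0; elim: m => [|m IH] md.
  rewrite /partial_exp -mulr_suml (eq_bigr (fun=> D.+1%:R^-1 ^+ d)); last first.
    by move=> z _; rewrite prodr_const card_ord.
  rewrite sumr_const card_ffun !card_ord -[_ *+ _]mulr_natr exprVn natrX mulVf ?mul1r// expf_neq0// pnatr_eq0.
apply: le_trans (IH (ltnW md)).
rewrite (partial_expS (Ordinal md)); apply: partial_exp_le => z.
by rewrite -mulr_suml ler_piMl.
Qed.

Lemma partial_exp_local m F : (m <= d)%N -> (forall z, 0 <= F z) ->
  (forall z j v, (m <= j)%N -> F (upd z j v) = F z) -> partial_exp d F <= partial_exp m F.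
Proof.
move=> md F0; have : (m + (d - m) = d)%N by rewrite subnKC.
move: (d - m)%N md => r; elim: r m => [|r IH] m md mr loc; first by rewrite -[in partial_exp d]mr addn0.
have mld : (m < d)%N by lia.
apply: le_trans (IH m.+1 mld _ _) _.
- by lia.
- by move=> z j v mj; apply: loc; exact: ltnW.
rewrite (partial_expS (Ordinal mld)); apply: partial_exp_le => z.
under eq_bigr do rewrite loc//.
by rewrite -mulr_suml ler_piMl.
Qed.

(** Draws after [s] are summed out, as [F] does not see them; the draw of [s] is then bounded for
    fixed earlier coordinates, whose total mass is at most 1. *)
Lemma sequential_exp_le F s c : (forall z, 0 <= F z) -> 0 <= c ->
  (forall z j v, (s < j)%N -> F (upd z j v) = F z) ->
  (forall z, \sum_v p s z v * F (upd z s v) <= c) ->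
  \sum_(z : T) (\prod_j p j z (z j)) * F z <= c.
Proof.
move=> F0 c0 loc H.
have -> : \sum_z (\prod_j p j z (z j)) * F z = partial_exp d F.
  by apply: eq_bigr => z _; congr (_ * _); apply: eq_bigr => j _; rewrite ltn_ord.
apply: le_trans (partial_exp_local (ltn_ord s) F0 _) _; first by move=> z j v; exact: loc.
rewrite partial_expS; apply: le_trans (partial_exp_le s H) _.
by apply: partial_exp_const => //; exact: ltnW.
Qed.

Lemma sequential_mass_le1 : \sum_z \prod_j p j z (z j) <= 1.
Proof.
have -> : \sum_z \prod_j p j z (z j) = partial_exp d (fun=> 1).
  by apply: eq_bigr => z _; rewrite mulr1; apply: eq_bigr => j _; rewrite ltn_ord.
exact: partial_exp_const.
Qed.

End SequentialExpectation.

(** * Component-by-component bounds *)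

Section Zeta.
Variable R : realType.
Implicit Types (s x : R).

(** The zero term at index 0 aligns the sums with frequency ranges starting at 0. *)
Definition zterm s (k : nat) : R := if k == 0%N then 0 else k%:R `^ (- s).

Definition zsum s N : R := \sum_(k <- iota 0 N) zterm s k.

Lemma zterm_ge0 s k : 0 <= zterm s k.
Proof. by rewrite /zterm; case: ifP => // _; exact: powR_ge0. Qed.

Lemma iota_shift (F : nat -> R) N : F 0%N = 0 -> \sum_(k <- iota 0 N.+1) F k = series (fun k => F k.+1) N.
Proof. by move=> F0; rewrite /= big_cons F0 add0r /series /= (iotaDl 1 0 N) big_map big_mkord -[in LHS](subn0 N) -/(index_iota 0 N) big_mkord. Qed.

Lemma zsumS s N : zsum s N.+1 = series (fun k => k.+1%:R `^ (- s)) N.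
Proof. by rewrite /zsum iota_shift. Qed.

Lemma zsum_mono s N M : (N <= M)%N -> zsum s N <= zsum s M.
Proof.
move=> NM; rewrite /zsum -(subnKC NM) iotaD big_cat /= lerDl; apply: sumr_ge0 => k _; exact: zterm_ge0.
Qed.

Lemma zterm_le s k l : 0 <= s -> (0 < k)%N -> (k <= l)%N -> zterm s l <= zterm s k.
Proof.
move=> s0 k0 kl; have l0 := leq_trans k0 kl; rewrite /zterm !gtn_eqF// !powRN.
rewrite lef_pV2 ?posrE ?powR_gt0 ?ltr0n//.
by apply: ge0_ler_powR; rewrite ?nnegrE ?ler0n ?ler_nat.
Qed.

Lemma zterm_double s k : zterm s k.*2 = 2 `^ (- s) * zterm s k.
Proof.
rewrite /zterm double_eq0; case: eqP => [_|_]; first by rewrite mulr0.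
by rewrite -mul2n natrM powRM.
Qed.

(** Apart from the leading 1, each odd term is at most the preceding even one, and even terms are
    [2 ^ (- s)] times the original terms. *)
Lemma zsum_double s N : 0 <= s -> zsum s N.*2.+2 <= 1 + 2 * 2 `^ (- s) * zsum s N.+1.
Proof.
move=> s0; rewrite /zsum; elim: N => [|N IH].
  rewrite /= !big_cons !big_nil /zterm /= powR1; have : 0 <= 2 `^ (- s) :> R by exact: powR_ge0.
  lra.
have e2 : \sum_(k <- iota 0 N.+1.*2.+2) zterm s k =
    \sum_(k <- iota 0 N.*2.+2) zterm s k + (zterm s N.*2.+2 + zterm s N.*2.+3).
  by rewrite doubleS -[N.*2.+4]addn2 iotaD big_cat; congr (_ + _); rewrite /= !big_cons big_nil addr0.
have e1 : \sum_(k <- iota 0 N.+2) zterm s k = \sum_(k <- iota 0 N.+1) zterm s k + zterm s N.+1.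
  by rewrite -[N.+2]addn1 iotaD big_cat; congr (_ + _); rewrite /= big_seq1.
rewrite e1 e2; apply: le_trans (lerD IH (lexx _)) _.
have h : zterm s N.*2.+3 <= zterm s N.*2.+2 by apply: zterm_le.
have e : zterm s N.*2.+2 = 2 `^ (- s) * zterm s N.+1 by rewrite -doubleS zterm_double.
rewrite [2 * 2 `^ (- s) * (_ + _)]mulrDr -(mulrA 2 _ (zterm _ _)) -e.
by move: h; move: (zterm _ _) (zterm _ _) (2 * _ * _) => a b c; clear; lra.
Qed.

(** [zsum_double] bounds the partial sum by 1 plus [2 ^ (1 - s) < 1] times itself. *)
Lemma zsum_bounded s : 1 < s -> exists B, forall N, zsum s N <= B.
Proof.
move=> s1; have s0 : 0 <= s by lra.
have q1 : 2 * 2 `^ (- s) < 1 :> R.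
  rewrite powRN ltr_pdivrMr ?powR_gt0// mul1r -[X in X < _]powRr1//.
  have -> : s = 1 + (s - 1) by lra.
  rewrite powRD_gt0// -[ltLHS]mulr1 ltr_pM2l ?powR_gt0// ?posrE//.
  have : (1 : R) `^ (s - 1) < 2 `^ (s - 1) by apply: gt0_ltr_powR; rewrite ?subr_gt0 ?nnegrE// ltr1n.
  by rewrite powR1.
exists (1 - 2 * 2 `^ (- s))^-1 => N; apply: le_trans (zsum_mono s (leqnSn N)) _.
have h : zsum s N.+1 <= 1 + 2 * 2 `^ (- s) * zsum s N.+1.
  by apply: le_trans (zsum_double N s0); apply: zsum_mono; lia.
rewrite -[leRHS]mul1r ler_pdivlMr ?subr_gt0// mulrBr mulr1.
by move: h; move: (zsum _ _) (2 * _) => a b; clear; lra.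
Qed.

Lemma zsum_cvg s : 1 < s -> zsum s N @[N --> \oo] --> zeta s.
Proof.
move=> s1; have [B HB] := zsum_bounded s1.
have h : cvgn (series (fun k => k.+1%:R `^ (- s) : R)).
  apply: nondecreasing_is_cvgn; first by apply: nondecreasing_series => k _ _; exact: powR_ge0.
  by exists B => _ [N _ <-]; rewrite -zsumS.
rewrite -cvg_shiftS; under eq_fun do rewrite zsumS; exact: h.
Qed.

Lemma zsum_le s N : 1 < s -> zsum s N <= zeta s.
Proof.
move=> s1; rewrite -(cvg_lim (@Rhausdorff R) (zsum_cvg s1)); apply: nondecreasing_cvgn_le.
  by move=> m n; exact: zsum_mono.
by apply/cvg_ex; eexists; exact: zsum_cvg.
Qed.

Lemma zeta_ge1 s : 1 < s -> 1 <= zeta s.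
Proof.
move=> s1; apply: le_trans (zsum_le 2 s1).
by rewrite /zsum /= !big_cons big_nil /zterm /= powR1 add0r addr0.
Qed.
End Zeta.

(** * Spectral form of the lattice criterion *)

Section SpectralSeries.
Variables (R : realType) (d : nat) (alpha : R).
Hypothesis alpha_gt : 1 < 2 * alpha.
Implicit Types (G : 'I_d -> R) (k z : 'I_d -> nat).

(** With [g] equal to [Gamma], the reciprocal of the lower bound of [sob_weight_ge]. *)
Definition freq_weight1 (g : R) (k : nat) : R := if k == 0%N then 1 else g ^+ 2 * k%:R `^ (- (2 * alpha)).

Definition freq_weight G k : R := \prod_(j < d) freq_weight1 (G j) (k j).

Lemma freq_weight1_ge0 g (k : nat) : 0 <= freq_weight1 g k.
Proof. by rewrite /freq_weight1; case: ifP => // _; rewrite mulr_ge0 ?sqr_ge0 ?powR_ge0. Qed.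

Lemma freq_weight_ge0 G k : 0 <= freq_weight G k.
Proof. by apply: prodr_ge0 => j _; exact: freq_weight1_ge0. Qed.

Definition lattice_crit G n z : R :=
  - 1 + n%:R^-1 * \sum_(i < n) \prod_(j < d)
    (1 + G j ^+ 2 * omega_series (2 * alpha) (Defs.frac ((i * z j)%:R / n%:R))).

Definition box_crit N G n z : R := \sum_(k <- box d N | nonzero k) freq_weight G k * avg R n z k.

Lemma cos_frac (k : nat) (x : R) : cos (2 * pi * k%:R * Defs.frac x) = cos (2 * pi * k%:R * x).
Proof.
rewrite -(cos_periodz (k%:Z * Num.floor x)); congr cos.
by rewrite /Defs.frac intrM -pmulrn; move: (_%:~R) => F; lra.
Qed.

Lemma omega_cvg (g x : R) :
  \sum_(k <- iota 0 N) freq_weight1 g k * wave k x @[N --> \oo] -->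
  1 + g ^+ 2 * omega_series (2 * alpha) (Defs.frac x).
Proof.
set u : nat -> R := fun k : nat => k.+1%:R `^ (- (2 * alpha)) * (2 * cos (2 * pi * k.+1%:R * Defs.frac x)).
have cu : cvgn (series u).
  apply: normed_cvg; apply: (@series_le_cvg _ _ (fun k : nat => 2 * k.+1%:R `^ (- (2 * alpha)))) => [k|k|k|].
  - exact: normr_ge0.
  - by rewrite mulr_ge0// powR_ge0.
  - rewrite /= normrM mulrC (ger0_norm (powR_ge0 _ _)) ler_wpM2r ?powR_ge0// normrM.
    by rewrite ger0_norm// -[leRHS]mulr1 ler_pM2l// cos_max.
  - have -> : series (fun k : nat => 2 * k.+1%:R `^ (- (2 * alpha))) = fun N => 2 * zsum (2 * alpha) N.+1 :> R.
      by apply/funext => N; rewrite zsumS /series /= mulr_sumr.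
    apply/cvg_ex; exists (2 * zeta (2 * alpha)); apply: cvgM; first exact: cvg_cst.
    by rewrite (cvg_shiftS (zsum (2 * alpha))); exact: zsum_cvg.
rewrite -cvg_shiftS.
have e N : \sum_(k <- iota 0 N.+1) freq_weight1 g k * wave k x = 1 + g ^+ 2 * series u N.
  pose F (k : nat) : R := if k == 0%N then 0 else freq_weight1 g k * wave k x.
  have -> : \sum_(k <- iota 0 N.+1) freq_weight1 g k * wave k x = 1 + \sum_(k <- iota 0 N.+1) F k.
    rewrite /= !big_cons {1}/freq_weight1 {1}/wave /= mulr1 {1}/F /= add0r; congr (_ + _).
    by rewrite big_seq [RHS]big_seq; apply: eq_bigr => -[|k]; rewrite mem_iota.
  rewrite iota_shift// /series /= mulr_sumr; congr (_ + _); apply: eq_bigr => k _.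
  by rewrite /u /F /freq_weight1 /wave /= cos_frac -mulrA.
under eq_fun do rewrite e.
by apply: cvgD; [exact: cvg_cst|apply: cvgM; [exact: cvg_cst|exact: cu]].
Qed.

(** Expanding the product of the series of [omega_series] over boxes of frequencies turns the
    average over nodes into [avg]; the constant -1 cancels the zero frequency. *)
Lemma lattice_crit_cvg G n z : (0 < n)%N -> box_crit N G n z @[N --> \oo] --> lattice_crit G n z.
Proof.
move=> n0.
have h : - 1 + n%:R^-1 * \sum_(i < n) \prod_(j < d)
     (\sum_(k <- iota 0 N) freq_weight1 (G j) k * wave k ((i * z j)%:R / n%:R)) @[N --> \oo] --> lattice_crit G n z.
  apply: cvgD; first exact: cvg_cst.
  apply: cvgM; first exact: cvg_cst.
  apply: cvg_bigsum_in => i _; apply: cvg_bigprod => j; exact: omega_cvg.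
apply: cvg_trans h; apply: near_eq_cvg; exists 1%N => // N /= N0.
under eq_bigr do rewrite -(big_box_prod (fun j (k : nat) => freq_weight1 (G j) k * wave k ((_ * z j)%:R / n%:R))).
rewrite exchange_big mulr_sumr /=.
have e k : n%:R^-1 * \sum_(i < n) \prod_(j < d) (freq_weight1 (G j) (k j) * wave (k j) ((i * z j)%:R / n%:R)) =
    freq_weight G k * avg R n z k.
  by rewrite /avg mulrCA; congr (_ * _); rewrite mulr_sumr; apply: eq_bigr => i _; rewrite big_split.
under eq_bigr do rewrite e.
rewrite (bigID (@nonzero d)) /=.
suff -> : \sum_(k <- box d N | ~~ nonzero k) freq_weight G k * avg R n z k = 1 by rewrite addrCA addNr addr0.
rewrite -[RHS](@box0 R d (fun=> 0%N) N)// big_mkcond; apply: eq_bigr => k _.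
case: (boolP (nonzero k)) => [/existsP[j kj]|/nonzeroPn ->] /=.
  by case: eqP => // e'; rewrite e' eqxx in kj.
by rewrite eqxx avg0// mulr1 /freq_weight big1// => j _; rewrite /freq_weight1 eqxx.
Qed.

Lemma box_crit_ge0 N G n z : 0 <= box_crit N G n z.
Proof. by apply: sumr_ge0 => k _; rewrite mulr_ge0 ?freq_weight_ge0 ?avg_ge0. Qed.

Lemma box_crit_mono G n z : nondecreasing_seq (fun N => box_crit N G n z).
Proof.
apply/nondecreasing_seqP => N; rewrite /box_crit big_mkcond [leRHS]big_mkcond.
apply: (box_mono (F := fun k => if nonzero k then freq_weight G k * avg R n z k else 0)) => k.
by case: ifP => // _; rewrite mulr_ge0 ?freq_weight_ge0 ?avg_ge0.
Qed.

Lemma box_crit_le N G n z : (0 < n)%N -> box_crit N G n z <= lattice_crit G n z.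
Proof.
move=> n0; rewrite -(cvg_lim (@Rhausdorff R) (@lattice_crit_cvg G n z n0)).
apply: nondecreasing_cvgn_le; first exact: box_crit_mono.
by apply/cvg_ex; eexists; exact: lattice_crit_cvg.
Qed.

Lemma lattice_crit_ge0 G n z : (0 < n)%N -> 0 <= lattice_crit G n z.
Proof. by move=> n0; apply: le_trans (box_crit_le 0 G z n0); exact: box_crit_ge0. Qed.

(** A zero weight removes a component, so every stage of the construction is an instance of the full
    criterion. *)
Definition restrict_weights G (m : nat) : 'I_d -> R := fun j => if (j < m)%N then G j else 0.

Lemma crit_sqE G n z s v :
  crit_sq alpha G n z s v = lattice_crit (restrict_weights G s.+1) n (update z s v).
Proof.
rewrite /crit_sq /lattice_crit; congr (_ + _ * _); apply: eq_bigr => i _.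
rewrite big_mkcond; apply: eq_bigr => j _; rewrite /restrict_weights ltnS /update.
by case: ifP => // _; rewrite expr0n mul0r addr0.
Qed.

End SpectralSeries.

Section PowerSums.
Variable R : realType.
Implicit Types (a b p : R).

(** For [t] equal to [a] or [b], the fraction [t / (a + b)] is at most its [p]-th power; the two
    fractions add up to 1. *)
Lemma powR_subadd a b p : 0 <= a -> 0 <= b -> 0 < p <= 1 -> (a + b) `^ p <= a `^ p + b `^ p.
Proof.
move=> a0 b0 /andP[p0 p1]; have [ab|ab] := eqVneq (a + b) 0.
  by rewrite ab powR0 ?gt_eqF// addr_ge0// powR_ge0.
have abp : 0 < a + b by rewrite lt_neqAle eq_sym ab addr_ge0.
have q (t : R) : 0 <= t -> t <= a + b -> t / (a + b) * (a + b) `^ p <= t `^ p.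
  move=> t0 tab; rewrite -ler_pdivlMr ?powR_gt0//.
  have [->|tn0] := eqVneq t 0; first by rewrite mul0r divr_ge0 ?powR_ge0.
  have tp : 0 < t by rewrite lt_neqAle eq_sym tn0.
  have -> : t `^ p / (a + b) `^ p = (t / (a + b)) `^ p.
    by rewrite powRM ?invr_ge0// ?(ltW abp)// -[in RHS]powR_inv1 ?(ltW abp)// powRAC powR_inv1 ?powR_ge0.
  by apply: ger1_powR => //; rewrite divr_gt0//= ler_pdivrMr// mul1r.
have := lerD (q a a0 _) (q b b0 _).
rewrite -mulrDl -mulrDl divff// mul1r; apply; by rewrite ?lerDl ?lerDr.
Qed.

Lemma powR_sum_le (I : Type) (s : seq I) (P : pred I) (F : I -> R) p : (forall i, 0 <= F i) -> 0 < p <= 1 ->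
  (\sum_(i <- s | P i) F i) `^ p <= \sum_(i <- s | P i) F i `^ p.
Proof.
move=> F0 p01; have /andP[p0 _] := p01; elim: s => [|i s IH].
  by rewrite !big_nil powR0 ?gt_eqF.
rewrite !big_cons; case: ifP => // _; apply: le_trans (powR_subadd _ _ p01) _ => //.
  by apply: sumr_ge0.
by rewrite lerD2l.
Qed.

Lemma powR_nat_le (n : nat) p : 0 < p <= 1 -> (n%:R : R) `^ p <= n%:R.
Proof.
move=> /andP[p0 p1]; case: n => [|n]; first by rewrite powR0 ?gt_eqF.
by apply: ler1_powR => //; rewrite ler1n.
Qed.

(** A zero limit is treated by hand, since the power function need not be differentiable there. *)
Lemma powR_cvgn (u : nat -> R) (l p : R) : 0 < p -> (forall n, 0 <= u n) -> u n @[n --> \oo] --> l ->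
  u n `^ p @[n --> \oo] --> l `^ p.
Proof.
move=> p0 u0 ul.
have l0 : 0 <= l.
  rewrite -(cvg_lim (@Rhausdorff R) ul); apply: limr_ge; first by apply/cvg_ex; exists l.
  by near=> n.
have [l00|ln0] := eqVneq l 0; last first.
  have lp : 0 < l by rewrite lt_neqAle eq_sym ln0.
  have cp : {for l, continuous (fun x : R => x `^ p)}.
    apply: differentiable_continuous; apply/derivable1_diffP.
    by apply: derivable_powR; rewrite in_itv/= andbT.
  exact: (cvg_comp u _ ul cp).
rewrite l00 powR0 ?gt_eqF//; rewrite l00 in ul.
apply/cvgrPdist_le => e e0; have ep : 0 < e `^ p^-1 by rewrite powR_gt0.
have /cvgrPdist_le /(_ _ ep) [M _ HM] := ul; exists M => // n Mn.
rewrite sub0r normrN ger0_norm ?powR_ge0//.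
have -> : e = (e `^ p^-1) `^ p by rewrite -powRrM mulVf ?gt_eqF// powRr1// ltW.
apply: ge0_ler_powR; rewrite ?nnegrE ?powR_ge0// ?(ltW p0)//.
by have := HM n Mn; rewrite sub0r normrN ger0_norm.
Unshelve. all: by end_near. Qed.

End PowerSums.

Section ComponentSums.
Variables (R : realType) (d : nat) (alpha p : R).
Hypothesis p_itv : 0 < p <= 1.
Hypothesis alphap_gt : 1 < 2 * alpha * p.
Implicit Types (G : 'I_d -> R) (k z : 'I_d -> nat) (s : 'I_d).
Notation c := (2 * alpha * p).
Notation rho := (freq_weight alpha).
Notation rho1 := (freq_weight1 alpha).

Definition Vp G : R := \prod_(j < d) (1 + 2 * G j `^ (2 * p) * zeta c).

Definition pweight (g : R) (m : nat) : R := rho1 g m `^ p * (if m == 0%N then 1 else 2).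

Lemma pweight_ge0 g m : 0 <= pweight g m.
Proof. by rewrite mulr_ge0 ?powR_ge0//; case: ifP. Qed.

Lemma freq_weight1_powR (g : R) m : 0 <= g -> m != 0%N -> rho1 g m `^ p = g `^ (2 * p) * zterm c m.
Proof.
move=> g0 m0; rewrite /freq_weight1 /zterm (negPf m0) powRM ?sqr_ge0 ?powR_ge0// -powRrM.
by rewrite -powR_mulrn// -powRrM mulNr.
Qed.

Lemma pweight0 g : pweight g 0 = 1.
Proof. by rewrite /pweight /freq_weight1 eqxx powR1 mulr1. Qed.

Lemma sum_pweight (g : R) N : 0 <= g ->
  \sum_(m <- iota 0 N.+1) pweight g m = 1 + 2 * g `^ (2 * p) * zsum c N.+1.
Proof.
move=> g0; rewrite /zsum /= !big_cons pweight0 {1}/zterm /= add0r mulr_sumr; congr (_ + _).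
rewrite big_seq [RHS]big_seq; apply: eq_bigr => -[|m]; rewrite mem_iota// => _.
by rewrite /pweight freq_weight1_powR//= mulrC mulrA.
Qed.

Lemma pweight_prod G k : (forall j, 0 <= G j) ->
  \prod_(j < d) pweight (G j) (k j) = rho G k `^ p * (twos k)%:R.
Proof.
move=> G0; rewrite big_split /=; congr (_ * _).
  rewrite /freq_weight; elim: (index_enum _) => [|j s IH]; first by rewrite !big_nil powR1.
  rewrite !big_cons powRM ?IH ?freq_weight1_ge0//; apply: prodr_ge0 => i _; exact: freq_weight1_ge0.
by rewrite /twos natr_prod; apply: eq_bigr => j _; case: ifP.
Qed.

Lemma sum_pweight_le G N : (forall j, 0 <= G j) ->
  \sum_(k <- box d N) rho G k `^ p * (twos k)%:R <= Vp G.
Proof.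
move=> G0; under eq_bigr do rewrite -pweight_prod//.
apply: (@le_trans _ _ (\sum_(k <- box d N.+1) \prod_(j < d) pweight (G j) (k j))).
  by apply: (box_mono (F := fun k => \prod_(j < d) pweight (G j) (k j))) => k; apply: prodr_ge0 => j _; exact: pweight_ge0.
rewrite (big_box_prod (fun j => pweight (G j))) /Vp; apply: ler_prod => j _.
rewrite sum_pweight// addr_ge0//=; last by rewrite !mulr_ge0 ?powR_ge0// sumr_ge0// => k _; exact: zterm_ge0.
by rewrite lerD2l ler_wpM2l ?mulr_ge0 ?powR_ge0// zsum_le.
Qed.

Lemma wave_dvd (k m n : nat) : (0 < n)%N -> k != 0%N -> (n %| k * m)%N -> wave k (m%:R / n%:R) = 2 :> R.
Proof.
move=> n0 k0 /dvdnP[q e]; rewrite /wave (negPf k0).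
have -> : 2 * pi * k%:R * (m%:R / n%:R) = 0 + q%:Z%:~R * (2 * pi) :> R.
  have : (k * m)%:R = (q * n)%:R :> R by rewrite e.
  rewrite !natrM -pmulrn add0r => h.
  have -> : 2 * pi * k%:R * (m%:R / n%:R) = 2 * pi * (k%:R * m%:R / n%:R) :> R by lra.
  by rewrite h mulfK ?pnatr_eq0 -?lt0n// mulrC.
by rewrite cos_periodz cos0 mulr1.
Qed.

Lemma avg_update_dvd n z k s v : (0 < n)%N -> (k s != 0)%N -> (n %| k s * v)%N ->
  avg R n (update z s v) k = 2 * avg R n z (update k s 0).
Proof.
move=> n0 ks nv; rewrite /avg mulrCA; congr (_ * _); rewrite mulr_sumr; apply: eq_bigr => i _.
rewrite (bigD1 s)//= [in RHS](bigD1 s)//= /update eqxx wave_dvd//; last by rewrite mulnCA dvdn_mull.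
rewrite {2}/wave eqxx mul1r; congr (_ * _); apply: eq_bigr => j js; by rewrite (negPf js).
Qed.

Lemma avg_update_zero n z k s v : k s = 0%N -> avg R n (update z s v) k = avg R n z k.
Proof.
move=> ks; rewrite /avg; congr (_ * _); apply: eq_bigr => i _; apply: eq_bigr => j _.
by rewrite /update; case: eqP => // ->; rewrite ks /wave.
Qed.

Lemma twos_update k s : k s != 0%N -> twos k = (2 * twos (update k s 0))%N.
Proof.
move=> ks; rewrite /twos (bigD1 s)//= [in RHS](bigD1 s)//= /update eqxx (negPf ks) mul1n.
by congr (_ * _)%N; apply: eq_bigr => j js; rewrite (negPf js).
Qed.

(** If [n] divides [k s], the average does not depend on [v]. Otherwise the sum over all residues is
    known, and the term [v = 0] is subtracted. *)
Lemma sum_avg_units n z k s : prime n -> k s != 0%N ->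
  \sum_(v <- iota 1 n.-1) avg R n (update z s v) k =
  if (n %| k s)%N then 2 * n.-1%:R * avg R n z (update k s 0)
  else 2 * (twos (update k s 0))%:R - 2 * avg R n z (update k s 0).
Proof.
move=> pn ks; have n0 := prime_gt0 pn; case: ifP => [nk|/negbT nk].
  rewrite (eq_bigr (fun=> 2 * avg R n z (update k s 0))); last first.
    by move=> v _; apply: avg_update_dvd => //; rewrite dvdn_mulr.
  by rewrite big_const_seq count_predT size_iota iter_addr addr0 -[_ *+ _]mulr_natl; lra.
have := sum_avg_update R z pn nk.
rewrite -(big_mkord xpredT (fun v => avg R n (update z s v) k)) /index_iota subn0 -[in iota 0 n](prednK n0).
rewrite /= big_cons (twos_update ks) natrM avg_update_dvd// ?muln0 ?dvdn0//.
by move=> <-; lra.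
Qed.

End ComponentSums.

Lemma sum_multiples (R : realType) (F : nat -> R) n N : (0 < n)%N ->
  \sum_(m <- iota 0 (N * n) | (n %| m)%N) F m = \sum_(m <- iota 0 N) F (n * m)%N.
Proof.
move=> n0; elim: N => [|N IH]; first by rewrite !big_nil.
have e1 : iota 0 N.+1 = iota 0 N ++ [:: N] by rewrite -addn1 iotaD.
have e2 : iota 0 (N.+1 * n) = iota 0 (N * n) ++ (N * n)%N :: iota (N * n).+1 n.-1.
  rewrite mulSn addnC iotaD add0n; congr (_ ++ _); move: (N * n)%N => a.
  by rewrite -[in LHS](prednK n0).
rewrite e1 e2 !big_cat /= IH big_seq1 big_cons dvdn_mull// mulnC; congr (_ + _).
rewrite big_seq_cond big1 ?addr0// => m /andP[]; rewrite mem_iota => /andP[h1 h2] /dvdnP[q e].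
have h3 : (m < N.+1 * n)%N by rewrite mulSn; lia.
by move: h1 h3; rewrite e mulnC !ltn_pmul2r// => ? ?; lia.
Qed.

Section ComponentIncrement.
Variables (R : realType) (d : nat) (alpha p : R).
Hypothesis p_itv : 0 < p <= 1.
Hypothesis alpha_gt : 1 < 2 * alpha.
Hypothesis alphap_gt : 1 < 2 * alpha * p.
Notation c := (2 * alpha * p).
Notation rho := (freq_weight alpha).
Notation rho1 := (freq_weight1 alpha).

(** Multiples of [n] are [n * m], and [n * (n * m) ^ (- c) <= m ^ (- c)] because [c > 1]. *)
Lemma sum_zterm_multiples n N : (0 < n)%N ->
  n%:R * \sum_(m <- iota 0 N | (n %| m)%N) zterm c m <= zsum c N.
Proof.
move=> n0; apply: (@le_trans _ _ (n%:R * \sum_(m <- iota 0 (N * n) | (n %| m)%N) zterm c m)).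
  rewrite ler_wpM2l// -[(N * n)%N](@subnKC N) ?leq_pmulr// iotaD big_cat /= lerDl.
  by apply: sumr_ge0 => m _; exact: zterm_ge0.
rewrite sum_multiples// mulr_sumr; apply: ler_sum => m _.
rewrite /zterm muln_eq0 eqn0Ngt n0 /=; case: ifP => _; first by rewrite mulr0.
rewrite natrM powRM// mulrA ler_piMl ?powR_ge0//.
rewrite powRN ler_pdivrMr ?powR_gt0 ?ltr0n// mul1r; apply: le1r_powR; first by rewrite ler1n.
exact: ltW.
Qed.

Variables (G : 'I_d -> R) (n : nat) (z : 'I_d -> nat) (s : 'I_d).
Hypothesis G_ge0 : forall j, 0 <= G j.
Hypothesis n_prime : prime n.
Implicit Types (k : 'I_d -> nat).

Lemma freq_weight_update_powR k m : m != 0%N ->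
  rho G (update k s m) `^ p = (\prod_(j < d | j != s) rho1 (G j) (k j)) `^ p * (G s `^ (2 * p) * zterm c m).
Proof.
move=> m0; rewrite /freq_weight (bigD1 s)//= /update eqxx mulrC.
have -> : \prod_(j < d | j != s) rho1 (G j) (if j == s then m else k j) = \prod_(j < d | j != s) rho1 (G j) (k j).
  by apply: eq_bigr => j js; rewrite (negPf js).
rewrite powRM ?freq_weight1_ge0 ?freq_weight1_powR//.
by apply: prodr_ge0 => j _; exact: freq_weight1_ge0.
Qed.

Lemma updateK k m : update (update k s m) s 0 = update k s 0.
Proof. by apply/funext => j; rewrite /update; case: eqP. Qed.

(* The coefficient of the average with zero [s]-th frequency is at most
   [n * \sum_(n | m) m ^ - c - \sum_m m ^ - c <= 0], because [1 < c]: that average may be dropped. *)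
Lemma component_sum_le N :
  \sum_(k <- box d N.+1 | k s != 0%N) rho G k `^ p * \sum_(v <- iota 1 n.-1) avg R n (update z s v) k <=
  \sum_(k <- box d N.+1 | k s != 0%N) rho G k `^ p * (twos k)%:R.
Proof.
have n0 := prime_gt0 n_prime.
rewrite big_mkcond [leRHS]big_mkcond /= !big_box.
rewrite -(sum_upd (fun k : {ffun 'I_d -> 'I_N.+1} => if (k s : nat) != 0%N then
    rho G (fun j => k j) `^ p * \sum_(v <- iota 1 n.-1) avg R n (update z s v) (fun j => k j) else 0) s).
rewrite -(sum_upd (fun k : {ffun 'I_d -> 'I_N.+1} => if (k s : nat) != 0%N then
    rho G (fun j => k j) `^ p * (twos (fun j => k j))%:R else 0) s).
apply: ler_sum => K _; rewrite -!mulr_sumr ler_wpM2l ?invr_ge0//.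
pose k j : nat := K j.
have e m : (fun j => nat_of_ord (upd K s m j)) = update k s m.
  by apply/funext => j; rewrite ffunE /update; case: ifP.
have es m : nat_of_ord (upd K s m s) = m by rewrite ffunE eqxx.
under eq_bigr do rewrite e es; under [leRHS]eq_bigr do rewrite e es.
set r := (\prod_(j < d | j != s) rho1 (G j) (k j)) `^ p; set g := G s `^ (2 * p).
set a := avg R n z (update k s 0); set t : R := (twos (update k s 0))%:R.
have a0 : 0 <= a by exact: avg_ge0.
have t0 : 0 <= t by exact: ler0n.
have rg : 0 <= r * g by rewrite mulr_ge0 ?powR_ge0.
apply: (@le_trans _ _ (\sum_(m < N.+1) (r * g) * (zterm c m * (2 * t - 2 * a + (if (n %| m)%N then 2 * n%:R * a else 0))))).
  apply: ler_sum => m _; case: ifP => [m0|/eqP ->]; last by rewrite /zterm eqxx mul0r mulr0.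
  have us : update k s m s = m by rewrite /update eqxx.
  rewrite freq_weight_update_powR// sum_avg_units// ?us// updateK -/a -/t -/r -/g mulrA -mulrA ler_wpM2l//.
  rewrite ler_wpM2l ?zterm_ge0//; case: ifP => _; last by rewrite addr0.
  have -> : n%:R = n.-1%:R + 1 :> R by rewrite natr1 prednK.
  by move: (n.-1%:R) => x; lra.
apply: (@le_trans _ _ (\sum_(m < N.+1) (r * g) * (zterm c m * (2 * t)))); last first.
  apply: ler_sum => m _; case: ifP => [m0|/eqP ->]; last by rewrite /zterm eqxx mul0r mulr0.
  by rewrite freq_weight_update_powR// (@twos_update _ (update k s m) s) ?updateK ?natrM -?/t -?/r -?/g -?mulrA// /update eqxx.
rewrite -!mulr_sumr ler_wpM2l//.
under eq_bigr do rewrite mulrDr; rewrite big_split /= -!mulr_suml.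
have eZ : \sum_(m < N.+1) zterm c m = zsum c N.+1.
  by rewrite /zsum -[in RHS](subn0 N.+1) -/(index_iota 0 N.+1) big_mkord.
have eM : \sum_(m < N.+1) zterm c m * (if (n %| m)%N then 2 * n%:R * a else 0) =
    2 * a * (n%:R * \sum_(m <- iota 0 N.+1 | (n %| m)%N) zterm c m).
  rewrite -[in RHS](subn0 N.+1) -/(index_iota 0 N.+1) big_mkord [in RHS]big_mkcond !mulr_sumr.
  by apply: eq_bigr => m _; case: ifP => _; [lra|rewrite !mulr0].
rewrite eZ eM; have := sum_zterm_multiples N.+1 n0 => h.
have : 2 * a * (n%:R * \sum_(m <- iota 0 N.+1 | (n %| m)%N) zterm c m) <= 2 * a * zsum c N.+1.
  by rewrite ler_wpM2l// mulr_ge0.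
by move: (2 * a * _) => x; clear; lra.
Qed.

Definition zero_weight : 'I_d -> R := fun j => if j == s then 0 else G j.

(** The frequencies that involve component [s]: the part of the criterion affected by the value
    [v]. *)
Definition box_theta N v : R := \sum_(k <- box d N | k s != 0%N) rho G k * avg R n (update z s v) k.

Lemma box_theta_ge0 N v : 0 <= box_theta N v.
Proof. by apply: sumr_ge0 => k _; rewrite mulr_ge0 ?freq_weight_ge0 ?avg_ge0. Qed.

(** Subadditivity moves the power inside the sum, and integrality of the averages drops it from
    them. What [component_sum_le] leaves is the part of the expanded product [Vp] in which component
    [s] contributes a nonzero frequency. *)
Lemma box_theta_powR_sum_le N :
  \sum_(v <- iota 1 n.-1) box_theta N.+1 v `^ p <= Vp alpha p G - Vp alpha p zero_weight.
Proof.
have n0 := prime_gt0 n_prime.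
apply: (@le_trans _ _ (\sum_(v <- iota 1 n.-1) \sum_(k <- box d N.+1 | k s != 0%N)
    rho G k `^ p * avg R n (update z s v) k)).
  apply: ler_sum => v _; apply: le_trans (powR_sum_le _ _ _ p_itv) _.
    by move=> k; rewrite mulr_ge0 ?freq_weight_ge0 ?avg_ge0.
  apply: ler_sum => k _; rewrite powRM ?freq_weight_ge0 ?avg_ge0// ler_wpM2l ?powR_ge0//.
  by have [A -> _] := avg_nat R (update z s v) k n0; exact: powR_nat_le.
rewrite exchange_big /=; under eq_bigr do rewrite -mulr_sumr.
apply: le_trans (component_sum_le N) _.
pose F j m : R := if j == s then (if m == 0%N then 0 else pweight alpha p (G j) m) else pweight alpha p (G j) m.
have -> : \sum_(k <- box d N.+1 | k s != 0%N) rho G k `^ p * (twos k)%:R =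
    \sum_(k <- box d N.+1) \prod_(j < d) F j (k j).
  rewrite big_mkcond; apply: eq_bigr => k _; rewrite -pweight_prod// (bigD1 s)//= [in RHS](bigD1 s)//= {1}/F eqxx.
  case: (k s == 0%N); first by rewrite mul0r.
  by congr (_ * _); apply: eq_bigr => j js; rewrite /F (negPf js).
rewrite (big_box_prod F) (bigD1 s)//= /Vp [X in _ <= X - _](bigD1 s)//= [X in _ <= _ - X](bigD1 s)//=.
rewrite [X in _ <= _ - _ * X](eq_bigr (fun j => 1 + 2 * G j `^ (2 * p) * zeta c)); last first.
  by move=> j js; rewrite /zero_weight (negPf js).
have /andP[p0 _] := p_itv.
rewrite {1}/zero_weight eqxx powR0 ?mulf_neq0 ?pnatr_eq0 ?(gt_eqF p0)// mulr0 mul0r addr0 -mulrBl addrAC subrr add0r.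
have Fs : \sum_(m <- iota 0 N.+1) F s m = 2 * G s `^ (2 * p) * zsum c N.+1.
  have := sum_pweight alpha p N (G_ge0 s); rewrite /= !big_cons pweight0 => /addrI <-.
  rewrite {1}/F !eqxx add0r big_seq [RHS]big_seq; apply: eq_bigr => -[|m]; rewrite mem_iota// => _.
  by rewrite /F eqxx.
have ge0 j : 0 <= 2 * G j `^ (2 * p) * zsum c N.+1.
  by rewrite !mulr_ge0 ?powR_ge0// sumr_ge0// => k _; exact: zterm_ge0.
have le j : 2 * G j `^ (2 * p) * zsum c N.+1 <= 2 * G j `^ (2 * p) * zeta c.
  by rewrite ler_wpM2l ?mulr_ge0 ?powR_ge0// zsum_le.
rewrite Fs; apply: ler_pM => //.
  apply: prodr_ge0 => j js; rewrite /F (negPf js) sum_pweight// addr_ge0//.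
apply: ler_prod => j js; rewrite /F (negPf js) sum_pweight// addr_ge0//= lerD2l.
exact: le.
Qed.

Lemma box_crit_update N v :
  box_crit alpha N G n (update z s v) = box_crit alpha N zero_weight n z + box_theta N v.
Proof.
rewrite /box_crit /box_theta big_mkcond [X in _ = X + _]big_mkcond [X in _ = _ + X]big_mkcond /= -big_split /=.
apply: eq_bigr => k _; have [ks|ks] := eqVneq (k s) 0%N.
  rewrite addr0 avg_update_zero//; case: ifP => // _; congr (_ * _).
  by apply: eq_bigr => j _; rewrite /zero_weight; case: eqP => // ->; rewrite ks /freq_weight1.
have -> : nonzero k by apply/existsP; exists s.
rewrite [X in _ = X * _ + _](_ : _ = 0) ?mul0r ?add0r//.
by rewrite /freq_weight (bigD1 s)//= /freq_weight1 (negPf ks) /zero_weight eqxx expr0n !mul0r.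
Qed.

(** The subtracted criterion does not depend on [v], so candidates ordered by criterion are ordered
    by [theta]. *)
Definition theta v : R := lattice_crit alpha G n (update z s v) - lattice_crit alpha zero_weight n z.

Lemma theta_cvg v : box_theta N v @[N --> \oo] --> theta v.
Proof.
have n0 := prime_gt0 n_prime.
rewrite (_ : box_theta ^~ v = fun N =>
  box_crit alpha N G n (update z s v) - box_crit alpha N zero_weight n z).
  by apply: cvgB; exact: lattice_crit_cvg.
by apply/funext => N; rewrite box_crit_update addrC addKr.
Qed.

Lemma theta_ge0 v : 0 <= theta v.
Proof.
rewrite -(cvg_lim (@Rhausdorff R) (@theta_cvg v)); apply: limr_ge; first by apply/cvg_ex; eexists; exact: theta_cvg.
by near=> N; exact: box_theta_ge0.
Unshelve. all: by end_near. Qed.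

Lemma theta_powR_sum_le :
  \sum_(v <- iota 1 n.-1) theta v `^ p <= Vp alpha p G - Vp alpha p zero_weight.
Proof.
have /andP[p0 _] := p_itv.
have h : \sum_(v <- iota 1 n.-1) box_theta N v `^ p @[N --> \oo] --> \sum_(v <- iota 1 n.-1) theta v `^ p.
  apply: cvg_bigsum_in => v _; apply: powR_cvgn => //; last exact: theta_cvg.
  by move=> N; exact: box_theta_ge0.
rewrite -(cvg_lim (@Rhausdorff R) h); apply: limr_le; first by apply/cvg_ex; eexists; exact: h.
by exists 1%N => // -[|N] //= _; exact: box_theta_powR_sum_le.
Qed.

End ComponentIncrement.

Section CandidateRank.
Variables (R : realType) (d : nat) (alpha tau : R) (G : 'I_d -> R) (n : nat) (z : 'I_d -> nat) (s : 'I_d).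
Hypothesis tau_itv : 0 < tau < 1.
Hypothesis alpha_gt : 1 < 2 * alpha.
Hypothesis n_prime : prime n.
Notation ord := (crit_order alpha G n z s).
Notation cr := (crit alpha G n z s).

Lemma crit_order_total : total ord.
Proof. by move=> v w; rewrite /crit_order; case: ltgtP => //= _; exact: leq_total. Qed.

Lemma crit_order_trans : transitive ord.
Proof.
move=> v u w; rewrite /crit_order => /orP[h1|/andP[/eqP e1 h1]] /orP[h2|/andP[/eqP e2 h2]].
- by rewrite (lt_trans h1 h2).
- by rewrite -e2 h1.
- by rewrite e1 h2.
- by rewrite e1 e2 eqxx (leq_trans h1 h2) orbT.
Qed.

Lemma crit_sq_ge0 v : 0 <= crit_sq alpha G n z s v.
Proof. by rewrite crit_sqE; apply: lattice_crit_ge0 => //; exact: prime_gt0. Qed.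

Lemma crit_order_le v w : ord v w -> crit_sq alpha G n z s v <= crit_sq alpha G n z s w.
Proof.
have h : cr v <= cr w -> crit_sq alpha G n z s v <= crit_sq alpha G n z s w.
  by rewrite /crit ler_sqrt ?crit_sq_ge0.
by move=> /orP[/ltW|/andP[/eqP e _]]; [exact: h|apply: h; rewrite e].
Qed.

Definition num_candidates : nat := `|Num.ceil (tau * n.-1%:R)|%N.

Lemma num_candidates_itv : tau * n.-1%:R <= num_candidates%:R < tau * n.-1%:R + 1.
Proof.
have /andP[t0 _] := tau_itv.
have c0 : 0 <= Num.ceil (tau * n.-1%:R).
  rewrite ceil_ge0; apply: (@lt_le_trans _ _ 0); first by rewrite ltrN10.
  by rewrite mulr_ge0// ltW.
rewrite /num_candidates natr_absz ger0_norm//.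
by rewrite ceil_ge /=; have := ceilB1_lt (tau * n.-1%:R); rewrite intrB ltrBlDr.
Qed.

(* At least [(1 - tau) (n - 1)] values have a criterion no smaller than that of a candidate. *)
Lemma candidate_average (f : nat -> R) x : x \in take num_candidates (sort ord (iota 1 n.-1)) ->
  (forall v, 0 <= f v) ->
  (forall v, crit_sq alpha G n z s x <= crit_sq alpha G n z s v -> f x <= f v) ->
  (1 - tau) * n.-1%:R * f x <= \sum_(v <- iota 1 n.-1) f v.
Proof.
set L := sort ord _ => xL f0 fle.
have -> : \sum_(v <- iota 1 n.-1) f v = \sum_(v <- L) f v.
  by apply: perm_big; rewrite perm_sym perm_sort.
have sL : size L = n.-1 by rewrite size_sort size_iota.
have xL' : x \in L by exact: mem_take xL.
pose i := index x L.
have iK : (i < num_candidates)%N by rewrite /i -in_take.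
rewrite -(cat_take_drop i L) big_cat /=; apply: le_trans (_ : \sum_(v <- drop i L) f x <= _).
  rewrite big_const_seq count_predT iter_addr addr0 size_drop sL -[leRHS]mulr_natl ler_wpM2r//.
  have /andP[_ h] := num_candidates_itv.
  have iL : (i < n.-1)%N by rewrite -sL index_mem.
  rewrite natrB ?(ltnW iL)//.
  have : i%:R + 1 <= num_candidates%:R :> R by rewrite natr1 ler_nat.
  by move: h; move: (num_candidates%:R) (i%:R) (n.-1%:R) => a b e; lra.
apply: ler_wpDl; first exact: sumr_ge0.
have : sorted ord (drop i L) by apply: drop_sorted; apply: sort_sorted; exact: crit_order_total.
rewrite (drop_index xL') /= => /(order_path_min crit_order_trans)/allP h.
rewrite big_seq [leRHS]big_seq; apply: ler_sum => v; rewrite inE => /predU1P[->//|vt].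
by apply: fle; apply: crit_order_le; exact: h.
Qed.

End CandidateRank.

(** All components other than [s] are constant on the lattice, so a single character sum remains. *)
Lemma avg_single (R : realType) (d n : nat) (k : 'I_d -> nat) (s : 'I_d) y : prime n ->
  (forall j, j != s -> (n %| k j)%N) -> k s != 0%N ->
  avg R n y k = (\prod_(j < d | j != s) (if k j == 0%N then 1 else 2)) * (if (n %| k s * y s)%N then 2 else 0).
Proof.
move=> n_prime k0 ks; have n0 := prime_gt0 n_prime; have n0' : (n%:R : R) != 0 by rewrite pnatr_eq0 -lt0n.
rewrite /avg; under eq_bigr => i _.
  rewrite (bigD1 s)//= (eq_bigr (fun j => if k j == 0%N then 1 else 2)); last first.
    move=> j js; have [e|kj] := eqVneq (k j) 0%N; first by rewrite e.
    by rewrite wave_dvd// dvdn_mulr// k0.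
  rewrite mulrC /wave (negPf ks).
  have -> : 2 * pi * (k s)%:R * ((i * y s)%:R / n%:R) = 2 * pi * ((k s * y s)%N%:Z%:~R * i%:R / n%:R) :> R.
    by rewrite -pmulrn !natrM; lra.
  over.
rewrite -!mulr_sumr sum_cos// -[(n %| _)%Z]/(n %| k s * y s)%N mulrCA; congr (_ * _).
case: ifP => _; last by rewrite !mulr0.
by rewrite mulrCA mulVf// mulr1.
Qed.

Section CriterionBound.
Variables (R : realType) (d : nat) (alpha tau p : R) (G : 'I_d -> R) (n : nat) (z : 'I_d -> nat).
Hypothesis tau_itv : 0 < tau < 1.
Hypothesis p_itv : 0 < p <= 1.
Hypothesis alpha_gt : 1 < 2 * alpha.
Hypothesis alphap_gt : 1 < 2 * alpha * p.
Hypothesis G_ge0 : forall j, 0 <= G j.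
Hypothesis n_prime : prime n.
Hypothesis z_cand : forall s, z s \in candidates alpha tau G n z s.
Notation GR := (restrict_weights G).

Lemma zero_weight_restrict (s : 'I_d) : zero_weight (GR s.+1) s = GR s.
Proof.
apply/funext => j; rewrite /zero_weight /restrict_weights ltnS; case: eqP => [->|/eqP js].
  by rewrite ltnn.
by rewrite leq_eqVlt (_ : (j == s :> nat) = false)//; exact/negbTE.
Qed.

Lemma update_id (s : 'I_d) : update z s (z s) = z.
Proof. by apply/funext => j; rewrite /update; case: eqP => // ->. Qed.

(** With one active component, a frequency counts according to whether [n] divides [k s * v], which
    does not depend on the unit [v]. Hence the prescribed first component 1 is as good as any
    other. *)
Lemma theta_first (s : 'I_d) v : s = 0%N :> nat -> (0 < v < n)%N ->
  theta alpha (GR s.+1) n z s v = theta alpha (GR s.+1) n z s 1.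
Proof.
move=> s0 /andP[v0 vn]; rewrite /theta; congr (_ - _).
have n0 := prime_gt0 n_prime.
have h y := @lattice_crit_cvg R d alpha alpha_gt (GR s.+1) n (update z s y) n0.
suff e : (fun N => box_crit alpha N (GR s.+1) n (update z s v)) = fun N => box_crit alpha N (GR s.+1) n (update z s 1).
  by have := h v; rewrite e => hv; exact: (cvg_unique (@Rhausdorff R) hv (h 1%N)).
apply/funext => N; apply: eq_bigr => k kn0.
have [k0|] := boolP [forall j : 'I_d, (j != s) ==> (k j == 0%N)]; last first.
  rewrite negb_forall => /existsP[j]; rewrite negb_imply => /andP[js kj].
  rewrite (_ : freq_weight alpha (GR s.+1) k = 0) ?mul0r//.
  rewrite /freq_weight (bigD1 j)//= /freq_weight1 (negPf kj) /restrict_weights s0 ltnS leqn0.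
  by rewrite (_ : (j == 0%N :> nat) = false) ?expr0n ?mul0r//; apply: contraNF js => /eqP e; apply/eqP/val_inj; rewrite /= e s0.
have {}k0 j : j != s -> k j = 0%N by move=> js; have /forallP/(_ j) := k0; rewrite js => /eqP.
have ks : k s != 0%N.
  have /existsP[j kj] := kn0; have [<-//|js] := eqVneq j s.
  by rewrite k0// eqxx in kj.
congr (_ * _); rewrite !(@avg_single _ _ _ k s _ n_prime)//; try by move=> j js; rewrite k0// dvdn0.
by rewrite /update eqxx muln1 Euclid_dvdM// (gtnNdvd v0 vn) orbF.
Qed.

Lemma theta_candidate (s : 'I_d) :
  (1 - tau) * n.-1%:R * theta alpha (GR s.+1) n z s (z s) `^ p <=
  \sum_(v <- iota 1 n.-1) theta alpha (GR s.+1) n z s v `^ p.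
Proof.
have /andP[p0 _] := p_itv; have /andP[t0 t1] := tau_itv.
have th0 := theta_ge0 alpha_gt (GR s.+1) z s n_prime.
have := z_cand s; rewrite /candidates; case: ifP => [/eqP s0|_ zs].
  rewrite inE => /eqP ->.
  rewrite big_seq (eq_bigr (fun=> theta alpha (GR s.+1) n z s 1 `^ p)) -?big_seq; last first.
    by move=> v; rewrite mem_iota => h; rewrite theta_first//; have := prime_gt0 n_prime; lia.
  rewrite big_const_seq count_predT size_iota iter_addr addr0 -[leRHS]mulr_natl ler_wpM2r ?powR_ge0//.
  by rewrite ler_piMl//; lra.
apply: (candidate_average tau_itv alpha_gt n_prime zs) => [v|v h]; first exact: powR_ge0.
apply: ge0_ler_powR; rewrite ?nnegrE ?(ltW p0)//.
by rewrite /theta lerD2r -!crit_sqE.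
Qed.

(** The increments are bounded by the differences of [Vp] for consecutive restrictions, which
    telescope; subadditivity splits the power of the criterion accordingly. *)
Lemma lattice_crit_restrict_le m : (m <= d)%N ->
  lattice_crit alpha (GR m) n z `^ p <= (Vp alpha p (GR m) - 1) / ((1 - tau) * n.-1%:R).
Proof.
have /andP[p0 _] := p_itv; have /andP[t0 t1] := tau_itv.
have n1 : 0 < n.-1%:R :> R by rewrite ltr0n -ltnS prednK ?prime_gt0// prime_gt1.
have q0 : 0 < (1 - tau) * n.-1%:R by rewrite mulr_gt0// subr_gt0.
have n0 : (n%:R : R) != 0 by rewrite pnatr_eq0 -lt0n prime_gt0.
elim: m => [|m IH] md.
  have -> : lattice_crit alpha (GR 0) n z = 0.
    rewrite /lattice_crit (eq_bigr (fun=> 1)); last first.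
      by move=> i _; rewrite big1// => j _; rewrite /restrict_weights /= expr0n mul0r addr0.
    by rewrite sumr_const card_ord mulVf// addNr.
  rewrite powR0 ?gt_eqF// /Vp big1 ?subrr ?mul0r// => j _.
  by rewrite /restrict_weights /= powR0 ?mulf_neq0 ?pnatr_eq0 ?(gt_eqF p0)// mulr0 mul0r addr0.
pose s := Ordinal md.
have -> : lattice_crit alpha (GR m.+1) n z = lattice_crit alpha (GR m) n z + theta alpha (GR s.+1) n z s (z s).
  by rewrite /theta update_id zero_weight_restrict /= addrC subrK.
apply: le_trans (powR_subadd _ _ p_itv) _.
- by apply: lattice_crit_ge0 => //; exact: prime_gt0.
- exact: theta_ge0.
have GRge0 j : 0 <= GR s.+1 j by rewrite /restrict_weights; case: ifP.
have h1 := theta_powR_sum_le p_itv alpha_gt alphap_gt z s GRge0 n_prime.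
have h2 := theta_candidate s.
rewrite zero_weight_restrict /= in h1.
have -> : Vp alpha p (GR m.+1) - 1 = (Vp alpha p (GR m) - 1) + (Vp alpha p (GR m.+1) - Vp alpha p (GR m)) by lra.
rewrite mulrDl lerD ?IH//; first exact: ltnW.
by rewrite ler_pdivlMr// mulrC; exact: le_trans h2 h1.
Qed.

Lemma lattice_crit_powR_le :
  lattice_crit alpha G n z `^ p <= (Vp alpha p G - 1) / ((1 - tau) * n.-1%:R).
Proof.
have := lattice_crit_restrict_le (leqnn d); rewrite (_ : GR d = G)//.
by apply/funext => j; rewrite /restrict_weights ltn_ord.
Qed.

End CriterionBound.

Lemma admissible_primesP nmax n : n \in admissible_primes nmax ->
  [/\ prime n, (n <= nmax)%N & (nmax <= 2 * n.-1)%N].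
Proof.
rewrite mem_filter mem_iota => /andP[/andP[pn un] /andP[_ h]]; split=> //.
have := odd_double_half nmax; rewrite uphalf_half in un; lia.
Qed.

Lemma admissible_primes_uniq nmax : uniq (admissible_primes nmax).
Proof. by rewrite filter_uniq// iota_uniq. Qed.

(** * The randomized rule *)

Section UniformMass.
Variable R : realType.

Lemma unif_mass_ge0 (S : seq nat) v : 0 <= unif_mass R S v.
Proof. by rewrite /unif_mass; case: ifP => // _; rewrite invr_ge0. Qed.

Lemma sum_unif_mass_le (S : seq nat) D (f : nat -> R) : uniq S -> (forall v, 0 <= f v) ->
  \sum_(v < D) unif_mass R S v * f v <= (size S)%:R^-1 * \sum_(v < D | (v : nat) \in S) f v.
Proof.
move=> uS f0; rewrite mulr_sumr [leRHS]big_mkcond; apply: ler_sum => v _.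
by rewrite /unif_mass; case: ifP => _; rewrite ?mul0r.
Qed.

Lemma sum_unif_mass_le1 (S : seq nat) D : uniq S -> \sum_(v < D) unif_mass R S v <= 1.
Proof.
move=> uS; have := @sum_unif_mass_le S D (fun=> 1) uS (fun=> ler01).
under eq_bigr do rewrite mulr1; move=> /le_trans; apply.
rewrite sumr_const; case: (posnP (size S)) => [->|S0]; first by rewrite invr0 mul0r.
rewrite ler_pdivrMl ?ltr0n// mulr1 ler_nat cardE -(size_map val).
apply: uniq_leq_size; first by rewrite map_inj_uniq ?enum_uniq//; exact: val_inj.
by move=> _ /mapP[v + ->]; rewrite mem_enum.
Qed.

End UniformMass.

Section RandomRule.
Variables (R : realType) (nmax d : nat) (alpha tau : R) (G : 'I_d -> R).
Hypothesis tau_itv : 0 < tau < 1.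
Hypothesis alpha_gt : 1 < 2 * alpha.
Hypothesis nmax_ge : (2 <= nmax)%N.
Notation T := {ffun 'I_d -> 'I_nmax.+1}.
Notation rho := (freq_weight alpha G).
Implicit Types (n : nat) (z : T) (k : 'I_d -> nat) (s : 'I_d).

Definition step_mass n s z (v : 'I_nmax.+1) : R :=
  unif_mass R (candidates alpha tau G n (fun j => z j) s) v.

Lemma candidates_uniq n (z : 'I_d -> nat) s : uniq (candidates alpha tau G n z s).
Proof. by rewrite /candidates; case: ifP => // _; rewrite take_uniq// sort_uniq iota_uniq. Qed.

Lemma candidates_local n (z y : 'I_d -> nat) s : (forall j : 'I_d, (j < s)%N -> z j = y j) ->
  candidates alpha tau G n z s = candidates alpha tau G n y s.
Proof.
move=> zy; have e : crit alpha G n z s = crit alpha G n y s.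
  apply/funext => v; congr Num.sqrt; congr (_ + _ * _); apply: eq_bigr => i _; apply: eq_bigr => j js.
  by case: eqP => // /eqP js'; rewrite zy// ltn_neqAle js'.
by rewrite /candidates (_ : crit_order _ _ _ z s = crit_order alpha G n y s)// /crit_order e.
Qed.

Lemma step_mass_local n s z (j : 'I_d) (v u : 'I_nmax.+1) : (s <= j)%N -> step_mass n s (upd z j v) u = step_mass n s z u.
Proof.
move=> sj; apply: (congr1 (fun S => unif_mass R S u)); apply: candidates_local => i js; by rewrite ffunE; case: eqP => // e; move: js; rewrite e ltnNge sj.
Qed.

Lemma step_mass_ge0 n s z v : 0 <= step_mass n s z v.
Proof. exact: unif_mass_ge0. Qed.

Lemma step_mass_le1 n s z : \sum_v step_mass n s z v <= 1.
Proof. by apply: sum_unif_mass_le1; exact: candidates_uniq. Qed.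

Definition exp_avg n k : R := \sum_(z : T) (\prod_(j < d) step_mass n j z (z j)) * avg R n (fun j => z j) k.

Lemma upd_update z s v : (fun j => nat_of_ord (upd z s v j)) = update (fun j => nat_of_ord (z j)) s v.
Proof. by apply/funext => j; rewrite ffunE /update; case: ifP. Qed.

Lemma candidates_size n (z : 'I_d -> nat) s : prime n -> s != 0%N :> nat ->
  tau * n.-1%:R <= (size (candidates alpha tau G n z s))%:R.
Proof.
move=> pn s0; rewrite /candidates (negPf s0) size_take size_sort size_iota -/(num_candidates tau n).
have /andP[h _] := num_candidates_itv n tau_itv; case: ifP => // _.
by rewrite ler_piMl//; have /andP[_ /ltW] := tau_itv.
Qed.

(* The draw of the last coordinate [s] with [k s] not divisible by [n] suffices: later ones do not affect
   the average, and the averages over all values of [z s] sum up to at most [twos k]. *)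
Lemma exp_avg_le n k : prime n -> (n <= nmax)%N -> [exists s, ~~ (n %| k s)%N] ->
  exp_avg n k <= (twos k)%:R / (tau * n.-1%:R).
Proof.
move=> pn nn /existsP[s0 ns0]; have n0 := prime_gt0 pn; have /andP[t0 t1] := tau_itv.
have n1 : 0 < n.-1%:R :> R by rewrite ltr0n -ltnS prednK// prime_gt1.
have q0 : 0 < tau * n.-1%:R by rewrite mulr_gt0.
pose s := [arg max_(s > s0 | ~~ (n %| k s)%N) (s : nat)].
have [nks smax] : ~~ (n %| k s)%N /\ forall j : 'I_d, ~~ (n %| k j)%N -> (j <= s)%N.
  by rewrite /s; case: arg_maxnP.
have ks : k s != 0%N by apply: contra nks => /eqP ->; exact: dvdn0.
have div (j : 'I_d) : (s < j)%N -> (n %| k j)%N.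
  by move=> sj; apply: contraTT sj => h; rewrite -leqNgt; exact: smax.
rewrite /exp_avg; apply: (@sequential_exp_le R d nmax (step_mass n) _ _ _ (fun z => avg R n (fun j => z j) k) s).
- exact: step_mass_ge0.
- exact: step_mass_le1.
- exact: step_mass_local.
- by move=> z; exact: avg_ge0.
- by rewrite divr_ge0// ltW.
- move=> z j v sj; rewrite upd_update; have [kj|kj] := eqVneq (k j) 0%N; first exact: avg_update_zero.
  rewrite avg_update_dvd// ?dvdn_mulr ?div// -[in RHS](update_id (fun j => nat_of_ord (z j)) j).
  by rewrite avg_update_dvd// dvdn_mulr ?div.
move=> z; under eq_bigr do rewrite upd_update.
pose y j : nat := z j.
apply: le_trans (sum_unif_mass_le _ (candidates_uniq _ _ _) (fun v => avg_ge0 _ _ _ _)) _.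
set S := candidates _ _ _ _ _ _.
have [s00|s00] := eqVneq (s : nat) 0%N.
  rewrite /S /candidates s00 eqxx /= invr1 mul1r big1; first by rewrite divr_ge0// ltW.
  move=> v; rewrite inE => /eqP ->; rewrite (@avg_single _ _ _ k s _ pn) ?div//.
    by rewrite /update eqxx muln1 (negPf nks) mulr0.
  by move=> j js; apply: div; rewrite s00 lt0n; apply: contraNneq js => e; apply/eqP/val_inj; rewrite /= e s00.
have Sle : tau * n.-1%:R <= (size S)%:R by apply: candidates_size.
have S0 : 0 < (size S)%:R :> R by exact: lt_le_trans Sle.
rewrite ler_pdivrMl// mulrA; apply: (@le_trans _ _ (twos k)%:R); last first.
  by rewrite ler_pdivlMr// mulrC ler_wpM2r.
rewrite -(sum_avg_update R y pn nks) (big_ord_widen nmax.+1 (fun v => avg R n (update y s v) k)); last exact: leqW.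
rewrite big_mkcond [leRHS]big_mkcond; apply: ler_sum => v _; case: ifP => [vS|_]; last first.
  by case: ifP => // _; exact: avg_ge0.
suff -> : (v < n)%N by [].
move: vS; rewrite /S /candidates (negPf s00) => /mem_take; rewrite mem_sort mem_iota; lia.
Qed.

Lemma exp_avg_le_twos n k : exp_avg n k <= (twos k)%:R.
Proof.
apply: (@le_trans _ _ (\sum_(z : T) (\prod_(j < d) step_mass n j z (z j)) * (twos k)%:R)).
  apply: ler_sum => z _; apply: ler_wpM2l; last exact: avg_le_twos.
  by apply: prodr_ge0 => j _; exact: step_mass_ge0.
rewrite -mulr_suml ler_piMl//; apply: sequential_mass_le1.
- exact: step_mass_ge0.
- exact: step_mass_le1.
- exact: step_mass_local.
Qed.

Lemma exp_avg_ge0 n k : 0 <= exp_avg n k.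
Proof.
apply: sumr_ge0 => z _; rewrite mulr_ge0 ?avg_ge0//.
by apply: prodr_ge0 => j _; exact: step_mass_ge0.
Qed.

Lemma cbc_massE (w : outcome nmax d) : cbc_mass alpha tau G w =
  unif_mass R (admissible_primes nmax) w.1 * \prod_(j < d) step_mass w.1 j w.2 (w.2 j).
Proof. by []. Qed.

Lemma cbc_mass_ge0 (w : outcome nmax d) : 0 <= cbc_mass alpha tau G w.
Proof. by rewrite cbc_massE mulr_ge0 ?unif_mass_ge0//; apply: prodr_ge0 => j _; exact: step_mass_ge0. Qed.

Lemma cbc_mass_support (w : outcome nmax d) : cbc_mass alpha tau G w != 0 ->
  (w.1 : nat) \in admissible_primes nmax /\
  forall s, outcome_z w s \in candidates alpha tau G w.1 (outcome_z w) s.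
Proof.
rewrite mulf_eq0 negb_or /unif_mass => /andP[h1 h2]; split.
  by move: h1; case: ifP => //; rewrite eqxx.
move=> s; move: h2; rewrite (bigD1 s)//= mulf_eq0 negb_or => /andP[+ _].
by case: ifP => //; rewrite eqxx.
Qed.

Definition unif_prime (n : nat) : R := unif_mass R (admissible_primes nmax) n.

Lemma mean_avgE k : mean_avg (@cbc_mass R nmax d alpha tau G) (fun w => w.1) (@outcome_z nmax d) k =
  \sum_(n < nmax.+1) unif_prime n * exp_avg n k.
Proof.
rewrite /mean_avg /exp_avg; under [RHS]eq_bigr do rewrite mulr_sumr.
by rewrite pair_big /=; apply: eq_bigr => w _; rewrite cbc_massE mulrA.
Qed.

Definition prob_dvd k : R := \sum_(n < nmax.+1) unif_prime n * [forall s, (n %| k s)%N]%:R.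

Definition mean_ndvd k : R := \sum_(n < nmax.+1) unif_prime n * ([exists s, ~~ (n %| k s)%N]%:R * exp_avg n k).

Lemma mean_avg_le k : mean_avg (@cbc_mass R nmax d alpha tau G) (fun w => w.1) (@outcome_z nmax d) k <=
  mean_ndvd k + (twos k)%:R * prob_dvd k.
Proof.
rewrite mean_avgE /mean_ndvd /prob_dvd mulr_sumr -big_split; apply: ler_sum => n _ /=.
rewrite [(twos k)%:R * (_ * _)]mulrCA -mulrDr ler_wpM2l ?unif_mass_ge0//.
have := exp_avg_le_twos n k; have := exp_avg_ge0 n k.
case: (boolP [forall s, (n %| k s)%N]) => [h|]; last first.
  by move=> _ _ _; rewrite mul1r mulr0 addr0.
by move=> _ h'; rewrite mul0r add0r mulr1.
Qed.

(** Every admissible prime satisfies [nmax <= 2 * (n - 1)], which brings in the factor 2. *)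
Lemma mean_ndvd_le k : mean_ndvd k <= (twos k)%:R * (2 / (tau * nmax%:R)).
Proof.
have /andP[t0 t1] := tau_itv.
have nm0 : 0 < nmax%:R :> R by rewrite ltr0n; exact: ltnW.
apply: (@le_trans _ _ (\sum_(n < nmax.+1) unif_prime n * ((twos k)%:R * (2 / (tau * nmax%:R))))); last first.
  by rewrite -mulr_suml ler_piMl ?mulr_ge0 ?invr_ge0 ?mulr_ge0 ?(ltW t0)// sum_unif_mass_le1// admissible_primes_uniq.
apply: ler_sum => n _; rewrite /unif_prime /unif_mass; case: ifP => [nA|_]; last by rewrite !mul0r.
rewrite ler_wpM2l ?invr_ge0//; have [pn nn n2] := admissible_primesP nA.
case: (boolP [exists s, ~~ (n %| k s)%N]) => h; last by rewrite mul0r !mulr_ge0 ?invr_ge0 ?mulr_ge0// ltW.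
have n1 : 0 < n.-1%:R :> R by rewrite ltr0n -ltnS prednK ?prime_gt0// prime_gt1.
rewrite mul1r; apply: le_trans (exp_avg_le pn nn h) _; rewrite ler_wpM2l//.
rewrite !invfM mulrA (mulrC 2) -mulrA ler_wpM2l ?invr_ge0 ?(ltW t0)//.
rewrite ler_pdivlMr// ler_pdivrMl//.
by rewrite mulrC -natrM ler_nat.
Qed.

Lemma twos_gt0 k : 0 < (twos k)%:R :> R.
Proof. by rewrite ltr0n /twos prodn_gt0// => j; case: ifP. Qed.

Lemma scale_prod_sqr k : scale_prod R k ^+ 2 = (twos k)%:R.
Proof.
rewrite /scale_prod -prodrXl /twos natr_prod; apply: eq_bigr => j _.
by rewrite cos_scale_sqr; case: ifP.
Qed.

(** Squaring the sum of the two parts costs a factor 2, and dividing by [scale_prod k ^ 2 = twos k]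
    cancels one [twos k]. In the square of [mean_ndvd k] one factor is estimated by [mean_ndvd_le],
    the other is summed to the expected criterion. *)
Lemma spectrum_sum_le N X : 0 <= X ->
  (forall w : outcome nmax d, cbc_mass alpha tau G w != 0 -> lattice_crit alpha G w.1 (outcome_z w) <= X) ->
  \sum_(k <- box d N | nonzero k)
    (mean_avg (@cbc_mass R nmax d alpha tau G) (fun w => w.1) (@outcome_z nmax d) k / scale_prod R k) ^+ 2 * rho k <=
  2 * (2 / (tau * nmax%:R)) * X +
  2 * \sum_(k <- box d N | nonzero k) (twos k)%:R * rho k * prob_dvd k ^+ 2.
Proof.
move=> X0 HX; have /andP[t0 t1] := tau_itv; set b := 2 / (tau * nmax%:R).
have b0 : 0 <= b by rewrite divr_ge0// mulr_ge0// ltW.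
have hb k : mean_ndvd k <= (twos k)%:R * b by exact: mean_ndvd_le.
clearbody b.
have nd0 k : 0 <= mean_ndvd k.
  by apply: sumr_ge0 => n _; rewrite !mulr_ge0 ?unif_mass_ge0 ?exp_avg_ge0.
have pd0 k : 0 <= prob_dvd k by apply: sumr_ge0 => n _; rewrite mulr_ge0 ?unif_mass_ge0.
apply: (@le_trans _ _ (\sum_(k <- box d N | nonzero k)
    (2 * b * (mean_ndvd k * rho k) + 2 * ((twos k)%:R * rho k * prob_dvd k ^+ 2)))).
  apply: ler_sum => k _; rewrite expr_div_n scale_prod_sqr.
  have m0 : 0 <= mean_avg (@cbc_mass R nmax d alpha tau G) (fun w => w.1) (@outcome_z nmax d) k.
    by rewrite mean_avgE; apply: sumr_ge0 => n _; rewrite mulr_ge0 ?unif_mass_ge0 ?exp_avg_ge0.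
  have h1 := mean_avg_le k; have h2 := hb k.
  have r0 := freq_weight_ge0 alpha G k; have w0 := twos_gt0 k.
  have -> : 2 * b * (mean_ndvd k * rho k) + 2 * ((twos k)%:R * rho k * prob_dvd k ^+ 2) =
    (2 * b * mean_ndvd k + 2 * (twos k)%:R * prob_dvd k ^+ 2) * rho k by lra.
  rewrite ler_wpM2r// ler_pdivrMr//.
  apply: (@le_trans _ _ ((mean_ndvd k + (twos k)%:R * prob_dvd k) ^+ 2)).
    by apply: lerXn2r; rewrite ?nnegrE// addr_ge0// mulr_ge0// ltW.
  have h3 : mean_ndvd k ^+ 2 <= mean_ndvd k * ((twos k)%:R * b) by rewrite expr2 ler_wpM2l.
  have := sqr_ge0 (mean_ndvd k - (twos k)%:R * prob_dvd k).
  move: h3; rewrite !expr2; move: (mean_ndvd k) ((twos k)%:R) (prob_dvd k) => a t q h3 h4.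
  by lra.
rewrite big_split /= -!mulr_sumr lerD2r ler_wpM2l ?mulr_ge0//.
apply: (@le_trans _ _ (\sum_(w : outcome nmax d) cbc_mass alpha tau G w * box_crit alpha N G w.1 (outcome_z w))).
  under [leRHS]eq_bigr do rewrite /box_crit mulr_sumr.
  rewrite exchange_big /=; apply: ler_sum => k _.
  rewrite (_ : \sum_w _ = rho k * mean_avg (@cbc_mass R nmax d alpha tau G) (fun w => w.1) (@outcome_z nmax d) k).
    rewrite mulrC ler_wpM2l ?freq_weight_ge0// mean_avgE; apply: ler_sum => n _.
    rewrite ler_wpM2l ?unif_mass_ge0// ler_piMl ?exp_avg_ge0//.
    by case: [exists _, _].
  by rewrite mulr_sumr; apply: eq_bigr => w _; rewrite mulrCA.
apply: (@le_trans _ _ (\sum_(w : outcome nmax d) cbc_mass alpha tau G w * X)).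
  apply: ler_sum => w _; have [->|w0] := eqVneq (cbc_mass alpha tau G w) 0; first by rewrite !mul0r.
  rewrite ler_wpM2l ?cbc_mass_ge0//; apply: le_trans (HX w w0).
  have [/admissible_primesP[pn _ _] _] := cbc_mass_support w0.
  by apply: box_crit_le => //; exact: prime_gt0.
rewrite -mulr_suml ler_piMl//.
rewrite -(pair_bigA _ (fun (n : 'I_nmax.+1) (z : T) => unif_prime n * \prod_(j < d) step_mass n j z (z j))) /=.
apply: (@le_trans _ _ (\sum_(n < nmax.+1) unif_prime n)); last first.
  by apply: sum_unif_mass_le1; exact: admissible_primes_uniq.
apply: ler_sum => n _; rewrite -mulr_sumr ler_piMr ?unif_mass_ge0//.
apply: sequential_mass_le1.
- exact: step_mass_ge0.
- exact: step_mass_le1.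
- exact: step_mass_local.
Qed.

End RandomRule.

Lemma powRN_nat_le1 (R : realType) (s : R) n : 0 <= s -> (0 < n)%N -> n%:R `^ (- s) <= 1.
Proof.
by move=> s0 n0; have := zterm_le s0 (ltn0Sn 0) n0; rewrite /zterm gtn_eqF//= powR1.
Qed.

Section DivisibleFrequencies.
Variables (R : realType) (d : nat) (alpha : R) (G : 'I_d -> R).
Hypothesis alpha_gt : 1 < 2 * alpha.
Hypothesis G_itv : forall j, 0 <= G j <= 1.
Notation rho := (freq_weight alpha G).
Implicit Types (k : 'I_d -> nat) (p : R).

Definition weight_sum N : R := \sum_(k <- box d N | nonzero k) (twos k)%:R * rho k.

Lemma sum_box_zero (F : ('I_d -> nat) -> R) N :
  \sum_(k <- box d N.+1 | ~~ nonzero k) F k = F (fun=> 0%N).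
Proof.
rewrite -[RHS]mul1r -[in RHS](@box0 R d (fun=> 0%N) N.+1)// mulr_suml big_mkcond; apply: eq_bigr => k _.
case: (boolP (nonzero k)) => [/existsP[j kj]|/nonzeroPn ->] /=; last by rewrite eqxx mul1r.
by case: eqP => [e|_]; [rewrite e eqxx in kj|rewrite mul0r].
Qed.

Lemma sum_box_nonzero_mono (F : ('I_d -> nat) -> R) N : (forall k, 0 <= F k) ->
  \sum_(k <- box d N | nonzero k) F k <= \sum_(k <- box d N.+1 | nonzero k) F k.
Proof.
move=> F0; rewrite big_mkcond [leRHS]big_mkcond.
by apply: (box_mono (F := fun k => if nonzero k then F k else 0)) => k; case: ifP.
Qed.

Lemma twos0 : twos ((fun=> 0%N) : 'I_d -> nat) = 1%N.
Proof. by rewrite /twos big1. Qed.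

Lemma freq_weight_zero : rho (fun=> 0%N) = 1.
Proof. by rewrite /freq_weight big1// => j _; rewrite /freq_weight1 eqxx. Qed.

Lemma G_ge0 j : 0 <= G j. Proof. by have /andP[] := G_itv j. Qed.

Lemma sum_nonzero_powR_le p N : 0 < p <= 1 -> 1 < 2 * alpha * p ->
  \sum_(k <- box d N | nonzero k) rho k `^ p * (twos k)%:R <= Vp alpha p G - 1.
Proof.
move=> p01 ap; apply: le_trans (sum_box_nonzero_mono _ _) _.
  by move=> k; rewrite mulr_ge0 ?powR_ge0.
rewrite lerBrDr; apply: le_trans (sum_pweight_le ap N.+1 G_ge0).
by rewrite [leRHS](bigID (@nonzero d)) /= sum_box_zero twos0 freq_weight_zero powR1 mulr1.
Qed.

Lemma freq_weight_le1 k : rho k <= 1.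
Proof.
rewrite /freq_weight; apply: prodr_ile1 => j _.
rewrite freq_weight1_ge0 /freq_weight1 /=; case: eqP => [_|/eqP kj]; first exact: lexx.
have /andP[g0 g1] := G_itv j; rewrite -[leRHS]mul1r; apply: ler_pM; rewrite ?sqr_ge0 ?powR_ge0//.
  by rewrite exprn_ile1.
by apply: powRN_nat_le1; [exact: ltW (lt_trans ltr01 alpha_gt)|rewrite lt0n].
Qed.

(** All weights are at most 1, so [rho k <= rho k ^ p]; here the bound on [gamma] enters through
    [G j <= 1]. *)
Lemma weight_sum_le p N : 0 < p <= 1 -> 1 < 2 * alpha * p -> weight_sum N <= Vp alpha p G - 1.
Proof.
move=> p01 ap; apply: le_trans (sum_nonzero_powR_le N p01 ap); have /andP[p0 p1] := p01.
apply: ler_sum => k _; rewrite mulrC ler_wpM2r//.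
have [->|r0] := eqVneq (rho k) 0; first exact: powR_ge0.
by apply: ger1_powR => //; rewrite freq_weight_le1 lt_neqAle eq_sym r0 freq_weight_ge0.
Qed.

(** Subadditivity, together with [(twos k) ^ p <= twos k] for a natural number. This bound is
    stronger than [weight_sum_le] when [Vp - 1] is small. *)
Lemma weight_sum_powR_le p N : 0 < p <= 1 -> 1 < 2 * alpha * p ->
  weight_sum N `^ p <= Vp alpha p G - 1.
Proof.
move=> p01 ap; apply: le_trans (sum_nonzero_powR_le N p01 ap).
apply: le_trans (powR_sum_le _ _ _ p01) _; first by move=> k; rewrite mulr_ge0 ?freq_weight_ge0.
apply: ler_sum => k _; rewrite powRM ?freq_weight_ge0// mulrC ler_wpM2l ?powR_ge0//.
exact: powR_nat_le.
Qed.

Lemma weight_sum_ge0 N : 0 <= weight_sum N.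
Proof. by apply: sumr_ge0 => k _; rewrite mulr_ge0 ?freq_weight_ge0. Qed.

(** As a function of [q] the product is a polynomial with nonnegative coefficients, hence convex,
    and lies below its chord on [[0, 1]]. The second conjunct serves the induction. *)
Lemma prod_shrink_le (I : Type) (s : seq I) (x : I -> R) q : 0 <= q <= 1 -> (forall i, 0 <= x i) ->
  \prod_(i <- s) (1 + q * x i) <= 1 - q + q * \prod_(i <- s) (1 + x i) /\ 1 <= \prod_(i <- s) (1 + x i).
Proof.
move=> /andP[q0 q1] x0; elim: s => [|i s [IH1 IH2]]; first by rewrite !big_nil; split; lra.
rewrite !big_cons; have xi := x0 i; split; last first.
  by rewrite -[leLHS]mul1r; apply: ler_pM => //; lra.
apply: le_trans (ler_wpM2l _ IH1) _; first by rewrite addr_ge0// mulr_ge0.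
move: (\prod_(j <- s) _) IH2 => P P1.
have h : 0 <= (q * x i) * ((1 - q) * (P - 1)) by rewrite !mulr_ge0// subr_ge0.
by move: h; lra.
Qed.

(** Restriction to multiples of [L] gains the factor [q] in every component with nonzero frequency.
    The chord bound of [prod_shrink_le] keeps a single [q] in front of the sum without its zero
    frequency. *)
Lemma sum_twos_freq_weight_multiples_le L N : (0 < L)%N ->
  \sum_(k <- box d N.+1 | nonzero k && [forall s, (L %| k s)%N]) (twos k)%:R * rho k <=
  L%:R `^ (- (2 * alpha)) * weight_sum N.+1.
Proof.
move=> L0; set q : R := L%:R `^ _.
have q01 : 0 <= q <= 1.
  by rewrite powR_ge0 /=; apply: powRN_nat_le1 => //; exact: ltW (lt_trans ltr01 alpha_gt).
have sumE (F : ('I_d -> nat) -> R) : F (fun=> 0%N) = 1 ->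
    \sum_(k <- box d N.+1) F k = 1 + \sum_(k <- box d N.+1 | nonzero k) F k.
  by move=> F0; rewrite (bigID (@nonzero d)) /= sum_box_zero F0 addrC.
pose pw j := pweight alpha 1 (G j).
have pwE k : \prod_(j < d) pw j (k j) = (twos k)%:R * rho k.
  by rewrite /pw pweight_prod ?powRr1 ?freq_weight_ge0 1?mulrC//; exact: G_ge0.
pose x j : R := 2 * G j `^ (2 * 1) * zsum (2 * alpha * 1) N.+1.
have x0 j : 0 <= x j by rewrite !mulr_ge0 ?powR_ge0// sumr_ge0// => m _; exact: zterm_ge0.
have [h1 _] := prod_shrink_le (index_enum 'I_d) q01 x0.
have e1 : \prod_(j < d) (1 + x j) = 1 + weight_sum N.+1.
  rewrite /weight_sum -(sumE (fun k => (twos k)%:R * rho k)); last by rewrite twos0 freq_weight_zero mulr1.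
  under [RHS]eq_bigr do rewrite -pwE; rewrite (big_box_prod pw); apply: eq_bigr => j _.
  by rewrite /pw sum_pweight ?G_ge0.
pose F j m : R := if (L %| m)%N then pw j m else 0.
have e2 : \prod_(j < d) \sum_(m <- iota 0 N.+1) F j m =
    1 + \sum_(k <- box d N.+1 | nonzero k && [forall s, (L %| k s)%N]) (twos k)%:R * rho k.
  rewrite -(big_box_prod F) sumE.
    rewrite big_mkcondr; congr (_ + _); apply: eq_bigr => k _; case: ifP => [/forallP h|/negbT].
      by rewrite -pwE; apply: eq_bigr => j _; rewrite /F h.
    by rewrite negb_forall => /existsP[j h]; rewrite (bigD1 j)//= /F (negPf h) mul0r.
  by rewrite big1// => j _; rewrite /F dvdn0 /pw pweight0.
have h2 : \prod_(j < d) \sum_(m <- iota 0 N.+1) F j m <= \prod_(j < d) (1 + q * x j).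
  apply: ler_prod => j _; rewrite sumr_ge0 /=; last first.
    by move=> m _; rewrite /F; case: ifP => // _; exact: pweight_ge0.
  have -> : \sum_(m <- iota 0 N.+1) F j m =
      1 + 2 * G j `^ (2 * 1) * \sum_(m <- iota 0 N.+1 | (L %| m)%N) zterm (2 * alpha * 1) m.
    rewrite /= !big_cons dvdn0 {1}/F dvdn0 /pw pweight0 {1}/zterm /= add0r mulr_sumr [in RHS]big_mkcond; congr (_ + _).
    rewrite big_seq [RHS]big_seq; apply: eq_bigr => -[|m]; rewrite mem_iota// => _.
    rewrite /F; case: ifP => // _; rewrite /pw /pweight /= freq_weight1_powR ?G_ge0//.
    by rewrite mulrC mulrA.
  rewrite lerD2l /x mulrCA ler_wpM2l ?mulr_ge0 ?powR_ge0//.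
  apply: (@le_trans _ _ (\sum_(m <- iota 0 (N.+1 * L) | (L %| m)%N) zterm (2 * alpha * 1) m)).
    rewrite -[(N.+1 * L)%N](@subnKC N.+1) ?leq_pmulr// iotaD big_cat /= lerDl.
    by apply: sumr_ge0 => m _; exact: zterm_ge0.
  rewrite sum_multiples// /zsum mulr_sumr; apply: ler_sum => m _.
  rewrite /zterm muln_eq0 eqn0Ngt L0 /=; case: ifP => _; first by rewrite mulr0.
  by rewrite natrM powRM// /q mulr1.
move: h1; rewrite e1; move: h2; rewrite e2; clear.
by move: (\sum_(k <- _ | _) _) (\prod_(_ <- _) _) (weight_sum _) => a b c; lra.
Qed.

Variable nmax : nat.
Hypothesis nmax_ge : (2 <= nmax)%N.
Notation M := ((size (admissible_primes nmax))%:R : R).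
Notation u := (unif_prime R nmax).

(* Squaring the probability gives pairs of primes; if both divide [k], so does [n] for equal primes and
   [n * m] for distinct ones, and the diagonal pairs carry only the fraction [1 / M]. *)
Lemma prob_dvd_sum_le N W : (forall N, weight_sum N <= W) ->
  \sum_(k <- box d N | nonzero k) (twos k)%:R * rho k * prob_dvd R nmax k ^+ 2 <=
  W * ((nmax%:R / 2) `^ (- (2 * alpha)) / M + ((nmax%:R / 2) `^ (- (2 * alpha))) ^+ 2).
Proof.
move=> HW; have W0 : 0 <= W by apply: le_trans (HW 0%N); exact: weight_sum_ge0.
have nm0 : 0 < nmax%:R / 2 :> R by rewrite divr_gt0// ltr0n; exact: ltnW.
set h : R := (nmax%:R / 2) `^ _; have h0 : 0 <= h by exact: powR_ge0.
have u0 n : 0 <= u n by exact: unif_mass_ge0.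
have big_n n : n \in admissible_primes nmax -> n%:R `^ (- (2 * alpha)) <= h.
  move=> /admissible_primesP[pn _ n2].
  have n0 : 0 < n%:R :> R by rewrite ltr0n prime_gt0.
  have s0 : 0 <= 2 * alpha by exact: ltW (lt_trans ltr01 alpha_gt).
  rewrite /h !powRN lef_pV2 ?posrE ?powR_gt0//; apply: ge0_ler_powR; rewrite ?nnegrE ?(ltW nm0) ?(ltW n0)//.
  rewrite ler_pdivrMr// -natrM ler_nat; apply: leq_trans n2 _.
  by rewrite mulnC leq_mul2r leq_pred.
apply: le_trans (sum_box_nonzero_mono _ _) _.
  by move=> k; rewrite mulr_ge0 ?sqr_ge0// mulr_ge0// freq_weight_ge0.
have pd2 k : prob_dvd R nmax k ^+ 2 = \sum_(n < nmax.+1) \sum_(m < nmax.+1)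
    u n * u m * ([forall s, (n %| k s)%N] && [forall s, (m %| k s)%N])%:R.
  rewrite expr2 /prob_dvd big_distrlr /=; apply: eq_bigr => n _; apply: eq_bigr => m _.
  by rewrite mulrACA -natrM mulnb.
under eq_bigr do rewrite pd2 mulr_sumr; rewrite exchange_big /=.
under eq_bigr do (under eq_bigr do rewrite mulr_sumr; rewrite exchange_big /=).
have key (n m : nat) : n \in admissible_primes nmax -> m \in admissible_primes nmax ->
   \sum_(k <- box d N.+1 | nonzero k) (twos k)%:R * rho k * ([forall s, (n %| k s)%N] && [forall s, (m %| k s)%N])%:R
   <= W * ((if n == m then h else 0) + h ^+ 2).
  move=> nA mA; have [pn _ _] := admissible_primesP nA; have [pm _ _] := admissible_primesP mA.
  pose L := (if n == m then n else n * m)%N.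
  have L0 : (0 < L)%N by rewrite /L; case: ifP => _; rewrite ?muln_gt0 !prime_gt0.
  have Lh : L%:R `^ (- (2 * alpha)) <= (if n == m then h else 0) + h ^+ 2.
    rewrite /L; case: ifP => _; first by apply: le_trans (big_n n nA) _; rewrite lerDl sqr_ge0.
    by rewrite add0r natrM powRM// expr2; apply: ler_pM; rewrite ?powR_ge0// big_n.
  have LW : L%:R `^ (- (2 * alpha)) * weight_sum N.+1 <= W * ((if n == m then h else 0) + h ^+ 2).
    by rewrite mulrC; apply: ler_pM; rewrite ?powR_ge0 ?weight_sum_ge0.
  apply: le_trans LW; apply: le_trans (sum_twos_freq_weight_multiples_le N L0).
  rewrite big_mkcondr; apply: ler_sum => k _.
  have [/andP[/forallP hn /forallP hm]|_] := boolP ([forall s, (n %| k s)%N] && [forall s, (m %| k s)%N]); last first.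
    by rewrite mulr0; case: ifP => // _; rewrite mulr_ge0 ?freq_weight_ge0.
  rewrite mulr1 (_ : [forall s, (L %| k s)%N])//; apply/forallP => s; rewrite /L; case: eqP => // /eqP nm.
  by rewrite Gauss_dvd ?hn ?hm// prime_coprime// dvdn_prime2.
apply: (@le_trans _ _ (\sum_(n < nmax.+1) \sum_(m < nmax.+1) u n * u m * (W * ((if n == m :> nat then h else 0) + h ^+ 2)))).
  apply: ler_sum => n _; apply: ler_sum => m _.
  under eq_bigr do rewrite mulrCA; rewrite -mulr_sumr.
  rewrite /unif_prime /unif_mass; case: ifP => nA; last by rewrite !mul0r.
  case: ifP => mA; last by rewrite !(mulr0, mul0r).
  by rewrite ler_wpM2l ?mulr_ge0 ?invr_ge0// key.
have us : \sum_(n < nmax.+1) u n <= 1 by apply: sum_unif_mass_le1; exact: admissible_primes_uniq.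
apply: (@le_trans _ _ (\sum_(n < nmax.+1) u n * (W * (h / M + h ^+ 2)))); last first.
  by rewrite -mulr_suml ler_piMl// mulr_ge0// addr_ge0 ?sqr_ge0// divr_ge0.
apply: ler_sum => n _; under eq_bigr do rewrite -mulrA; rewrite -mulr_sumr ler_wpM2l//.
under eq_bigr do rewrite mulrCA; rewrite -mulr_sumr ler_wpM2l//.
under eq_bigr do rewrite mulrDr; rewrite big_split /= lerD//; last first.
  by rewrite -mulr_suml ler_piMl// sqr_ge0.
rewrite (bigD1 n)//= eqxx big1 ?addr0; last first.
  by move=> m mn; rewrite (_ : (n == m :> nat) = false) ?mulr0// eq_sym; exact/negbTE.
rewrite mulrC ler_wpM2l// /unif_prime /unif_mass; by case: ifP => //; rewrite invr_ge0.
Qed.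

End DivisibleFrequencies.

Lemma powR_div (R : realType) (a b r : R) : 0 <= a -> 0 < b -> (a / b) `^ r = a `^ r / b `^ r.
Proof.
move=> a0 b0; rewrite powRM ?invr_ge0 ?(ltW b0)//; congr (_ * _).
by rewrite -[in LHS]powR_inv1 ?(ltW b0)// powRAC powR_inv1 ?powR_ge0.
Qed.

Section Regrouping.
Variables (R : realType) (a b c e t n : R).

(** Stated for bare variables, so that powers and inverses are atoms for linear arithmetic. *)
Lemma regroup_ratio : 2 / c * (a / e) * (c * b) = a * (2 * b / e) * (c / c).
Proof. by lra. Qed.

Lemma regroup_cancel : 16 / c * a * (c * b) = 16 * (a * b) * (c / c).
Proof. by lra. Qed.

Lemma regroup_main : 2 * (2 * (t^-1 * n^-1)) * (a * (b * e)) = 4 / t * a * (b * (e * n^-1)).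
Proof. by lra. Qed.

Lemma regroup_sum : (a + 2 * b) * (c * e) = a * (c * e) + 2 * (c * (b * e)).
Proof. by lra. Qed.
End Regrouping.

(** * Exponents and constants of the final bound *)

Section Assembly.
Variables (R : realType) (alpha lambda delta tau : R) (d : nat) (gamma : 'I_d -> R) (nmax : nat).
Hypothesis lambda_gt : 2^-1 < lambda.
Hypothesis delta_gt0 : 0 < delta.
Hypothesis delta_lt : delta < lambda - 2^-1.
Hypothesis tau_itv : 0 < tau < 1.
Hypothesis alpha_itv : 2^-1 < alpha < 2.
Hypothesis lambda_lt : lambda < alpha.
Hypothesis d_gt0 : (0 < d)%N.
Hypothesis gamma_itv : forall j, 0 < gamma j <= kappa alpha `^ 2^-1.
Hypothesis nmax_ge : (2 <= nmax)%N.
Hypothesis nmax_inf : 2 * inf [set (V alpha l gamma - 1) / (1 - tau) | l in [set l : R | 2^-1 <= l < alpha]] <= nmax%:R.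
Notation G := (Gamma alpha gamma).
Notation y := (V alpha lambda gamma - 1).
Notation eps := (2 * (lambda - delta)).

(** Read off from the hypotheses: if [kappa] vanished, no positive [gamma j] could satisfy the upper
    bound, and [d > 0] supplies some [j]. *)
Lemma kappa_gt0 : 0 < kappa alpha.
Proof.
rewrite lt_neqAle kappa_ge0// andbT eq_sym; apply/eqP => k0.
have := gamma_itv (Ordinal d_gt0); rewrite k0 powR0 ?invr_eq0 ?pnatr_eq0// => /andP[h1 h2].
by have := lt_le_trans h1 h2; rewrite ltxx.
Qed.

Lemma Gamma_itv j : 0 < G j <= 1.
Proof.
have k0 := kappa_gt0; have /andP[g0 g1] := gamma_itv j.
rewrite /Gamma powRN mulr_gt0 ?invr_gt0 ?powR_gt0//=.
by rewrite mulrC ler_pdivrMr ?powR_gt0// mul1r.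
Qed.

Lemma Gamma_ge0 j : 0 <= G j. Proof. by have /andP[/ltW] := Gamma_itv j. Qed.

Lemma Gamma_unit_itv j : 0 <= G j <= 1.
Proof. by have /andP[/ltW -> ->] := Gamma_itv j. Qed.

Lemma Gamma_sqr j : G j ^+ 2 = gamma j ^+ 2 / kappa alpha.
Proof.
rewrite /Gamma exprMn mulrC; congr (_ * _).
have k0 := kappa_gt0; rewrite -powR_mulrn ?powR_ge0// -powRrM.
by rewrite mulNr mulVf ?pnatr_eq0// powR_inv1// ltW.
Qed.

Lemma alpha2_gt1 : 1 < 2 * alpha.
Proof. by have := alpha_itv; lra. Qed.

Lemma freq_weight_sob_weights_ge1 k : 1 <= freq_weight alpha G k * sob_weights alpha gamma k.
Proof.
rewrite /freq_weight /sob_weights -big_split /=.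
rewrite -[leLHS](_ : \prod_(j < d) 1 = 1); last by rewrite big1.
apply: ler_prod => j _; rewrite ler01 /=.
rewrite /freq_weight1; case: (posnP (k j)) => [->|kj]; first by rewrite sob_weight0 mulr1.
have /andP[g0 _] := gamma_itv j; have k0 := kappa_gt0.
have h := sob_weight_ge (gamma j) alpha_itv kj.
have kp : 0 < (k j)%:R `^ (2 * alpha) by rewrite powR_gt0// ltr0n.
rewrite Gamma_sqr powRN.
set w := sob_weight _ _ _ in h *; set q := _ `^ _ in h kp *.
have g2 : 0 < gamma j ^+ 2 by rewrite exprn_gt0.
have : (gamma j ^+ 2 / kappa alpha / q) * (kappa alpha / gamma j ^+ 2 * q) <= gamma j ^+ 2 / kappa alpha / q * w.
  by apply: ler_wpM2l h; apply: ltW; rewrite !divr_gt0.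
apply: le_trans; rewrite le_eqVlt; apply/orP; left; apply/eqP.
by rewrite mulrACA mulVf ?gt_eqF// mulr1 -[kappa alpha / _]invf_div mulfV// gt_eqF// divr_gt0.
Qed.

Lemma V_Vp l : 0 < l -> V alpha l gamma = Vp alpha (2 * l)^-1 G.
Proof.
move=> l0; apply: eq_bigr => j _; congr (1 + 2 * _ `^ _ * zeta _); rewrite invfM.
  by rewrite mulrA mulfV// mul1r.
by rewrite mulrACA mulfV ?pnatr_eq0// mul1r.
Qed.

Lemma exponent_itv l : 2^-1 <= l < alpha -> 0 < (2 * l)^-1 <= 1 /\ 1 < 2 * alpha * (2 * l)^-1.
Proof.
move=> /andP[l1 l2]; have l0 : 0 < 2 * l by lra.
rewrite invr_gt0 l0 invf_le1//=; split; first by lra.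
by rewrite ltr_pdivlMr// mul1r ltr_pM2l.
Qed.

Lemma zeta_gt0 l : 2^-1 <= l < alpha -> 0 < zeta (alpha / l).
Proof.
move=> /andP[l1 l2]; apply: lt_le_trans ltr01 _; apply: zeta_ge1.
by rewrite ltr_pdivlMr ?mul1r//; lra.
Qed.

Lemma V_gt1 l : 2^-1 <= l < alpha -> 1 < V alpha l gamma.
Proof.
move=> hl; have z0 := zeta_gt0 hl.
have t0 j : 0 < 2 * G j `^ l^-1 * zeta (alpha / l).
  by rewrite !mulr_gt0// powR_gt0//; have /andP[] := Gamma_itv j.
rewrite /V (bigD1 (Ordinal d_gt0))//=.
have P1 : 1 <= \prod_(j < d | j != Ordinal d_gt0) (1 + 2 * G j `^ l^-1 * zeta (alpha / l)).
  rewrite -[leLHS](_ : \prod_(j < d | j != Ordinal d_gt0) 1 = 1); last by rewrite big1.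
  by apply: ler_prod => j _; rewrite ler01 lerDl ltW.
apply: (@lt_le_trans _ _ (1 + 2 * G (Ordinal d_gt0) `^ l^-1 * zeta (alpha / l))); first by rewrite ltrDl.
by rewrite ler_peMr// addr_ge0// ltW.
Qed.

Lemma lambda_itv : 2^-1 <= lambda < alpha.
Proof. by rewrite lambda_lt ltW. Qed.

Lemma y_gt0 : 0 < y.
Proof. by rewrite subr_gt0; apply: V_gt1; exact: lambda_itv. Qed.

Lemma eps_itv : 1 <= eps <= 2 * lambda.
Proof. by have := delta_lt; have := delta_gt0; lra. Qed.

(** For [x <= 1] the exponent [2 * lambda] may be lowered to [eps]; for [x > 1] either alternative
    suffices, because [1 <= eps]. *)
Lemma min_powR_le (b : R) x : 0 < x -> b <= x `^ (2 * lambda) -> b <= x \/ b <= 1 -> b <= x `^ eps.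
Proof.
move=> x0 h1 h2; have /andP[e1 e2] := eps_itv.
case: (leP x 1) => x1; first by apply: le_trans h1 _; apply: ger_powR => //; rewrite x0.
have h3 : x <= x `^ eps by apply: le1r_powR => //; exact: ltW.
by case: h2 => h; apply: le_trans h _ => //; apply: le_trans (ltW x1) h3.
Qed.

Lemma weight_sum_le_eps N : weight_sum alpha G N <= y `^ eps.
Proof.
have [p01 ap] := exponent_itv lambda_itv; have l0 : 0 < lambda by have := lambda_gt; lra.
have h := weight_sum_powR_le Gamma_unit_itv N p01 ap.
have := weight_sum_le alpha2_gt1 Gamma_unit_itv N p01 ap.
rewrite -V_Vp// in h * => h2.
apply: min_powR_le; [exact: y_gt0| |by left].
have -> : weight_sum alpha G N = (weight_sum alpha G N `^ (2 * lambda)^-1) `^ (2 * lambda).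
  by rewrite -powRrM mulVf ?powRr1 ?weight_sum_ge0// gt_eqF// mulr_gt0.
by apply: ge0_ler_powR; rewrite ?nnegrE ?powR_ge0 ?(ltW y_gt0)// mulr_ge0// ltW.
Qed.

Section Outcome.
Variable w : outcome nmax d.
Hypothesis w_mass : cbc_mass alpha tau G w != 0.
Notation L := (lattice_crit alpha G w.1 (outcome_z w)).
Notation n1 := ((w.1 : nat).-1%:R : R).

Lemma outcome_prime : prime w.1.
Proof. by have [/admissible_primesP[]] := cbc_mass_support w_mass. Qed.

Lemma outcome_ge : nmax%:R <= 2 * n1.
Proof. by have [/admissible_primesP[_ _ h] _] := cbc_mass_support w_mass; rewrite -natrM ler_nat. Qed.

Lemma outcome_gt0 : 0 < n1.
Proof. by rewrite ltr0n -ltnS prednK ?prime_gt0 ?prime_gt1 ?outcome_prime. Qed.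

Lemma outcome_crit_ge0 : 0 <= L.
Proof. by apply: (lattice_crit_ge0 alpha2_gt1); apply: prime_gt0; exact: outcome_prime. Qed.

Lemma outcome_crit_le l : 2^-1 <= l < alpha ->
  L `^ (2 * l)^-1 <= (V alpha l gamma - 1) / ((1 - tau) * n1).
Proof.
move=> hl; have [p01 ap] := exponent_itv hl.
rewrite V_Vp; last by have /andP[h _] := hl; lra.
have [_ hz] := cbc_mass_support w_mass.
exact: (lattice_crit_powR_le tau_itv p01 alpha2_gt1 ap Gamma_ge0 outcome_prime hz).
Qed.

(** The only use of the lower bound on [nmax]: the infimum is at most [nmax / 2], hence at most
    [n - 1]. The infimum may not be attained, so [L > 1] is refuted by a nearly optimal [l]. The
    exponents [1 / (2 * l)] stay above [1 / 4] since [l < alpha < 2], which gives a gap independent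
    of [l]. *)
Lemma outcome_crit_le1 : L <= 1.
Proof.
have /andP[t0 t1] := tau_itv; have m0 := outcome_gt0.
rewrite leNgt; apply/negP => L1.
have ninf := nmax_inf; set S := [set (V alpha l gamma - 1) / (1 - tau) | l in [set l : R | 2^-1 <= l < alpha]] in ninf.
have q : 1 < L `^ 4^-1.
  have : 1 `^ 4^-1 < L `^ 4^-1 by apply: gt0_ltr_powR; rewrite ?nnegrE ?outcome_crit_ge0// invr_gt0.
  by rewrite powR1.
have hS : has_inf S.
  split.
    exists ((V alpha 2^-1 gamma - 1) / (1 - tau)); exists 2^-1 => //=; rewrite lexx /=.
    by have /andP[] := alpha_itv.
  exists 0 => _ [l hl <-]; rewrite divr_ge0 ?subr_ge0//; [exact: ltW (V_gt1 hl)|exact: ltW].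
(* Half of the gap, scaled by [n - 1]: the bound for the near minimizer stays below
   [L ^ (1 / 4)]. *)
have e0 : 0 < n1 * (L `^ 4^-1 - 1) / 2 by rewrite divr_gt0// mulr_gt0// subr_gt0.
have [_ [l hl <-] hlt] := inf_adherent e0 hS.
have h1 := outcome_crit_le hl.
have l2 : 0 < 2 * l by have /andP[h _] := hl; lra.
have h2 : L `^ 4^-1 <= L `^ (2 * l)^-1.
  apply: ler_powR; first exact: ltW.
  rewrite lef_pV2 ?posrE//; have /andP[_ h] := hl; have /andP[_ h'] := alpha_itv; lra.
have h3 : (V alpha l gamma - 1) / ((1 - tau) * n1) < 1 + (L `^ 4^-1 - 1) / 2.
  rewrite invfM mulrA ltr_pdivrMr//; apply: lt_le_trans hlt _.
  have := ninf; have := outcome_ge; move: (inf S) (L `^ 4^-1) n1 => a b c; lra.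
have := le_lt_trans (le_trans h2 h1) h3; move: q; move: (L `^ 4^-1) => a; lra.
Qed.

Lemma outcome_crit_le_eps : L <= (2 / (1 - tau)) `^ eps * (y `^ eps / nmax%:R `^ eps).
Proof.
have /andP[t0 t1] := tau_itv; have m0 := outcome_gt0; have y0 := y_gt0.
have nm0 : 0 < nmax%:R :> R by rewrite ltr0n; exact: ltnW.
have tt0 : 0 < 1 - tau by rewrite subr_gt0.
have h := outcome_crit_le lambda_itv.
set x := y / ((1 - tau) * n1) in h.
have x0 : 0 < x by rewrite divr_gt0// mulr_gt0.
have l0 : 0 < lambda by have := lambda_gt; lra.
have h2 : L <= x `^ eps.
  apply: min_powR_le => //; last by right; exact: outcome_crit_le1.
  have -> : L = (L `^ (2 * lambda)^-1) `^ (2 * lambda).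
    by rewrite -powRrM mulVf ?powRr1 ?outcome_crit_ge0// gt_eqF// mulr_gt0.
  by apply: ge0_ler_powR; rewrite ?nnegrE ?powR_ge0 ?(ltW x0)// mulr_ge0// ltW.
apply: le_trans h2 _.
have /andP[e1 _] := eps_itv.
rewrite -powR_div ?(ltW y0)// -powRM ?divr_ge0 ?(ltW y0) ?(ltW nm0) ?(ltW tt0)//.
apply: ge0_ler_powR; rewrite ?nnegrE ?(ltW x0)//; first by lra.
  by rewrite mulr_ge0// divr_ge0// ltW.
rewrite /x ler_pdivrMr ?mulr_gt0//.
rewrite regroup_ratio.
rewrite divff ?gt_eqF// mulr1 ler_peMr ?(ltW y0)// ler_pdivlMr// mul1r.
exact: outcome_ge.
Qed.

End Outcome.

(** The first summand stems from primes not dividing the frequency, the second from the divisible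
    ones. The number 16 bounds [2 ^ (2 * alpha)] uniformly in [alpha < 2], and [c] is the constant
    of the prime count. *)
Definition error_constant (c : R) : R :=
  4 / tau * (2 / (1 - tau)) `^ eps + 2 * (16 / c + 16 ^+ 2).

Lemma error_constant_gt0 (c : R) : 0 < c -> 0 < error_constant c.
Proof.
move=> c0; have /andP[t0 t1] := tau_itv; apply: ltr_wpDl; first by rewrite !mulr_ge0 ?invr_ge0 ?powR_ge0// ltW.
by apply: mulr_gt0 => //; apply: addr_gt0; [exact: divr_gt0|exact: exprn_gt0].
Qed.

Lemma nmax_powR_le r : eps + 1 <= r -> nmax%:R `^ (- r) <= (nmax%:R `^ (eps + 1))^-1 :> R.
Proof.
move=> h; rewrite -powRN; apply: ler_powR; last by lra.
by rewrite ler1n; exact: ltnW.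
Qed.

Lemma half_nmax_powR : (nmax%:R / 2) `^ (- (2 * alpha)) <= 16 * nmax%:R `^ (- (2 * alpha)) :> R.
Proof.
have nm0 : 0 < nmax%:R :> R by rewrite ltr0n; exact: ltnW.
rewrite powR_div ?(ltW nm0)// mulrC ler_wpM2r ?powR_ge0// powRN invrK.
rewrite (_ : 16 = 2 `^ 4%:R); last by rewrite powR_mulrn// -natrX.
by apply: ler_powR; [rewrite ler1n|have := alpha_itv; lra].
Qed.

Lemma cbc_spectrum_le (c : R) N : 0 < c ->
  ((0 < size (admissible_primes nmax))%N ->
    c * nmax%:R `^ (1 - 2 * delta) <= (size (admissible_primes nmax))%:R) ->
  \sum_(k <- box d N | nonzero k)
    (mean_avg (@cbc_mass R nmax d alpha tau G) (fun w => w.1) (@outcome_z nmax d) k / scale_prod R k) ^+ 2 * freq_weight alpha G k <=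
  error_constant c * (y `^ eps / nmax%:R `^ (eps + 1)).
Proof.
move=> c0 hc; have /andP[t0 t1] := tau_itv; have /andP[e1 e2] := eps_itv; have y0 := y_gt0.
have nm0 : 0 < nmax%:R :> R by rewrite ltr0n; exact: ltnW.
pose X := (2 / (1 - tau)) `^ eps * (y `^ eps / nmax%:R `^ eps).
have X0 : 0 <= X by rewrite !mulr_ge0 ?invr_ge0 ?powR_ge0.
apply: le_trans (spectrum_sum_le tau_itv alpha2_gt1 nmax_ge N X0 outcome_crit_le_eps) _.
set Q := (nmax%:R `^ (eps + 1))^-1.
have Q0 : 0 <= Q by rewrite invr_ge0 powR_ge0.
have eQ : (nmax%:R `^ eps)^-1 / nmax%:R = Q.
  by rewrite /Q powRD_gt0// powRr1 ?(ltW nm0)// invfM.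
set h := (nmax%:R / 2) `^ (- (2 * alpha)).
have h0 : 0 <= h by exact: powR_ge0.
have h2 : h ^+ 2 <= 16 ^+ 2 * Q.
  apply: (@le_trans _ _ ((16 * nmax%:R `^ (- (2 * alpha))) ^+ 2)).
    by apply: lerXn2r; rewrite ?nnegrE ?mulr_ge0 ?powR_ge0// half_nmax_powR.
  rewrite exprMn -[(_ `^ _) ^+ 2]powR_mulrn ?powR_ge0// -powRrM.
  rewrite ler_wpM2l// mulNr; apply: nmax_powR_le.
  by have := alpha2_gt1; have := lambda_lt; have := delta_gt0; lra.
have hM : h / (size (admissible_primes nmax))%:R <= 16 / c * Q.
  (* Without admissible primes the inverse of their number is 0. *)
  case: (posnP (size (admissible_primes nmax))) => [->|M0].
    by rewrite invr0 mulr0 !mulr_ge0 ?invr_ge0// ltW.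
  have M0' : 0 < (size (admissible_primes nmax))%:R :> R by rewrite ltr0n.
  rewrite ler_pdivrMr//; have := hc M0 => hc'.
  apply: (@le_trans _ _ (16 / c * Q * (c * nmax%:R `^ (1 - 2 * delta)))); last first.
    by apply: ler_wpM2l hc'; rewrite !mulr_ge0 ?invr_ge0// ltW.
  rewrite regroup_cancel.
  rewrite divff ?gt_eqF// mulr1; apply: le_trans half_nmax_powR _; rewrite ler_wpM2l//.
  (* The exponents [eps + 1] and [1 - 2 * delta] differ by [2 * lambda], which is below
     [2 * alpha]. *)
  rewrite /Q -powRN -powRD_gt0//; apply: ler_powR; first by rewrite ler1n; exact: ltnW.
  by have := lambda_lt; lra.
have S2 := prob_dvd_sum_le alpha2_gt1 Gamma_unit_itv nmax_ge N weight_sum_le_eps.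
have Y0 : 0 <= y `^ eps by exact: powR_ge0.
have S2' : \sum_(k <- box d N | nonzero k) (twos k)%:R * freq_weight alpha G k * prob_dvd R nmax k ^+ 2 <=
    y `^ eps * ((16 / c + 16 ^+ 2) * Q).
  apply: le_trans S2 _; apply: ler_wpM2l Y0 _ _ _.
  by rewrite [(_ + 16 ^+ 2) * Q]mulrDl; exact: lerD.
have eX : 2 * (2 / (tau * nmax%:R)) * X = 4 / tau * (2 / (1 - tau)) `^ eps * (y `^ eps * Q).
  by rewrite -eQ /X invfM regroup_main.
rewrite eX /error_constant regroup_sum lerD2l.
exact: ler_wpM2l S2'.
Qed.

Lemma cbc_ran_error_le (c : R) : 0 < c ->
  ((0 < size (admissible_primes nmax))%N ->
    c * nmax%:R `^ (1 - 2 * delta) <= (size (admissible_primes nmax))%:R) ->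
  (ran_error (sob alpha gamma) (@cube_integral R d)
     (@cbc_mass R nmax d alpha tau G) (@cbc_rule R nmax d)
   <= (Num.sqrt (error_constant c) * (y `^ (lambda - delta) / nmax%:R `^ (lambda + 2^-1 - delta)))%:E)%E.
Proof.
move=> c0 hc; have /andP[t0 t1] := tau_itv; have y0 := y_gt0.
have nm0 : 0 < nmax%:R :> R by rewrite ltr0n; exact: ltnW.
have C0 := error_constant_gt0 c0.
set B := Num.sqrt _ * _.
have B0 : 0 < B by rewrite mulr_gt0 ?sqrtr_gt0// divr_gt0// powR_gt0.
have BE : B ^+ 2 = error_constant c * (y `^ eps / nmax%:R `^ (eps + 1)).
  rewrite /B exprMn sqr_sqrtr ?(ltW C0)// expr_div_n; congr (_ * (_ / _)).
    by rewrite -powR_mulrn ?powR_ge0// -powRrM mulrC.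
  by rewrite -powR_mulrn ?powR_ge0// -powRrM; congr (_ `^ _); lra.
apply: (ran_error_le alpha_itv (nn := fun w : outcome nmax d => w.1 : nat) (zz := @outcome_z nmax d) (rho := freq_weight alpha G) _ _ B0).
- exact: cbc_mass_ge0.
- by move=> w /cbc_mass_support[/admissible_primesP[/prime_gt0]].
- exact: freq_weight_sob_weights_ge1.
- by move=> N; rewrite BE; exact: cbc_spectrum_le.
Qed.

End Assembly.

Theorem theorem4p3 (R : realType) (lambda delta tau : R)
    (hlambda : 2^-1 < lambda)
    (hdelta : 0 < delta < Num.min (lambda - 2^-1) 1)
    (htau : 0 < tau < 1) :
  exists C : R, 0 < C /\
    forall (alpha : R) (d : nat) (gamma : 'I_d -> R) (nmax : nat),
      2^-1 < alpha < 2 ->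
      lambda < alpha ->
      (0 < d)%N ->
      (forall j, 0 < gamma j <= kappa alpha `^ 2^-1) ->
      (2 <= nmax)%N ->
      2 * inf [set (V alpha l gamma - 1) / (1 - tau)
              | l in [set l : R | 2^-1 <= l < alpha]] <= nmax%:R ->
      (ran_error (sob alpha gamma) (@cube_integral R d)
         (@cbc_mass R nmax d alpha tau (Gamma alpha gamma))
         (@cbc_rule R nmax d)
       <= (C * ((V alpha lambda gamma - 1) `^ (lambda - delta) /
                nmax%:R `^ (lambda + 2^-1 - delta)))%:E)%E.
Proof.
have /andP[d0] := hdelta; rewrite lt_min => /andP[d1 _].
(* The prime count enters the squared error, so a loss of [2 * delta] there is [delta] in the
   theorem. *)
have e0 : 0 < 2 * delta by rewrite mulr_gt0.
have [c c0 hc] := size_admissible_primes_ge e0.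
exists (Num.sqrt (error_constant lambda delta tau c)); split.
  by rewrite sqrtr_gt0; exact: error_constant_gt0.
move=> alpha d gamma nmax ha hl hd hg hn hinf.
by apply: cbc_ran_error_le => // hs; exact: hc.
Qed.
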